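(* $\mathrm{NPSB}_s(1)=\mathrm{NPSB}_s(2)=\mathbf{NP}$ and $\mathrm{NPSB}_s(3)=\mathrm{NPSB}_s=\mathbf{L}^{\mathbf{NP}}$.
   Context: All structures are finite with at least two elements; problems are isomorphism-closed classes of finite structures; a problem is in a complexity class if its string encoding is. $\mathbf{L}^{\mathbf{NP}}$ is the class of problems accepted by log-space deterministic oracle Turing machines with an $\mathbf{NP}$ oracle. Program schemes of $\mathrm{NPSA}(1)$ over $\sigma$: variables $x_1,\dots,x_k$, array symbols; instructions $\mathtt{input}(x_1,\dots,x_l)$ first, $\mathtt{output}(x_1,\dots,x_l)$ last, others assignments $x_i:=y$, $x_i:=A[y_1,\dots,y_d]$, $A[y_1,\dots,y_d]:=y_0$ ($y_j$ variables, constants of $\sigma$, or special constants $0,max$), guesses $\mathtt{guess}\ x_i$, and while instructions with quantifier-free first-order tests; $x_{l+1},\dots,x_k$ are free variables (never assigned). Semantics: $0,max$ arbitrary distinct elements; input-output variables and arrays start at $0$; guesses nondeterministic; acceptance iff some computation reaches output with all input-output variables equal to $max$. $\mathrm{NPSA}(2m)$: schemes $\forall x_{i_1}\dots\forall x_{i_p}\rho$ ($\rho\in\mathrm{NPSA}(2m-1)$, $x_{i_j}$ free in $\rho$) accepting iff $\rho$ accepts for all values of them (arrays initialised to $0$). $\mathrm{NPSA}(2m+1)$: as $\mathrm{NPSA}(1)$ but while-tests are schemes of $\mathrm{NPSA}(2m)$, evaluated on current values of the outer variables with the test's arrays initialised to $0$, after which the outer computation resumes unchanged. $\mathrm{NPSB}(m)$: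 the subclass of $\mathrm{NPSA}(m)$ where every array assignment (at every level) has the form $A[\dots]:=max$; $\mathrm{NPSB}=\bigcup_m\mathrm{NPSB}(m)$. The subscript $s$ means a built-in successor relation: a binary symbol $succ$ usable in tests, interpreted as the successor relation of a linear order of the universe with least element $0$ and greatest element $max$, with only schemes whose acceptance is independent of the choice of successor relation admitted. *)

(* Defs.v *)
From mathcomp Require Import all_boot.
From Stdlib Require Import Relations.Relation_Operators.

Set Implicit Arguments.
Unset Strict Implicit.
Unset Printing Implicit Defensive.

(** * Signatures, finite structures, problems *)

Record signature := Signature {
  nrel  : nat;
  arity : 'I_nrel -> nat;
  ncst  : nat
}.

Record structure (sigma : signature) := Structure {
  dom      :> finType;
  dom_gt1  : 1 < #|dom|;
  rel_of   : forall i : 'I_(nrel sigma), (arity i).-tuple dom -> bool;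
  cst_of   : 'I_(ncst sigma) -> dom
}.

Definition isomorphic (sigma : signature) (A B : structure sigma) : Prop :=
  exists f : A -> B,
    [/\ bijective f,
        forall (i : 'I_(nrel sigma)) (t : (arity i).-tuple A),
          rel_of (map_tuple f t) = rel_of t
      & forall c : 'I_(ncst sigma), f (cst_of A c) = cst_of B c].

Record problem (sigma : signature) := Problem {
  in_problem :> structure sigma -> Prop;
  problem_iso : forall A B : structure sigma,
    isomorphic A B -> in_problem A -> in_problem B
}.

(** * Program schemes with a built-in successor relation

    Variables are named by numbers.  The header [input(x_1,...,x_l)] /
    [output(x_1,...,x_l)] of a scheme is the list [inputs]; every other
    variable is free in the scheme.  When a scheme occurs as a while-test its
    free variables are thus variables of the enclosing scheme, while its own
    input-output variables are local to it (and shadow outer variables of the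
    same name). *)

Definition var := nat.

(** An array symbol is a name together with its dimension. *)
Definition arrsym := (nat * nat)%type.

Inductive term (sigma : signature) : Type :=
| Var of var
| Cst of 'I_(ncst sigma)
| Zero
| Max.

Arguments Var {sigma} _.
Arguments Cst {sigma} _.
Arguments Zero {sigma}.
Arguments Max {sigma}.

(** Quantifier-free first-order formulas over sigma, 0, max, and succ. *)
Inductive qf (sigma : signature) : Type :=
| QEq of term sigma & term sigma
| QRel (i : 'I_(nrel sigma)) of (arity i).-tuple (term sigma)
| QSucc of term sigma & term sigma
| QNot of qf sigma
| QAnd of qf sigma & qf sigma
| QOr of qf sigma & qf sigma.

Inductive instr (sigma : signature) (test : Type) : Type :=
| Assign of var & term sigma
| ARead (x : var) (R : arrsym) of (R.2).-tuple (term sigma)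
| AWrite (R : arrsym) of (R.2).-tuple (term sigma) & term sigma
| Guess of var
| While of test & seq (instr sigma test).

Record prog (sigma : signature) (test : Type) := Prog {
  inputs : seq var;
  body   : seq (instr sigma test)
}.

(** The scheme "forall uvars, uprog". *)
Record univ_scheme (sigma : signature) (test : Type) := UnivScheme {
  uvars : seq var;
  uprog : prog sigma test
}.

(** [even_scheme sigma m] is the raw syntax of the schemes of NPSA(2m) for
    m > 0, and [odd_scheme sigma m] that of the schemes of NPSA(2m+1).  For
    m = 0, [even_scheme] consists of the quantifier-free formulas, which are
    the while-tests of NPSA(1). *)
Fixpoint even_scheme (sigma : signature) (m : nat) : Type :=
  if m is m'.+1 then univ_scheme sigma (even_scheme sigma m') else qf sigma.

Definition odd_scheme (sigma : signature) (m : nat) : Type :=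
  prog sigma (even_scheme sigma m).

(** ** Syntactic conditions *)

Definition wf_term (sigma : signature) (V : seq var) (y : term sigma) : bool :=
  if y is Var x then x \in V else true.

Fixpoint wf_qf (sigma : signature) (V : seq var) (phi : qf sigma) : bool :=
  match phi with
  | QEq y z | QSucc y z => wf_term V y && wf_term V z
  | QRel _ ys => all (wf_term V) ys
  | QNot psi => wf_qf V psi
  | QAnd psi chi | QOr psi chi => wf_qf V psi && wf_qf V chi
  end.

(** Only the input-output variables [io] may be assigned or guessed; [V] is
    the set of all variables of the scheme. *)
Fixpoint wf_instr (sigma : signature) (test : Type)
    (wf_test : seq var -> test -> bool) (io V : seq var)
    (i : instr sigma test) : bool :=
  match i with
  | Assign x y => (x \in io) && wf_term V y
  | ARead x _ ys => (x \in io) && all (wf_term V) ys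
  | AWrite _ ys y => all (wf_term V) ys && wf_term V y
  | Guess x => x \in io
  | While t q => wf_test V t && all (wf_instr wf_test io V) q
  end.

(** [wf_prog wf_test F r]: [r] is well formed with free variables among [F]. *)
Definition wf_prog (sigma : signature) (test : Type)
    (wf_test : seq var -> test -> bool) (F : seq var)
    (r : prog sigma test) : bool :=
  [&& inputs r != [::], uniq (inputs r)
    & all (wf_instr wf_test (inputs r) (inputs r ++ F)) (body r)].

Fixpoint wf_even (sigma : signature) (m : nat) :
    seq var -> even_scheme sigma m -> bool :=
  match m with
  | 0 => fun F phi => wf_qf F phi
  | m'.+1 => fun F r =>
      all (fun x => x \notin inputs (uprog r)) (uvars r)
      && wf_prog (@wf_even sigma m') (uvars r ++ F) (uprog r)
  end.

Definition wf_odd (sigma : signature) (m : nat) (F : seq var)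
    (r : odd_scheme sigma m) : bool :=
  wf_prog (@wf_even sigma m) F r.

(** NPSB inside NPSA: every array assignment, at every level, writes max. *)
Fixpoint onlymax_instr (sigma : signature) (test : Type)
    (onlymax_test : test -> bool) (i : instr sigma test) : bool :=
  match i with
  | AWrite _ _ y => if y is Max then true else false
  | While t q => onlymax_test t && all (onlymax_instr onlymax_test) q
  | _ => true
  end.

Definition onlymax_prog (sigma : signature) (test : Type)
    (onlymax_test : test -> bool) (r : prog sigma test) : bool :=
  all (onlymax_instr onlymax_test) (body r).

Fixpoint onlymax_even (sigma : signature) (m : nat) :
    even_scheme sigma m -> bool :=
  match m with
  | 0 => fun=> true
  | m'.+1 => fun r => onlymax_prog (@onlymax_even sigma m') (uprog r)
  end.

Definition onlymax_odd (sigma : signature) (m : nat)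
    (r : odd_scheme sigma m) : bool :=
  onlymax_prog (@onlymax_even sigma m) r.

(** ** Semantics *)

Record builtins (T : Type) := Builtins {
  bsucc : rel T;
  bzero : T;
  bmax  : T
}.

(** [b] consists of the successor relation, the least and the greatest element
    of some linear order. *)
Definition is_successor (T : finType) (b : builtins T) : Prop :=
  exists le : rel T,
    [/\ [/\ reflexive le, antisymmetric le, transitive le & total le],
        forall x, le (bzero b) x,
        forall x, le x (bmax b)
      & forall x y, bsucc b x y =
          [&& x != y, le x y
            & [forall z, (le x z && le z y) ==> ((z == x) || (z == y))]]].

Section Semantics.
Variables (sigma : signature) (A : structure sigma) (b : builtins A).

Definition env := var -> A.
Definition store := arrsym -> seq A -> A.

Definition eval (e : env) (y : term sigma) : A :=
  match y with
  | Var x => e x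
  | Cst c => cst_of A c
  | Zero => bzero b
  | Max => bmax b
  end.

Fixpoint qf_holds (phi : qf sigma) (e : env) : bool :=
  match phi with
  | QEq y z => eval e y == eval e z
  | QRel _ ys => rel_of (map_tuple (eval e) ys)
  | QSucc y z => bsucc b (eval e y) (eval e z)
  | QNot psi => ~~ qf_holds psi e
  | QAnd psi chi => qf_holds psi e && qf_holds chi e
  | QOr psi chi => qf_holds psi e || qf_holds chi e
  end.

Definition set_var (e : env) (x : var) (a : A) : env :=
  fun z => if z == x then a else e z.

Definition set_arr (S : store) (R : arrsym) (ix : seq A) (a : A) : store :=
  fun R' ix' => if (R' == R) && (ix' == ix) then a else S R' ix'.

Section Exec.
Variables (test : Type) (holds : test -> env -> Prop).

(** [exec p e S e' S']: some terminating computation of [p] leads from variable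
    values [e] and array contents [S] to [e'] and [S'].  Tests see the variables
    but not the arrays, and have no side effect. *)
Inductive exec : seq (instr sigma test) -> env -> store -> env -> store -> Prop :=
| exec_nil e S : exec [::] e S e S
| exec_assign x y p e S e' S' :
    exec p (set_var e x (eval e y)) S e' S' ->
    exec (Assign _ x y :: p) e S e' S'
| exec_read x (R : arrsym) (ys : (R.2).-tuple (term sigma)) p e S e' S' :
    exec p (set_var e x (S R (map (eval e) ys))) S e' S' ->
    exec (ARead _ x ys :: p) e S e' S'
| exec_write (R : arrsym) (ys : (R.2).-tuple (term sigma)) y p e S e' S' :
    exec p e (set_arr S R (map (eval e) ys) (eval e y)) e' S' ->
    exec (AWrite _ ys y :: p) e S e' S'
| exec_guess x a p e S e' S' :
    exec p (set_var e x a) S e' S' ->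
    exec (Guess _ _ x :: p) e S e' S'
| exec_while_true t q p e S e1 S1 e' S' :
    holds t e -> exec q e S e1 S1 -> exec (While t q :: p) e1 S1 e' S' ->
    exec (While t q :: p) e S e' S'
| exec_while_false t q p e S e' S' :
    ~ holds t e -> exec p e S e' S' ->
    exec (While t q :: p) e S e' S'.

Definition prog_accepts (r : prog sigma test) (e : env) : Prop :=
  exists (e' : env) (S' : store),
    exec (body r)
         (fun x => if x \in inputs r then bzero b else e x)
         (fun _ _ => bzero b) e' S'
    /\ forall x, x \in inputs r -> e' x = bmax b.

End Exec.

Fixpoint even_accepts (m : nat) : even_scheme sigma m -> env -> Prop :=
  match m with
  | 0 => fun phi e => qf_holds phi e
  | m'.+1 => fun r e =>
      forall e' : env, (forall x, x \notin uvars r -> e' x = e x) ->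
        prog_accepts (@even_accepts m') (uprog r) e'
  end.

Definition odd_accepts (m : nat) (r : odd_scheme sigma m) (e : env) : Prop :=
  prog_accepts (@even_accepts m) r e.

End Semantics.

(** The equivalence is required for every successor relation, which includes
    that acceptance does not depend on it.  Schemes defining problems have no
    free variables, so that the initial environment is irrelevant. *)
Definition defines (sigma : signature)
    (accepts : forall A : structure sigma, builtins A -> env A -> Prop)
    (Omega : problem sigma) : Prop :=
  forall (A : structure sigma) (b : builtins A), is_successor b ->
    (accepts A b (fun=> bzero b) <-> Omega A).

(** Meaningful for m > 0; m = 0 gives the quantifier-free sentences. *)
Definition NPSB_s (m : nat) (sigma : signature) (Omega : problem sigma) : Prop :=
  if odd m then
    exists r : odd_scheme sigma m./2,
      [/\ wf_odd [::] r, onlymax_odd r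
        & defines (fun A b e => odd_accepts b r e) Omega]
  else
    exists r : even_scheme sigma m./2,
      [/\ wf_even [::] r, onlymax_even r
        & defines (fun A b e => even_accepts b r e) Omega].

Definition NPSB_s_all (sigma : signature) (Omega : problem sigma) : Prop :=
  exists m : nat, 0 < m /\ NPSB_s m Omega.

(** * String encodings *)

Definition language := seq bool -> Prop.

(** [n]-tuples in lexicographic order. *)
Fixpoint lex_tuples (T : finType) (n : nat) : seq (n.-tuple T) :=
  match n with
  | 0 => [:: [tuple]]
  | n'.+1 => [seq cons_tuple x t | x <- enum T, t <- lex_tuples T n']
  end.

(** The size in unary, then the truth table of each relation, then each
    constant as the truth table of a singleton.  The unary prefix makes the
    length of the encoding polynomially related to the size of the universe
    also for signatures without relation symbols of positive arity.  The
    elements are listed in the order of the finType structure of the universe;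
    problems being closed under isomorphism, [encoding Omega] contains the
    encodings of the members of [Omega] for all orders. *)
Definition encode (sigma : signature) (A : structure sigma) : seq bool :=
  nseq #|A| true ++ false ::
  flatten [seq [seq rel_of t | t <- lex_tuples A (arity i)]
          | i <- enum 'I_(nrel sigma)] ++
  flatten [seq [seq x == cst_of A c | x <- enum A]
          | c <- enum 'I_(ncst sigma)].

Definition encoding (sigma : signature) (Omega : problem sigma) : language :=
  fun w => exists A : structure sigma, Omega A /\ w = encode A.

(** * NP *)

Inductive move := MLeft | MStay | MRight.

(** Tapes are infinite to the right; a left move from cell 0 has no effect. *)
Definition shift (d : move) (h : nat) : nat :=
  match d with MLeft => h.-1 | MStay => h | MRight => h.+1 end.

Definition write_cell (T : Type) (tp : nat -> T) (h : nat) (a : T) : nat -> T :=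
  fun i => if i == h then a else tp i.

(** Nondeterministic one-tape machines: the tape symbols are blank ([None]),
    the input symbols ([Some (inl _)]) and further symbols ([Some (inr _)]). *)
Record ntm := NTM {
  n_state  : finType;
  n_extra  : finType;
  n_start  : n_state;
  n_accept : n_state;
  n_trans  : n_state -> option (bool + n_extra) ->
             n_state -> option (bool + n_extra) -> move -> bool
}.

Record ntm_config (M : ntm) := NConfig {
  nc_state : n_state M;
  nc_tape  : nat -> option (bool + n_extra M);
  nc_head  : nat
}.

Definition ntm_init (M : ntm) (w : seq bool) : ntm_config M :=
  NConfig (n_start M)
    (fun i => if i < size w then Some (inl (nth false w i)) else None) 0.

Inductive ntm_step (M : ntm) : ntm_config M -> ntm_config M -> Prop :=
| NStep q tp h q' a d :
    n_trans q (tp h) q' a d ->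
    ntm_step (NConfig q tp h) (NConfig q' (write_cell tp h a) (shift d h)).

Inductive ntm_run (M : ntm) : nat -> ntm_config M -> ntm_config M -> Prop :=
| NRun0 c : ntm_run 0 c c
| NRunS t c c' c'' : ntm_step c c' -> ntm_run t c' c'' -> ntm_run t.+1 c c''.

Definition ntm_accepts (M : ntm) (w : seq bool) : Prop :=
  exists t c, ntm_run t (ntm_init M w) c /\ nc_state c = n_accept M.

(** Every computation on [w] has at most |w|^k + k steps. *)
Definition ntm_polytime (M : ntm) : Prop :=
  exists k : nat, forall (w : seq bool) t c,
    ntm_run t (ntm_init M w) c -> t <= size w ^ k + k.

Definition NP_language (L : language) : Prop :=
  exists M : ntm, ntm_polytime M /\ forall w, L w <-> ntm_accepts M w.

(** * L^NP *)

Inductive insym := LeftEnd | RightEnd | Bit of bool.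

(** Deterministic oracle machines with a two-way read-only input tape between
    end markers, one work tape, and a write-only oracle tape.  A transition
    depends on the state, the scanned input symbol and the scanned work symbol
    ([None] is blank), and optionally appends a bit to the oracle tape.  In the
    query state the machine moves to the yes or the no state according to the
    oracle, and the oracle tape is erased. *)
Record otm := OTM {
  o_state  : finType;
  o_work   : finType;
  o_start  : o_state;
  o_accept : o_state;
  o_query  : o_state;
  o_yes    : o_state;
  o_no     : o_state;
  o_trans  : o_state -> insym -> option o_work ->
             o_state * move * option o_work * move * option bool
}.

Record otm_config (M : otm) := OConfig {
  oc_state  : o_state M;
  oc_inhead : nat;
  oc_tape   : nat -> option (o_work M);
  oc_head   : nat;
  oc_oracle : seq bool
}.

Definition otm_init (M : otm) : otm_config M :=
  OConfig (o_start M) 0 (fun=> None) 0 [::].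

Definition in_symbol (w : seq bool) (i : nat) : insym :=
  if i is j.+1 then
    if j < size w then Bit (nth false w j) else RightEnd
  else LeftEnd.

(** The input head cannot leave the end markers. *)
Definition shift_in (w : seq bool) (d : move) (i : nat) : nat :=
  minn (shift d i) (size w).+1.

Inductive otm_step (M : otm) (O : language) (w : seq bool) :
    otm_config M -> otm_config M -> Prop :=
| OStep q i tp h z q' di a d ob :
    q != o_accept M -> q != o_query M ->
    o_trans q (in_symbol w i) (tp h) = (q', di, a, d, ob) ->
    otm_step O w (OConfig q i tp h z)
      (OConfig q' (shift_in w di i) (write_cell tp h a) (shift d h)
         (if ob is Some x then rcons z x else z))
| OYes i tp h z :
    o_query M != o_accept M -> O z ->
    otm_step O w (OConfig (o_query M) i tp h z)
      (OConfig (o_yes M) i tp h [::])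
| ONo i tp h z :
    o_query M != o_accept M -> ~ O z ->
    otm_step O w (OConfig (o_query M) i tp h z)
      (OConfig (o_no M) i tp h [::]).

Definition otm_reach (M : otm) (O : language) (w : seq bool)
    (c : otm_config M) : Prop :=
  clos_refl_trans _ (@otm_step M O w) (otm_init M) c.

Definition otm_accepts (M : otm) (O : language) (w : seq bool) : Prop :=
  exists c, otm_reach O w c /\ oc_state c = o_accept M.

(** Only the work tape is subject to the space bound: the oracle tape is not,
    so that queries may be of polynomial length. *)
Definition otm_logspace (M : otm) (O : language) : Prop :=
  exists k : nat, forall (w : seq bool) (c : otm_config M),
    otm_reach O w c -> oc_head c <= k * (trunc_log 2 (size w)).+1.

Definition LNP_language (L : language) : Prop :=
  exists (O : language) (M : otm),
    [/\ NP_language O, otm_logspace M O & forall w, L w <-> otm_accepts M O w].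

(** * The classes of problems *)

Definition NP (sigma : signature) (Omega : problem sigma) : Prop :=
  NP_language (encoding Omega).

Definition LNP (sigma : signature) (Omega : problem sigma) : Prop :=
  LNP_language (encoding Omega).

(* Main.v *)
Require Import Defs.
From HB Require Import structures.
From mathcomp Require Import all_boot.
From mathcomp Require Import zify.
From Stdlib Require Import Classical ClassicalEpsilon FunctionalExtensionality PropExtensionality.
From Stdlib Require Import Relations.Relation_Operators Relations.Operators_Properties.

Set Implicit Arguments.
Unset Strict Implicit.
Unset Printing Implicit Defensive.


(** * Bounded arithmetic with one function variable *)

(** All four inclusions pass through one normal form. A formula of bounded arithmetic ([fm]) speaks
    about numbers of polynomial size, an input predicate, an oracle predicate and one function [fn].
    A property is existential second-order if it asserts that some [fn] with polynomially bounded
    values satisfies such a formula; this is what both machines and schemes can guess and check.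

    From formulas to computations. A formula is evaluated by a counter program whose counters stay
    below a polynomial capacity and which finds [fn] in a certificate of bits, each value being the
    number of ones in a block ([computes_cfm], [decode_surj]). A counter program runs on a one-tape
    machine, its counters being pebbles on a row of cells ([runs_ctm]), whence [word_eso_NP]. It
    also runs as a scheme, its counters being tuples of variables read as numbers in base n along
    the built-in successor, and its certificate an array in which [max] is written at guessed places
    ([hx_sc], [mkprog_accepts]), whence [scheme1_of_eso]. If oracle atoms become while-tests of the
    second level, the result is a scheme of the third level ([scheme3_of_eso]).

    NP lies in NPSB(1) because the tableau of an accepting run on the encoding of the structure is
    described by such a formula ([ntm_tab]), and NPSB(1) lies in NPSB(2) by an empty quantifier
    prefix. NPSB(2) lies in NP because array cells are never reset: along a run the number of cells
    set determines the set of these cells, so the part of a run between two configurations with the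
    same continuation, variable values and number of cells set can be cut out. Accepting runs thus
    may be taken of polynomial length ([tab_runP]), and one function can hold a run for each of the
    polynomially many values of the quantified variables ([NPSB2_NP]).

    NPSB lies in L^NP by a census. A certificate claims, level by level, that certain tests hold for
    certain values, and backs each claim by accepting runs. The failure of a test has no such
    certificate. But if the claims on the lower levels are exactly the truth, then all claims on the
    next level are true, so the number of claims, weighted with the lowest level first, is largest
    exactly when the claims are complete ([tot_max]). The largest total is found by bisection with
    logarithmically many NP queries, and one last query asks for a certificate with this total in
    which the whole scheme is claimed to accept ([census_coded], [all_LNP]).

    L^NP lies in NPSB(3). Without its oracle tape a log-space machine has polynomially many
    configurations, and the query string is determined by the configuration right after the previous
    query. An outer formula guesses the run; its oracle atom asks whether the run from such a
    configuration writes a string accepted by the NP machine, which is existential again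
    ([inner_orcP], [LNP_scheme3]). *)

Record ctx := Ctx {
  base : nat;
  inp  : nat -> seq nat -> bool;
  orc  : nat -> bool;
  fn   : nat -> nat
}.

Inductive tm :=
| TVar of nat | TBase | TNum of nat | TAdd of tm & tm | TMul of tm & tm
| TFn of tm.

Inductive fm :=
| FEq of tm & tm | FIn of nat & seq tm | FOrc of tm | FAnd of fm & fm
| FNot of fm | FEx of tm & fm.

Definition scons (x : nat) (e : nat -> nat) (i : nat) : nat :=
  if i is j.+1 then e j else x.

Fixpoint teval (c : ctx) (e : nat -> nat) (t : tm) : nat :=
  match t with
  | TVar i => e i
  | TBase => base c
  | TNum k => k
  | TAdd t1 t2 => teval c e t1 + teval c e t2
  | TMul t1 t2 => teval c e t1 * teval c e t2
  | TFn t1 => fn c (teval c e t1)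
  end.

Fixpoint holds (c : ctx) (e : nat -> nat) (phi : fm) : bool :=
  match phi with
  | FEq t1 t2 => teval c e t1 == teval c e t2
  | FIn i ts => inp c i [seq teval c e t | t <- ts]
  | FOrc t => orc c (teval c e t)
  | FAnd f g => holds c e f && holds c e g
  | FNot f => ~~ holds c e f
  | FEx t f => has (fun x => holds c (scons x e) f) (iota 0 (teval c e t))
  end.

(** Formulas are hardly ever written out: a predicate is shown to be definable by following its
    shape with closure lemmas. Environments are de Bruijn, index 0 being the innermost bound
    variable. *)
Definition dterm (g : ctx -> (nat -> nat) -> nat) : Prop :=
  exists t, forall c e, g c e = teval c e t.

Definition defin (P : ctx -> (nat -> nat) -> Prop) : Prop :=
  exists f, forall c e, P c e <-> holds c e f.

(* Stability under renaming, so that [h] may be used below quantifiers. *)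
Definition deff (h : ctx -> (nat -> nat) -> nat -> nat) : Prop :=
  forall r g, dterm g -> dterm (fun c e => h c (fun i => e (r i)) (g c e)).

Definition defp (h : ctx -> (nat -> nat) -> nat -> Prop) : Prop :=
  forall r g, dterm g -> defin (fun c e => h c (fun i => e (r i)) (g c e)).

Lemma dt_var i : dterm (fun _ e => e i).
Proof. by exists (TVar i). Qed.

Lemma dt_base : dterm (fun c _ => base c).
Proof. by exists TBase. Qed.

Lemma dt_num k : dterm (fun _ _ => k).
Proof. by exists (TNum k). Qed.

Lemma dt_add g h : dterm g -> dterm h -> dterm (fun c e => g c e + h c e).
Proof. by move=> [t Ht] [u Hu]; exists (TAdd t u) => c e; rewrite Ht Hu. Qed.

Lemma dt_mul g h : dterm g -> dterm h -> dterm (fun c e => g c e * h c e).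
Proof. by move=> [t Ht] [u Hu]; exists (TMul t u) => c e; rewrite Ht Hu. Qed.

Lemma dt_succ g : dterm g -> dterm (fun c e => (g c e).+1).
Proof. by move=> [t Ht]; exists (TAdd t (TNum 1)) => c e /=; rewrite Ht addn1. Qed.

Lemma dt_exp g k : dterm g -> dterm (fun c e => g c e ^ k).
Proof.
move=> Hg; elim: k => [|k [t Ht]]; first exact: (dt_num 1).
by case: Hg => u Hu; exists (TMul u t) => c e /=; rewrite -Ht -Hu expnS.
Qed.

Lemma dt_fn g : dterm g -> dterm (fun c e => fn c (g c e)).
Proof. by move=> [t Ht]; exists (TFn t) => c e; rewrite Ht. Qed.

Lemma dt_foldr (T : Type) (F : T -> ctx -> (nat -> nat) -> nat) (s : seq T) :
  (forall x, dterm (F x)) ->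
  dterm (fun c e => foldr (fun x a => F x c e + a) 0 s).
Proof.
move=> HF; elim: s => [|x s IH] /=; first exact: dt_num.
exact: (dt_add (HF x) IH).
Qed.

Lemma dt_sum (I : Type) (s : seq I) (F : I -> ctx -> (nat -> nat) -> nat) :
  (forall x, dterm (F x)) -> dterm (fun c e => \sum_(x <- s) F x c e).
Proof.
move=> HF; elim: s => [|x s [t Ht]].
  by exists (TNum 0) => c e; rewrite big_nil.
case: (HF x) => u Hu; exists (TAdd u t) => c e /=.
by rewrite big_cons Ht Hu.
Qed.

(** With [r := S] this is weakening below a quantifier. *)
Lemma dt_ren g r : dterm g -> dterm (fun c e => g c (fun i => e (r i))).
Proof.
move=> [t Ht].
suff [u Hu] : exists u, forall c e, teval c (fun i => e (r i)) t = teval c e u.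
  by exists u => c e; rewrite Ht Hu.
elim: t {Ht} => [i||k|t1 [u1 H1] t2 [u2 H2]|t1 [u1 H1] t2 [u2 H2]|t1 [u1 H1]].
- by exists (TVar (r i)).
- by exists TBase.
- by exists (TNum k).
- by exists (TAdd u1 u2) => c e /=; rewrite H1 H2.
- by exists (TMul u1 u2) => c e /=; rewrite H1 H2.
- by exists (TFn u1) => c e /=; rewrite H1.
Qed.

Lemma dt_app h r g : deff h -> dterm g ->
  dterm (fun c e => h c (fun i => e (r i)) (g c e)).
Proof. by move=> H; apply: H. Qed.

Lemma df_app h r g : defp h -> dterm g ->
  defin (fun c e => h c (fun i => e (r i)) (g c e)).
Proof. by move=> H; apply: H. Qed.

Lemma df_eq g h : dterm g -> dterm h -> defin (fun c e => g c e = h c e).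
Proof.
move=> [t Ht] [u Hu]; exists (FEq t u) => c e; rewrite Ht Hu /=.
by split=> [->|/eqP].
Qed.

Lemma df_ext P Q : (forall c e, P c e <-> Q c e) -> defin Q -> defin P.
Proof. by move=> H [f Hf]; exists f => c e; rewrite H. Qed.

Lemma df_and P Q : defin P -> defin Q -> defin (fun c e => P c e /\ Q c e).
Proof.
move=> [f Hf] [g Hg]; exists (FAnd f g) => c e; rewrite Hf Hg /=.
by split=> [[-> ->]|/andP].
Qed.

Lemma df_not P : defin P -> defin (fun c e => ~ P c e).
Proof.
move=> [f Hf]; exists (FNot f) => c e; rewrite Hf /=.
by split=> /negP.
Qed.

Lemma df_or P Q : defin P -> defin Q -> defin (fun c e => P c e \/ Q c e).
Proof.
move=> HP HQ; apply: (@df_ext _ (fun c e => ~ (~ P c e /\ ~ Q c e))).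
  by move=> c e; split=> [|/not_and_or [/NNPP|/NNPP]]; tauto.
by apply/df_not/df_and; apply: df_not.
Qed.

Lemma df_imp P Q : defin P -> defin Q -> defin (fun c e => P c e -> Q c e).
Proof.
move=> HP HQ; apply: (@df_ext _ (fun c e => ~ P c e \/ Q c e)).
  by move=> c e; split; [apply: imply_to_or|tauto].
by apply: df_or => //; apply: df_not.
Qed.

Lemma df_iff P Q : defin P -> defin Q -> defin (fun c e => P c e <-> Q c e).
Proof. by move=> HP HQ; apply: df_and; apply: df_imp. Qed.

Lemma df_const (X : Prop) : defin (fun _ _ => X).
Proof.
case: (classic X) => H.
  by exists (FEq TBase TBase) => c e; rewrite /= eqxx.
by exists (FNot (FEq TBase TBase)) => c e; rewrite /= eqxx.
Qed.

Lemma df_ex (g : ctx -> (nat -> nat) -> nat) (Q : ctx -> (nat -> nat) -> nat -> Prop) :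
  dterm g -> defin (fun c e => Q c (fun i => e i.+1) (e 0)) ->
  defin (fun c e => exists2 x, x < g c e & Q c e x).
Proof.
move=> [t Ht] [f Hf]; exists (FEx t f) => c e; split.
  case=> x; rewrite Ht => xt Hx; apply/hasP; exists x; first by rewrite mem_iota.
  by apply/Hf.
case/hasP => x; rewrite mem_iota add0n => /andP[_ xt] /Hf Hx.
by exists x => //; rewrite Ht.
Qed.

Lemma df_all (g : ctx -> (nat -> nat) -> nat) (Q : ctx -> (nat -> nat) -> nat -> Prop) :
  dterm g -> defin (fun c e => Q c (fun i => e i.+1) (e 0)) ->
  defin (fun c e => forall x, x < g c e -> Q c e x).
Proof.
move=> Hg HQ.
apply: (@df_ext _ (fun c e => ~ exists2 x, x < g c e & ~ Q c e x)).
  move=> c e; split=> [H [x xg nQ]|H x xg]; first exact/nQ/H.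
  by apply: NNPP => nQ; apply: H; exists x.
by apply/df_not/df_ex => //; apply: df_not.
Qed.

Lemma df_lt g h : dterm g -> dterm h -> defin (fun c e => g c e < h c e).
Proof.
move=> Hg Hh; apply: (@df_ext _ (fun c e => exists2 x, x < h c e & x = g c e)).
  by move=> c e; split=> [H|[x xh <-]//]; exists (g c e).
apply: df_ex => //; apply: df_eq; first exact: dt_var.
exact: (@dt_ren g S).
Qed.

Lemma df_le g h : dterm g -> dterm h -> defin (fun c e => g c e <= h c e).
Proof. by move=> Hg Hh; apply: (@df_lt g (fun c e => (h c e).+1)) => //; apply: dt_succ. Qed.

Lemma df_eqb g h : dterm g -> dterm h -> defin (fun c e => g c e == h c e).
Proof.
move=> Hg Hh; apply: (@df_ext _ (fun c e => g c e = h c e)); last exact: df_eq.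
by move=> c e; split=> [/eqP|->].
Qed.

Lemma df_negb (b : ctx -> (nat -> nat) -> bool) :
  defin (fun c e => b c e) -> defin (fun c e => ~~ b c e).
Proof.
move=> H; apply: (@df_ext _ (fun c e => ~ b c e)); last exact: df_not.
by move=> c e; split=> /negP.
Qed.

Lemma df_andb (a b : ctx -> (nat -> nat) -> bool) :
  defin (fun c e => a c e) -> defin (fun c e => b c e) ->
  defin (fun c e => a c e && b c e).
Proof.
move=> Ha Hb; apply: (@df_ext _ (fun c e => a c e /\ b c e)); last exact: df_and.
by move=> c e; split=> /andP.
Qed.

Lemma df_orb (a b : ctx -> (nat -> nat) -> bool) :
  defin (fun c e => a c e) -> defin (fun c e => b c e) ->
  defin (fun c e => a c e || b c e).
Proof.
move=> Ha Hb; apply: (@df_ext _ (fun c e => a c e \/ b c e)); last exact: df_or.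
by move=> c e; split=> /orP.
Qed.

Lemma df_orc g : dterm g -> defin (fun c e => orc c (g c e)).
Proof. by move=> [t Ht]; exists (FOrc t) => c e; rewrite Ht. Qed.

Lemma df_inp i (gs : seq (ctx -> (nat -> nat) -> nat)) :
  List.Forall dterm gs -> defin (fun c e => inp c i [seq g c e | g <- gs]).
Proof.
move=> Hgs.
suff [ts Hts] : exists ts, forall c e, [seq g c e | g <- gs] = [seq teval c e t | t <- ts].
  by exists (FIn i ts) => c e; rewrite Hts.
elim: Hgs => [|g gs' [t Ht] _ [ts IH]]; first by exists [::].
by exists (t :: ts) => c e /=; rewrite IH Ht.
Qed.

Lemma df_inp1 i g : dterm g -> defin (fun c e => inp c i [:: g c e]).
Proof. by move=> Hg; apply: (@df_inp i [:: g]); constructor. Qed.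

Lemma df_exs (T : Type) (s : seq T) (Q : T -> ctx -> (nat -> nat) -> Prop) :
  (forall x, defin (Q x)) ->
  defin (fun c e => exists2 x, List.In x s & Q x c e).
Proof.
move=> HQ; elim: s => [|x s IH].
  by apply: (@df_ext _ (fun _ _ => False)); [move=> c e; split=> [[]|]|exact: df_const].
apply: (@df_ext _ (fun c e => Q x c e \/ exists2 y, List.In y s & Q y c e)).
  move=> c e; split=> [[y [<-|ys] Hy]|[Hx|[y ys Hy]]]; [by left|by right; exists y| |].
    by exists x => //; left.
  by exists y => //; right.
exact: df_or.
Qed.

Lemma df_alls (T : Type) (s : seq T) (Q : T -> ctx -> (nat -> nat) -> Prop) :
  (forall x, defin (Q x)) ->
  defin (fun c e => forall x, List.In x s -> Q x c e).
Proof.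
move=> HQ; apply: (@df_ext _ (fun c e => ~ exists2 x, List.In x s & ~ Q x c e)).
  move=> c e; split=> [H [x xs nQ]|H x xs]; first exact/nQ/H.
  by apply: NNPP => nQ; apply: H; exists x.
by apply/df_not/df_exs => x; apply: df_not.
Qed.

Lemma In_enum (T : finType) (x : T) : List.In x (enum T).
Proof.
have: x \in enum T by rewrite mem_enum.
elim: (enum T) => //= y s IH; rewrite inE => /orP[/eqP->|/IH]; by [left|right].
Qed.

Lemma df_exf (T : finType) (Q : T -> ctx -> (nat -> nat) -> Prop) :
  (forall x, defin (Q x)) -> defin (fun c e => exists x, Q x c e).
Proof.
move=> HQ; apply: (df_ext _ (df_exs (enum T) HQ)) => c e.
by split=> [[x Hx]|[x _ Hx]]; exists x => //; apply: In_enum.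
Qed.

Lemma df_allf (T : finType) (Q : T -> ctx -> (nat -> nat) -> Prop) :
  (forall x, defin (Q x)) -> defin (fun c e => forall x, Q x c e).
Proof.
move=> HQ; apply: (df_ext _ (df_alls (enum T) HQ)) => c e.
by split=> [H x _|H x]; apply: H; apply: In_enum.
Qed.

(* [(x + y) ^ 2 + x] is injective since it lies between consecutive squares. *)
Definition pair (x y : nat) : nat := (x + y) * (x + y) + x.

Lemma pair_inj x y x' y' : pair x y = pair x' y' -> x = x' /\ y = y'.
Proof.
rewrite /pair => H.
have E : x + y = x' + y'.
  by case: (ltngtP (x + y) (x' + y')) => // Hlt; nia.
by move: H; rewrite E; lia.
Qed.

Lemma dt_pair g h : dterm g -> dterm h -> dterm (fun c e => pair (g c e) (h c e)).
Proof.
move=> Hg Hh; have H := dt_add Hg Hh.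
exact: (dt_add (dt_mul H H) Hg).
Qed.

Lemma dt_if (b : bool) g h : dterm g -> dterm h ->
  dterm (fun c e => if b then g c e else h c e).
Proof. by case: b. Qed.

Ltac dtm := repeat first
  [ assumption
  | apply: dt_var | apply: dt_num | apply: dt_base | apply: dt_succ | apply: dt_pair
  | apply: dt_fn | apply: dt_exp | apply: dt_add | apply: dt_mul
  | solve [apply: dt_ren; assumption] | apply: dt_app; first assumption ].

Ltac dfn := repeat first
  [ apply: df_const | apply: df_and | apply: df_or
  | apply: df_all; [solve [dtm]|] | apply: df_ex; [solve [dtm]|]
  | apply: df_imp | apply: df_iff | apply: df_not
  | apply: df_eq; solve [dtm] | apply: df_lt; solve [dtm] | apply: df_le; solve [dtm]
  | apply: df_app; [assumption|solve [dtm]]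
  | apply: df_orc; solve [dtm]
  | apply: df_exs => ? | apply: df_exf => ? | apply: df_allf => ? ].

Lemma deff_comp h g : deff h -> deff g -> deff (fun c e x => h c e (g c e x)).
Proof. by move=> Hh Hg r t Ht; apply: dt_app => //; apply: dt_app. Qed.

Lemma deff_fn : deff (fun c _ x => fn c x).
Proof. by move=> r g Hg; apply: dt_fn. Qed.

Lemma deff_sub h g : deff h -> dterm g -> deff (fun c e x => h c e (pair (g c e) x)).
Proof.
move=> Hh Hg r t Ht; apply: dt_app => //; apply: dt_pair => //.
exact: dt_ren.
Qed.

Lemma defp_orc : defp (fun c _ x => orc c x).
Proof. by move=> r g Hg; apply: df_orc. Qed.

(** Merges the tables of a certificate into one function. Since [pair] is injective there is no
    conflict, and arguments off its range get the value 0, which keeps the bound. *)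
Lemma pack (g : nat -> nat -> nat) k : (forall i x, g i x <= k) ->
  exists h, (forall i x, h (pair i x) = g i x) /\ forall z, h z <= k.
Proof.
move=> Hg.
have Hz z : {y | (forall i x, z = pair i x -> y = g i x) /\ y <= k}.
  apply: constructive_indefinite_description.
  case: (classic (exists i x, z = pair i x)) => [[i [x ->]]|H].
    by exists (g i x); split=> // i' x' /pair_inj [-> ->].
  by exists 0; split=> // i x E; case: H; exists i, x.
exists (fun z => proj1_sig (Hz z)); split=> [i x|z]; case: (Hz _) => y [H1 H2] //=.
exact: H1.
Qed.


(** * Counter programs *)

Inductive cmd :=
| CSet0 of nat
| CInc of nat
| CEq of nat & nat & nat
| CCert of nat & nat
| CIn of nat & nat & seq nat
| COrc of nat & nat
| CSeq of cmd & cmd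
| CFor of nat & nat & cmd
| CApp.

Definition upd (e : nat -> nat) (p x : nat) : nat -> nat :=
  fun q => if q == p then x else e q.

Lemma upd_same e p x : upd e p x p = x.
Proof. by rewrite /upd eqxx. Qed.

Lemma upd_other e p x q : q != p -> upd e p x q = e q.
Proof. by rewrite /upd => /negbTE ->. Qed.

Section Run.
Variables (I : nat -> seq nat -> bool) (O C : nat -> bool).

(* Counters saturate at [N - 1], where [N] is the current capacity. *)
Definition inc (p : nat) (s : nat * (nat -> nat)) :=
  (s.1, upd s.2 p (minn (s.2 p).+1 s.1.-1)).

Fixpoint run (c : cmd) (s : nat * (nat -> nat)) : nat * (nat -> nat) :=
  match c with
  | CSet0 p => (s.1, upd s.2 p 0)
  | CInc p => inc p s
  | CEq r p q => (s.1, upd s.2 r (s.2 p == s.2 q))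
  | CCert r p => (s.1, upd s.2 r (C (s.2 p)))
  | CIn r i ps => (s.1, upd s.2 r (I i [seq s.2 p | p <- ps]))
  | COrc r p => (s.1, upd s.2 r (O (s.2 p)))
  | CSeq c1 c2 => run c2 (run c1 s)
  | CFor p q c1 => iter (s.2 q) (fun s' => inc p (run c1 s')) (s.1, upd s.2 p 0)
  | CApp => (s.1.+1, s.2)
  end.

Fixpoint writes (c : cmd) : seq nat :=
  match c with
  | CSet0 p | CInc p => [:: p]
  | CEq r _ _ | CCert r _ | CIn r _ _ | COrc r _ => [:: r]
  | CSeq c1 c2 => writes c1 ++ writes c2
  | CFor p q c1 => p :: writes c1
  | CApp => [::]
  end.

(** A loop body writes neither the counter nor the bound of its loop, so the number of rounds is
    fixed at entry. The target of a test differs from its arguments, so that it may be cleared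
    before the test is made. *)
Fixpoint wfc (c : cmd) : bool :=
  match c with
  | CEq r p q => (r != p) && (r != q)
  | CCert r p | COrc r p => r != p
  | CIn r i ps => r \notin ps
  | CSeq c1 c2 => wfc c1 && wfc c2
  | CFor p q c1 =>
      [&& p != q, p \notin writes c1, q \notin writes c1 & wfc c1]
  | _ => true
  end.

Fixpoint maxreg (c : cmd) : nat :=
  match c with
  | CSet0 p | CInc p => p
  | CEq r p q => maxn r (maxn p q)
  | CCert r p | COrc r p => maxn r p
  | CIn r i ps => maxn r (foldr maxn 0 ps)
  | CSeq c1 c2 => maxn (maxreg c1) (maxreg c2)
  | CFor p q c1 => maxn (maxn p q) (maxreg c1)
  | CApp => 0
  end.

Fixpoint noapp (c : cmd) : bool :=
  match c with
  | CSeq c1 c2 => noapp c1 && noapp c2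
  | CFor _ _ c1 => noapp c1
  | CApp => false
  | _ => true
  end.

Lemma run_writes c s j : j \notin writes c -> (run c s).2 j = s.2 j.
Proof.
elim: c s j => [p|p|r p q|r p|r i ps|r p|c1 IH1 c2 IH2|p q c1 IH|] s j /=;
  rewrite ?inE ?mem_cat ?negb_or //; try by move=> H; rewrite upd_other.
  by case/andP => H1 H2; rewrite IH2 // IH1.
case/andP => jp jc; elim: (s.2 q) => [|n IHn] /=; first by rewrite upd_other.
by rewrite upd_other // IH.
Qed.

Lemma run_lt c s : 1 < s.1 -> (forall j, s.2 j < s.1) ->
  s.1 <= (run c s).1 /\ (forall j, (run c s).2 j < (run c s).1).
Proof.
elim: c s => [p|p|r p q|r p|r i ps|r p|c1 IH1 c2 IH2|p q c1 IH|] s /= N2 Hs.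
- by split=> // j; rewrite /upd; case: eqP => // _; lia.
- by split=> // j; rewrite /upd; case: eqP => // _; lia.
- by split=> // j; rewrite /upd; case: eqP => // _; case: (_ == _) => /=; lia.
- by split=> // j; rewrite /upd; case: eqP => // _; case: (C _) => /=; lia.
- by split=> // j; rewrite /upd; case: eqP => // _; case: (I _ _) => /=; lia.
- by split=> // j; rewrite /upd; case: eqP => // _; case: (O _) => /=; lia.
- case: (IH1 s N2 Hs) => H1 H2.
  case: (IH2 (run c1 s)) => [||H3 H4] //; first by lia.
  by split=> //; lia.
- elim: (s.2 q) => [|n [IHn1 IHn2]] /=.
    by split=> // j; rewrite /upd; case: eqP => // _; lia.
  set s1 := iter _ _ _ in IHn1 IHn2 *.
  case: (IH s1) => [||H3 H4] //; first by lia.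
  split; first by lia.
  by move=> j; rewrite /upd; case: eqP => // _; lia.
- by split=> // j; move: (Hs j); lia.
Qed.

Lemma run_noapp c s : noapp c -> (run c s).1 = s.1.
Proof.
elim: c s => //= [c1 IH1 c2 IH2|p q c1 IH] s.
  by case/andP => H1 H2; rewrite IH2 // IH1.
by move=> H; elim: (s.2 q) => //= n IHn; rewrite IH.
Qed.

(** Loop rule whose invariant is indexed by the number of completed rounds; as the bound is below
    the capacity, the loop counter never saturates. *)
Lemma run_for (N : nat) p q c e (J : nat -> (nat -> nat) -> Prop) :
  e q < N -> J 0 (upd e p 0) ->
  (forall i e1, i < e q -> J i e1 -> e1 p = i ->
     exists e2, [/\ run c (N, e1) = (N, e2), e2 p = i & J i.+1 (upd e2 p i.+1)]) ->
  exists e', [/\ run (CFor p q c) (N, e) = (N, e'), e' p = e q & J (e q) e'].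
Proof.
move=> qN J0 Hstep /=.
suff H n : n <= e q -> exists e', [/\ iter n (fun s' => inc p (run c s'))
   (N, upd e p 0) = (N, e'), e' p = n & J n e'] by exact: H.
elim: n => [|n IHn] Hn /=; first by exists (upd e p 0); rewrite upd_same.
case: IHn => [|e1 [-> e1p HJ]]; first by lia.
case: (Hstep n e1) => // e2 [-> e2p HJ2].
exists (upd e2 p n.+1); rewrite /inc /= e2p upd_same; split=> //.
by have -> : minn n.+1 N.-1 = n.+1 by lia.
Qed.

Definition addto (r a z : nat) := CFor z a (CInc r).

Lemma run_addto N e r a z : r != a -> z != a -> z != r -> e r + e a < N ->
  run (addto r a z) (N, e) = (N, upd (upd e r (e r + e a)) z (e a)).
Proof.
move=> ra za zr HN; rewrite /addto.
pose J i e1 := e1 r = e r + i /\ (forall j, j != r -> j != z -> e1 j = e j).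
case: (@run_for N z a (CInc r) e J) => [|||e' [-> e'z [HJ1 HJ2]]].
- by lia.
- by split=> [|j H1 H2]; rewrite upd_other // 1?eq_sym // addn0.
- move=> i e1 Hi [H1 H2] H3; exists (upd e1 r (e1 r).+1); split.
  + by rewrite /= /inc /=; have -> : minn (e1 r).+1 N.-1 = (e1 r).+1 by lia.
  + by rewrite upd_other.
  + split=> [|j jr jz]; first by rewrite upd_other 1?eq_sym // upd_same H1; lia.
    by rewrite !upd_other // H2.
congr (_, _); apply: functional_extensionality => j; rewrite /upd.
by case: eqP => [->//|/eqP jz]; case: eqP => [->//|/eqP jr]; apply: HJ2.
Qed.

Definition addmul (r a b z z' : nat) := CFor z a (addto r b z').

Lemma run_addmul N e r a b z z' :
  uniq [:: r; a; b; z; z'] -> (forall j, e j < N) -> e r + e a * e b < N ->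
  exists e', [/\ run (addmul r a b z z') (N, e) = (N, e'),
    e' r = e r + e a * e b,
    (forall j, j != r -> j != z -> j != z' -> e' j = e j)
    & forall j, e' j < N].
Proof.
rewrite /addmul /= !inE !negb_or => /and5P[/and4P[ra rb rz rz'] /and3P[ab az az'] /andP[bz bz'] zz' _] HeN HN.
pose J i e1 := [/\ e1 r = e r + i * e b,
     (forall j, j != r -> j != z -> j != z' -> e1 j = e j) & forall j, e1 j < N].
case: (@run_for N z a (addto r b z') e J) => [|||e' [/= -> e'z [HJ1 HJ2 HJ3]]].
- by [].
- split=> [|j H1 H2 H3|j]; [by rewrite upd_other // mul0n addn0|by rewrite upd_other|].
  by rewrite /upd; case: eqP => // _; move: (HeN j); lia.
- move=> i e1 Hi [H1 H2 H4] H3.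
  have Eb : e1 b = e b by apply: H2; rewrite // eq_sym.
  exists (upd (upd e1 r (e r + i * e b + e b)) z' (e b)); split.
  + by rewrite run_addto 1?eq_sym // ?H1 ?Eb //; nia.
  + by rewrite !upd_other // 1?eq_sym.
  + split=> [|j j1 j2 j3|j].
    * by rewrite (upd_other _ _ rz) (upd_other _ _ rz') upd_same; lia.
    * by rewrite !upd_other // H2.
    * rewrite /upd; case: eqP => [_|_]; first by move: (HeN a); lia.
      by case: eqP => // _; case: eqP => // _; nia.
by exists e'; split.
Qed.

Lemma run_when0 N e q z c : e q = 0 ->
  run (CFor z q c) (N, e) = (N, upd e z 0).
Proof. by move=> /= ->. Qed.

Lemma run_when1 N e q z c : e q = 1 ->
  run (CFor z q c) (N, e) = inc z (run c (N, upd e z 0)).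
Proof. by move=> /= ->. Qed.

End Run.

Opaque addto addmul.

(** ** Evaluation of formulas by counter programs *)

Section Compile.
(* [kb]: values of the function variable are at most [(base + 1) ^ kb]. *)
Variables (kb o : nat).

Fixpoint cincs (n r : nat) : cmd :=
  if n is n'.+1 then CSeq (cincs n' r) (CInc r) else CSet0 r.

Fixpoint cpow (k r : nat) : cmd :=
  if k is k'.+1 then
    CSeq (cpow k' r.+1) (CSeq (CSeq (CSet0 r.+2) (CSeq (addto r.+2 0 r.+3) (CInc r.+2)))
      (CSeq (CSet0 r) (addmul r r.+1 r.+2 r.+3 r.+4)))
  else CSeq (CSet0 r) (CInc r).

(** One round of the scan through a block of the certificate: [r] accumulates the value, [r.+1]
    holds the argument, [r.+2] the block length and [r.+3], the counter of the surrounding loop, the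
    position in the block. *)
Definition cfnbody (r : nat) : cmd :=
  CSeq (CSet0 r.+4) (CSeq (addmul r.+4 r.+1 r.+2 (r + 5) (r + 6))
    (CSeq (addto r.+4 r.+3 (r + 5)) (CSeq (CCert (r + 5) r.+4) (addto r (r + 5) (r + 6))))).

Fixpoint cterm (vm : nat -> nat) (t : tm) (r : nat) : cmd :=
  match t with
  | TVar i => CSeq (CSet0 r) (addto r (vm i) r.+1)
  | TBase => CSeq (CSet0 r) (addto r 0 r.+1)
  | TNum n => cincs n r
  | TAdd a b => CSeq (cterm vm a r) (CSeq (cterm vm b r.+1) (addto r r.+1 r.+2))
  | TMul a b => CSeq (cterm vm a r.+1) (CSeq (cterm vm b r.+2)
                  (CSeq (CSet0 r) (addmul r r.+1 r.+2 r.+3 r.+4)))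
  | TFn a => CSeq (cterm vm a r.+1) (CSeq (cpow kb r.+2)
               (CSeq (CSet0 r) (CFor r.+3 r.+2 (cfnbody r))))
  end.

Fixpoint cterms (vm : nat -> nat) (ts : seq tm) (r : nat) : cmd :=
  if ts is t :: ts' then CSeq (cterm vm t r) (cterms vm ts' r.+1) else CSet0 r.

Fixpoint cfm (vm : nat -> nat) (f : fm) (r : nat) : cmd :=
  match f with
  | FEq a b => CSeq (cterm vm a r.+1) (CSeq (cterm vm b r.+2) (CEq r r.+1 r.+2))
  | FIn i ts => CSeq (cterms vm ts r.+1) (CIn r i (iota r.+1 (size ts)))
  | FOrc t => CSeq (cterm vm t r.+1) (CSeq (CSet0 o) (CSeq (addto o r.+1 r.+2) (COrc r o)))
  | FAnd f g => CSeq (cfm vm f r.+1) (CSeq (CSet0 r)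
      (CFor r.+2 r.+1 (CSeq (cfm vm g r.+3) (addto r r.+3 r.+4))))
  | FNot f => CSeq (cfm vm f r.+1) (CSeq (CSet0 r) (CSeq (CInc r) (CFor r.+2 r.+1 (CSet0 r))))
  | FEx t f => CSeq (cterm vm t r.+1) (CSeq (CSet0 r)
      (CFor r.+2 r.+1 (CSeq (cfm (scons r.+2 vm) f r.+3)
         (CFor r.+4 r.+3 (CSeq (CSet0 r) (CInc r))))))
  end.

(** A degree in [b.+1] that bounds all intermediate values if the variables have degree [d]; it
    determines the capacity that an evaluation needs. *)
Fixpoint tdeg (d : nat) (t : tm) : nat :=
  match t with
  | TVar _ => d
  | TBase => 1
  | TNum n => n
  | TAdd a b => (maxn (tdeg d a) (tdeg d b)).+1
  | TMul a b => tdeg d a + tdeg d b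
  | TFn a => tdeg d a + kb.+1
  end.

Fixpoint fdeg (d : nat) (f : fm) : nat :=
  match f with
  | FEq a b => maxn (tdeg d a) (tdeg d b)
  | FIn _ ts => foldr maxn 0 [seq tdeg d t | t <- ts]
  | FOrc t => tdeg d t
  | FAnd f g => maxn (fdeg d f) (fdeg d g)
  | FNot f => fdeg d f
  | FEx t f => maxn (tdeg d t) (fdeg (maxn d (tdeg d t)) f)
  end.

Variables (I : nat -> seq nat -> bool) (O C : nat -> bool) (N b : nat).
Hypotheses (b0 : 0 < b) (N1 : 1 < N) (o0 : 0 < o).

(** A certificate consists of bits, so a function value is coded in unary, as the number of ones in
    its block of length [b.+1 ^ kb]. *)
Definition decode (x : nat) : nat :=
  \sum_(0 <= y < b.+1 ^ kb) C (x * b.+1 ^ kb + y).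

Let Fc := Ctx b I O decode.

Lemma decode_le x : decode x <= b.+1 ^ kb.
Proof.
apply: (@leq_trans (\sum_(0 <= y < b.+1 ^ kb) 1)); last by rewrite sum_nat_const_nat subn0 muln1.
by apply: leq_sum => i _; case: (C _).
Qed.

(** Registers are used as a stack: everything from [r] on is scratch, and below [r] only the query
    register [o] may be overwritten. Accordingly [okenv] keeps the variables below [r] and away from
    [o]. *)
Definition computes (c : cmd) (r : nat) (e : nat -> nat) (v : nat) : Prop :=
  exists e', [/\ run I O C c (N, e) = (N, e'), e' r = v,
    (forall j, j < r -> j != o -> e' j = e j) & forall j, e' j < N].

Definition okenv (e : nat -> nat) (r : nat) (vm rho : nat -> nat) (d : nat) : Prop :=
  [/\ e 0 = b, 0 < r, o < r, (forall j, e j < N)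
    & forall i, [/\ vm i < r, vm i != o, e (vm i) = rho i & rho i < b.+1 ^ d]].

Lemma ltn_pow (x y d d' : nat) : x < b.+1 ^ d -> d <= d' -> b.+1 ^ d' <= y -> x < y.
Proof.
move=> H1 H2 H3; apply: leq_trans H1 (leq_trans _ H3).
by rewrite leq_exp2l.
Qed.

Lemma teval_deg rho d t : (forall i, rho i < b.+1 ^ d) ->
  teval Fc rho t < b.+1 ^ tdeg d t.
Proof.
move=> Hr; elim: t => [i||n|t IHt u IHu|t IHt u IHu|t IHt] /=.
- exact: Hr.
- by rewrite expn1.
- exact: ltn_expl.
- have Ht := ltn_pow IHt (leq_maxl _ (tdeg d u)) (leqnn _).
  have Hu := ltn_pow IHu (leq_maxr (tdeg d t) _) (leqnn _).
  by rewrite expnS; nia.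
- by rewrite expnD; nia.
- rewrite expnD expnS; have := decode_le (teval Fc rho t).
  have : 0 < b.+1 ^ tdeg d t by rewrite expn_gt0.
  have : 0 < b.+1 ^ kb by rewrite expn_gt0.
  by nia.
Qed.

Lemma computes_cincs n r e : (forall j, e j < N) -> n < N -> computes (cincs n r) r e n.
Proof.
move=> HN; elim: n => [|n IH] Hn /=.
  exists (upd e r 0); rewrite upd_same; split=> // j.
    by move=> jr _; rewrite upd_other //; lia.
  by rewrite /upd; case: eqP => //; lia.
case: IH => [|e' [E e'r H1 H2]]; first by lia.
exists (upd e' r n.+1); rewrite /= E /inc /= e'r.
have -> : minn n.+1 N.-1 = n.+1 by lia.
rewrite upd_same; split=> // j.
  by move=> jr jo; rewrite upd_other ?H1 //; lia.
by rewrite /upd; case: eqP.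
Qed.

Lemma computes_copy a r e : a < r -> (forall j, e j < N) ->
  computes (CSeq (CSet0 r) (addto r a r.+1)) r e (e a).
Proof.
move=> ar HN; rewrite /computes; move: (addto r a r.+1) (@run_addto I O C N (upd e r 0) r a r.+1) => c Hc.
have Ea : upd e r 0 a = e a by rewrite upd_other //; lia.
rewrite /= Hc ?upd_same ?Ea; try lia; last by move: (HN a); lia.
eexists; split; first reflexivity.
- by rewrite upd_other ?upd_same //; lia.
- by move=> j jr jo; rewrite !upd_other //; lia.
- by move=> j; rewrite /upd add0n; case: eqP => // _; case: (j == r).
Qed.

Ltac eqx := try (apply/eqP; lia).

Lemma computes_cpow k r e : 0 < r -> e 0 = b -> o < r -> (forall j, e j < N) ->
  b.+1 ^ k < N -> computes (cpow k r) r e (b.+1 ^ k).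
Proof.
elim: k r e => [|k IH] r e r0 e0 ore HN Hk.
  by move: (@computes_cincs 1 r e HN N1).
have Hk' : b.+1 ^ k < N by move: Hk; rewrite expnS; nia.
have Hb1 : b.+1 < N.
  by move: Hk; rewrite expnS; move: (expn_gt0 b.+1 k) => /=; nia.
case: (IH r.+1 e) => // [|e1 [E1 e1r H1 H1N]]; first by lia.
have := @computes_copy 0 r.+2 e1 ltac:(lia) H1N.
case=> e2 [E2 e2r H2 H2N].
have e10 : e1 0 = b by rewrite H1 //; lia.
pose e3 := upd e2 r.+2 b.+1.
have H3N j : e3 j < N by rewrite /e3 /upd; case: eqP.
pose e4 := upd e3 r 0.
have H4N j : e4 j < N by rewrite /e4 /upd; case: eqP => // _; lia.
have E4a : e4 r.+1 = b.+1 ^ k.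
  by rewrite /e4 upd_other ?/e3 ?upd_other ?H2 //; lia.
have E4b : e4 r.+2 = b.+1.
  by rewrite /e4 upd_other ?/e3 ?upd_same //; lia.
have E4r : e4 r = 0 by rewrite /e4 upd_same.
have [||| e5 [E5 e5r H5 H5N]] := @run_addmul I O C N e4 r r.+1 r.+2 r.+3 r.+4.
- by rewrite /= !inE; lia.
- by [].
- by rewrite E4a E4b E4r add0n -expnSr.
exists e5; split=> //.
- move: E2; rewrite /= E1 /= => ->; rewrite /inc /= -/e3 e2r e10.
  have -> : minn b.+1 N.-1 = b.+1 by lia.
  by rewrite /= -/e3 -/e4.
- by rewrite e5r E4r E4a E4b add0n -expnSr.
- move=> j jr jo; rewrite H5; try lia.
  by rewrite /e4 upd_other ?/e3 ?upd_other ?H2 ?H1 //; lia.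
Qed.

Lemma computes_weaken c r e v r' : computes c r e v -> r' <= r ->
  exists e', [/\ run I O C c (N, e) = (N, e'), e' r = v,
    (forall j, j < r' -> j != o -> e' j = e j) & forall j, e' j < N].
Proof.
case=> e' [E er H HN] Hr; exists e'; split=> // j jr jo.
by apply: H => //; apply: leq_trans jr Hr.
Qed.

Lemma okenv_ext e e' r r' vm rho d : okenv e r vm rho d ->
  (forall j, j < r -> j != o -> e' j = e j) -> (forall j, e' j < N) -> r <= r' ->
  okenv e' r' vm rho d.
Proof.
case=> e0 r0 ore HN Hv H HN' rr; split=> //; try lia.
  by rewrite H //; lia.
by move=> i; case: (Hv i) => v1 v2 v3 v4; split=> //; [lia|rewrite H].
Qed.

Lemma computes_cterm t vm r e rho d : okenv e r vm rho d -> b.+1 ^ tdeg d t <= N ->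
  computes (cterm vm t r) r e (teval Fc rho t).
Proof.
elim: t vm r e => [i||n|t IHt u IHu|t IHt u IHu|t IHt] vm r e Hok Hdeg.
- case: (Hok) => e0 r0 ore HN Hv; case: (Hv i) => v1 v2 v3 v4 /=.
  by rewrite -v3; apply: computes_copy.
- case: (Hok) => e0 r0 ore HN Hv.
  by rewrite /= -e0; apply: computes_copy.
- case: (Hok) => e0 r0 ore HN Hv.
  apply: computes_cincs => //.
  by apply: leq_trans Hdeg => /=; apply: ltn_expl.
- case: (Hok) => e0 r0 ore HN Hv.
  have Hd1 : b.+1 ^ tdeg d t <= N.
    by apply: leq_trans Hdeg; rewrite leq_exp2l //=; lia.
  have Hd2 : b.+1 ^ tdeg d u <= N.
    by apply: leq_trans Hdeg; rewrite leq_exp2l //=; lia.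
  have [e1 [E1 e1r H1 H1N]] := IHt vm r e Hok Hd1.
  have Hok1 : okenv e1 r.+1 vm rho d by apply: okenv_ext Hok _ _ _.
  have [e2 [E2 e2r H2 H2N]] := IHu vm r.+1 e1 Hok1 Hd2.
  have e2r' : e2 r = teval Fc rho t by rewrite H2 //; lia.
  have HNv : teval Fc rho t + teval Fc rho u < N.
    have Hr i : rho i < b.+1 ^ d by case: (Hv i).
    have Hd := @teval_deg rho d (TAdd t u) Hr.
    exact: leq_trans Hd Hdeg.
  have := @run_addto I O C N e2 r r.+1 r.+2; rewrite e2r e2r' => E3.
  eexists; split.
  + by move: E3; rewrite /= E1 /= E2 => -> //; lia.
  + by rewrite upd_other ?upd_same //; lia.
  + by move=> j jr jo; rewrite !upd_other ?H2 ?H1 //; lia.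
  + move=> j; rewrite /upd; case: eqP => _; first by rewrite -e2r.
    by case: eqP.
- case: (Hok) => e0 r0 ore HN Hv.
  have Hd1 : b.+1 ^ tdeg d t <= N.
    by apply: leq_trans Hdeg; rewrite leq_exp2l //=; lia.
  have Hd2 : b.+1 ^ tdeg d u <= N.
    by apply: leq_trans Hdeg; rewrite leq_exp2l //=; lia.
  have Hok0 : okenv e r.+1 vm rho d by apply: okenv_ext Hok _ _ _.
  have [e1 [E1 e1r H1 H1N]] := IHt vm r.+1 e Hok0 Hd1.
  have Hok1 : okenv e1 r.+2 vm rho d by apply: okenv_ext Hok0 _ _ _.
  have [e2 [E2 e2r H2 H2N]] := IHu vm r.+2 e1 Hok1 Hd2.
  have e2r' : e2 r.+1 = teval Fc rho t by rewrite H2 //; lia.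
  have HNv : teval Fc rho t * teval Fc rho u < N.
    have Hr i : rho i < b.+1 ^ d by case: (Hv i).
    have Hd := @teval_deg rho d (TMul t u) Hr.
    exact: leq_trans Hd Hdeg.
  pose e3 := upd e2 r 0.
  have H3N j : e3 j < N by rewrite /e3 /upd; case: eqP => // _; lia.
  have E3a : e3 r.+1 = teval Fc rho t by rewrite /e3 upd_other //; lia.
  have E3b : e3 r.+2 = teval Fc rho u by rewrite /e3 upd_other //; lia.
  have E3r : e3 r = 0 by rewrite /e3 upd_same.
  have [||| e4 [E4 e4r H4 H4N]] := @run_addmul I O C N e3 r r.+1 r.+2 r.+3 r.+4.
  + by rewrite /= !inE; lia.
  + by [].
  + by rewrite E3a E3b E3r add0n.
  exists e4; split=> //.
  + by rewrite /= E1 /= E2 /= -/e3 E4.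
  + by rewrite e4r E3r E3a E3b add0n.
  + move=> j jr jo; rewrite H4; try lia.
    by rewrite /e3 upd_other ?H2 ?H1 //; lia.
- case: (Hok) => e0 r0 ore HN Hv.
  have Hr i : rho i < b.+1 ^ d by case: (Hv i).
  have Hd1 : b.+1 ^ tdeg d t <= N.
    by apply: leq_trans Hdeg; rewrite leq_exp2l //=; lia.
  have Hok0 : okenv e r.+1 vm rho d by apply: okenv_ext Hok _ _ _.
  have [e1 [E1 e1r H1 H1N]] := IHt vm r.+1 e Hok0 Hd1.
  have Hok1 : okenv e1 r.+2 vm rho d by apply: okenv_ext Hok0 _ _ _.
  have HkN : b.+1 ^ kb < N.
    apply: leq_trans Hdeg; rewrite ltn_exp2l //=; lia.
  case: Hok1 => e10 r10 or1 _ _.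
  have [e2 [E2 e2r H2 H2N]] := @computes_cpow kb r.+2 e1 r10 e10 or1 H1N HkN.
  set a := teval Fc rho t in e1r.
  have Ha : a < b.+1 ^ tdeg d t by apply: teval_deg.
  have e2a : e2 r.+1 = a by rewrite H2 ?e1r //; lia.
  have HaN : a * b.+1 ^ kb + b.+1 ^ kb <= N.
    apply: leq_trans Hdeg; rewrite /= expnD expnS.
    have : 0 < b.+1 ^ kb by rewrite expn_gt0.
    by nia.
  pose e3 := upd e2 r 0.
  have H3N j : e3 j < N by rewrite /e3 /upd; case: eqP => // _; lia.
  have E3a : e3 r.+1 = a by rewrite /e3 upd_other //; lia.
  have E3b : e3 r.+2 = b.+1 ^ kb by rewrite /e3 upd_other //; lia.
  (* Invariant of the scan: [r] holds the number of ones among the first [i] bits of block [a]. *)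
  pose J i e' := [/\ e' r = \sum_(0 <= y < i) C (a * b.+1 ^ kb + y),
    e' r.+1 = a, e' r.+2 = b.+1 ^ kb,
    (forall j, j < r -> e' j = e3 j) & forall j, e' j < N].
  have [||| e' [E' e'p [J1 J2 J3 J4 J5]]] := @run_for I O C N r.+3 r.+2 (cfnbody r) e3 J.
  + by rewrite E3b.
  + split=> [||| j jr| j].
    * by rewrite upd_other ?big_geq // /e3 ?upd_same //; lia.
    * by rewrite upd_other //; lia.
    * by rewrite upd_other //; lia.
    * by rewrite upd_other //; lia.
    * by rewrite /upd; case: eqP => // _; lia.
  + rewrite E3b => i f Hi [F1 F2 F3 F4 F5] F6.
    pose f1 := upd f r.+4 0.
    have G1 j : f1 j < N by rewrite /f1 /upd; case: eqP => // _; lia.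
    have f1a : f1 r.+1 = a by rewrite /f1 upd_other //; lia.
    have f1b : f1 r.+2 = b.+1 ^ kb by rewrite /f1 upd_other //; lia.
    have f1r : f1 r.+4 = 0 by rewrite /f1 upd_same.
    have [||| f2 [R2 f2r G2 G2N]] := @run_addmul I O C N f1 r.+4 r.+1 r.+2 (r + 5) (r + 6).
    * by rewrite /= !inE; lia.
    * by [].
    * by rewrite f1r f1a f1b add0n; lia.
    have f2i : f2 r.+3 = i by rewrite G2 ?/f1 ?upd_other //; lia.
    rewrite f1r f1a f1b add0n in f2r.
    have R3 := @run_addto I O C N f2 r.+4 r.+3 (r + 5).
    rewrite f2r f2i in R3.
    have {}R3 := R3 ltac:(lia) ltac:(lia) ltac:(lia) ltac:(lia).
    set f3 := upd _ _ _ in R3.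
    have f3r : f3 r.+4 = a * b.+1 ^ kb + i.
      by rewrite /f3 upd_other ?upd_same //; lia.
    pose f4 := upd f3 (r + 5) (C (f3 r.+4)).
    have f4r : f4 r = f r.
      by rewrite /f4 upd_other ?/f3 ?upd_other ?G2 ?/f1 ?upd_other //; lia.
    have G4N j : f4 j < N.
      rewrite /f4 /upd; case: eqP => _; first by case: (C _) => /=; lia.
      rewrite /f3 /upd; case: eqP => _; first by lia.
      by case: eqP => // _; lia.
    have f4c : f4 (r + 5) = C (a * b.+1 ^ kb + i) by rewrite /f4 upd_same f3r.
    have Hsum : \sum_(0 <= y < i) C (a * b.+1 ^ kb + y) <= i.
      apply: (@leq_trans (\sum_(0 <= y < i) 1)); last by rewrite sum_nat_const_nat subn0 muln1.
      by apply: leq_sum => y _; case: (C _).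
    have R5 := @run_addto I O C N f4 r (r + 5) (r + 6).
    rewrite f4c f4r F1 in R5.
    have {}R5 := R5 ltac:(lia) ltac:(lia) ltac:(lia) ltac:(case: (C _) => /=; lia).
    set f5 := upd _ _ _ in R5.
    exists f5; split.
    * by rewrite /cfnbody /= -/f1 R2 /= R3 /= -/f4 R5.
    * by rewrite /f5 !upd_other ?/f4 ?upd_other ?/f3 ?upd_other //; lia.
    * split=> [||| j jr| j].
      - rewrite upd_other; last by lia.
        by rewrite /f5 upd_other ?upd_same ?big_nat_recr //=; lia.
      - by rewrite upd_other ?/f5 ?upd_other ?/f4 ?upd_other ?/f3 ?upd_other ?G2 //; lia.
      - by rewrite upd_other ?/f5 ?upd_other ?/f4 ?upd_other ?/f3 ?upd_other ?G2 //; lia.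
      - rewrite upd_other ?/f5 ?upd_other ?/f4 ?upd_other ?/f3 ?upd_other ?G2 ?/f1 ?upd_other; try lia.
        by rewrite F4.
      - rewrite /upd; case: eqP => _; first by lia.
        rewrite /f5 /upd; case: eqP => _; first by case: (C _) => /=; lia.
        by case: eqP => // _; case: (C _) => /=; lia.
  exists e'; split=> //.
  + rewrite /= E1 /= E2 /= -/e3; exact: E'.
  + by rewrite J1 E3b.
  + by move=> j jr jo; rewrite J4 // /e3 upd_other ?H2 ?H1 //; lia.
Qed.

Lemma computes_cterms ts vm r e rho d : okenv e r vm rho d ->
  b.+1 ^ foldr maxn 0 [seq tdeg d t | t <- ts] <= N ->
  exists e', [/\ run I O C (cterms vm ts r) (N, e) = (N, e'),
    [seq e' j | j <- iota r (size ts)] = [seq teval Fc rho t | t <- ts],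
    (forall j, j < r -> j != o -> e' j = e j) & forall j, e' j < N].
Proof.
elim: ts r e => [|t ts IH] r e Hok Hdeg.
  case: (Hok) => e0 r0 ore HN Hv.
  exists (upd e r 0); split=> // j; first by move=> jr _; rewrite upd_other //; lia.
  by rewrite /upd; case: eqP => // _; lia.
case: (Hok) => e0 r0 ore HN Hv.
have Hd1 : b.+1 ^ tdeg d t <= N.
  by apply: leq_trans Hdeg; rewrite leq_exp2l //=; lia.
have Hd2 : b.+1 ^ foldr maxn 0 [seq tdeg d t | t <- ts] <= N.
  by apply: leq_trans Hdeg; rewrite leq_exp2l //=; lia.
have [e1 [E1 e1r H1 H1N]] := computes_cterm Hok Hd1.
have Hok1 : okenv e1 r.+1 vm rho d by apply: okenv_ext Hok _ _ _.
have [e2 [E2 e2r H2 H2N]] := IH r.+1 e1 Hok1 Hd2.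
exists e2; split=> //=.
- by rewrite E1.
- by rewrite e2r H2 ?e1r //; lia.
- by move=> j jr jo; rewrite H2 ?H1 //; lia.
Qed.

Lemma run_for_bool (e : nat -> nat) z q c (v : bool) : e q = v ->
  run I O C (CFor z q c) (N, e) =
  if v then inc z (run I O C c (N, upd e z 0)) else (N, upd e z 0).
Proof. by case: v => H; [exact: run_when1|exact: run_when0]. Qed.

(** Truth values are 0 or 1, so a loop bounded by such a register is a conditional ([run_for_bool]).
    A bounded quantifier is a loop that sets the result to 1 at each round where its body holds. *)
Lemma computes_cfm f vm r e rho d : okenv e r vm rho d -> b.+1 ^ fdeg d f <= N ->
  computes (cfm vm f r) r e (holds Fc rho f).
Proof.
elim: f vm r e rho d => [t u|i ts|t|f IHf g IHg|f IHf|t f IHf] vm r e rho d Hok Hdeg;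
  case: (Hok) => e0 r0 ore HN Hv;
  have Hok0 : okenv e r.+1 vm rho d by apply: okenv_ext Hok _ _ _.
- have Hd1 : b.+1 ^ tdeg d t <= N.
    by apply: leq_trans Hdeg; rewrite leq_exp2l //=; lia.
  have Hd2 : b.+1 ^ tdeg d u <= N.
    by apply: leq_trans Hdeg; rewrite leq_exp2l //=; lia.
  have [e1 [E1 e1r H1 H1N]] := computes_cterm Hok0 Hd1.
  have Hok1 : okenv e1 r.+2 vm rho d by apply: okenv_ext Hok0 _ _ _.
  have [e2 [E2 e2r H2 H2N]] := computes_cterm Hok1 Hd2.
  exists (upd e2 r (e2 r.+1 == e2 r.+2)); split.
  + by rewrite /= E1 /= E2.
  + by rewrite upd_same e2r (H2 r.+1) ?e1r //; lia.
  + by move=> j jr jo; rewrite upd_other ?H2 ?H1 //; lia.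
  + by move=> j; rewrite /upd; case: eqP => // _; case: (_ == _) => /=; lia.
- have [e1 [E1 e1r H1 H1N]] := computes_cterms Hok0 Hdeg.
  eexists; split.
  + by rewrite /= E1.
  + by rewrite /= upd_same e1r.
  + by move=> j jr jo; rewrite /= upd_other ?H1 //; lia.
  + by move=> j; rewrite /= /upd; case: eqP => // _; case: (I _ _) => /=; lia.
- have [e1 [E1 e1r H1 H1N]] := computes_cterm Hok0 Hdeg.
  pose e2 := upd e1 o 0.
  have := @run_addto I O C N e2 o r.+1 r.+2.
  have -> : e2 o = 0 by rewrite /e2 upd_same.
  have -> : e2 r.+1 = teval Fc rho t by rewrite /e2 upd_other //; lia.
  rewrite add0n; set v := teval _ _ _ in e1r *.
  have HvN : v < N by rewrite -e1r.
  move=> E3; have {}E3 := E3 ltac:(lia) ltac:(lia) ltac:(lia) HvN.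
  set e3 := upd _ _ _ in E3.
  exists (upd e3 r (O (e3 o))); split.
  + by rewrite /= E1 /= -/e2 E3.
  + by rewrite upd_same /e3 upd_other ?upd_same //; lia.
  + by move=> j jr jo; rewrite upd_other ?/e3 ?upd_other // ?/e2 ?upd_other // ?H1 //; lia.
  + move=> j; rewrite /upd; case: eqP => [_|_]; first by case: (O _) => /=; lia.
    by rewrite /e3 /e2 /upd; do 2 case: eqP => // _; case: eqP => // _; lia.
- have Hd1 : b.+1 ^ fdeg d f <= N.
    by apply: leq_trans Hdeg; rewrite leq_exp2l //=; lia.
  have Hd2 : b.+1 ^ fdeg d g <= N.
    by apply: leq_trans Hdeg; rewrite leq_exp2l //=; lia.
  have [e1 [E1 e1r H1 H1N]] := IHf _ _ _ _ _ Hok0 Hd1.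
  pose e2 := upd e1 r 0.
  have e2r : e2 r.+1 = holds Fc rho f by rewrite /e2 upd_other // -?e1r; lia.
  pose e3 := upd e2 r.+2 0.
  have H3N j : e3 j < N by rewrite /e3 /e2 /upd; do 2 (case: eqP => // _; first lia).
  have Hok3 : okenv e3 r.+3 vm rho d.
    apply: (@okenv_ext e _ r) Hok _ _ _ => //; last by lia.
    by move=> j jr jo; rewrite /e3 upd_other ?/e2 ?upd_other ?H1 //; lia.
  have [e4 [E4 e4r H4 H4N]] := IHg _ _ _ _ _ Hok3 Hd2.
  have e4r0 : e4 r = 0 by rewrite H4 ?/e3 ?upd_other ?/e2 ?upd_same //; lia.
  have E5 := @run_addto I O C N e4 r r.+3 r.+4.
  rewrite e4r0 e4r add0n in E5.
  have {}E5 := E5 ltac:(lia) ltac:(lia) ltac:(lia) ltac:(case: (holds _ _ g) => /=; lia).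
  set e5 := upd _ _ _ in E5.
  have H5 j : j <= r.+2 -> j != o -> j != r -> e5 j = e3 j.
    by move=> jr jo jr'; rewrite /e5 !upd_other ?H4 //; lia.
  have e5r : e5 r = holds Fc rho g by rewrite /e5 upd_other ?upd_same //; lia.
  have H5N j : e5 j < N.
    rewrite /e5 /upd; case: eqP => _; first by case: (holds _ _ _) => /=; lia.
    by case: eqP => // _; case: (holds _ _ _) => /=; lia.
  pose e6 := if holds Fc rho f then upd e5 r.+2 1 else e3.
  exists e6; split.
  + move: (run_for_bool r.+2 (CSeq (cfm vm g r.+3) (addto r r.+3 r.+4)) e2r).
    rewrite /= E1 /= -/e2 => ->; rewrite -/e3 /e6; case: (holds _ _ f) => //.
    rewrite E4 /= E5 /inc /= H5 //; try lia; rewrite /e3 upd_same.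
    by have -> : minn 1 N.-1 = 1 by lia.
  + rewrite /e6 /=; case: (holds _ _ f) => /=; first by rewrite upd_other //; lia.
    by rewrite /e3 upd_other ?/e2 ?upd_same //; lia.
  + move=> j jr jo; rewrite /e6; case: (holds _ _ f).
      by rewrite upd_other ?H5 ?/e3 ?upd_other ?/e2 ?upd_other ?H1 //; lia.
    by rewrite /e3 ?upd_other ?/e2 ?upd_other ?H1 //; lia.
  + move=> j; rewrite /e6; case: (holds _ _ f) => //.
    by rewrite /upd; case: eqP => // _; lia.
- have [e1 [E1 e1r H1 H1N]] := IHf _ _ _ _ _ Hok0 Hdeg.
  pose e2 := upd e1 r 1.
  have e2r : e2 r.+1 = holds Fc rho f by rewrite /e2 upd_other // -?e1r; lia.
  pose e3 := upd e2 r.+2 0.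
  pose e6 := if holds Fc rho f then upd (upd e3 r 0) r.+2 1 else e3.
  exists e6; split.
  + move: (run_for_bool r.+2 (CSet0 r) e2r).
    rewrite /= E1 /inc /=; have -> : upd (upd e1 r 0) r (minn (upd e1 r 0 r).+1 N.-1) = e2.
      apply: functional_extensionality => j; rewrite /e2 /upd eqxx.
      by case: eqP => // _; lia.
    move=> ->; rewrite -/e3 /e6; case: (holds _ _ f) => //=.
    rewrite (_ : upd e3 r 0 r.+2 = 0); last by rewrite upd_other ?/e3 ?upd_same //; lia.
    by have -> : minn 1 N.-1 = 1 by lia.
  + rewrite /e6 /=; case: (holds _ _ f) => /=; first by rewrite upd_other ?upd_same //; lia.
    by rewrite /e3 upd_other ?/e2 ?upd_same //; lia.
  + move=> j jr jo; rewrite /e6; case: (holds _ _ f).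
      by rewrite !upd_other ?/e3 ?upd_other ?/e2 ?upd_other ?H1 //; lia.
    by rewrite /e3 ?upd_other ?/e2 ?upd_other ?H1 //; lia.
  + move=> j; rewrite /e6 /e3 /e2; case: (holds _ _ f); rewrite /upd;
    by do 4 (case: eqP => // _; try lia).
- have Hd1 : b.+1 ^ tdeg d t <= N.
    by apply: leq_trans Hdeg; rewrite leq_exp2l //=; lia.
  have Hd2 : b.+1 ^ fdeg (maxn d (tdeg d t)) f <= N.
    by apply: leq_trans Hdeg; rewrite leq_exp2l //=; lia.
  have Hrho i : rho i < b.+1 ^ d by case: (Hv i).
  have [e1 [E1 e1r H1 H1N]] := computes_cterm Hok0 Hd1.
  have Ht := teval_deg t Hrho.
  rewrite /= in e1r *; set v := teval _ _ _ in e1r Ht *.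
  pose e2 := upd e1 r 0.
  pose P x := holds Fc (scons x rho) f.
  pose J i (e' : nat -> nat) := [/\ e' r = has P (iota 0 i), e' r.+1 = v,
    (forall j, j < r -> j != o -> e' j = e j) & forall j, e' j < N].
  have e2v : e2 r.+1 = v by rewrite /e2 upd_other //; lia.
  set body := CSeq (cfm _ f _) _.
  have [||| e' [E' e'p [J1 J2 J3 J4]]] := @run_for I O C N r.+2 r.+1 body e2 J.
  + by rewrite e2v -e1r.
  + split=> [||j jr jo|j].
    * by rewrite upd_other ?/e2 ?upd_same //; lia.
    * by rewrite upd_other //; lia.
    * by rewrite upd_other ?/e2 ?upd_other ?H1 //; lia.
    * by rewrite /e2 /upd; do 2 (case: eqP => // _; try lia).
  + rewrite e2v => i f1 Hi [F1 F2 F3 F4] F5.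
    have Hokf : okenv f1 r.+3 (scons r.+2 vm) (scons i rho) (maxn d (tdeg d t)).
      split=> //; [by rewrite F3 //; lia|by lia|].
      case=> [|j] /=.
        split=> //; [by lia|].
        by apply: leq_trans (ltn_trans Hi Ht) _; rewrite leq_exp2l //; lia.
      case: (Hv j) => v1 v2 v3 v4; split=> //; [by lia|by rewrite F3|].
      by apply: leq_trans v4 _; rewrite leq_exp2l //; lia.
    have [f2 [G2 f2r F6 F7]] := IHf _ _ _ _ _ Hokf Hd2.
    pose f3 := upd f2 r.+4 0.
    pose f4 := if P i then upd (upd f3 r 1) r.+4 1 else f3.
    exists f4; split.
    * rewrite /body /= G2.
      move: (run_for_bool r.+4 (CSeq (CSet0 r) (CInc r)) f2r) => /= ->.
      rewrite -/f3 -/(P i) /f4; case: (P i) => //=; rewrite /inc /=.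
      have -> : upd (upd f3 r 0) r (minn (upd f3 r 0 r).+1 N.-1) = upd f3 r 1.
        apply: functional_extensionality => j; rewrite /upd eqxx.
        by case: eqP => // _; lia.
      rewrite (_ : upd f3 r 1 r.+4 = 0); last by rewrite upd_other ?/f3 ?upd_same //; lia.
      by have -> : minn 1 N.-1 = 1 by lia.
    * rewrite /f4; case: (P i); rewrite ?upd_other ?/f3 ?upd_other ?F6 //; lia.
    * split=> [||j jr jo|j].
      - rewrite upd_other; last by lia.
        rewrite -addn1 iotaD has_cat /= orbF add0n /f4; case: (P i).
          by rewrite orbT upd_other ?upd_same //; lia.
        by rewrite orbF /f3 upd_other ?F6 //; lia.
      - by rewrite /f4; case: (P i); rewrite ?upd_other ?/f3 ?upd_other ?F6 //; lia.
      - by rewrite /f4; case: (P i); rewrite ?upd_other ?/f3 ?upd_other ?F6 ?F3 //; lia.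
      - rewrite /upd; case: eqP => _.
          by move: (H1N r.+1); rewrite e1r; lia.
        rewrite /f4 /f3; case: (P i); rewrite /upd; by do 3 (case: eqP => // _; try lia).
  exists e'; split=> //.
  + rewrite /= E1 /= -/e2; exact: E'.
  + by rewrite J1 e2v.
Qed.

End Compile.

(** The certificate sets the first [F x] bits of block [x]. *)
Lemma decode_surj kb b (F : nat -> nat) : (forall x, F x <= b.+1 ^ kb) ->
  exists C, forall x, decode kb C b x = F x.
Proof.
move=> HF; set B := b.+1 ^ kb.
have B0 : 0 < B by rewrite expn_gt0.
exists (fun z => z %% B < F (z %/ B)) => x; rewrite /decode -/B.
transitivity (\sum_(0 <= y < B) (y < F x : nat)).
  rewrite !big_nat; apply: eq_bigr => y /andP[_ yB].
  by rewrite modnMDl modn_small // divnMDl // divn_small // addn0.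
rewrite (@big_cat_nat _ _ _ (F x)) //=.
rewrite [X in X + _](_ : _ = \sum_(0 <= y < F x) 1); last first.
  by rewrite !big_nat; apply: eq_bigr => y /andP[_ ->].
rewrite [X in _ + X](_ : _ = \sum_(F x <= y < B) 0); last first.
  by rewrite !big_nat; apply: eq_bigr => y /andP[H _]; rewrite ltnNge H.
by rewrite !sum_nat_const_nat muln0 subn0 muln1 addn0.
Qed.

(* Syntactic properties of the compiled counter programs *)
Transparent addto addmul.

Lemma writes_cincs n r j : j \in writes (cincs n r) -> j = r.
Proof. by elim: n => [|n IH] /=; rewrite ?mem_cat !inE; [move/eqP|case/orP=> [/IH|/eqP]]. Qed.

Lemma wfc_cincs n r : wfc (cincs n r) && noapp (cincs n r).
Proof. by elim: n => //= n /andP[-> ->]. Qed.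

Lemma writes_cpow k r j : j \in writes (cpow k r) -> r <= j.
Proof.
elim: k r => [|k IH] r /=; rewrite ?mem_cat !inE; first by lia.
by move=> /orP[/IH|]; lia.
Qed.

Lemma wfc_cpow k r : 0 < r -> wfc (cpow k r) && noapp (cpow k r).
Proof.
elim: k r => //= k IH r r0; move: (IH r.+1 isT); rewrite !inE; lia.
Qed.

Lemma writes_cterm kb vm t r j : j \in writes (cterm kb vm t r) -> r <= j.
Proof.
elim: t r => [i||n|t IHt u IHu|t IHt u IHu|t IHt] r /=;
  rewrite ?(mem_cat, inE).
- by lia.
- by lia.
- by move/writes_cincs => ->.
- by move=> /or3P[/IHt|/IHu|]; lia.
- by move=> /or3P[/IHt|/IHu|]; lia.
- by move=> /or3P[/IHt|/writes_cpow|]; lia.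
Qed.

Lemma wfc_cterm kb vm t r : 0 < r -> (forall i, vm i < r) ->
  wfc (cterm kb vm t r) && noapp (cterm kb vm t r).
Proof.
elim: t r => [i||n|t IHt u IHu|t IHt u IHu|t IHt] r r0 Hv /=; rewrite ?inE.
- by move: (Hv i); lia.
- by lia.
- exact: wfc_cincs.
- have Hv1 i : vm i < r.+1 by move: (Hv i); lia.
  by move: (IHt r r0 Hv) (IHu r.+1 isT Hv1); lia.
- have Hv1 i : vm i < r.+1 by move: (Hv i); lia.
  have Hv2 i : vm i < r.+2 by move: (Hv i); lia.
  by move: (IHt r.+1 isT Hv1) (IHu r.+2 isT Hv2); lia.
- have Hv1 i : vm i < r.+1 by move: (Hv i); lia.
  by move: (IHt r.+1 isT Hv1) (@wfc_cpow kb r.+2 isT); lia.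
Qed.

Lemma writes_cterms kb vm ts r j : j \in writes (cterms kb vm ts r) -> r <= j.
Proof.
elim: ts r => [|t ts IH] r /=; first by rewrite inE; lia.
by rewrite mem_cat => /orP[/writes_cterm|/IH]; lia.
Qed.

Lemma wfc_cterms kb vm ts r : 0 < r -> (forall i, vm i < r) ->
  wfc (cterms kb vm ts r) && noapp (cterms kb vm ts r).
Proof.
elim: ts r => //= t ts IH r r0 Hv.
have Hv1 i : vm i < r.+1 by move: (Hv i); lia.
by move: (wfc_cterm kb t r0 Hv) (IH r.+1 isT Hv1); lia.
Qed.

Lemma writes_cfm kb o vm f r j : j \in writes (cfm kb o vm f r) -> r <= j \/ j = o.
Proof.
elim: f vm r => [t u|i ts|t|f IHf g IHg|f IHf|t f IHf] vm r /=;
  rewrite ?(mem_cat, inE).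
- by move=> /or3P[/writes_cterm|/writes_cterm|]; lia.
- by move=> /orP[/writes_cterms|]; lia.
- by move=> /orP[/writes_cterm|]; lia.
- by move=> /or4P[/IHf||/eqP->|/orP[/IHg|]]; lia.
- by move=> /orP[/IHf|]; lia.
- by move=> /or4P[/writes_cterm||/eqP->|/orP[/IHf|]]; lia.
Qed.

Lemma notin_writes_cfm kb o vm f r j : j < r -> j != o -> j \notin writes (cfm kb o vm f r).
Proof.
move=> jr jo; apply/negP => /writes_cfm [|E]; first by lia.
by rewrite E eqxx in jo.
Qed.

Lemma wfc_cfm kb o vm f r : 0 < r -> o < r -> (forall i, vm i < r) ->
  wfc (cfm kb o vm f r) && noapp (cfm kb o vm f r).
Proof.
elim: f vm r => [t u|i ts|t|f IHf g IHg|f IHf|t f IHf] vm r r0 ore Hv;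
  have Hv1 x : vm x < r.+1 by move: (Hv x); lia.
- have Hv2 i : vm i < r.+2 by move: (Hv i); lia.
  have := wfc_cterm kb t (isT : 0 < r.+1) Hv1.
  by have := wfc_cterm kb u (isT : 0 < r.+2) Hv2; rewrite /=; lia.
- have := wfc_cterms kb ts (isT : 0 < r.+1) Hv1.
  have : r \notin iota r.+1 (size ts) by rewrite mem_iota; lia.
  by rewrite /=; lia.
- have := wfc_cterm kb t (isT : 0 < r.+1) Hv1.
  by rewrite /= !inE; lia.
- have Hv3 i : vm i < r.+3 by move: (Hv i); lia.
  have := IHf _ r.+1 isT (ltnW ore) Hv1.
  have := IHg _ r.+3 isT (ltac:(lia) : o < r.+3) Hv3.
  have : r.+2 \notin writes (cfm kb o vm g r.+3) by apply: notin_writes_cfm; lia.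
  have : r.+1 \notin writes (cfm kb o vm g r.+3) by apply: notin_writes_cfm; lia.
  move=> /negbTE H1 /negbTE H2 /andP[H3 H4] /andP[H5 H6].
  by rewrite /= !mem_cat !inE H1 H2 H3 H4 H5 H6 /=; lia.
- have := IHf _ r.+1 isT (ltnW ore) Hv1.
  by rewrite /= !inE; lia.
- have Hv3 i : scons r.+2 vm i < r.+3 by case: i => [|i] /=; [lia|move: (Hv i); lia].
  have := wfc_cterm kb t (isT : 0 < r.+1) Hv1.
  have := IHf (scons r.+2 vm) r.+3 isT (ltac:(lia) : o < r.+3) Hv3.
  have : r.+2 \notin writes (cfm kb o (scons r.+2 vm) f r.+3) by apply: notin_writes_cfm; lia.
  have : r.+1 \notin writes (cfm kb o (scons r.+2 vm) f r.+3) by apply: notin_writes_cfm; lia.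
  move=> /negbTE H1 /negbTE H2 /andP[H3 H4] /andP[H5 H6].
  by rewrite /= !mem_cat !inE H1 H2 H3 H4 H5 H6 /=; lia.
Qed.

(** * Counter programs on one-tape machines *)

Section Fragments.
Variable X : finType.
Local Notation sym := (option (bool + X)).
Local Notation tape := (nat -> sym).

(* A deterministic machine with a boolean on exit. *)
Record frag := Frag {
  fS  : finType;
  fin : fS;
  ftr : fS -> sym -> (fS + bool) * sym * move
}.

Inductive frun (F : frag) : nat -> fS F -> tape -> nat -> bool -> tape -> nat -> Prop :=
| frun_exit s tp h x a d :
    ftr s (tp h) = (inr x, a, d) ->
    frun 1 s tp h x (write_cell tp h a) (shift d h)
| frun_step s tp h s' a d t x tp' h' :
    ftr s (tp h) = (inl s', a, d) ->
    frun t s' (write_cell tp h a) (shift d h) x tp' h' ->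
    frun t.+1 s tp h x tp' h'.

Definition runs (F : frag) t tp x tp' := frun t (fin F) tp 0 x tp' 0.

(** [F] runs inside [G] along [j], an exit with [x] being redirected to [k x]; all compositions of
    machines below are of this kind. *)
Definition embeds (F G : frag) (j : fS F -> fS G) (k : bool -> fS G + bool) :=
  forall s a, ftr (j s) a =
    match ftr s a with
    | (inl s', a', d) => (inl (j s'), a', d)
    | (inr x, a', d) => (k x, a', d)
    end.

Lemma embeds_exit F G j k t s tp h x tp' h' y : @embeds F G j k ->
  frun t s tp h x tp' h' -> k x = inr y -> frun t (j s) tp h y tp' h'.
Proof.
move=> HE; elim=> {t s tp h x tp' h'} [s tp h x a d E|s tp h s' a d t x tp' h' E _ IH] kx.
  by apply: frun_exit; rewrite HE E kx.
by apply: frun_step (IH kx); rewrite HE E.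
Qed.

Lemma embeds_go F G j k t s tp h x tp' h' s2 t2 y tp2 h2 : @embeds F G j k ->
  frun t s tp h x tp' h' -> k x = inl s2 -> frun t2 s2 tp' h' y tp2 h2 ->
  frun (t + t2) (j s) tp h y tp2 h2.
Proof.
move=> HE; elim=> {t s tp h x tp' h'} [s tp h x a d E|s tp h s' a d t x tp' h' E _ IH] kx H2.
  by rewrite add1n; apply: frun_step H2; rewrite HE E kx.
by rewrite addSn; apply: frun_step (IH kx H2); rewrite HE E.
Qed.

Definition iteF (F0 F1 F2 : frag) : frag :=
  @Frag (fS F0 + (fS F1 + fS F2))%type (inl (fin F0)) (fun s a =>
    match s with
    | inl s0 => match ftr s0 a with
      | (inl s', a', d) => (inl (inl s'), a', d)
      | (inr x, a', d) => (inl (inr (if x then inl (fin F1) else inr (fin F2))), a', d)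
      end
    | inr (inl s1) => match ftr s1 a with
      | (inl s', a', d) => (inl (inr (inl s')), a', d)
      | (inr x, a', d) => (inr x, a', d)
      end
    | inr (inr s2) => match ftr s2 a with
      | (inl s', a', d) => (inl (inr (inr s')), a', d)
      | (inr x, a', d) => (inr x, a', d)
      end
    end).

Lemma runs_ite F0 F1 F2 t0 t tp x tp1 y tp2 :
  runs F0 t0 tp x tp1 -> runs (if x then F1 else F2) t tp1 y tp2 ->
  runs (iteF F0 F1 F2) (t0 + t) tp y tp2.
Proof.
move=> H0 H1.
apply: (@embeds_go F0 (iteF F0 F1 F2) inl
  (fun x => inl (inr (if x then inl (fin F1) else inr (fin F2)))) _ _ _ _ _ _ _ _ _ _ _ _ _ H0 erefl).
  by [].
case: x H1 {H0} => H1.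
  by apply: (@embeds_exit F1 (iteF F0 F1 F2) (fun s => inr (inl s)) (fun y => inr y) _ _ _ _ _ _ _ _ _ H1).
by apply: (@embeds_exit F2 (iteF F0 F1 F2) (fun s => inr (inr s)) (fun y => inr y) _ _ _ _ _ _ _ _ _ H1).
Qed.

Definition seqF (F1 F2 : frag) : frag :=
  @Frag (fS F1 + fS F2)%type (inl (fin F1)) (fun s a =>
    match s with
    | inl s1 => match ftr s1 a with
      | (inl s', a', d) => (inl (inl s'), a', d)
      | (inr _, a', d) => (inl (inr (fin F2)), a', d)
      end
    | inr s2 => match ftr s2 a with
      | (inl s', a', d) => (inl (inr s'), a', d)
      | (inr x, a', d) => (inr x, a', d)
      end
    end).

Lemma runs_seq F1 F2 t1 t2 tp x tp1 y tp2 :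
  runs F1 t1 tp x tp1 -> runs F2 t2 tp1 y tp2 -> runs (seqF F1 F2) (t1 + t2) tp y tp2.
Proof.
move=> H1 H2.
apply: (@embeds_go F1 (seqF F1 F2) inl (fun=> inl (inr (fin F2)))
  _ _ _ _ _ _ _ _ _ _ _ _ _ H1 erefl); first by [].
by apply: (@embeds_exit F2 (seqF F1 F2) inr inr _ _ _ _ _ _ _ _ _ H2).
Qed.

(* Repeats [B] until [T] exits with [true]. *)
Definition untilF (T B : frag) : frag :=
  @Frag (fS T + fS B)%type (inl (fin T)) (fun s a =>
    match s with
    | inl s1 => match ftr s1 a with
      | (inl s', a', d) => (inl (inl s'), a', d)
      | (inr x, a', d) => (if x then inr true else inl (inr (fin B)), a', d)
      end
    | inr s2 => match ftr s2 a with
      | (inl s', a', d) => (inl (inr s'), a', d)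
      | (inr _, a', d) => (inl (inl (fin T)), a', d)
      end
    end).

Lemma runs_until_stop T B t tp tp1 : runs T t tp true tp1 -> runs (untilF T B) t tp true tp1.
Proof.
move=> H; apply: (@embeds_exit T (untilF T B) inl
  (fun x => if x then inr true else inl (inr (fin B))) _ _ _ _ _ _ _ _ _ H) => //.
Qed.

Lemma runs_until_go T B t1 t2 t3 tp tp1 x tp2 y tp3 :
  runs T t1 tp false tp1 -> runs B t2 tp1 x tp2 -> runs (untilF T B) t3 tp2 y tp3 ->
  runs (untilF T B) (t1 + (t2 + t3)) tp y tp3.
Proof.
move=> H1 H2 H3; apply: (@embeds_go T (untilF T B) inl
  (fun x => if x then inr true else inl (inr (fin B))) _ _ _ _ _ _ _ _ _ _ _ _ _ H1 erefl) => //.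
exact: (@embeds_go B (untilF T B) inr (fun=> inl (inl (fin T))) _ _ _ _ _ _ _ _ _ _ _ _ _ H2 erefl).
Qed.

Definition rowtape (row : seq X) : tape := nth None [seq Some (inr x) | x <- row].

Lemma rowtape_at s1 x s2 : rowtape (s1 ++ x :: s2) (size s1) = Some (inr x).
Proof. by rewrite /rowtape map_cat /= nth_cat size_map ltnn subnn. Qed.

Lemma rowtape_end s : rowtape s (size s) = None.
Proof. by rewrite /rowtape nth_default // size_map. Qed.

Lemma write_rowtape s1 x y s2 :
  write_cell (rowtape (s1 ++ x :: s2)) (size s1) (Some (inr y)) = rowtape (s1 ++ y :: s2).
Proof.
apply: functional_extensionality => i; rewrite /write_cell /rowtape !map_cat !nth_cat !size_map /=.
case: (ltngtP i (size s1)) => [//|H|->]; last by rewrite subnn.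
by case: (i - size s1) (ltac:(lia) : 0 < i - size s1).
Qed.

Lemma write_same tp h : write_cell tp h (tp h) = tp :> tape.
Proof. by apply: functional_extensionality => i; rewrite /write_cell; case: eqP => [->|]. Qed.

Lemma write_rowtape_end s (o : option X) :
  write_cell (rowtape s) (size s) (omap inr o) = rowtape (s ++ seq_of_opt o).
Proof.
apply: functional_extensionality => i; rewrite /write_cell /rowtape map_cat nth_cat size_map.
case: (ltngtP i (size s)) => [//|H|->].
  rewrite nth_default ?size_map; last by lia.
  by case: o => [x|] /=; case: (i - size s) (ltac:(lia) : 0 < i - size s) => // -[].
by rewrite subnn; case: o.
Qed.

Section Sweep.
Variables (first : X -> bool) (Z : finType) (z0 : Z) (delta : Z -> X -> Z * X)
  (out : Z -> bool) (app : option X).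

(** One pass of a Mealy machine to the end of the row, where a cell may be appended, and the return
    to the first cell. A state [inr b] carries the exit value back. *)
Definition sweep : frag :=
  @Frag (Z + bool)%type (inl z0) (fun s a =>
    match s with
    | inl z => if a is Some (inr x) then
                 let: (z', x') := delta z x in (inl (inl z'), Some (inr x'), MRight)
               else (inl (inr (out z)), omap inr app, MLeft)
    | inr b => if a is Some (inr x) then
                 if first x then (inr b, a, MStay) else (inl (inr b), a, MLeft)
               else (inr b, a, MStay)
    end).

Fixpoint mealy (z : Z) (row : seq X) : Z * seq X :=
  if row is x :: row' then
    let: (z', x') := delta z x in
    let: (zf, r) := mealy z' row' in (zf, x' :: r)
  else (z, [::]).

Lemma sweep_right t s1 s2 z zf r x tp' h' :
  mealy z s2 = (zf, r) ->
  @frun sweep t (inl zf) (rowtape (s1 ++ r)) (size s1 + size s2) x tp' h' ->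
  @frun sweep (size s2 + t) (inl z) (rowtape (s1 ++ s2)) (size s1) x tp' h'.
Proof.
elim: s2 s1 z r => [|a s2 IH] s1 z r /=.
  by case=> <- <-; rewrite addn0.
case Ed: (delta z a) => [z' a']; case Em: (mealy z' s2) => [zf' r'] [Ez <-] H.
rewrite Ez in Em.
rewrite addSn; apply: (@frun_step sweep _ _ _ (inl z') (Some (inr a')) MRight).
  by rewrite rowtape_at /= Ed.
rewrite write_rowtape /= -cat1s catA.
have -> : (size s1).+1 = size (s1 ++ [:: a']) by rewrite size_cat addn1.
apply: (IH (s1 ++ [:: a']) z' r') => //.
by move: H; rewrite -catA size_cat /= addn1 addSnnS.
Qed.

Lemma sweep_left row h b :
  (forall i, i < size row -> forall x, nth None [seq Some y | y <- row] i = Some x -> first x = (i == 0)) ->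
  h < size row ->
  @frun sweep h.+1 (inr b) (rowtape row) h b (rowtape row) 0.
Proof.
move=> Hf; elim: h => [|h IH] Hh.
  case: row Hf Hh => // x row Hf _.
  have fx : first x by rewrite (Hf 0 _ x).
  have E := @frun_exit sweep (inr b) (rowtape (x :: row)) 0 b (Some (inr x)) MStay.
  have {}E := E ltac:(by rewrite /= fx).
  suff W : write_cell (rowtape (x :: row)) 0 (Some (inr x)) = rowtape (x :: row) by rewrite W in E.
  exact: (@write_same (rowtape (x :: row)) 0).
have [x Ex] : exists x, nth None [seq Some y | y <- row] h.+1 = Some x.
  case: row Hh {Hf IH} => // x0 row Hh.
  by exists (nth x0 (x0 :: row) h.+1); rewrite (nth_map x0).
have Er : rowtape row h.+1 = Some (inr x).
  case: row Hh Ex {Hf IH} => // x0 row Hh; rewrite (nth_map x0) // => -[Ex].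
  by rewrite /rowtape (nth_map x0) //; congr (Some (inr _)); apply: Ex.
apply: (@frun_step sweep _ _ _ (inr b) (Some (inr x)) MLeft).
  by rewrite Er /= (Hf h.+1).
by rewrite -Er write_same; apply: IH; lia.
Qed.

Lemma runs_sweep row zf r : mealy z0 row = (zf, r) -> 0 < size row ->
  (forall i, i < size r -> forall x, nth None [seq Some y | y <- r] i = Some x -> first x = (i == 0)) ->
  (forall x, app = Some x -> first x = false) ->
  runs sweep (2 * size row).+1 (rowtape row) (out zf) (rowtape (r ++ seq_of_opt app)).
Proof.
move=> Em H0 Hf Happ.
have Sr : size r = size row.
  elim: row z0 r Em {H0 Hf} => [|a row IH] z r /=; first by case=> _ <-.
  case: (delta z a) => z' a'; case E: (mealy z' row) => [zf' r'] [Ez <-] /=.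
  by rewrite (IH z' r') // E Ez.
rewrite mul2n -addnn -addnS.
apply: (@sweep_right _ [::] row z0 zf r) => //.
rewrite cat0s /= add0n -Sr.
apply: (@frun_step sweep _ _ _ (inr (out zf)) (omap inr app) MLeft).
  by rewrite rowtape_end.
rewrite write_rowtape_end /=.
case: r Sr Hf Em => [|x0 r] Sr Hf Em; first by move: H0; rewrite -Sr.
apply: sweep_left; last by rewrite size_cat; exact: leq_addr.
move=> i Hi x; rewrite map_cat nth_cat size_map; case: ltnP => [H|H]; first exact: Hf.
move: Happ; case: (app) => [y|] Happ //=; last by rewrite nth_nil.
case: (i - size (x0 :: r)) => [|k] /=; last by rewrite nth_nil.
by case=> <-; rewrite Happ //; move: H => /=; case: (i).
Qed.

Lemma mealy_mkseq (zs : nat -> Z) (f g : nat -> X) N : zs 0 = z0 ->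
  (forall i, i < N -> delta (zs i) (f i) = (zs i.+1, g i)) ->
  mealy z0 (mkseq f N) = (zs N, mkseq g N).
Proof.
move=> <- H.
suff HH k m : m + k <= N -> mealy (zs m) [seq f i | i <- iota m k] =
    (zs (m + k), [seq g i | i <- iota m k]) by apply: (HH N 0).
elim: k m => [|k IH] m Hm /=; first by rewrite addn0.
by rewrite H ?IH ?addSnnS //; lia.
Qed.

End Sweep.

End Fragments.

Section Rows.
Variable P : nat.

(* First and last cell marks, input bit, certificate bit, counters here. *)
Definition cell : finType :=
  (bool * bool * option bool * bool * {ffun 'I_P -> bool})%type.

Definition mkcell f l i c p : cell := (f, l, i, c, p).
Definition cfirst (x : cell) := x.1.1.1.1.
Definition clast (x : cell) := x.1.1.1.2.
Definition cinp (x : cell) := x.1.1.2.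
Definition ccert (x : cell) := x.1.2.
Definition cpeb (x : cell) (p : nat) : bool :=
  if insub p is Some q then x.2 q else false.
Definition setpeb (x : cell) (p : nat) (v : bool) : cell :=
  (x.1, [ffun q : 'I_P => if val q == p then v else x.2 q]).

Variable u : nat -> option bool.

(** A counter with value [i] is a pebble on cell [i], and the capacity is the length of the row. *)
Definition rowcell (C : nat -> bool) (N : nat) (e : nat -> nat) (i : nat) : cell :=
  mkcell (i == 0) (i.+1 == N) (u i) (C i) [ffun p : 'I_P => e (val p) == i].

Definition row C N e := mkseq (rowcell C N e) N.

Lemma cpeb_row C N e i p : p < P -> cpeb (rowcell C N e i) p = (e p == i).
Proof. by move=> pP; rewrite /cpeb insubT /= ffunE. Qed.

Lemma setpeb_row C N e i p v :
  setpeb (rowcell C N e i) p (v == i) = rowcell C N (upd e p v) i.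
Proof.
rewrite /setpeb /rowcell /mkcell /=; congr (_, _); apply/ffunP => q.
by rewrite !ffunE /upd; case: eqP.
Qed.

Definition fSet0 p : frag cell :=
  sweep cfirst tt (fun _ x => (tt, setpeb x p (cfirst x))) (fun=> true) None.

(** The state remembers whether the pebble was on the preceding cell; a pebble on the last cell
    stays there, which is saturation. *)
Definition fInc p : frag cell :=
  sweep cfirst false
    (fun z x => (cpeb x p, setpeb x p (z || clast x && cpeb x p))) (fun=> true) None.

Definition fSeek (f : cell -> bool) : frag cell :=
  sweep cfirst false (fun z x => (z || f x, x)) id None.

Definition fApp : frag cell :=
  sweep cfirst tt
    (fun _ x => (tt, (x.1.1.1.1, false, x.1.1.2, x.1.2, x.2))) (fun=> true)
    (Some (mkcell false true None false [ffun=> false])).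

Definition fBool r F := iteF F (seqF (fSet0 r) (fInc r)) (fSet0 r).

Lemma mkseq_first (f : nat -> cell) N : (forall i, cfirst (f i) = (i == 0)) ->
  forall i, i < size (mkseq f N) ->
  forall x, nth None [seq Some y | y <- mkseq f N] i = Some x -> cfirst x = (i == 0).
Proof.
move=> H i; rewrite size_mkseq => iN x.
by rewrite (nth_map (f 0)) ?size_mkseq // nth_mkseq // => -[<-].
Qed.

Lemma runs_row_sweep (Z : finType) (z0 : Z) delta out (zs : nat -> Z) (f g : nat -> cell) N :
  0 < N -> zs 0 = z0 -> (forall i, i < N -> delta (zs i) (f i) = (zs i.+1, g i)) ->
  (forall i, cfirst (g i) = (i == 0)) ->
  runs (sweep cfirst z0 delta out None) (2 * N).+1
    (rowtape (mkseq f N)) (out (zs N)) (rowtape (mkseq g N)).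
Proof.
move=> N0 z00 H Hg.
have E := mealy_mkseq z00 H.
have HH := runs_sweep out (app := None) E.
rewrite /= cats0 size_mkseq in HH.
by apply: HH => //; apply: mkseq_first.
Qed.

Lemma runs_Set0 C N e p : 0 < N ->
  runs (fSet0 p) (2 * N).+1 (rowtape (row C N e)) true (rowtape (row C N (upd e p 0))).
Proof.
move=> N0; apply: (@runs_row_sweep _ _ _ _ (fun=> tt)) => // i iN.
by rewrite -setpeb_row /cfirst /= eq_sym.
Qed.

Lemma runs_Inc C N e p : p < P -> 0 < N -> e p < N ->
  runs (fInc p) (2 * N).+1 (rowtape (row C N e)) true
    (rowtape (row C N (upd e p (minn (e p).+1 N.-1)))).
Proof.
move=> pP N0 ep; apply: (@runs_row_sweep _ _ _ _ (fun i => (0 < i) && (e p == i.-1))) => // i iN.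
rewrite cpeb_row // -setpeb_row; congr (_, setpeb _ _ _).
rewrite /clast /=; case: i iN => [|i] iN /=; first by lia.
by case: (e p == i) / eqP => [->|?]; [lia|case: (_ == N) / eqP => ?; lia].
Qed.

Lemma runs_Seek C N e (f : cell -> bool) : 0 < N ->
  runs (fSeek f) (2 * N).+1 (rowtape (row C N e))
    [exists i : 'I_N, f (rowcell C N e i)] (rowtape (row C N e)).
Proof.
move=> N0.
set zs := fun n : nat => has (fun i => f (rowcell C N e i)) (iota 0 n).
have -> : [exists i : 'I_N, f (rowcell C N e i)] = id (zs N).
  apply/existsP/hasP => [[i Hi]|[i]]; first by exists (val i); rewrite // mem_iota /=.
  by rewrite mem_iota add0n => /= iN Hi; exists (Ordinal iN).
apply: (@runs_row_sweep _ _ _ _ zs) => // i iN; congr (_, _).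
by rewrite /zs -[in RHS]addn1 iotaD has_cat /= orbF.
Qed.

Lemma runs_Seek1 C N e (f : cell -> bool) x : x < N ->
  (forall i, i < N -> i != x -> ~~ f (rowcell C N e i)) ->
  runs (fSeek f) (2 * N).+1 (rowtape (row C N e)) (f (rowcell C N e x)) (rowtape (row C N e)).
Proof.
move=> xN H; have N0 : 0 < N by lia.
suff -> : f (rowcell C N e x) = [exists i : 'I_N, f (rowcell C N e i)] by apply: runs_Seek.
apply/idP/existsP => [Hf|[i Hi]]; first by exists (Ordinal xN).
case: (eqVneq (val i) x) => [<-//|/H]; by move=> /(_ (ltn_ord i)); rewrite Hi.
Qed.

Lemma runs_App C N e : 0 < N -> (forall j, e j < N) -> u N = None -> C N = false ->
  runs fApp (2 * N).+1 (rowtape (row C N e)) true (rowtape (row C N.+1 e)).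
Proof.
move=> N0 eN uN CN.
pose g i := mkcell (i == 0) false (u i) (C i) [ffun p : 'I_P => e (val p) == i].
have E : mealy (fun (_ : unit) (x : cell) => (tt, (x.1.1.1.1, false, x.1.1.2, x.1.2, x.2) : cell)) tt
    (mkseq (rowcell C N e) N) = (tt, mkseq g N).
  exact: (@mealy_mkseq _ _ _ _ (fun=> tt)).
have HH := runs_sweep (fun=> true) E.
have {}HH := HH cfirst (Some (mkcell false true None false [ffun=> false])).
rewrite size_mkseq in HH.
rewrite (_ : row C N.+1 e = mkseq g N ++ [:: mkcell false true None false [ffun=> false]]).
  by apply: HH => //; [apply: mkseq_first|move=> x [<-]].
rewrite /row /mkseq -addn1 iotaD map_cat /= add0n; congr (_ ++ [:: _]).
  apply/eq_in_map => i; rewrite mem_iota => /= iN; rewrite /rowcell /g; congr mkcell; lia.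
rewrite /rowcell uN CN addn1 eqxx; congr mkcell; first by lia.
by apply/ffunP => p; rewrite !ffunE ltn_eqF // eN.
Qed.

Lemma runs_Bool C N e r F t x : 1 < N -> r < P -> 
  runs F t (rowtape (row C N e)) x (rowtape (row C N e)) ->
  exists t', [/\ t' <= t + 6 * N & exists y,
    runs (fBool r F) t' (rowtape (row C N e)) y (rowtape (row C N (upd e r x)))].
Proof.
move=> N1 rP H; have N0 : 0 < N by lia.
case: x H => H.
  have H1 := runs_Set0 C e r N0.
  have H2 : runs (fInc r) (2 * N).+1 (rowtape (row C N (upd e r 0))) true
      (rowtape (row C N (upd e r true))).
    have E : upd (upd e r 0) r (minn (upd e r 0 r).+1 N.-1) = upd e r true.
      apply: functional_extensionality => j; rewrite upd_same /upd.
      by case: eqP => // _; have -> : minn 1 N.-1 = 1 by lia.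
    by rewrite -E; apply: runs_Inc => //; rewrite upd_same.
  have H3 := runs_seq H1 H2.
  exists (t + ((2 * N).+1 + (2 * N).+1)); split; first by lia.
  by exists true; apply: (runs_ite H).
have H1 := runs_Set0 C e r N0.
exists (t + (2 * N).+1); split; first by lia.
by exists true; apply: (runs_ite H).
Qed.

(** Counters are equal if their pebbles share a cell, and certificate or input are read under a
    pebble, so each test is one search through the row. Input symbol 0 asks for a letter 1, input
    symbol 1 for any letter at all; oracle atoms are false. *)
Fixpoint ctm (c : cmd) : frag cell :=
  match c with
  | CSet0 p => fSet0 p
  | CInc p => fInc p
  | CEq r p q => fBool r (fSeek (fun x => cpeb x p && cpeb x q))
  | CCert r p => fBool r (fSeek (fun x => cpeb x p && ccert x))
  | CIn r i ps => fBool r (fSeek (fun x =>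
      if ps is [:: p] then cpeb x p &&
        (if i == 0 then cinp x == Some true else (i == 1) && (cinp x != None))
      else false))
  | COrc r _ => fBool r (fSeek (fun=> false))
  | CSeq c1 c2 => seqF (ctm c1) (ctm c2)
  | CFor p q c1 => seqF (fSet0 p) (untilF (fSeek (fun x => cpeb x p && cpeb x q))
                                     (seqF (ctm c1) (fInc p)))
  | CApp => fApp
  end.

Definition winp (i : nat) (xs : seq nat) : bool :=
  if xs is [:: x] then
    (if i == 0 then u x == Some true else (i == 1) && (u x != None))
  else false.

Fixpoint cost (c : cmd) (M : nat) : nat :=
  match c with
  | CSeq c1 c2 => cost c1 M + cost c2 M
  | CFor _ _ c1 => M * (6 * M + cost c1 M) + 6 * M
  | _ => 9 * M
  end.

(** Either the capacity is fixed, or nothing has been guessed yet and the input ends before [N]; in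
    the second case an appended cell, without letter and with certificate bit [false], agrees with
    [u] and [C]. *)
Lemma runs_ctm C c N e M : wfc c -> maxreg c < P -> 1 < N -> (forall j, e j < N) ->
  noapp c \/ (forall i, C i = false) /\ (forall i, N <= i -> u i = None) ->
  (run winp (fun=> false) C c (N, e)).1 <= M ->
  exists t, [/\ t <= cost c M & exists x, runs (ctm c) t (rowtape (row C N e)) x
    (rowtape (row C (run winp (fun=> false) C c (N, e)).1
                    (run winp (fun=> false) C c (N, e)).2))].
Proof.
elim: c N e => [p|p|r p q|r p|r i ps|r p|c1 IH1 c2 IH2|p q c1 IH|] N e Hw HP N1 HN HA HM;
  have N0 : 0 < N by lia.
- exists (2 * N).+1; split; first by move: HM => /=; lia.
  by exists true; apply: runs_Set0.
- exists (2 * N).+1; split; first by move: HM => /=; lia.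
  by exists true; apply: runs_Inc.
- rewrite /= in HP HM *; have rP : r < P by lia.
  have H := @runs_Seek1 C N e (fun x => cpeb x p && cpeb x q) (e p) (HN p).
  have {}H := H _.
  have [|t' [Ht [y Hy]]] := runs_Bool N1 rP (H _).
    move=> i iN; rewrite !cpeb_row; try lia.
  exists t'; split; first by lia.
  exists y; rewrite !cpeb_row in Hy; try lia.
  by move: Hy; rewrite eqxx eq_sym.
- rewrite /= in HP HM *; have rP : r < P by lia.
  have H := @runs_Seek1 C N e (fun x => cpeb x p && ccert x) (e p) (HN p).
  have [|t' [Ht [y Hy]]] := runs_Bool N1 rP (H _).
    move=> i iN; rewrite !cpeb_row; lia.
  exists t'; split; first by lia.
  exists y; rewrite !cpeb_row in Hy; try lia.
  by move: Hy; rewrite eqxx.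
- rewrite /= in HP HM *; have rP : r < P by lia.
  case: ps Hw HP HA => [|p [|p' ps]] Hw HP _.
  + have H := @runs_Seek1 C N e (fun x => false) 0 N0 (fun _ _ _ => isT).
    have [t' [Ht [y Hy]]] := runs_Bool N1 rP H.
    by exists t'; split; [lia|exists y].
  + have H := @runs_Seek1 C N e (fun x => cpeb x p && 
        (if i == 0 then cinp x == Some true else (i == 1) && (cinp x != None))) (e p) (HN p).
    have pP : p < P by move: HP => /=; lia.
    have [|t' [Ht [y Hy]]] := runs_Bool N1 rP (H _).
      by move=> j jN; rewrite cpeb_row // eq_sym => /negbTE ->.
    exists t'; split; first by lia.
    exists y; rewrite !cpeb_row in Hy; try lia.
    by move: Hy; rewrite eqxx.
  + have H := @runs_Seek1 C N e (fun x => false) 0 N0 (fun _ _ _ => isT).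
    have [t' [Ht [y Hy]]] := runs_Bool N1 rP H.
    by exists t'; split; [lia|exists y].
- rewrite /= in HP HM *; have rP : r < P by lia.
  have H := @runs_Seek1 C N e (fun x => false) 0 N0 (fun _ _ _ => isT).
  have [t' [Ht [y Hy]]] := runs_Bool N1 rP H.
  by exists t'; split; [lia|exists y].
- rewrite /= in Hw HP HM *; case/andP: Hw => Hw1 Hw2.
  have [L1 L2] := @run_lt winp (fun=> false) C c1 (N, e) N1 HN.
  set s1 := run _ _ _ c1 _ in L1 L2 HM *.
  have L1' : 1 < s1.1 by move: L1 => /=; lia.
  have [L3 L4] := @run_lt winp (fun=> false) C c2 s1 L1' L2.
  have [||||| t1 [Ht1 [x1 H1]]] := IH1 N e Hw1 => //.
  + by lia.
  + by case: HA => [/andP[H _]|H]; [left|right].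
  + by rewrite -/s1; lia.
  have [||||| t2 [Ht2 [x2 H2]]] := IH2 s1.1 s1.2 Hw2 => //.
  + by lia.
  + case: HA => [/andP[_ H]|[HC Hu]]; [by left|right; split=> // i iN].
    by apply: Hu; move: L1 => /=; lia.
  + by rewrite -surjective_pairing.
  exists (t1 + t2); split; first by lia.
  exists x2; rewrite -surjective_pairing in H2; exact: runs_seq H1 H2.
- rewrite /= in HP; case/and4P: Hw => pq pw qw Hw1.
  set f := fun s' => inc p (run winp (fun=> false) C c1 s').
  pose s n := iter n f (N, upd e p 0).
  have Hs n : n <= e q -> [/\ N <= (s n).1, (forall j, (s n).2 j < (s n).1),
      (s n).2 p = n & (s n).2 q = e q].
    elim: n => [_|n IHn Hn].
      split=> //= [j||]; [by rewrite /upd; case: eqP|by rewrite upd_same|].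
      by rewrite upd_other // eq_sym.
    case: IHn => [|A1 A2 A3 A4]; first by lia.
    have A1' : 1 < (s n).1 by lia.
    have [B1 B2] := @run_lt winp (fun=> false) C c1 (s n) A1' A2.
    rewrite /s iterS -/(s n) /f /inc /=.
    have E3 := @run_writes winp (fun=> false) C c1 (s n) p pw.
    have E4 := @run_writes winp (fun=> false) C c1 (s n) q qw.
    split; first by lia.
    + move=> j; rewrite /upd; case: eqP => // _; lia.
    + rewrite upd_same E3 A3; have := HN q; lia.
    + by rewrite upd_other 1?eq_sym // E4.
  have Hmono n m : n <= m -> m <= e q -> (s n).1 <= (s m).1.
    elim: m => [|m IHm]; first by rewrite leqn0 => /eqP ->.
    rewrite leq_eqVlt => /orP[/eqP->//|nm] Hm.
    case: (Hs m) => [|A1 A2 A3 A4]; first by lia.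
    have A1' : 1 < (s m).1 by lia.
    have [B1 B2] := @run_lt winp (fun=> false) C c1 (s m) A1' A2.
    by apply: leq_trans (IHm _ _) B1; lia.
  have E : run winp (fun=> false) C (CFor p q c1) (N, e) = s (e q) by [].
  rewrite E in HM *.
  (* Induction on the number [k] of rounds that remain. *)
  suff Hloop k : k <= e q -> exists t, [/\ t <= k * (6 * M + cost c1 M) + 3 * M & exists x,
      runs (untilF (fSeek (fun x => cpeb x p && cpeb x q)) (seqF (ctm c1) (fInc p))) t
        (rowtape (row C (s (e q - k)).1 (s (e q - k)).2)) x
        (rowtape (row C (s (e q)).1 (s (e q)).2))].
    have [t [Ht [x Hx]]] := Hloop (e q) (leqnn _).
    exists ((2 * N).+1 + t); split.
      have NM : N <= M by apply: leq_trans HM; case: (Hs (e q)).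
      move: (HN q) => HNq /=.
      have : e q * (6 * M + cost c1 M) <= M * (6 * M + cost c1 M) by apply: leq_mul; lia.
      by lia.
    exists x; move: Hx; rewrite subnn => Hx.
    exact: (runs_seq (@runs_Set0 C N e p N0) Hx).
  have seekP n : n <= e q -> exists t, t <= 3 * M /\
      runs (fSeek (fun x => cpeb x p && cpeb x q)) t (rowtape (row C (s n).1 (s n).2))
        (n == e q) (rowtape (row C (s n).1 (s n).2)).
    move=> nq; case: (Hs n nq) => A1 A2 A3 A4.
    have Hm := Hmono n (e q) nq (leqnn _).
    exists (2 * (s n).1).+1; split; first by lia.
    have H := @runs_Seek1 C (s n).1 (s n).2 (fun x => cpeb x p && cpeb x q) n.
    rewrite !cpeb_row in H; try lia.
    rewrite A3 A4 eqxx /= in H; rewrite eq_sym; apply: H; first by rewrite -{1}A3.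
    by move=> i iN Hi; rewrite !cpeb_row; try lia.
  elim: k => [_|k IHk Hk].
    rewrite subn0; have [t [Ht Hr]] := seekP (e q) (leqnn _).
    exists t; split; first by lia.
    by exists true; apply: runs_until_stop; rewrite eqxx in Hr.
  case: IHk => [|t3 [Ht3 [x Hx]]]; first by lia.
  set n := e q - k.+1 in Hx *; have En : e q - k = n.+1 by rewrite /n; lia.
  have nq : n < e q by rewrite /n; lia.
  rewrite En in Hx.
  have [t1 [Ht1 Hr1]] := seekP n (ltnW nq).
  rewrite (ltn_eqF nq) in Hr1.
  case: (Hs n (ltnW nq)) => A1 A2 A3 A4.
  have A1' : 1 < (s n).1 by lia.
  have [B1 B2] := @run_lt winp (fun=> false) C c1 (s n) A1' A2.
  have Esn : s n.+1 = inc p (run winp (fun=> false) C c1 (s n)) by [].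
  have HmM : (run winp (fun=> false) C c1 (s n)).1 <= M.
    by apply: leq_trans HM; have := Hmono n.+1 (e q) nq (leqnn _); rewrite Esn.
  have [||||| t2 [Ht2 [y Hy]]] := IH (s n).1 (s n).2 Hw1 => //.
  + by lia.
  + case: HA => [|[HC Hu]]; [by left|right; split=> // i iN].
    by apply: Hu; lia.
  + by rewrite -surjective_pairing.
  rewrite -surjective_pairing in Hy.
  set s2 := run _ _ _ c1 _ in Hy HmM B1 B2 Esn.
  have Hi := @runs_Inc C s2.1 s2.2 p ltac:(lia) ltac:(lia) (B2 p).
  have Hbody := runs_seq Hy Hi.
  rewrite Esn /inc /= in Hx.
  exists (t1 + ((t2 + (2 * s2.1).+1) + t3)); split; first by lia.
  by exists x; apply: runs_until_go Hr1 Hbody Hx.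
- exists (2 * N).+1; split; first by move: HM => /=; lia.
  case: HA => [//|[HC Hu]].
  by exists true; apply: runs_App => //; apply: Hu.
Qed.

End Rows.

(** * Existential second-order predicates of words are in NP *)

Definition word_fun (w : seq bool) (i : nat) : option bool :=
  if i < size w then Some (nth false w i) else None.

Definition word_inp (w : seq bool) := winp (word_fun w).

Definition nospec (_ : nat) := false.

(* All runs from [c] have length at most [T], and acceptance is equivalent to [Q]. *)
Definition spec (M : ntm) (c : ntm_config M) (T : nat) (Q : Prop) : Prop :=
  (forall t c', ntm_run t c c' -> t <= T) /\
  ((exists t c', ntm_run t c c' /\ nc_state c' = n_accept M) <-> Q).

Lemma spec_weaken M c T T' Q Q' : @spec M c T Q -> T <= T' -> (Q <-> Q') -> spec c T' Q'.
Proof.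
move=> [H1 H2] HT HQ; split; last by rewrite H2.
by move=> t c' /H1 H; apply: leq_trans H HT.
Qed.

Lemma spec_halt M c : (forall c', ~ @ntm_step M c c') -> spec c 0 (nc_state c = n_accept M).
Proof.
move=> H; split=> [t c' Hr|].
  by case: Hr H => // t1 x y z Hs _ /(_ y).
split=> [[t [c' [Hr]]]|E]; last by exists 0, c; split=> //; constructor.
by case: Hr H => // t1 x y z Hs _ /(_ y).
Qed.

Lemma spec_or M c c1 c2 T Q1 Q2 : nc_state c <> n_accept M ->
  @ntm_step M c c1 -> @ntm_step M c c2 ->
  (forall c', ntm_step c c' -> c' = c1 \/ c' = c2) ->
  spec c1 T Q1 -> spec c2 T Q2 -> spec c T.+1 (Q1 \/ Q2).
Proof.
move=> Hna S1 S2 HS [T1 A1] [T2 A2]; split.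
  move=> t c' Hr; case: t c c' / Hr HS {S1 S2 Hna} => // t c c' c'' Hs Hr HS.
  by case: (HS _ Hs) => E; rewrite E in Hr; [apply: T1 Hr|apply: T2 Hr].
split.
  case=> t [c' [Hr]]; case: t c c' / Hr HS Hna {S1 S2} => // t c c' c'' Hs Hr HS _ E.
  case: (HS _ Hs) => Ec; rewrite Ec in Hr; [left; apply/A1|right; apply/A2];
  by exists t, c''.
by case=> [/A1|/A2] [t [c' [Hr E]]]; exists t.+1, c'; split=> //; apply: NRunS Hr.
Qed.

Lemma spec_det M c c1 T Q : nc_state c <> n_accept M -> @ntm_step M c c1 ->
  (forall c', ntm_step c c' -> c' = c1) -> spec c1 T Q -> spec c T.+1 Q.
Proof.
move=> Hna S1 HS H1.
apply: (@spec_weaken _ _ T.+1 _ (Q \/ Q)) => //; last by tauto.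
by apply: (spec_or Hna S1 S1 _ H1 H1) => c' /HS; left.
Qed.

(** Nested loops, all bounded by register 1, which extend the row by [e 1 ^ K] cells; this creates
    polynomial capacity on the tape. *)
Fixpoint nest (K r : nat) : cmd := if K is K'.+1 then CFor r 1 (nest K' r.+1) else CApp.

Lemma writes_nest K r j : j \in writes (nest K r) -> r <= j.
Proof. by elim: K r => //= K IH r; rewrite inE => /orP[/eqP->|/IH]; lia. Qed.

Lemma wfc_nest K r : 1 < r -> wfc (nest K r).
Proof.
elim: K r => //= K IH r r1; rewrite IH; last by lia.
have H j : j <= r -> j \notin writes (nest K r.+1).
  by move=> jr; apply/negP => /writes_nest; lia.
by rewrite !H //; lia.
Qed.

Lemma run_nest I O C K r N e : 1 < r -> (run I O C (nest K r) (N, e)).1 = N + e 1 ^ K.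
Proof.
elim: K r N e => [|K IH] r N e r1; first by rewrite /= addn1.
rewrite expnS [run _ _ _ _ _]/=.
set f := fun s' => _.
suff H n : (iter n f (N, upd e r 0)).1 = N + n * e 1 ^ K /\ (iter n f (N, upd e r 0)).2 1 = e 1.
  by case: (H (e 1)).
elim: n => [|n [IH1 IH2]]; first by rewrite mul0n addn0 /= upd_other //; lia.
rewrite iterS; set s := iter n _ _ in IH1 IH2 *; rewrite /f /=; split.
  by rewrite [s]surjective_pairing IH ?IH1 ?IH2 //; lia.
rewrite upd_other; last by lia.
by rewrite run_writes //; apply/negP => /writes_nest; lia.
Qed.

Section Host.
Variables (kb : nat) (f : fm).

Definition hK := fdeg kb 0 f.
Definition hbuild := nest hK 3.
Definition heval := cfm kb 1 (fun=> 2) f 3.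
Definition hP := (maxn 3 (maxn (maxreg hbuild) (maxreg heval))).+1.
Definition hX := cell hP.
Definition hF1 : frag hX := ctm hP hbuild.
(** The truth value of [f] is left in counter 3; it is 1 if the pebble is not on the first cell. *)
Definition hF2 : frag hX :=
  seqF (ctm hP heval) (fSeek (fun x : hX => ~~ cfirst x && cpeb x 3)).

Definition hS : finType := ('I_9 + (fS hF1 + fS hF2))%type.
Definition hq k (H : k < 9) : hS := inl (Ordinal H).
Local Notation q k := (@hq k isT).
Local Notation sym := (option (bool + hX)).

Definition pebs (g : nat -> bool) : {ffun 'I_hP -> bool} := [ffun p => g (val p)].
Definition hcell fst lst i (g : nat -> bool) : sym :=
  Some (inr (mkcell fst lst i false (pebs g))).

(** States 0 and 1 turn the input into cells and add a cell without letter; 2 and 3 add two more,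
    for the initial pebbles of counters 0 and 1. States 4 and 6 return to the first cell, before the
    row is extended and before the evaluation; 5 guesses the certificate, 7 accepts and 8
    rejects. *)
Definition htr (s : hS) (a : sym) : seq (hS * sym * move) :=
  match s with
  | inl i =>
    match val i, a with
    | 0, Some (inl b) => [:: (q 1, hcell true false (Some b) (fun p => 1 < p), MRight)]
    | 0, _ => [:: (q 2, hcell true false None (fun p => 1 < p), MRight)]
    | 1, Some (inl b) => [:: (q 1, hcell false false (Some b) xpred0, MRight)]
    | 1, _ => [:: (q 2, hcell false false None xpred0, MRight)]
    | 2, _ => [:: (q 3, hcell false false None (fun p => p == 0), MRight)]
    | 3, _ => [:: (q 4, hcell false true None (fun p => p == 1), MLeft)]
    | 4, Some (inr x) => if cfirst x then [:: (inr (inl (fin hF1)), a, MStay)]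
                         else [:: (q 4, a, MLeft)]
    | 5, Some (inr x) =>
        [:: (q 5, Some (inr (mkcell (cfirst x) (clast x) (cinp x) false x.2)), MRight);
            (q 5, Some (inr (mkcell (cfirst x) (clast x) (cinp x) true x.2)), MRight)]
    | 5, _ => [:: (q 6, None, MLeft)]
    | 6, Some (inr x) => if cfirst x then [:: (inr (inr (fin hF2)), a, MStay)]
                         else [:: (q 6, a, MLeft)]
    | _, _ => [::]
    end
  | inr (inl s1) =>
    match ftr s1 a with
    | (inl s', a', d) => [:: (inr (inl s'), a', d)]
    | (inr _, a', d) => [:: (q 5, a', d)]
    end
  | inr (inr s2) =>
    match ftr s2 a with
    | (inl s', a', d) => [:: (inr (inr s'), a', d)]
    | (inr x, a', d) => [:: (if x then q 7 else q 8, a', d)]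
    end
  end.

Definition move_eqb (d d' : move) : bool :=
  match d, d' with
  | MLeft, MLeft | MStay, MStay | MRight, MRight => true
  | _, _ => false
  end.

Lemma move_eqbP d d' : move_eqb d d' -> d = d'.
Proof. by case: d d' => -[]. Qed.

Definition host : ntm := @NTM hS hX (q 0) (q 7)
  (fun s a s' a' d => has (fun x => [&& x.1.1 == s', x.1.2 == a' & move_eqb x.2 d]) (htr s a)).

Lemma host_stepP s tp h c : @ntm_step host (@NConfig host s tp h) c <->
  exists2 x, List.In x (htr s (tp h)) &
    c = @NConfig host x.1.1 (write_cell tp h x.1.2) (shift x.2 h).
Proof.
split.
  move E: (NConfig s tp h) => c0 H; case: c0 c / H E => q0 tp0 h0 q' a d H [-> -> ->].
  move: H; rewrite /n_trans /=; elim: (htr q0 (tp0 h0)) => //= x l IH /orP[|/IH [y yl ->]].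
    by move=> /and3P[/eqP <- /eqP <- /move_eqbP <-]; exists x => //; left.
  by exists y => //; right.
case=> x Hx ->; apply: NStep; rewrite /n_trans /=.
elim: (htr s (tp h)) Hx => //= y l IH [->|/IH ->]; last by rewrite orbT.
by rewrite !eqxx; case: (x.2).
Qed.

Lemma host_det s tp h s' a d T Q : htr s (tp h) = [:: (s', a, d)] -> s <> q 7 ->
  spec (@NConfig host s' (write_cell tp h a) (shift d h)) T Q ->
  spec (@NConfig host s tp h) T.+1 Q.
Proof.
move=> E ns; apply: spec_det => //.
  by apply/host_stepP; exists (s', a, d) => //; rewrite E; left.
by move=> c' /host_stepP [x]; rewrite E => -[<-|//] ->.
Qed.

Lemma host_frag (F : frag hX) (j : fS F -> hS) (k : bool -> hS) t s tp h x tp' h' T Q :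
  (forall s, j s <> q 7) ->
  (forall s a, htr (j s) a = match ftr s a with
     | (inl s', a', d) => [:: (j s', a', d)]
     | (inr x, a', d) => [:: (k x, a', d)] end) ->
  frun t s tp h x tp' h' ->
  spec (@NConfig host (k x) tp' h') T Q -> spec (@NConfig host (j s) tp h) (t + T) Q.
Proof.
move=> Hj HE; elim=> {t s tp h x tp' h'} [s tp h x a d E|s tp h s' a d t x tp' h' E _ IH] H.
  by rewrite add1n; apply: host_det H => //; rewrite HE E.
by rewrite addSn; apply: host_det (IH H) => //; rewrite HE E.
Qed.

Lemma host_ret (k : 'I_9) s' (r : nat -> hX) N h T Q :
  k != 7 :> nat ->
  (forall x, htr (inl k) (Some (inr x)) =
     if cfirst x then [:: (s', Some (inr x), MStay)] else [:: (inl k, Some (inr x), MLeft)]) ->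
  (forall i, cfirst (r i) = (i == 0)) -> h < N ->
  spec (@NConfig host s' (rowtape (mkseq r N)) 0) T Q ->
  spec (@NConfig host (inl k) (rowtape (mkseq r N)) h) (h.+1 + T) Q.
Proof.
move=> k7 HE Hr hN HS.
have Hk : inl k <> q 7 :> hS by case=> E; rewrite E in k7.
have Hat i : i < N -> rowtape (mkseq r N) i = Some (inr (r i)).
  by move=> iN; rewrite /rowtape (nth_map (r 0)) ?size_mkseq // nth_mkseq.
elim: h hN => [|h IH] hN; rewrite addSn.
  apply: (@host_det _ _ _ s' (Some (inr (r 0))) MStay) => //.
    by rewrite Hat // HE Hr.
  by rewrite -[Some _](Hat 0) // write_same.
apply: (@host_det _ _ _ (inl k) (Some (inr (r h.+1))) MLeft) => //.
  by rewrite Hat // HE Hr.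
rewrite -[Some _](Hat h.+1) // write_same; apply: IH; lia.
Qed.

(** Induction from the right end of the row: a cell has two successors, one for each bit, and the
    disjunction of their outcomes is the existence of a certificate that extends the part already
    fixed. *)
Lemma host_guess u N e T (R : (nat -> bool) -> Prop) :
  (forall C, spec (@NConfig host (q 5) (rowtape (row hP u C N e)) N) T (R C)) ->
  forall k C, k <= N ->
  spec (@NConfig host (q 5) (rowtape (row hP u C N e)) (N - k)) (k + T)
    (exists C', (forall i, i < N - k -> C' i = C i) /\ R C').
Proof.
move=> H; elim=> [|k IH] C Hk.
  rewrite subn0; apply: spec_weaken (H C) (leqnn _) _.
  split=> [RC|[C' [E RC']]]; first by exists C.
  have ER : row hP u C N e = row hP u C' N e.
    by apply/eq_in_map => i; rewrite mem_iota => /= iN; rewrite /rowcell E.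
  have [_ <-] := H C; rewrite ER.
  by have [_ ->] := H C'.
pose setC v i := if i == N - k.+1 then v else C i.
have iN : N - k.+1 < N by lia.
have HN : N - k.+1 + 1 = N - k by lia.
have Hrow v : write_cell (rowtape (row hP u C N e)) (N - k.+1)
    (Some (inr (rowcell hP u (setC v) N e (N - k.+1)))) = rowtape (row hP u (setC v) N e).
  apply: functional_extensionality => i; rewrite /write_cell /rowtape.
  case: eqP => [->|/eqP Hi].
    by rewrite (nth_map (rowcell hP u (setC v) N e 0)) ?size_mkseq // nth_mkseq.
  case: (ltnP i N) => [iN'|Ni]; last by rewrite !nth_default // size_map size_mkseq.
  rewrite !(nth_map (rowcell hP u (setC v) N e 0)) ?size_mkseq // !nth_mkseq //.
  by rewrite /rowcell /setC (negbTE Hi).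
have E : htr (q 5) (rowtape (row hP u C N e) (N - k.+1)) =
    [:: (q 5, Some (inr (rowcell hP u (setC false) N e (N - k.+1))), MRight);
        (q 5, Some (inr (rowcell hP u (setC true) N e (N - k.+1))), MRight)].
  rewrite /rowtape (nth_map (rowcell hP u C N e 0)) ?size_mkseq // nth_mkseq //.
  by rewrite /rowcell /setC eqxx.
have Hk' : k <= N by lia.
have Hs v := IH (setC v) Hk'.
rewrite -HN addn1 in Hs.
apply: (@spec_weaken _ _ (k + T).+1 _ (
   (exists C', (forall i, i < (N - k.+1).+1 -> C' i = setC false i) /\ R C') \/
   (exists C', (forall i, i < (N - k.+1).+1 -> C' i = setC true i) /\ R C'))) => //.
  apply: (@spec_or host _ (@NConfig host (q 5) (rowtape (row hP u (setC false) N e)) (N - k.+1).+1)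
    (@NConfig host (q 5) (rowtape (row hP u (setC true) N e)) (N - k.+1).+1)) => //.
  - apply/host_stepP; rewrite E; eexists; first by left; reflexivity.
    by rewrite /= Hrow.
  - apply/host_stepP; rewrite E; eexists; first by right; left; reflexivity.
    by rewrite /= Hrow.
  - move=> c' /host_stepP [x]; rewrite E => -[<-|[<-|//]] ->; rewrite /= Hrow; by [left|right].
split.
  case=> -[C' [E' RC']]; exists C'; split=> // i Hi; rewrite E' ?/setC; try lia;
  by case: eqP => // Ei; lia.
case=> C' [E' RC'].
have Hc v : C' (N - k.+1) = v -> forall i, i < (N - k.+1).+1 -> C' i = setC v i.
  by move=> Ev i Hi; rewrite /setC; case: eqP => [->//|?]; apply: E'; lia.
by case Ev: (C' (N - k.+1)); [right|left]; exists C'; split=> //; apply: Hc.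
Qed.

Section Correct.
Variable w : seq bool.
Let m := size w.
Let u := word_fun w.
(** Counter 0 holds the base [m.+1]; counter 1 bounds the nested loops, so that the capacity reaches
    [m.+2 ^ hK], enough for all values of degree [hK]. *)
Let e0 (p : nat) := if p == 0 then m.+1 else if p == 1 then m.+2 else 0.
Let N0 := m + 3.
Let C0 := fun _ : nat => false.
Let s1 := run (word_inp w) nospec C0 hbuild (N0, e0).
Let N := s1.1.
Let e1 := s1.2.

Lemma host_capacity : N = m + 3 + m.+2 ^ hK.
Proof. by rewrite /N /s1 /hbuild run_nest. Qed.

Lemma host_env : [/\ forall j, e0 j < N0, forall j, e1 j < N, e1 0 = m.+1 & e1 2 = 0].
Proof.
have H0 j : e0 j < N0 by rewrite /e0 /N0; do 2 (case: eqP => _; first lia); lia.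
have [||_ H1] := @run_lt (word_inp w) nospec C0 hbuild (N0, e0).
- by rewrite /= /N0; lia.
- by [].
have Hw j : j < 3 -> e1 j = e0 j.
  move=> j3; rewrite /e1 /s1 run_writes //.
  by apply/negP => /writes_nest; lia.
by split=> //; rewrite Hw.
Qed.

Let accw C := exists F, F = decode kb C m.+1 /\
  holds (Ctx m.+1 (word_inp w) nospec F) (fun=> 0) f.

Lemma spec_eval C :
  spec (@NConfig host (inr (inr (fin hF2))) (rowtape (row hP u C N e1)) 0)
    (cost heval N + (2 * N).+1) (accw C).
Proof.
have [H0 H1 H10 H12] := host_env.
have HN := host_capacity.
have Npos : 0 < m.+2 ^ hK by rewrite expn_gt0.
have N1 : 1 < N by lia.
have Hok : okenv 1 N m.+1 e1 3 (fun=> 2) (fun=> 0) 0 by split.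
have Hdeg : m.+2 ^ fdeg kb 0 f <= N by rewrite HN -/hK leq_addl.
have [e2 [E2 e2r _ H2]] := @computes_cfm kb 1 (word_inp w) nospec C N m.+1 isT N1 isT f _ _ _ _ _ Hok Hdeg.
have /andP[Hwf Hna] := @wfc_cfm kb 1 (fun=> 2) f 3 isT isT (fun=> isT).
have [||t [Ht [x Hx]]] := @runs_ctm hP u C heval N e1 N Hwf _ N1 H1 (or_introl Hna).
- by rewrite /hP; lia.
- by rewrite run_noapp.
rewrite [X in row hP u C X.1 X.2]E2 /= in Hx.
have N0' : 0 < N by lia.
have Hs := @runs_Seek hP u C N e2 (fun x => ~~ cfirst x && cpeb x 3) N0'.
have Eb : [exists i : 'I_N, ~~ cfirst (rowcell hP u C N e2 i) && cpeb (rowcell hP u C N e2 i) 3]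
    = holds (Ctx m.+1 (word_inp w) nospec (decode kb C m.+1)) (fun=> 0) f.
  have P3 : 3 < hP by rewrite /hP; lia.
  apply/existsP/idP => [[i]|Hh].
    rewrite cpeb_row // e2r; case: (holds _ _ _) => // /andP[i0 /eqP E].
    by move: i0; rewrite /cfirst /= -E.
  by exists (Ordinal N1); rewrite cpeb_row // e2r Hh.
rewrite Eb in Hs.
have Hrun := runs_seq Hx Hs.
apply: (@spec_weaken _ _ (t + (2 * N).+1 + 0) _
  (holds (Ctx m.+1 (word_inp w) nospec (decode kb C m.+1)) (fun=> 0) f)).
- apply: (@host_frag hF2 (fun s => inr (inr s)) (fun x => if x then q 7 else q 8)) Hrun _ => //.
  set c := NConfig _ _ _.
  have Hh : forall c', ~ ntm_step c c'.
    by rewrite /c; case: (holds _ _ _) => c' /host_stepP [y] [].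
  apply: spec_weaken (spec_halt Hh) (leqnn _) _.
  by rewrite /c /=; case: (holds _ _ _); split.
- by lia.
- by split=> [H|[F [-> H]]] //; exists (decode kb C m.+1).
Qed.

Lemma spec_row : spec (@NConfig host (inr (inl (fin hF1))) (rowtape (row hP u C0 N0 e0)) 0)
    (cost hbuild N + (N + (N + (N + 1) + (cost heval N + (2 * N).+1)))) (exists C, accw C).
Proof.
have [H0 H1 H10 H12] := host_env.
have HN := host_capacity.
have Hwf : wfc hbuild by apply: wfc_nest.
have N01 : 1 < N0 by rewrite /N0; lia.
have [|||t [Ht [x Hx]]] := @runs_ctm hP u C0 hbuild N0 e0 N Hwf _ N01 H0 _.
- by rewrite /hP; lia.
- by right; split=> // i Hi; rewrite /u /word_fun ltnNge; move: Hi; rewrite /N0 -/m => ?; rewrite (_ : m <= i) //; lia.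
- by [].
apply: (@spec_weaken _ _ (t + (N + (1 + (N.-1.+1 + (cost heval N + (2 * N).+1)))))
   _ (exists C', (forall i, i < N - N -> C' i = C0 i) /\ accw C')); [|by lia|]; last first.
  split; first by case=> C [_ HC]; exists C.
  by case=> C HC; exists C; split=> // i; rewrite subnn.
apply: (@host_frag hF1 (fun s => inr (inl s)) (fun=> q 5)) Hx _ => //.
rewrite -/(word_inp w) -/s1 -/N -/e1.
have := @host_guess u N e1 (1 + (N.-1.+1 + (cost heval N + (2 * N).+1))) accw.
move=> Hg; have {}Hg := Hg _ N C0 (leqnn _).
rewrite [in X in NConfig _ _ X]subnn in Hg; apply: Hg => C.
rewrite add1n; apply: (@host_det _ _ _ (q 6) None MLeft) => //.
  by rewrite -{2}(size_mkseq (rowcell hP u C N e1) N) rowtape_end.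
have -> : write_cell (rowtape (row hP u C N e1)) N None = rowtape (row hP u C N e1).
  by rewrite -[None](rowtape_end (row hP u C N e1)) size_mkseq write_same.
apply: (@host_ret (@Ordinal 9 6 isT) (inr (inr (fin hF2)))) => //=; first by lia.
exact: spec_eval.
Qed.

Let cv (i j : nat) : sym :=
  if j < i then Some (inr (rowcell hP u C0 N0 e0 j)) else
  if j < m then Some (inl (nth false w j)) else None.

Lemma write_cv i : write_cell (cv i) i (Some (inr (rowcell hP u C0 N0 e0 i))) = cv i.+1.
Proof.
apply: functional_extensionality => j; rewrite /write_cell /cv ltnS.
by case: (ltngtP j i) => // ->.
Qed.

Lemma spec_init T Q :
  spec (@NConfig host (inr (inl (fin hF1))) (rowtape (row hP u C0 N0 e0)) 0) T Q ->
  spec (ntm_init host w) (m + (3 + (m.+2 + T))) Q.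
Proof.
move=> H.
have Hcell i fst lst (o : option bool) g : u i = o -> (i == 0) = fst -> (i.+1 == N0) = lst ->
    (forall p, (e0 p == i) = g p) ->
    hcell fst lst o g = Some (inr (rowcell hP u C0 N0 e0 i)).
  move=> <- <- <- Hg; rewrite /hcell /rowcell /C0; congr (Some (inr (mkcell _ _ _ _ _))).
  by apply/ffunP => p; rewrite !ffunE Hg.
have e0i i : 0 < i -> i <= m -> forall p, (e0 p == i) = false.
  by move=> i0 im p; apply/eqP; rewrite /e0; case: (p == 0); [lia|case: (p == 1); lia].
have e00 p : (e0 p == 0) = (1 < p) by rewrite /e0; case: p => [|[|p]].
pose st i : hS := if i == 0 then q 0 else q 1.
suff Hc k : k <= m -> spec (@NConfig host (st (m - k)) (cv (m - k)) (m - k)) (k + (3 + (m.+2 + T))) Q.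
  have := Hc m (leqnn _); rewrite subnn /ntm_init.
  by congr spec; congr NConfig; apply: functional_extensionality => i; rewrite /cv ltn0.
elim: k => [_|k IH Hk].
  rewrite subn0 add0n.
  have um i : m <= i -> u i = None by move=> Hi; rewrite /u /word_fun ltnNge Hi.
  have cvm i : m <= i -> cv i i = None by move=> Hi; rewrite /cv ltnn ltnNge Hi.
  have Ht : htr (st m) (cv m m) = [:: (q 2, Some (inr (rowcell hP u C0 N0 e0 m)), MRight)].
    rewrite cvm // /st; case: eqP => Em /=; congr [:: (_, _, _)].
      apply: Hcell; rewrite ?um ?Em //; apply/eqP; rewrite /N0; lia.
    apply: Hcell; rewrite ?um //; try lia; try by apply/eqP; rewrite /N0; lia.
    by apply: e0i; lia.
  rewrite addSn; apply: (host_det Ht); first by rewrite /st; case: eqP.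
  rewrite write_cv /=.
  have Ht1 : htr (q 2) (cv m.+1 m.+1) = [:: (q 3, Some (inr (rowcell hP u C0 N0 e0 m.+1)), MRight)].
    rewrite cvm // /=; congr [:: (_, _, _)]; apply: Hcell; rewrite ?um //; try lia; try by apply/eqP; rewrite /N0; lia.
    by case=> [|[|p]]; rewrite /e0 /=; lia.
  rewrite addSn; apply: (host_det Ht1) => //.
  rewrite write_cv /=.
  have Ht2 : htr (q 3) (cv m.+2 m.+2) = [:: (q 4, Some (inr (rowcell hP u C0 N0 e0 m.+2)), MLeft)].
    have m2 : m <= m.+2 by lia.
    rewrite (cvm _ m2) /=; congr [:: (_, _, _)]; apply: Hcell; rewrite ?(um _ m2) //; try lia; try by apply/eqP; rewrite /N0; lia.
    by case=> [|[|p]]; rewrite /e0 /=; lia.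
  rewrite add1n; apply: (host_det Ht2) => //.
  rewrite write_cv /=.
  have -> : cv m.+3 = rowtape (row hP u C0 N0 e0).
    apply: functional_extensionality => i; rewrite /cv /rowtape.
    case: ltnP => Hi.
      by rewrite (nth_map (rowcell hP u C0 N0 e0 0)) ?size_mkseq ?nth_mkseq // /N0; lia.
    have HN : size [seq Some (inr x) : sym | x <- row hP u C0 N0 e0] <= i by rewrite size_map size_mkseq /N0; lia.
    rewrite (nth_default _ HN).
    by rewrite ltnNge (_ : m <= i) //; lia.
  by apply: (@host_ret (@Ordinal 9 4 isT) (inr (inl (fin hF1)))) => //; rewrite /N0; lia.
have im : m - k.+1 < m by lia.
have Hn : (m - k.+1).+1 = m - k by lia.
set i := m - k.+1 in im Hn *.
have Ht : htr (st i) (cv i i) = [:: (st i.+1, Some (inr (rowcell hP u C0 N0 e0 i)), MRight)].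
  rewrite /cv ltnn im /st /=.
  have ui : u i = Some (nth false w i) by rewrite /u /word_fun im.
  case: eqP => Ei /=; congr [:: (_, _, _)]; apply: Hcell => //; try by apply/eqP; rewrite /N0; lia.
    by rewrite Ei.
  by apply: e0i; lia.
rewrite addSn; apply: (host_det Ht); first by rewrite /st; case: eqP.
rewrite write_cv /= Hn.
have := IH (ltnW Hk); rewrite -Hn /st /=; done.
Qed.

End Correct.

Lemma cost_poly c : exists k, forall M, 1 < M -> cost c M <= M ^ k.
Proof.
have H9 M : 1 < M -> 9 * M <= M ^ 5.
  move=> M1; have : 2 ^ 4 <= M ^ 4 by rewrite leq_exp2r.
  by rewrite (expnS M 4); nia.
have Hmono M a b : 1 < M -> a <= b -> M ^ a <= M ^ b by move=> M1; rewrite leq_exp2l.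
elim: c => [p|p|r p q0|r p|r i ps|r p|c1 [k1 IH1] c2 [k2 IH2]|p q0 c1 [k1 IH1]|];
  try by exists 5 => M M1 /=; apply: H9.
- exists (k1 + k2).+1 => M M1; rewrite /= expnS.
  have := IH1 M M1; have := IH2 M M1.
  have := Hmono M k1 (k1 + k2) M1 ltac:(lia).
  have := Hmono M k2 (k1 + k2) M1 ltac:(lia).
  by nia.
- exists (k1 + 8) => M M1 /=.
  have A := IH1 M M1; have B := H9 M M1.
  have C := Hmono M k1 (k1 + 5) M1 ltac:(lia).
  have D := Hmono M 5 (k1 + 5) M1 ltac:(lia).
  have E : M * (6 * M + cost c1 M) + 6 * M <= (M * M) * (2 * M ^ (k1 + 5)) by nia.
  apply: leq_trans E _; rewrite (_ : k1 + 8 = 3 + (k1 + 5)); last by lia.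
  rewrite (expnD M 3) (_ : M ^ 3 = M * M * M); last by rewrite !expnS expn0 muln1 mulnA.
  by rewrite -(mulnA (M * M)) leq_mul2l leq_mul2r M1 !orbT.
Qed.

(** Brings a bound into the form required of running times. For [m <= 1] the additive constant takes
    over, whence the summand [4 ^ a]. *)
Lemma poly_shift a : exists k, forall m, (m + 3) ^ a <= m ^ k + k.
Proof.
exists (3 * a + 4 ^ a) => m.
case: (ltnP 1 m) => [m1|m1].
  apply: leq_trans (leq_addr _ _).
  apply: (@leq_trans ((m ^ 3) ^ a)); last first.
    by rewrite -expnM leq_exp2l //; lia.
  have H : m + 3 <= m ^ 3.
    have : 2 ^ 2 <= m ^ 2 by rewrite leq_exp2r.
    by rewrite (expnS m 2); nia.
  by case: a => [|a]; rewrite ?expn0 // leq_exp2r.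
apply: (@leq_trans (4 ^ a)); last by lia.
by case: a => [|a]; rewrite ?expn0 // leq_exp2r //; lia.
Qed.

Lemma leq_exp2 a b k : a <= b -> a ^ k <= b ^ k.
Proof. by case: k => [|k] H; rewrite ?expn0 // leq_exp2r. Qed.

(** The host machine guesses a certificate instead of [F]; certificates and bounded functions
    correspond by [decode_le] and [decode_surj]. *)
Theorem word_eso_NP : NP_language (fun w => exists F,
  (forall x, F x <= (size w).+2 ^ kb) /\
  holds (Ctx (size w).+1 (word_inp w) nospec F) (fun=> 0) f).
Proof.
exists host.
have Hspec w := spec_init (spec_row w).
split.
  have [k1 H1] := cost_poly hbuild.
  have [k2 H2] := cost_poly heval.
  have [k3 H3] := poly_shift ((hK + 2) * (k1 + k2 + 6)).
  exists k3 => w t c Hr.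
  have [Ht _] := Hspec w; apply: leq_trans (Ht _ _ Hr) _.
  apply: leq_trans (H3 (size w)).
  set N := (run _ _ _ hbuild _).1.
  have EN : N = size w + 3 + (size w).+2 ^ hK by apply: host_capacity.
  have HN : N <= (size w + 3) ^ (hK + 2).
    have A : (size w).+2 ^ hK <= (size w + 3) ^ hK by apply: leq_exp2; lia.
    have B : 0 < (size w + 3) ^ hK by rewrite expn_gt0; lia.
    by rewrite EN addn2 !expnS; nia.
  have N1 : 1 < N by rewrite EN; lia.
  rewrite expnM; apply: leq_trans (leq_exp2 _ HN).
  have A1 := H1 N N1; have A2 := H2 N N1.
  have B1 : N ^ k1 <= N ^ (k1 + k2) by rewrite leq_exp2l //; lia.
  have B2 : N ^ k2 <= N ^ (k1 + k2) by rewrite leq_exp2l //; lia.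
  have B0 : 0 < N ^ (k1 + k2) by rewrite expn_gt0; lia.
  have C : 18 * N <= N ^ 6.
    have : 2 ^ 5 <= N ^ 5 by rewrite leq_exp2r.
    by rewrite (expnS N 5); nia.
  have E : size w + (3 + ((size w).+2 + (cost hbuild N + (N + (N + (N + 1) + (cost heval N + (2 * N).+1))))))
     <= 2 * N ^ (k1 + k2) + 9 * N by lia.
  apply: leq_trans E _; rewrite (expnD N (k1 + k2) 6).
  set x := N ^ (k1 + k2) in B0 *; set y := N ^ 6 in C *.
  have D : x * (18 * N) <= x * y by rewrite leq_mul2l C orbT.
  by apply: leq_trans _ D; nia.
move=> w; have [_ H] := Hspec w.
rewrite /ntm_accepts (_ : (exists t c, _) <-> _); last exact: H.
split.
  case=> F [/decode_surj [C HC] Hh]; exists C; exists F; split=> //.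
  exact/esym/functional_extensionality.
by case=> C [F [-> Hh]]; exists (decode kb C (size w).+1); split=> // x; apply: decode_le.
Qed.

End Host.

(** * Lexicographic numbering of tuples *)

(** The number with base-[n] digits [s], most significant first; on ranks this is the position in
    the lexicographic order. *)
Fixpoint lexv (n : nat) (s : seq nat) : nat :=
  if s is x :: s' then x * n ^ size s' + lexv n s' else 0.

Lemma lexv_lt n s : 0 < n -> all (fun x => x < n) s -> lexv n s < n ^ size s.
Proof.
move=> n0; elim: s => [|x s IH] //= /andP[xn /IH H].
by rewrite expnS; nia.
Qed.

Lemma lexv_inj n s t : size s = size t ->
  all (fun x => x < n) s -> all (fun x => x < n) t -> lexv n s = lexv n t -> s = t.
Proof.
elim: s t => [|x s IH] [|y t] //= [st] /andP[xn sn] /andP[yn tn].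
have n0 : 0 < n by lia.
have Hs := lexv_lt n0 sn; have Ht := lexv_lt n0 tn; rewrite st in Hs * => E.
have Exy : x = y by case: (ltngtP x y) => // Hlt; nia.
by rewrite Exy (IH t) //; move: E; rewrite Exy; lia.
Qed.

Lemma lexv_rcons n s x : lexv n (rcons s x) = lexv n s * n + x.
Proof.
elim: s => [|y s IH] /=; first by rewrite expn0; lia.
by rewrite IH size_rcons expnS; lia.
Qed.

Lemma lexv_nseq0 n k : lexv n (nseq k 0) = 0.
Proof. by elim: k. Qed.

Lemma lexv_nseqmax n k : (lexv n.+1 (nseq k n)).+1 = n.+1 ^ k.
Proof. by elim: k => //= k IH; rewrite size_nseq expnS -IH; lia. Qed.

Lemma lexv_surj n k x : 0 < n -> x < n ^ k ->
  exists s, [/\ size s = k, all (fun x => x < n) s & lexv n s = x].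
Proof.
move=> n0; elim: k x => [|k IH] x Hx; first by exists [::]; split=> //; move: Hx; rewrite expn0; case: x.
have p0 : 0 < n ^ k by rewrite expn_gt0 n0.
case: (IH (x %% n ^ k)) => [|s [Hs Ha Hv]]; first by rewrite ltn_mod.
exists (x %/ n ^ k :: s); split=> /=; first by rewrite Hs.
  by rewrite Ha andbT ltn_divLR // -expnS.
by rewrite Hs Hv -divn_eq.
Qed.

(** * Ranks of a successor relation *)

Record ranking (T : finType) (b : builtins T) (rk : T -> nat) : Prop := Ranking {
  rk_inj  : injective rk;
  rk_lt   : forall x, rk x < #|T|;
  rk_succ : forall x y, bsucc b x y = (rk y == (rk x).+1);
  rk_zero : rk (bzero b) = 0;
  rk_max  : (rk (bmax b)).+1 = #|T|
}.

(** The rank of an element is the number of elements strictly below it. It is strictly monotone,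
    hence injective, hence onto the numbers below [#|T|], and so immediate successors have
    consecutive ranks. *)
Lemma ranking_exists (T : finType) (b : builtins T) : is_successor b -> exists rk, ranking b rk.
Proof.
case=> le [[lerefl leanti letrans letot] le0 lemax Hs].
pose rk x := #|[set y | (y != x) && le y x]|.
have mono x y : x != y -> le x y -> rk x < rk y.
  move=> xy lexy; apply: proper_card; apply/properP; split.
    apply/subsetP => z; rewrite !inE => /andP[zx lezx].
    rewrite (letrans _ _ _ lezx lexy) andbT; apply/eqP => zy.
    by move: zx; rewrite zy (leanti x y) ?lexy -?zy ?lezx ?eqxx.
  by exists x; rewrite !inE ?xy ?lexy // eqxx.
have inj : injective rk.
  move=> x y E; apply/eqP/negPn/negP => xy.
  case/orP: (letot x y) => H.
    by move: (mono _ _ xy H); rewrite E ltnn.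
  by move: (mono y x); rewrite eq_sym xy H E ltnn => /(_ isT isT).
have lt x : rk x < #|T|.
  rewrite -cardsT; apply: proper_card; apply/properP; split; first exact: subsetT.
  by exists x; rewrite ?inE // eqxx.
have le_rk x y : le x y = (rk x <= rk y).
  case: (eqVneq x y) => [->|xy]; first by rewrite lerefl leqnn.
  case/orP: (letot x y) => H; first by rewrite H (ltnW (mono _ _ xy H)).
  have Hlt : rk y < rk x by apply: mono; rewrite // eq_sym.
  rewrite leqNgt Hlt; apply/negP => H2.
  by move: xy; rewrite (leanti x y) ?eqxx // H H2.
have surj k : k < #|T| -> exists x, rk x = k.
  move=> kn.
  pose f x : 'I_#|T| := Ordinal (lt x).
  have finj : injective f by move=> x y /(congr1 val) /= /inj.
  have : Ordinal kn \in codom f by apply: inj_card_onto; rewrite ?card_ord.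
  by case/codomP => x /(congr1 val) /= ->; exists x.
exists rk; split=> //.
- move=> x y; rewrite Hs; apply/and3P/eqP.
    case=> xy lexy /forallP Hz.
    have Hlt := mono _ _ xy lexy.
    have [z Ez] := surj (rk x).+1 (leq_ltn_trans Hlt (lt y)).
    have := Hz z; rewrite !le_rk Ez leqnSn Hlt /= => /orP[/eqP E|/eqP E].
      by move: Ez; rewrite E; lia.
    by rewrite -E.
  move=> E; split.
  + by apply/eqP => xy; move: E; rewrite xy; lia.
  + by rewrite le_rk E.
  + apply/forallP => z; apply/implyP; rewrite !le_rk E => /andP[H1 H2].
    case: (eqVneq (rk z) (rk x)) => [/inj->|Hzx]; first by rewrite eqxx.
    have : rk z = rk y by rewrite E; lia.
    by move/inj => ->; rewrite eqxx orbT.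
- have [|x Ex] := surj 0; first by apply: leq_ltn_trans (lt (bzero b)).
  by have := le0 x; rewrite le_rk Ex leqn0 => /eqP.
- have n0 : 0 < #|T| by apply: leq_ltn_trans (lt (bzero b)).
  have [|x Ex] := surj #|T|.-1; first by lia.
  by have := lemax x; rewrite le_rk Ex; have := lt (bmax b); lia.
Qed.

Lemma ranking_surj (T : finType) (b : builtins T) rk k : ranking b rk -> k < #|T| -> exists x, rk x = k.
Proof.
case=> inj lt _ _ _ kn.
pose f x : 'I_#|T| := Ordinal (lt x).
have finj : injective f by move=> x y /(congr1 val) /= /inj.
have : Ordinal kn \in codom f by apply: inj_card_onto; rewrite ?card_ord.
by case/codomP => x /(congr1 val) /= ->; exists x.
Qed.

(** * Executions *)

Section Hoare.
Variables (sigma : signature) (A : structure sigma) (b : builtins A).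
Variables (test : Type) (holdsT : test -> env A -> Prop).
Local Notation instr := (instr sigma test).
Local Notation exec := (exec b holdsT).

Lemma exec_inv p e S e' S' : exec p e S e' S' ->
  match p with
  | [::] => e' = e /\ S' = S
  | Assign x y :: p' => exec p' (set_var e x (eval b e y)) S e' S'
  | ARead x R ys :: p' => exec p' (set_var e x (S R (map (eval b e) ys))) S e' S'
  | AWrite R ys y :: p' => exec p' e (set_arr S R (map (eval b e) ys) (eval b e y)) e' S'
  | Guess x :: p' => exists a, exec p' (set_var e x a) S e' S'
  | While t q :: p' =>
      (holdsT t e /\ exists e1 S1, exec q e S e1 S1 /\ exec (While t q :: p') e1 S1 e' S') \/
      (~ holdsT t e /\ exec p' e S e' S')
  end.
Proof.
case=> {p e S e' S'} //.
- by move=> x a p e S e' S' H; exists a.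
- by move=> t q p e S e1 S1 e' S' Ht H1 H2; left; split=> //; exists e1, S1.
- by move=> t q p e S e' S' Ht H; right.
Qed.

Lemma exec_cat p q e S e1 S1 e' S' :
  exec p e S e1 S1 -> exec q e1 S1 e' S' -> exec (p ++ q) e S e' S'.
Proof.
move=> H; elim: H q e' S' => {p e S e1 S1} //=.
- by move=> x y p e S e1 S1 _ IH q e' S' H; apply: exec_assign; apply: IH.
- by move=> x R ys p e S e1 S1 _ IH q e' S' H; apply: exec_read; apply: IH.
- by move=> R ys y p e S e1 S1 _ IH q e' S' H; apply: exec_write; apply: IH.
- by move=> x a p e S e1 S1 _ IH q e' S' H; apply: exec_guess; apply: IH.
- move=> t q p e S e1 S1 e2 S2 Ht H1 _ _ IH q' e' S' H.
  by apply: exec_while_true Ht H1 _; apply: IH.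
- by move=> t q p e S e1 S1 Ht _ IH q' e' S' H; apply: exec_while_false Ht _; apply: IH.
Qed.

Lemma exec_cat_inv p q e S e' S' : exec (p ++ q) e S e' S' ->
  exists e1 S1, exec p e S e1 S1 /\ exec q e1 S1 e' S'.
Proof.
move E: (p ++ q) => r H; elim: H p E => {r e S e' S'}.
- by move=> e S [|//] /= ->; exists e, S; split; constructor.
- move=> x y r e S e' S' H IH [|i p] /=.
    by move=> ->; exists e, S; split; constructor.
  case=> -> /IH [e1 [S1 [H1 H2]]]; exists e1, S1; split=> //; exact: exec_assign.
- move=> x R ys r e S e' S' H IH [|i p] /=.
    by move=> ->; exists e, S; split; [constructor|apply: exec_read].
  case=> -> /IH [e1 [S1 [H1 H2]]]; exists e1, S1; split=> //; exact: exec_read.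
- move=> R ys y r e S e' S' H IH [|i p] /=.
    by move=> ->; exists e, S; split; [constructor|apply: exec_write].
  case=> -> /IH [e1 [S1 [H1 H2]]]; exists e1, S1; split=> //; exact: exec_write.
- move=> x a r e S e' S' H IH [|i p] /=.
    by move=> ->; exists e, S; split; [constructor|apply: exec_guess H].
  case=> -> /IH [e1 [S1 [H1 H2]]]; exists e1, S1; split=> //; exact: exec_guess H1.
- move=> t q' r e S e1 S1 e' S' Ht H1 _ H2 IH [|i p] /=.
    by move=> ->; exists e, S; split; [constructor|apply: exec_while_true H1 H2].
  case=> -> E.
  case: (IH (While t q' :: p)) => [|e2 [S2 [H3 H4]]]; first by rewrite /= E.
  by exists e2, S2; split=> //; apply: exec_while_true H1 H3.
- move=> t q' r e S e' S' Ht H IH [|i p] /=.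
    by move=> ->; exists e, S; split; [constructor|apply: exec_while_false H].
  case=> -> /IH [e1 [S1 [H1 H2]]]; exists e1, S1; split=> //; exact: exec_while_false H1.
Qed.

(* Total correctness for programs all of whose runs satisfy [Q]. *)
Definition hx (p : seq instr) (e : env A) (S : store A) (Q : env A -> store A -> Prop) : Prop :=
  (exists e' S', exec p e S e' S' /\ Q e' S') /\ forall e' S', exec p e S e' S' -> Q e' S'.

Lemma hx_cat p q e S (Q R : env A -> store A -> Prop) : hx p e S Q ->
  (forall e1 S1, Q e1 S1 -> hx q e1 S1 R) -> hx (p ++ q) e S R.
Proof.
case=> -[e1 [S1 [H1 Q1]]] HQ HR; split.
  have [[e2 [S2 [H2 R2]]] _] := HR e1 S1 Q1.
  by exists e2, S2; split=> //; apply: exec_cat H1 H2.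
move=> e' S' /exec_cat_inv [e2 [S2 [H2 H3]]].
by have [_ H] := HR e2 S2 (HQ _ _ H2); apply: H H3.
Qed.

Lemma hx_weaken p e S (Q R : env A -> store A -> Prop) : hx p e S Q ->
  (forall e1 S1, Q e1 S1 -> R e1 S1) -> hx p e S R.
Proof.
case=> -[e1 [S1 [H1 Q1]]] HQ HR; split; first by exists e1, S1; split=> //; apply: HR.
by move=> e' S' /HQ /HR.
Qed.

Lemma hx_nil e S (Q : env A -> store A -> Prop) : Q e S -> hx [::] e S Q.
Proof.
move=> H; split; first by exists e, S; split=> //; constructor.
by move=> e' S' /exec_inv [-> ->].
Qed.

Lemma hx_assign x y p e S Q : hx p (set_var e x (eval b e y)) S Q -> hx (Assign _ x y :: p) e S Q.
Proof.
case=> -[e1 [S1 [H1 Q1]]] HQ; split; last by move=> e' S' /exec_inv /HQ.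
by exists e1, S1; split=> //; apply: exec_assign.
Qed.

Lemma hx_read x (R : arrsym) (ys : (R.2).-tuple (term sigma)) p e S Q :
  hx p (set_var e x (S R (map (eval b e) ys))) S Q -> hx (ARead _ x ys :: p) e S Q.
Proof.
case=> -[e1 [S1 [H1 Q1]]] HQ; split; last by move=> e' S' /exec_inv /HQ.
by exists e1, S1; split=> //; apply: exec_read.
Qed.

Lemma hx_while_false t q p e S Q : ~ holdsT t e -> hx p e S Q -> hx (While t q :: p) e S Q.
Proof.
move=> Ht [[e1 [S1 [H1 Q1]]] HQ]; split.
  by exists e1, S1; split=> //; apply: exec_while_false.
by move=> e' S' /exec_inv [[/Ht]|[_ /HQ]].
Qed.

Lemma hx_while_true t q p e S (Q R : env A -> store A -> Prop) : holdsT t e -> hx q e S Q ->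
  (forall e1 S1, Q e1 S1 -> hx (While t q :: p) e1 S1 R) -> hx (While t q :: p) e S R.
Proof.
move=> Ht [[e1 [S1 [H1 Q1]]] HQ] HR; split.
  have [[e2 [S2 [H2 R2]]] _] := HR e1 S1 Q1.
  by exists e2, S2; split=> //; apply: exec_while_true H1 H2.
move=> e' S' /exec_inv [[_ [e2 [S2 [H2 H3]]]]|[/(_ Ht)]] //.
by have [_ H] := HR e2 S2 (HQ _ _ H2); apply: H H3.
Qed.

(** An empty body changes nothing, so once the test holds the loop runs forever: [While t [::]]
    asserts the negation of [t] and discards all other computations. *)
Lemma exec_loop t p e S e' S' : exec (While t [::] :: p) e S e' S' -> ~ holdsT t e /\ exec p e S e' S'.
Proof.
move E: (While t [::] :: p) => r H; elim: H p E => {r e S e' S'} //.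
  move=> t' q r e S e1 S1 e' S' Ht H1 _ H2 IH p [Et Eq Er].
  move: H1; rewrite -Eq => /exec_inv [E1 ES]; rewrite E1 ES in IH.
  by apply: IH; rewrite Et Eq Er.
by move=> t' q r e S e' S' Ht H _ p [-> _ ->].
Qed.

Lemma exec_guesses zs e S (e' : env A) : (forall z, z \notin zs -> e' z = e z) -> uniq zs ->
  exec [seq Guess _ _ z | z <- zs] e S e' S.
Proof.
elim: zs e => [|z zs IH] e H.
  have -> : e' = e by apply: functional_extensionality => z; apply: H.
  by move=> _; constructor.
case/andP => zzs uz; apply: (@exec_guess _ _ _ _ _ z (e' z)); apply: IH => // y yzs.
rewrite /set_var; case: eqP => [->//|/eqP yz]; apply: H.
by rewrite inE negb_or yz.
Qed.

Lemma exec_guesses_inv zs e S e' S' : exec [seq Guess _ _ z | z <- zs] e S e' S' ->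
  S' = S /\ forall z, z \notin zs -> e' z = e z.
Proof.
elim: zs e => [|z zs IH] e /exec_inv; first by case=> -> ->.
case=> a /IH [-> H]; split=> // y; rewrite inE negb_or => /andP[yz yzs].
by rewrite H // /set_var (negbTE yz).
Qed.

(* Guess new values of [zs] satisfying the negation of [t]; otherwise diverge. *)
Lemma hx_guess_check zs t p e S Q : uniq zs ->
  (exists e1, (forall z, z \notin zs -> e1 z = e z) /\ ~ holdsT t e1) ->
  (forall e1, (forall z, z \notin zs -> e1 z = e z) -> ~ holdsT t e1 -> hx p e1 S Q) ->
  hx ([seq Guess _ _ z | z <- zs] ++ While t [::] :: p) e S Q.
Proof.
move=> uz [e1 [H1 Ht]] H; split.
  have [[e2 [S2 [H2 Q2]]] _] := H e1 H1 Ht.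
  exists e2, S2; split=> //; apply: exec_cat (exec_guesses S H1 uz) _.
  exact: exec_while_false.
move=> e' S' /exec_cat_inv [e2 [S2 [/exec_guesses_inv [-> H2] /exec_loop [Ht2 H3]]]].
by have [_ HH] := H e2 H2 Ht2; apply: HH.
Qed.

Definition assigns (xs : seq var) (ts : seq (term sigma)) : seq instr :=
  [seq Assign _ x.1 x.2 | x <- zip xs ts].

Lemma hx_assigns xs ts e S : size xs = size ts -> uniq xs ->
  all (fun t => if t is Var x then x \notin xs else true) ts ->
  hx (assigns xs ts) e S (fun e' S' => S' = S /\
    (forall z, z \notin xs -> e' z = e z) /\ [seq e' x | x <- xs] = [seq eval b e t | t <- ts]).
Proof.
elim: xs ts e => [|x xs IH] [|t ts] e //=; first by move=> _ _ _; apply: hx_nil.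
case=> Hs /andP[xxs ux] /andP[Ht Hts].
have Hts' : all (fun t => if t is Var x then x \notin xs else true) ts.
  apply: sub_all Hts => -[z|c||] //; by rewrite inE negb_or => /andP[].
have Ee : [seq eval b (set_var e x (eval b e t)) u | u <- ts] = [seq eval b e u | u <- ts].
  elim: ts {IH Hs Hts'} Hts => //= u ts IHt /andP[Hu /IHt ->]; congr (_ :: _).
  by case: u Hu => //= z; rewrite inE negb_or /set_var => /andP[/negbTE ->].
apply: hx_assign; apply: hx_weaken (IH ts _ Hs ux Hts') _ => e' S' [-> [H1 H2]]; split=> //.
split=> [z|]; first by rewrite inE negb_or => /andP[zx zxs]; rewrite H1 // /set_var (negbTE zx).
by rewrite H2 Ee H1 // /set_var eqxx.
Qed.

End Hoare.

(** * Counter programs as program schemes *)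

(* Relation symbols come first, constants are unary and follow. *)
Definition struct_inp (sigma : signature) (A : structure sigma) (rk : A -> nat)
    (i : nat) (xs : seq nat) : bool :=
  if insub i is Some i' then
    [exists t : (@arity sigma i').-tuple A, (map rk t == xs) && rel_of t]
  else if insub (i - nrel sigma) is Some c then xs == [:: rk (cst_of A c)]
  else false.

Section Formulas.
Variable sigma : signature.
Local Notation term := (term sigma).
Local Notation qf := (qf sigma).

Definition qtrue : qf := QEq (@Zero sigma) Zero.
Definition qfalse : qf := QNot qtrue.
Definition qall (s : seq qf) : qf := foldr (@QAnd sigma) qtrue s.
Definition qzs (ts : seq term) : qf := qall [seq QEq t Zero | t <- ts].
Definition qms (ts : seq term) : qf := qall [seq QEq t Max | t <- ts].
Definition qeqs (ts us : seq term) : qf := qall [seq QEq x.1 x.2 | x <- zip ts us].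
(** Successor with carry: either the leading digits agree and the rests are successive, or the
    leading digit goes up while the rest passes from all [Max] to all [Zero]. The variant [qinc]
    lets the largest number be its own successor, as counters saturate. *)
Fixpoint qsucc (ts us : seq term) : qf :=
  match ts, us with
  | t :: ts', u :: us' =>
      QOr (QAnd (QEq t u) (qsucc ts' us')) (QAnd (QSucc t u) (QAnd (qms ts') (qzs us')))
  | _, _ => qfalse
  end.
Definition qinc (ts us : seq term) : qf := QOr (qsucc ts us) (QAnd (qms ts) (qeqs ts us)).

Lemma wf_qall W s : wf_qf W (qall s) = all (wf_qf W) s.
Proof. by elim: s => //= f s ->. Qed.

Lemma wf_qzs W ts : wf_qf W (qzs ts) = all (wf_term W) ts.
Proof. by rewrite wf_qall all_map; apply: eq_all => t /=; rewrite andbT. Qed.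

Lemma wf_qms W ts : wf_qf W (qms ts) = all (wf_term W) ts.
Proof. by rewrite wf_qall all_map; apply: eq_all => t /=; rewrite andbT. Qed.

Lemma wf_qeqs W ts us : all (wf_term W) ts -> all (wf_term W) us -> wf_qf W (qeqs ts us).
Proof.
rewrite wf_qall; elim: ts us => [|t ts IH] [|u us] //= /andP[-> H1] /andP[-> H2].
exact: IH.
Qed.

Lemma wf_qsucc W ts us : all (wf_term W) ts -> all (wf_term W) us -> wf_qf W (qsucc ts us).
Proof.
elim: ts us => [|t ts IH] [|u us] //= /andP[Ht H1] /andP[Hu H2].
by rewrite Ht Hu wf_qms wf_qzs H1 H2 IH.
Qed.

Lemma wf_qinc W ts us : all (wf_term W) ts -> all (wf_term W) us -> wf_qf W (qinc ts us).
Proof. by move=> H1 H2; rewrite /= wf_qsucc // wf_qms H1 wf_qeqs. Qed.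

Variables (A : structure sigma) (b : builtins A) (rk : A -> nat).
Hypothesis Hrk : ranking b rk.
Let n := #|A|.

Definition rl (e : env A) (ts : seq term) : seq nat := [seq rk (eval b e t) | t <- ts].

Lemma card_pos : 1 < n.
Proof. exact: dom_gt1. Qed.

Lemma holds_qall s e : qf_holds b (qall s) e = all (fun f => qf_holds b f e) s.
Proof. by elim: s => [|f s IH] /=; rewrite ?eqxx // IH. Qed.

Lemma rk_eq x y : (x == y) = (rk x == rk y).
Proof. by apply/eqP/eqP => [->|/(rk_inj Hrk)]. Qed.

Lemma all_rl e ts : all (fun x => x < n) (rl e ts).
Proof. by elim: ts => //= t ts ->; rewrite (rk_lt Hrk). Qed.

Lemma holds_qeqs ts us e : size ts = size us ->
  qf_holds b (qeqs ts us) e = (lexv n (rl e ts) == lexv n (rl e us)).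
Proof.
move=> Hs; transitivity (rl e ts == rl e us).
  rewrite holds_qall; elim: ts us Hs => [|t ts IH] [|u us] //= [Hs].
  by rewrite IH // eqseq_cons rk_eq.
apply/eqP/eqP => [->//|]; apply: lexv_inj; rewrite ?all_rl //.
by rewrite !size_map.
Qed.

Lemma holds_qzs ts e : qf_holds b (qzs ts) e = (lexv n (rl e ts) == 0).
Proof.
rewrite holds_qall; elim: ts => //= t ts ->.
rewrite rk_eq (rk_zero Hrk) addn_eq0 muln_eq0 expn_eq0.
by have := card_pos; case: n => //= k _; rewrite orbF.
Qed.

Lemma holds_qms ts e : qf_holds b (qms ts) e = ((lexv n (rl e ts)).+1 == n ^ size ts).
Proof.
rewrite holds_qall; elim: ts => //= t ts ->.
rewrite rk_eq size_map expnS.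
have Hm := rk_max Hrk; rewrite -/n in Hm.
have := all_rl e ts; set s := rl e ts => Hs.
have Hl := lexv_lt (ltnW card_pos) Hs; rewrite size_map in Hl.
have := rk_lt Hrk (eval b e t); rewrite -/n => Ht.
apply/andP/eqP.
  by case=> /eqP E1 /eqP E2; rewrite E1 -E2 -Hm; lia.
move=> E; have Et : rk (eval b e t) = rk (bmax b) by nia.
by rewrite Et eqxx; split=> //; apply/eqP; nia.
Qed.

Lemma holds_qsucc ts us e : size ts = size us ->
  qf_holds b (qsucc ts us) e = (lexv n (rl e us) == (lexv n (rl e ts)).+1).
Proof.
elim: ts us => [|t ts IH] [|u us] //=; first by rewrite eqxx.
case=> Hs; rewrite IH // holds_qms holds_qzs rk_eq (rk_succ Hrk) !size_map Hs.
have H1 := lexv_lt (ltnW card_pos) (all_rl e ts).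
have H2 := lexv_lt (ltnW card_pos) (all_rl e us).
rewrite !size_map Hs in H1 H2.
set x := lexv n (rl e ts) in H1 *; set y := lexv n (rl e us) in H2 *.
set r := rk _; set r' := rk _; set M := n ^ _ in H1 H2 *.
apply/orP/eqP.
  case=> [/andP[/eqP-> /eqP->]|/and3P[/eqP-> /eqP E /eqP->]]; first by lia.
  by rewrite -E; lia.
case: (ltngtP r r') => Hr E.
- by right; apply/and3P; split; apply/eqP; nia.
- by nia.
- by left; apply/andP; split; rewrite ?Hr //; apply/eqP; nia.
Qed.

Lemma holds_qinc ts us e : size ts = size us -> 0 < size ts ->
  qf_holds b (qinc ts us) e = (lexv n (rl e us) == minn (lexv n (rl e ts)).+1 (n ^ size ts).-1).
Proof.
move=> Hs H0; rewrite /= holds_qsucc // holds_qms holds_qeqs //.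
have H1 := lexv_lt (ltnW card_pos) (all_rl e ts); rewrite size_map in H1.
have H2 := lexv_lt (ltnW card_pos) (all_rl e us); rewrite size_map -Hs in H2.
set x := lexv _ _ in H1 *; set y := lexv _ _ in H2 *; set M := n ^ _ in H1 H2 *.
by apply/orP/eqP; lia.
Qed.

End Formulas.

Section Compile.
Variables (sigma : signature) (test : Type) (qt : qf sigma -> test) (ot : test).
Variables (K P : nat) (g : var).
Hypothesis K0 : 0 < K.
Local Notation term := (term sigma).
Local Notation instr := (instr sigma test).

(** Register [p] is the block of [K] variables [z] with [z %/ K = p]; their ranks are the digits of
    a number below [n ^ K], the capacity. *)
Definition names (p : nat) : seq var := [seq p * K + j | j <- iota 0 K].
Definition regs (p : nat) : seq term := [seq Var x | x <- names p].
Definition regtup (p : nat) : K.-tuple term :=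
  map_tuple (fun j => Var (p * K + j)) (iota_tuple K 0).

Lemma mem_names z p : (z \in names p) = (z %/ K == p).
Proof.
apply/mapP/eqP => [[j]|<-].
  by rewrite mem_iota add0n => /= jK ->; rewrite divnMDl // divn_small // addn0.
by exists (z %% K); rewrite -?divn_eq // mem_iota add0n ltn_mod.
Qed.

Lemma size_names p : size (names p) = K.
Proof. by rewrite size_map size_iota. Qed.

Lemma uniq_names p : uniq (names p).
Proof. by rewrite map_inj_uniq ?iota_uniq // => x y /addnI. Qed.

Lemma tval_regtup p : tval (regtup p) = regs p.
Proof. by rewrite /= /regs /names -map_comp. Qed.

Lemma names_rcons p : names p = rcons [seq p * K + j | j <- iota 0 K.-1] (p * K + K.-1).
Proof.
have E : iota 0 K = rcons (iota 0 K.-1) K.-1.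
  by rewrite -{1}(prednK K0) -[K.-1.+1]addn1 iotaD add0n cats1.
by rewrite /names E map_rcons.
Qed.

Definition setz p : seq instr := assigns test (names p) (nseq K (@Zero sigma)).
(** The successor of a tuple is guessed in the scratch register [P], checked, and copied; a wrong
    guess diverges. *)
Definition incp p : seq instr :=
  [seq Guess _ _ z | z <- names P] ++
  While (qt (QNot (qinc (regs p) (regs P)))) [::] :: assigns test (names p) (regs P).
(** A conditional made from a loop: its first round raises [r] to 1 and thereby falsifies the
    test. *)
Definition cond r (f : qf sigma) : seq instr :=
  [:: While (qt (QAnd f (qzs (regs r)))) (incp r)].

Definition qsmall p : qf sigma := qzs [seq Var (p * K + j) | j <- iota 0 K.-1].
Definition qlast p : term := Var (p * K + K.-1).

(** Input atoms concern elements, that is, numbers below n: all digits except the last must be 0,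
    and the last one is the element itself. *)
Definition qin (i : nat) (ps : seq nat) : qf sigma :=
  QAnd (qall [seq qsmall p | p <- ps])
    (if insub i is Some i' then
       if insub [seq qlast p | p <- ps] is Some t then @QRel sigma i' t else qfalse sigma
     else if insub (i - nrel sigma) is Some c then
       if ps is [:: p] then QEq (qlast p) (Cst c) else qfalse sigma
     else qfalse sigma).

(** In an oracle call the flag [g] is cleared first. The test [ot] is to hold only while [g] is 0,
    and the body sets [g] to [max], so there is at most one round. The test sees variables only and
    therefore expects its argument in a fixed register, which [orcreg] imposes on the program. *)
Fixpoint sc (c : cmd) : seq instr :=
  match c with
  | CSet0 p => setz p
  | CInc p => incp p
  | CEq r p q => setz r ++ cond r (qeqs (regs p) (regs q))
  | CCert r p => setz r ++ @ARead sigma test g (0, K) (regtup p) :: cond r (QEq (Var g) Max)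
  | CIn r i ps => setz r ++ cond r (qin i ps)
  | COrc r _ => setz r ++ Assign _ g Zero :: [:: While ot (incp r ++ [:: Assign _ g Max])]
  | CSeq c1 c2 => sc c1 ++ sc c2
  | CFor p q c1 => setz p ++ [:: While (qt (QNot (qeqs (regs p) (regs q)))) (sc c1 ++ incp p)]
  | CApp => [::]
  end.

(** Compiled formulas satisfy this because [cfm] copies each oracle argument into [o] before the
    query. *)
Fixpoint orcreg (o : nat) (c : cmd) : bool :=
  match c with
  | COrc _ p => p == o
  | CSeq c1 c2 => orcreg o c1 && orcreg o c2
  | CFor _ _ c1 => orcreg o c1
  | _ => true
  end.

Lemma names_lt p x : p <= P -> x \in names p -> x < P.+1 * K.
Proof. by rewrite mem_names => pP /eqP E; rewrite -ltn_divLR // E ltnS. Qed.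

Lemma reg_lt p j : p <= P -> j < K -> p * K + j < P.+1 * K.
Proof. by move=> pP jK; apply: (names_lt pP); apply: map_f; rewrite mem_iota. Qed.

Lemma foldr_maxn_lt ps : foldr maxn 0 ps < P -> all (fun p => p < P) ps.
Proof. by elim: ps => //= p ps IH; rewrite gtn_max => /andP[-> /IH]. Qed.

(** ** Well-formedness *)

Section WF.
Variables (wft : seq var -> test -> bool) (omt : test -> bool) (io W : seq var) (fr : nat).
Hypotheses (HW : forall x, x < P.+1 * K -> x \in W) (gW : g \in W).
Hypotheses (Hio : forall x, x < P.+1 * K -> x %/ K != fr -> x \in io) (gio : g \in io).
Hypotheses (frP : fr != P)
  (wfqt : forall f, wf_qf W f -> wft W (qt f)) (wfot : wft W ot)
  (omqt : forall f, omt (qt f)) (omot : omt ot).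
Local Notation wfp := (all (@wf_instr sigma test wft io W)).
Local Notation omp := (all (@onlymax_instr sigma test omt)).

Lemma wf_regs p : p <= P -> all (wf_term W) (regs p).
Proof. by move=> pP; rewrite all_map; apply/allP => x /(names_lt pP) /HW. Qed.

Lemma io_names p : p <= P -> p != fr -> {subset names p <= io}.
Proof.
move=> pP pf x xp; apply: Hio; first exact: names_lt xp.
by move: xp; rewrite mem_names => /eqP ->.
Qed.

Lemma wf_assigns xs ts : {subset xs <= io} -> all (wf_term W) ts -> wfp (assigns test xs ts).
Proof.
elim: xs ts => [|x xs IH] [|t ts] //= Hx /andP[Ht Hts].
rewrite Hx ?inE ?eqxx // Ht IH // => y yx; apply: Hx; by rewrite inE yx orbT.
Qed.

Lemma om_assigns xs (ts : seq term) : omp (assigns test xs ts).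
Proof. by rewrite /assigns; elim: xs ts => [|x xs IH] [|t ts] //=. Qed.

Lemma wf_setz p : p <= P -> p != fr -> wfp (setz p) && omp (setz p).
Proof.
move=> pP pf; rewrite om_assigns andbT; apply: wf_assigns; first exact: io_names.
by elim: K.
Qed.

Lemma wf_incp p : p < P -> p != fr -> wfp (incp p) && omp (incp p).
Proof.
move=> pP pf; rewrite /incp !all_cat /= !omqt !om_assigns.
rewrite wfqt /=; last by rewrite wf_qsucc ?wf_qms ?wf_qeqs ?wf_regs // ltnW.
rewrite wf_assigns ?wf_regs //; last by apply: io_names => //; apply: ltnW.
rewrite !andbT !all_map /=; apply/andP; split; last by apply/allP.
have PF : P != fr by rewrite eq_sym.
by apply/allP => x xP; apply: (@io_names P (leqnn _) PF); apply: map_f xP.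
Qed.

Lemma wf_cond r f : r < P -> r != fr -> wf_qf W f -> wfp (cond r f) && omp (cond r f).
Proof.
move=> rP rf Wf; have /andP[H1 H2] := wf_incp rP rf.
by rewrite /cond /= omqt wfqt ?H1 ?H2 //= Wf wf_qzs wf_regs // ltnW.
Qed.

Lemma wf_qin i ps : all (fun p => p < P) ps -> wf_qf W (qin i ps).
Proof using K0 HW.
move=> Hps; rewrite /= wf_qall; apply/andP; split.
  rewrite all_map; apply: sub_all Hps => p pP /=.
  rewrite wf_qzs all_map; apply/allP => j; rewrite mem_iota => /= jK.
  by apply: HW; apply: reg_lt (ltnW pP) (leq_trans jK (leq_pred K)).
have Hl p : p < P -> p * K + K.-1 \in W.
  by move=> pP; apply: HW; apply: reg_lt (ltnW pP) _; rewrite prednK.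
case: insubP => [i' _ _|_] /=.
  case: insubP => [t _ Et|//] /=; rewrite /= (_ : tval t = val t) // Et all_map.
  by apply: sub_all Hps => p /Hl.
case: insubP => [c _ _|_] //=.
by case: ps Hps => [|p [|p' ps]] //= /andP[/Hl -> _].
Qed.

Lemma wf_sc c : maxreg c < P -> fr \notin writes c -> wfp (sc c) && omp (sc c).
Proof.
elim: c => [p|p|r p q|r p|r i ps|r p|c1 IH1 c2 IH2|p q c IH|] /= HP; rewrite ?inE.
- by rewrite eq_sym => Hf; apply: wf_setz => //; lia.
- by rewrite eq_sym => Hf; apply: wf_incp => //; lia.
- rewrite eq_sym => Hf; have rP : r < P by lia.
  have /andP[H1 H2] := wf_setz (ltnW rP) Hf.
  have Wf : wf_qf W (qeqs (regs p) (regs q)) by apply: wf_qeqs; apply: wf_regs; lia.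
  have /andP[H3 H4] := wf_cond rP Hf Wf.
  by rewrite !all_cat H1 H2 H3 H4.
- rewrite eq_sym => Hf; have rP : r < P by lia.
  have /andP[H1 H2] := wf_setz (ltnW rP) Hf.
  have Wf : wf_qf W (QEq (@Var sigma g) Max) by rewrite /= gW.
  have /andP[H3 H4] := wf_cond rP Hf Wf.
  have Hp : all (wf_term W) (regs p) by apply: wf_regs; lia.
  rewrite -tval_regtup in Hp.
  by rewrite -cat1s !all_cat H1 H2 H3 H4 /= gio; move: Hp => /= ->.
- rewrite eq_sym => Hf; have rP : r < P by lia.
  have /andP[H1 H2] := wf_setz (ltnW rP) Hf.
  have Wf : wf_qf W (qin i ps) by apply/wf_qin/foldr_maxn_lt; lia.
  have /andP[H3 H4] := wf_cond rP Hf Wf.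
  by rewrite !all_cat H1 H2 H3 H4.
- rewrite eq_sym => Hf; have rP : r < P by lia.
  have /andP[H1 H2] := wf_setz (ltnW rP) Hf.
  have /andP[H3 H4] := wf_incp rP Hf.
  move: (incp r) H3 H4 => q H3 H4.
  by rewrite !all_cat H1 H2 /= !all_cat H3 H4 /= gio wfot omot.
- rewrite mem_cat negb_or => /andP[F1 F2].
  have [P1 P2] : maxreg c1 < P /\ maxreg c2 < P by move: HP; rewrite gtn_max => /andP.
  have /andP[H1 H2] := IH1 P1 F1; have /andP[H3 H4] := IH2 P2 F2.
  by rewrite !all_cat H1 H2 H3 H4.
- rewrite negb_or eq_sym => /andP[Hf F1].
  move: HP; rewrite !gtn_max => /andP[/andP[pP qP] cP].
  have /andP[H1 H2] := wf_setz (ltnW pP) Hf.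
  have /andP[H3 H4] := wf_incp pP Hf.
  have /andP[H5 H6] := IH cP F1.
  move: (incp p) (sc c) H3 H4 H5 H6 => i1 i2 H3 H4 H5 H6.
  rewrite !all_cat H1 H2 /= !all_cat H3 H4 H5 H6 omqt /= wfqt //=.
  by apply: wf_qeqs; apply: wf_regs; apply: ltnW.
- by [].
Qed.

End WF.

End Compile.

(** * Correctness of compiled counter programs as schemes *)

Section Semantics.
Variables (sigma : signature) (A : structure sigma) (b : builtins A) (rk : A -> nat).
Hypothesis Hrk : ranking b rk.
Variables (test : Type) (qt : qf sigma -> test) (ot : test) (holdsT : test -> env A -> Prop).
Variables (K P : nat) (g : var) (W : seq var) (OR : nat -> bool) (o : nat).
Hypotheses (K0 : 0 < K) (HW : forall x, x < P.+1 * K -> x \in W) (gW : g \in W)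
  (gP : P.+1 * K <= g).
Hypothesis Hqt : forall f e, wf_qf W f -> (holdsT (qt f) e <-> qf_holds b f e).
Let n := #|A|.
Let N := n ^ K.
Local Notation names := (names K).
Local Notation regs := (regs sigma K).
Local Notation setz := (setz sigma test K).
Local Notation incp := (incp qt K P).
Local Notation cond := (cond qt K P).
Local Notation sc := (sc qt ot K P g).
Local Notation hx := (hx b holdsT).

Definition regval (e : env A) (p : nat) : nat := lexv n [seq rk (e x) | x <- names p].

Hypothesis Hot : forall e, holdsT ot e <-> e g = bzero b /\ OR (regval e o).

Definition out (zs : seq var) (e e' : env A) := forall z, z \notin zs -> e' z = e z.

Definition rep (e : env A) (r : nat -> nat) := forall p, p < P -> regval e p = r p.

(** The array [(0, K)] read as a certificate: the index tuple consists of the digits of the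
    position, and [max] stands for a one. *)
Definition certS (S : store A) (x : nat) : bool :=
  [exists t : K.-tuple A, (lexv n (map rk t) == x) && (S (0, K) t == bmax b)].

Lemma n_gt1 : 1 < n.
Proof. exact: dom_gt1. Qed.

Lemma N_gt1 : 1 < N.
Proof. by rewrite -(exp1n K) ltn_exp2r // n_gt1. Qed.

Lemma val_rl e p : lexv n (rl b rk e (regs p)) = regval e p.
Proof. by rewrite /regval /rl /regs -map_comp. Qed.

Lemma val_lt e p : regval e p < N.
Proof.
rewrite /regval /N -{2}(size_names K p) -(size_map (fun x => rk (e x))).
apply: lexv_lt; first by have := n_gt1; lia.
by rewrite all_map; apply/allP => x _ /=; apply: rk_lt Hrk _.
Qed.

Lemma val_ext e e' p : {in names p, e' =1 e} -> regval e' p = regval e p.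
Proof. by move=> H; rewrite /regval; congr lexv; apply/eq_in_map => x /H ->. Qed.

Lemma val_out zs e e' p : out zs e e' -> (forall x, x \in names p -> x \notin zs) ->
  regval e' p = regval e p.
Proof. by move=> H Hn; apply: val_ext => x /Hn /H. Qed.

Lemma names_disj p q x : p != q -> x \in names p -> x \notin names q.
Proof. by rewrite !mem_names // => pq /eqP ->. Qed.

Lemma certS_val S e p : certS S (regval e p) = (S (0, K) [seq e x | x <- names p] == bmax b).
Proof.
pose t := map_tuple (fun j => e (p * K + j)) (iota_tuple K 0).
have Et : tval t = [seq e x | x <- names p] by rewrite /= -map_comp.
apply/existsP/eqP => [[t' /andP[/eqP Ev /eqP <-]]|E].
  suff -> : tval t' = [seq e x | x <- names p] by [].
  apply: (inj_map (rk_inj Hrk)); apply: (@lexv_inj n).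
  - by rewrite !size_map size_tuple size_iota.
  - by rewrite all_map; apply/allP => x _; apply: rk_lt Hrk _.
  - by rewrite !all_map; apply/allP => x _; apply: rk_lt Hrk _.
  - by rewrite Ev /regval -[in RHS]map_comp.
exists t; rewrite Et E eqxx andbT /regval -map_comp; exact/eqP.
Qed.

Definition elt (k : nat) : A := odflt (bzero b) [pick x | rk x == k].

Lemma rk_elt k : k < n -> rk (elt k) = k.
Proof.
move=> kn; rewrite /elt; case: pickP => [x /eqP //|H].
by have [x Ex] := ranking_surj Hrk kn; move: (H x); rewrite Ex eqxx.
Qed.

Lemma set_val e p v : v < N -> exists e', out (names p) e e' /\ regval e' p = v.
Proof.
move=> vN; have [s [Hs Ha <-]] := lexv_surj (ltnW n_gt1) vN.
exists (fun z => if z \in names p then elt (nth 0 s (index z (names p))) else e z).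
split; first by move=> z /negbTE ->.
rewrite /regval; congr lexv; apply: (@eq_from_nth _ 0); first by rewrite size_map size_names.
move=> i; rewrite size_map size_names => iK.
rewrite (nth_map 0) ?size_names // mem_nth ?size_names // index_uniq ?size_names ?uniq_names //.
by rewrite rk_elt //; apply: (allP Ha); rewrite mem_nth // Hs.
Qed.

Lemma hx_setz p e S : hx (setz p) e S (fun e' S' =>
  [/\ S' = S, out (names p) e e' & regval e' p = 0]).
Proof.
apply: hx_weaken (hx_assigns b holdsT e S _ _ _) _.
- by rewrite size_names size_nseq.
- exact: uniq_names.
- by rewrite all_nseq orbT.
- move=> e' S' [-> [H1 H2]]; split=> //.
  have -> : regval e' p = lexv n (map rk [seq e' x | x <- names p]) by rewrite -map_comp.
  rewrite H2 map_nseq /= (_ : map _ _ = nseq K 0) ?lexv_nseq0 //.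
  by elim: (K) => //= k ->; rewrite (rk_zero Hrk).
Qed.

Lemma wfr p : p <= P -> all (wf_term W) (regs p).
Proof. by move=> pP; apply: (@wf_regs sigma K P K0 W HW). Qed.

Lemma hx_incp p e S : p < P -> hx (incp p) e S (fun e' S' =>
  [/\ S' = S, out (names p ++ names P) e e' & regval e' p = minn (regval e p).+1 N.-1]).
Proof.
move=> pP.
have Wq : wf_qf W (QNot (qinc (regs p) (regs P))).
  by apply: wf_qinc; apply: wfr; lia.
have Hs : size (regs p) = size (regs P) by rewrite !size_map !size_iota.
have HK : size (regs p) = K by rewrite !size_map size_iota.
have Hh e1 : ~ holdsT (qt (QNot (qinc (regs p) (regs P)))) e1 <->
    regval e1 P = minn (regval e1 p).+1 N.-1.
  rewrite Hqt // [qf_holds _ (QNot _) _]/= -[qf_holds _ _ _ || _]/(qf_holds b (qinc (regs p) (regs P)) e1).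
  rewrite (holds_qinc Hrk _ Hs) HK // -/n !val_rl -/N.
  by split=> [/negP|->]; [rewrite negbK => /eqP|rewrite eqxx].
have pP' : p != P by rewrite neq_ltn pP.
have Hd x : x \in names p -> x \notin names P by apply: names_disj.
apply: hx_guess_check.
- exact: uniq_names.
- have [|e1 [H1 H2]] := @set_val e P (minn (regval e p).+1 N.-1).
    by have := N_gt1; lia.
  exists e1; split=> //; apply/Hh; rewrite H2; congr (minn _.+1 _).
  by apply/esym; apply: val_out H1 Hd.
- move=> e1 H1 /Hh H2.
  apply: hx_weaken (hx_assigns b holdsT e1 S _ _ _) _.
  + by rewrite size_names !size_map size_iota.
  + exact: uniq_names.
  + rewrite all_map; apply/allP => x xP /=; apply: names_disj xP; by rewrite eq_sym.
  + move=> e' S' [-> [H3 H4]]; split=> //.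
      by move=> z; rewrite mem_cat negb_or => /andP[z1 z2]; rewrite H3 // H1.
    rewrite -(val_out H1 Hd) -H2 /regval (map_comp rk e') H4.
    by rewrite /regs -!map_comp.
Qed.

Lemma hx_cond r f B e S : r < P -> wf_qf W f -> regval e r = 0 ->
  (forall e', out (names r ++ names P) e e' -> qf_holds b f e' = B) ->
  hx (cond r f) e S (fun e' S' =>
    [/\ S' = S, out (names r ++ names P) e e' & regval e' r = B]).
Proof.
move=> rP Wf r0 Hf.
have Wq : wf_qf W (QAnd f (qzs (regs r))).
  by rewrite /= Wf wf_qzs wfr // ltnW.
have Hh e' : out (names r ++ names P) e e' ->
    (holdsT (qt (QAnd f (qzs (regs r)))) e' <-> B && (regval e' r == 0)).
  by move=> H; rewrite Hqt //= Hf // (holds_qzs Hrk) -/n val_rl.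
case: B Hf Hh => Hf Hh; last first.
  apply: hx_while_false; first by rewrite Hh.
  by apply: hx_nil; split.
apply: (hx_while_true _ (hx_incp e S rP)); first by rewrite Hh // r0.
move=> e1 S1 [-> H1 H2]; apply: hx_while_false.
  rewrite Hh // H2 r0; have := N_gt1; case: (minn 1 N.-1 == 0) / eqP => //=; lia.
apply: hx_nil; split=> //; rewrite H2 r0; have := N_gt1; rewrite /=; lia.
Qed.

Lemma holds_qsmall p e : qf_holds b (qsmall sigma K p) e = (regval e p < n).
Proof.
rewrite (holds_qzs Hrk) /regval (names_rcons K0) map_rcons lexv_rcons -/n.
have Hl := rk_lt Hrk (e (p * K + K.-1)).
rewrite /rl -!map_comp /=; set x := lexv _ _; rewrite -/n in Hl.
by case: eqP => [->|] ; nia.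
Qed.

Lemma val_small p e : regval e p < n -> regval e p = rk (e (p * K + K.-1)).
Proof.
rewrite /regval (names_rcons K0) map_rcons lexv_rcons -/n.
by set x := lexv _ _; case: x => [|x]; [rewrite mul0n|nia].
Qed.

Lemma holds_qin i ps e : qf_holds b (qin sigma K i ps) e = struct_inp rk i [seq regval e p | p <- ps].
Proof.
rewrite /qin [LHS]/= holds_qall all_map.
have -> : all (preim (qsmall sigma K) (fun f => qf_holds b f e)) ps = all (fun p => regval e p < n) ps.
  by apply: eq_all => p; rewrite /= holds_qsmall.
rewrite /struct_inp; case: insubP => [i' _ _|_].
  have Et (t : (arity i').-tuple (term sigma)) : tval t = [seq qlast sigma K p | p <- ps] ->
      rel_of (map_tuple (eval b e) t) =
      [exists t : (arity i').-tuple A, (map rk t == [seq rk (e (p * K + K.-1)) | p <- ps]) && rel_of t].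
    move=> Et; apply/idP/existsP => [H|[t' /andP[/eqP E H]]].
      by exists (map_tuple (eval b e) t); rewrite H andbT /= Et -!map_comp.
    suff -> : map_tuple (eval b e) t = t' by [].
    apply/val_inj/(inj_map (rk_inj Hrk)); rewrite E /= Et -!map_comp.
    by apply: eq_map.
  case: (boolP (all _ ps)) => [Hs|/allPn [p pps Hp]] /=.
    have -> : [seq regval e p | p <- ps] = [seq rk (e (p * K + K.-1)) | p <- ps].
      by apply/eq_in_map => p /(allP Hs); apply: val_small.
    case: insubP => [t _ /Et //|Hn] /=.
    rewrite eqxx /=; apply/esym/existsP => -[t /andP[/eqP E _]].
    move: Hn; rewrite size_map => /negP; apply.
    by rewrite -(size_map (fun p => rk (e (p * K + K.-1)))) -E size_map size_tuple.
  apply/esym/existsP => -[t /andP[/eqP E _]]; move: Hp.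
  have : regval e p \in map rk t by rewrite E map_f.
  by case/mapP => x _ ->; rewrite (rk_lt Hrk).
case: insubP => [c _ _|_]; last by rewrite /= eqxx andbF.
case: ps => [|p [|p' ps]] /=; [by rewrite eqxx| |by rewrite eqxx andbF eqseq_cons andbF].
rewrite andbT eqseq_cons andbT (rk_eq Hrk).
apply/andP/eqP => [[Hs /eqP]|E]; first by rewrite val_small.
have Hs : regval e p < n by rewrite E (rk_lt Hrk).
by rewrite Hs -E val_small.
Qed.

Lemma rep_out r v e e' rho : rep e rho -> out (names r ++ names P) e e' -> regval e' r = v ->
  rep e' (upd rho r v).
Proof.
move=> Hr Ho Hv p pP; rewrite /upd; case: eqP => [->//|/eqP pr].
rewrite -Hr //; apply: val_out Ho _ => x xp; rewrite mem_cat negb_or.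
by rewrite (names_disj pr xp) (names_disj _ xp) // neq_ltn pP.
Qed.

Lemma rep_upd e e' rho : rep e rho -> (forall x, x < P.+1 * K -> e' x = e x) -> rep e' rho.
Proof.
move=> Hr H p pP; rewrite -Hr //; apply: val_ext => x xp; apply: H.
by apply: (@names_lt K P K0 p) => //; apply: ltnW.
Qed.

Lemma hx_bool r f B e S rho : r < P -> wf_qf W f -> rep e rho ->
  (forall e', out (names r ++ names P) e e' -> qf_holds b f e' = B) ->
  hx (setz r ++ cond r f) e S (fun e' S' => S' = S /\ rep e' (upd rho r B)).
Proof.
move=> rP Wf Hr Hf; apply: hx_cat (hx_setz r e S) _ => e1 S1 [-> H1 H2].
apply: hx_weaken (hx_cond S rP Wf H2 _) _.
  move=> e' H3; apply: Hf => z; rewrite mem_cat negb_or => /andP[z1 z2].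
  by rewrite H3 ?mem_cat ?negb_or ?z1 // H1.
move=> e2 S2 [-> H3 H4]; split=> //; apply: (rep_out Hr _ H4).
move=> z; rewrite mem_cat negb_or => /andP[z1 z2].
by rewrite H3 ?mem_cat ?negb_or ?z1 // H1.
Qed.

Lemma out_val r e e' p : p < P -> p != r -> out (names r ++ names P) e e' -> regval e' p = regval e p.
Proof.
move=> pP pr H; apply: val_out H _ => x xp; rewrite mem_cat negb_or.
by rewrite (names_disj pr xp) (names_disj _ xp) // neq_ltn pP.
Qed.

(** The scheme simulates the counter program command by command, with capacity [n ^ K] and the array
    as certificate. The scratch register [P] may contain anything, since [rep] speaks only of the
    registers below it. *)
Theorem hx_sc c e S rho : wfc c -> noapp c -> orcreg o c -> maxreg c < P -> rep e rho ->
  hx (sc c) e S (fun e' S' => S' = S /\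
    rep e' (run (struct_inp rk) OR (certS S) c (N, rho)).2).
Proof.
elim: c e rho => [p|p|r p q|r p|r i ps|r p|c1 IH1 c2 IH2|p q c IH|] e rho //.
- move=> _ _ _ /= pP Hr; apply: hx_weaken (hx_setz p e S) _ => e' S' [-> H1 H2]; split=> //.
  apply: (rep_out Hr _ H2) => z; rewrite mem_cat negb_or => /andP[z1 z2]; exact: H1.
- move=> _ _ _ /= pP Hr; apply: hx_weaken (hx_incp e S pP) _ => e' S' [-> H1 H2]; split=> //.
  by rewrite /= -(Hr p) //; apply: rep_out Hr H1 H2.
- move=> /= /andP[rp rq] _ _ HP Hr.
  have [pP qP rP] : [/\ p < P, q < P & r < P] by split; lia.
  have Hpq : (rho p == rho q) = (regval e p == regval e q) by rewrite !Hr.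
  rewrite Hpq; apply: hx_bool => //; first by apply: wf_qeqs; apply: wfr; apply: ltnW.
  move=> e' H; rewrite (holds_qeqs Hrk) ?size_map ?size_iota // -/n !val_rl.
  by rewrite !(out_val _ _ H) // eq_sym.
- move=> /= rp _ _ HP Hr.
  have [pP rP] : p < P /\ r < P by split; lia.
  apply: hx_cat (hx_setz r e S) _ => e1 S1 [-> H1 H2].
  have Hp : regval e1 p = rho p.
    by rewrite -Hr //; apply: val_out H1 _ => x; apply: names_disj; rewrite eq_sym.
  apply: hx_read; set a := S _ _.
  have Ea : (a == bmax b) = certS S (rho p).
    rewrite -Hp certS_val /a; congr (S _ _ == _).
    have -> : map (eval b e1) (regtup sigma K p) = map (eval b e1) (tval (regtup sigma K p)) by [].
    by rewrite tval_regtup /regs -map_comp.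
  have gn q : q <= P -> g \notin names q.
    move=> qP; apply/negP => /(names_lt K0 qP); lia.
  apply: hx_weaken (hx_cond (B := certS S (rho p)) S rP _ _ _) _.
  + by rewrite /= gW.
  + rewrite -H2; apply: val_ext => x xr; rewrite /set_var; case: eqP => // Ex.
    by move: xr; rewrite Ex (negbTE (gn r (ltnW rP))).
  + move=> e' H; rewrite /= H ?mem_cat ?negb_or ?gn //; last exact: ltnW.
    by rewrite /set_var eqxx.
  + move=> e' S' [-> H3 H4]; split=> //.
    have Hr2 : rep (set_var e1 g a) (upd rho r 0).
      apply: (@rep_upd e1); last by move=> x xP; rewrite /set_var; case: eqP => //; lia.
      apply: (rep_out Hr _ H2) => z; rewrite mem_cat negb_or => /andP[z1 z2]; exact: H1.
    have := rep_out Hr2 H3 H4; congr rep; apply: functional_extensionality => z.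
    by rewrite /upd; case: eqP.
- move=> /= rps _ _ HP Hr.
  have rP : r < P by lia.
  have Hps : all (fun p => p < P) ps by apply: foldr_maxn_lt; lia.
  apply: hx_bool => //; first exact: (wf_qin sigma K0 HW).
  move=> e' H; rewrite holds_qin; congr struct_inp; apply/eq_in_map => p pps.
  have pP := allP Hps p pps.
  rewrite (out_val pP _ H) ?Hr //.
  by apply/eqP => E; move: rps; rewrite -E pps.
- move=> /= rp _ /eqP Ep HP Hr; rewrite Ep in rp HP *.
  have [pP rP] : o < P /\ r < P by split; lia.
  apply: hx_cat (hx_setz r e S) _ => e1 S1 [-> H1 H2].
  apply: hx_assign; rewrite /=; set e2 := set_var _ _ _.
  have gn q : q <= P -> g \notin names q.
    move=> qP; apply/negP => /(names_lt K0 qP); lia.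
  have E2 q : q <= P -> regval e2 q = regval e1 q.
    move=> qP; apply: val_ext => x xq; rewrite /e2 /set_var; case: eqP => // Ex.
    by move: xq; rewrite Ex (negbTE (gn q qP)).
  have Hr2 : rep e2 (upd rho r 0).
    apply: (@rep_upd e1); last by move=> x xP; rewrite /e2 /set_var; case: eqP => //; lia.
    apply: (rep_out Hr _ H2) => z; rewrite mem_cat negb_or => /andP[z1 z2]; exact: H1.
  have Ho : holdsT ot e2 <-> OR (rho o).
    rewrite Hot E2 ?(ltnW pP) // (val_out H1) ?Hr // /e2 /set_var ?eqxx; first by split=> [[]|].
    by move=> x; apply: names_disj; rewrite eq_sym.
  case Eo: (OR (rho o)); last first.
    by apply: hx_while_false; [rewrite Ho Eo|apply: hx_nil; split].
  (* After the first round the flag is [max], so [Hot] refutes the test and the loop ends. *)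
  apply: (hx_while_true (Q := fun e' S' => [/\ S' = S, e' g = bmax b & rep e' (upd rho r 1)])).
  + by rewrite Ho Eo.
  + apply: hx_cat (hx_incp e2 S rP) _ => e3 S3 [-> H5 H6].
    apply: hx_assign; apply: hx_nil; split=> //; first by rewrite /set_var eqxx.
    apply: (@rep_upd e3); last by move=> x xP; rewrite /set_var; case: eqP => //; lia.
    rewrite E2 ?(ltnW rP) // H2 in H6.
    have M1 : minn 1 N.-1 = 1 by have := N_gt1; lia.
    rewrite M1 in H6; have := rep_out Hr2 H5 H6.
    congr rep; apply: functional_extensionality => z; by rewrite /upd; case: eqP.
  + move=> e3 S3 [-> H5 H6]; apply: hx_while_false; last by apply: hx_nil; split.
    rewrite Hot H5 => -[E _]; have := rk_zero Hrk; rewrite -E; have := rk_max Hrk.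
    by have := n_gt1; rewrite -/n; lia.
- move=> /= /andP[w1 w2] /andP[a1 a2] /andP[o1 o2] HP Hr.
  apply: hx_cat (IH1 e rho w1 a1 o1 _ Hr) _ => [|e1 S1 [-> H1]]; first by lia.
  apply: hx_weaken (IH2 e1 _ w2 a2 o2 _ H1) _; first by lia.
  move=> e2 S2 [-> H2]; split=> //.
  set s := run _ _ _ c1 _ in H2 *.
  have Es : s.1 = N by rewrite /s run_noapp.
  by rewrite [s]surjective_pairing Es.
- move=> /= /and4P[pq pw qw Hw] Ha Hoc HP Hr.
  have [pP qP] : p < P /\ q < P by split; lia.
  apply: hx_cat (hx_setz p e S) _ => e1 S1 [-> H1 H2].
  set f := fun s' => inc p _.
  pose s k := iter k f (N, upd rho p 0).
  have Hrho j : j < P -> rho j < N by move=> jP; rewrite -Hr // val_lt.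
  have HrS : rep e1 (s 0).2.
    apply: (rep_out Hr _ H2) => z; rewrite mem_cat negb_or => /andP[z1 z2]; exact: H1.
  have Hs k : k <= rho q -> [/\ (s k).1 = N, (s k).2 p = k & (s k).2 q = rho q].
    elim: k => [_|k IHk Hk].
      by split=> //=; rewrite ?upd_same // upd_other // eq_sym.
    case: IHk => [|E1 E2 E3]; first by lia.
    rewrite /s iterS -/(s k) /f /inc /=; split.
    + by rewrite run_noapp.
    + rewrite upd_same run_writes // E2 run_noapp // E1; have := Hrho q qP; lia.
    + by rewrite upd_other 1?eq_sym // run_writes.
  have Wq : wf_qf W (QNot (qeqs (regs p) (regs q))) by apply: wf_qeqs; apply: wfr; lia.
  have Hh e' r' : rep e' r' -> (holdsT (qt (QNot (qeqs (regs p) (regs q)))) e' <-> r' p != r' q).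
    move=> Hr'; rewrite Hqt //= (holds_qeqs Hrk) ?size_map ?size_iota // -/n !val_rl.
    by rewrite !Hr'.
  suff Hloop k e' : k <= rho q -> rep e' (s (rho q - k)).2 ->
    hx [:: While (qt (QNot (qeqs (regs p) (regs q)))) (sc c ++ incp p)] e' S
      (fun e' S' => S' = S /\ rep e' (s (rho q)).2).
    by apply: (Hloop (rho q)) => //; rewrite subnn.
  elim: k e' => [|k IHk] e' Hk Hr'.
    rewrite subn0 in Hr'; case: (Hs (rho q)) => // E1 E2 E3.
    apply: hx_while_false; last by apply: hx_nil; split.
    by rewrite (Hh _ _ Hr') E2 E3 eqxx.
  set j := rho q - k.+1 in Hr'; have Ej : rho q - k = j.+1 by rewrite /j; lia.
  have jq : j < rho q by rewrite /j; lia.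
  case: (Hs j (ltnW jq)) => E1 E2 E3.
  apply: (hx_while_true (Q := fun e' S' => S' = S /\ rep e' (s j.+1).2)).
  + by rewrite (Hh _ _ Hr') E2 E3; apply/eqP; lia.
  + apply: hx_cat (IH e' _ Hw Ha Hoc _ Hr') _ => [|e2 S2 [-> H3]]; first by lia.
    apply: hx_weaken (hx_incp e2 S pP) _ => e3 S3 [-> H4 H5]; split=> //.
    rewrite /s iterS -/(s j) /f /inc [s j]surjective_pairing E1 /= run_noapp //=.
    by apply: (rep_out H3 H4); rewrite H5 H3.
  + by move=> e2 S2 [-> H3]; apply: IHk; [lia|rewrite Ej].
Qed.

End Semantics.

Definition asb (X : Prop) : bool := if excluded_middle_informative X then true else false.

Lemma asbP X : asb X <-> X.
Proof. by rewrite /asb; case: excluded_middle_informative. Qed.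

(** Counters stay below the capacity, so the certificate is read only there; an array supplies
    exactly these positions. *)
Lemma run_extC I O C C' c s : noapp c -> 1 < s.1 -> (forall j, s.2 j < s.1) ->
  (forall x, x < s.1 -> C x = C' x) -> run I O C c s = run I O C' c s.
Proof.
move=> + N1 + HC; elim: c s N1 HC => //= [r p|c1 IH1 c2 IH2|p q c IH] s N1 HC.
- by move=> _ Hs; rewrite HC.
- case/andP => a1 a2 Hs; rewrite -IH1 //.
  have [L1 L2] := @run_lt I O C c1 s N1 Hs.
  by apply: IH2; rewrite // run_noapp.
- move=> Ha Hs; have Hq := Hs q; elim: (s.2 q) => //= k IHk.
  rewrite -IHk; congr inc; set s' := iter _ _ _.
  suff [E L] : s'.1 = s.1 /\ forall j, s'.2 j < s'.1 by apply: IH; rewrite // E.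
  rewrite /s'; elim: k {IHk s'} => [|k [E L]] /=.
    by split=> // j; rewrite /upd; case: eqP => // _; lia.
  set s' := iter _ _ _ in E L *.
  have N1' : 1 < s'.1 by rewrite E.
  have [L1 L2] := @run_lt I O C c s' N1' L.
  rewrite run_noapp //= E; split=> // j; rewrite /upd; case: eqP => _; first by lia.
  by have := L2 j; rewrite run_noapp // E.
Qed.

(** * Guessing the certificate in an array *)

Section GuessPhase.
Variables (sigma : signature) (test : Type) (qt : qf sigma -> test) (ot : test).
Variables (K P : nat) (g : var).
Hypothesis K0 : 0 < K.
Local Notation names := (names K).
Local Notation regs := (regs sigma K).

(** The guessed value of [g] decides whether the cell becomes [max] or keeps its initial 0, so an
    arbitrary certificate arises from writing [max] only. Resetting [g] makes the loop a
    conditional. *)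
Definition gcell p : seq (instr sigma test) :=
  [:: Guess _ _ g; While (qt (QEq (Var g) Max))
        [:: @AWrite sigma test (0, K) (regtup sigma K p) Max; Assign _ g Zero]].

Definition gphase p :=
  setz sigma test K p ++ gcell p ++
  [:: While (qt (QNot (qms (regs p)))) (incp qt K P p ++ gcell p)].

Section WF.
Variables (wft : seq var -> test -> bool) (omt : test -> bool) (io W : seq var) (fr : nat).
Hypotheses (HW : forall x, x < P.+1 * K -> x \in W) (gW : g \in W).
Hypotheses (Hio : forall x, x < P.+1 * K -> x %/ K != fr -> x \in io) (gio : g \in io).
Hypotheses (frP : fr != P)
  (wfqt : forall f, wf_qf W f -> wft W (qt f)) (omqt : forall f, omt (qt f)).

Lemma wf_gcell p : p < P ->
  all (@wf_instr sigma test wft io W) (gcell p) && all (@onlymax_instr sigma test omt) (gcell p).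
Proof.
move=> pP; rewrite /gcell /= gio !omqt wfqt /= ?gW //.
have := wf_regs sigma K0 HW (ltnW pP); rewrite -tval_regtup /= => ->.
by [].
Qed.

Lemma wf_gphase p : p < P -> p != fr ->
  all (@wf_instr sigma test wft io W) (gphase p) && all (@onlymax_instr sigma test omt) (gphase p).
Proof.
move=> pP pf; have /andP[H1 H2] := wf_gcell pP.
have /andP[H3 H4] := wf_setz sigma K0 wft omt W Hio (ltnW pP) pf.
have /andP[H5 H6] := wf_incp K0 HW Hio frP wfqt omqt pP pf.
rewrite /gphase !all_cat H1 H2 H3 H4 /=; move: (incp _ _ _ _) (gcell p) H1 H2 H5 H6 => i1 i2 H1 H2 H5 H6.
rewrite !all_cat H1 H2 H5 H6 omqt /= wfqt //= wf_qms.
by rewrite (wf_regs sigma K0 HW) // ltnW.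
Qed.

End WF.

Variables (A : structure sigma) (b : builtins A) (rk : A -> nat).
Hypothesis Hrk : ranking b rk.
Variables (holdsT : test -> env A -> Prop) (W : seq var).
Hypotheses (HW : forall x, x < P.+1 * K -> x \in W) (gW : g \in W) (gP : P.+1 * K <= g).
Hypothesis Hqt : forall f e, wf_qf W f -> (holdsT (qt f) e <-> qf_holds b f e).
Let n := #|A|.
Let N := n ^ K.
Local Notation val := (regval rk K).
Local Notation rep := (rep rk K P).
Local Notation exec := (exec b holdsT).
Local Notation certS := (certS b rk K).

Lemma exec_while_inv (J : env A -> Prop) t q e S e' S' :
  (forall e1 S1 e2 S2, J e1 -> exec q e1 S1 e2 S2 -> J e2) -> J e ->
  exec [:: While t q] e S e' S' -> J e' /\ ~ holdsT t e'.
Proof.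
move=> HJ; move E: [:: While t q] => p Je H; elim: H E Je => {p e S e' S'} //.
- move=> t' q' p e S e1 S1 e' S' Ht H1 _ H2 IH [Et Eq Ep] Je.
  apply: IH; first by rewrite Et Eq Ep.
  by apply: HJ Je _; rewrite Eq; apply: H1.
- move=> t' q' p e S e' S' Ht H1 _ [Et Eq Ep] Je; rewrite Et.
  by move: H1; rewrite -Ep => /exec_inv [-> _].
Qed.

Lemma g_notin q : q <= P -> g \notin names q.
Proof. by move=> qP; apply/negP => /(names_lt K0 qP); lia. Qed.

Lemma gcell_out p e S e' S' : exec (gcell p) e S e' S' -> out [:: g] e e'.
Proof.
rewrite /gcell => /exec_inv [a] H.
have J1 : out [:: g] e (set_var e g a).
  by move=> z; rewrite inE /set_var => /negbTE ->.
have [] // := exec_while_inv (J := out [:: g] e) _ J1 H.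
move=> e1 S1 e2 S2 H1 /exec_inv /exec_inv /exec_inv [-> _] z zg.
by rewrite -H1 // /set_var; move: zg; rewrite inE => /negbTE ->.
Qed.

Lemma certS_set S e p x : 
  certS (set_arr S (0, K) [seq e z | z <- names p] (bmax b)) x = (x == val e p) || certS S x.
Proof.
have Ht (t : K.-tuple A) : (tval t == [seq e z | z <- names p]) = (lexv n (map rk t) == val e p).
  apply/eqP/eqP => [->|E]; first by rewrite /regval -map_comp.
  apply: (inj_map (rk_inj Hrk)); apply: (@lexv_inj n).
  - by rewrite !size_map size_tuple size_iota.
  - by rewrite all_map; apply/allP => y _; apply: rk_lt Hrk _.
  - by rewrite !all_map; apply/allP => y _; apply: rk_lt Hrk _.
  - by rewrite E /regval -map_comp.
apply/existsP/orP => [[t /andP[/eqP <-]]|[/eqP Ex|/existsP [t /andP[/eqP Ex Et]]]].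
- rewrite /set_arr eqxx /= Ht; case: ifP => [Hv _|_ Hm]; [by left|right].
  by apply/existsP; exists t; rewrite Hm eqxx.
- exists (map_tuple (fun j => e (p * K + j)) (iota_tuple K 0)).
  rewrite /set_arr eqxx /= Ht /= Ex; have -> : lexv n (map rk [seq e (p * K + j) | j <- iota 0 K]) = val e p.
    by rewrite /regval -!map_comp.
  by rewrite /n eqxx /= eqxx.
- exists t; rewrite /set_arr eqxx /= Ex eqxx /=; case: ifP => // _; exact: eqxx.
Qed.

Lemma zero_max : bzero b <> bmax b.
Proof.
move=> E; have := rk_zero Hrk; rewrite E; have := rk_max Hrk.
by have := dom_gt1 A; lia.
Qed.

Lemma gcell_complete p e S (v : bool) : p < P ->
  exists e' S', [/\ exec (gcell p) e S e' S', out [:: g] e e' &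
    forall x, certS S' x = v && (x == val e p) || certS S x].
Proof.
move=> pP.
have Wq : wf_qf W (QEq (@Var sigma g) Max) by rewrite /= gW.
case: v.
  pose e1 := set_var e g (bmax b).
  have E1 : [seq e1 z | z <- names p] = [seq e z | z <- names p].
    apply/eq_in_map => z zp; rewrite /e1 /set_var; case: eqP => // Ez.
    by move: zp; rewrite Ez (negbTE (g_notin (ltnW pP))).
  exists (set_var e1 g (bzero b)), (set_arr S (0, K) [seq e1 z | z <- names p] (bmax b)); split.
  - apply: (exec_guess (a := bmax b)); rewrite -/e1.
    apply: exec_while_true.
    + by apply/Hqt => //; rewrite /= /e1 /set_var eqxx.
    + apply: exec_write; apply: exec_assign; exact: exec_nil.
    + apply: exec_while_false; last first.
        rewrite (_ : [seq e1 z | z <- names p] = map (eval b e1) (regtup sigma K p)); first exact: exec_nil.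
        by have := tval_regtup sigma K p; rewrite /regs /= => ->; rewrite -[in RHS]map_comp.
      move/Hqt => /(_ Wq); rewrite /= /set_var eqxx => /eqP; exact: zero_max.
  - by move=> z; rewrite inE /e1 /set_var => /negbTE ->.
  - by move=> x; rewrite E1 certS_set.
exists (set_var e g (bzero b)), S; split.
- apply: (exec_guess (a := bzero b)); apply: exec_while_false; last exact: exec_nil.
  move/Hqt => /(_ Wq); rewrite /= /set_var eqxx => /eqP; exact: zero_max.
- by move=> z; rewrite inE /set_var => /negbTE ->.
- by [].
Qed.

Lemma val_outg e e' q : q <= P -> out [:: g] e e' -> val e' q = val e q.
Proof.
move=> qP H; apply: val_out H _ => x xq; rewrite inE; apply/eqP => E.
by move: xq; rewrite E (negbTE (g_notin qP)).
Qed.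

Lemma rep_outg e e' rho : rep e rho -> out [:: g] e e' -> rep e' rho.
Proof. by move=> Hr Ho p pP; rewrite (val_outg (ltnW pP) Ho) Hr. Qed.

Lemma wf_full p : p < P -> wf_qf W (QNot (qms (regs p))).
Proof. by move=> pP; rewrite /= wf_qms (wf_regs sigma K0 HW) // ltnW. Qed.

Lemma holds_full p e : p < P -> (holdsT (qt (QNot (qms (regs p)))) e <-> val e p <> N.-1).
Proof.
move=> pP; rewrite Hqt; last exact: wf_full.
rewrite /= (holds_qms Hrk) -/n val_rl /regs !size_map size_iota -/N.
have N0 : 0 < N by rewrite expn_gt0 /n; have := dom_gt1 A; lia.
by split=> [/eqP|]; [lia|move=> ?; apply/eqP; lia].
Qed.

(** Any resulting array is a legitimate certificate, so it is enough to track the registers; control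
    over the array contents is the matter of [gphase_complete]. *)
Lemma gphase_sound p e S e' S' rho : p < P -> rep e rho -> exec (gphase p) e S e' S' ->
  rep e' (upd rho p N.-1).
Proof.
move=> pP Hr /exec_cat_inv [e1 [S1 [H1 /exec_cat_inv [e2 [S2 [H2 H3]]]]]].
have [_ Hz] := hx_setz Hrk holdsT K p e S; have [_ O1 V1] := Hz _ _ H1.
pose J e1 := exists v, rep e1 (upd rho p v).
have J2 : J e2.
  exists 0; apply: rep_outg (gcell_out H2).
  apply: (rep_out K0 Hr _ V1) => z; rewrite mem_cat negb_or => /andP[z1 _]; exact: O1.
have [|[v Jv] Hf] := exec_while_inv (J := J) _ J2 H3.
  move=> f1 T1 f2 T2 [v Jv] /exec_cat_inv [f3 [T3 [H4 H5]]].
  have [_ Hi] := hx_incp Hrk K0 HW gW gP Hqt f1 T1 pP.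
  have [_ O2 V2] := Hi _ _ H4.
  eexists; apply: rep_outg (gcell_out H5).
  have := rep_out K0 Jv O2 V2; congr (rep f3 _).
  by apply: functional_extensionality => z; rewrite /upd; case: eqP.
have : val e' p = N.-1 by apply: NNPP => H; apply: Hf; apply/holds_full.
by rewrite Jv // upd_same => <-.
Qed.

Lemma gphase_complete p e S rho (C : nat -> bool) : p < P -> rep e rho ->
  (forall x, certS S x = false) ->
  exists e' S', [/\ exec (gphase p) e S e' S', rep e' (upd rho p N.-1) &
    forall x, x < N -> certS S' x = C x].
Proof.
move=> pP Hr HS.
have N0 : 0 < N by rewrite expn_gt0 /n; have := dom_gt1 A; lia.
have [[e1 [S1 [H1 [ES O1 V1]]]] _] := hx_setz Hrk holdsT K p e S.
have R1 : rep e1 (upd rho p 0).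
  apply: (rep_out K0 Hr _ V1) => z; rewrite mem_cat negb_or => /andP[z1 _]; exact: O1.
have [e2 [S2 [H2 O2 V2]]] := gcell_complete e1 S1 (C 0) pP.
have R2 := rep_outg R1 O2.
(* Induction on the number [k] of cells still to be treated; those up to position [N.-1 - k] already
   agree with [C]. *)
suff Hl k f T : k < N -> rep f (upd rho p (N.-1 - k)) ->
   (forall x, certS T x = (x <= N.-1 - k) && C x) ->
   exists e' S', [/\ exec [:: While (qt (QNot (qms (regs p)))) (incp qt K P p ++ gcell p)] f T e' S',
     rep e' (upd rho p N.-1) & forall x, x < N -> certS S' x = C x].
  have [||e' [S' [H3 R3 C3]]] := Hl N.-1 e2 S2 ltac:(lia).
  - by rewrite subnn.
  - move=> x; rewrite V2 V1 ES HS orbF subnn leqn0 andbC; by case: eqP => // ->.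
  exists e', S'; split=> //; apply: exec_cat H1 _; exact: exec_cat H2 H3.
elim: k f T => [|k IH] f T kN Rf HT.
  rewrite subn0 in Rf HT; exists f, T; split=> //.
    apply: exec_while_false; last exact: exec_nil.
    by rewrite holds_full // Rf // upd_same.
  by move=> x xN; rewrite HT; have -> : x <= N.-1 by lia.
set v := N.-1 - k.+1 in Rf HT.
have Ev : N.-1 - k = v.+1 by rewrite /v; lia.
have [[f1 [T1 [H3 [ET O3 V3]]]] _] := hx_incp Hrk K0 HW gW gP Hqt f T pP.
have Vf1 : val f1 p = v.+1.
  by rewrite V3 Rf // upd_same -/n -/N; rewrite /v; lia.
have [f2 [T2 [H4 O4 V4]]] := gcell_complete f1 T1 (C v.+1) pP.
case: (IH f2 T2) => [||x|e' [S' [H5 R5 C5]]].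
- by lia.
- rewrite Ev; apply: rep_outg O4.
  have := rep_out K0 Rf O3 Vf1; congr (rep f1 _).
  by apply: functional_extensionality => z; rewrite /upd; case: eqP.
- rewrite V4 Vf1 ET HT Ev; case: (ltngtP x v.+1) => [H|H|->] /=.
  + by rewrite andbF -ltnS H.
  + by rewrite andbF /= leqNgt (ltnW H).
  + by rewrite andbT ltnn orbF.
- exists e', S'; split=> //; apply: exec_while_true H5.
    by rewrite holds_full // Rf // upd_same /v; lia.
  exact: exec_cat H3 H4.
Qed.

End GuessPhase.

Lemma writes_maxreg c j : j \in writes c -> j <= maxreg c.
Proof.
elim: c j => [p|p|r p q|r p|r i ps|r p|c1 IH1 c2 IH2|p q c IH|] j //=;
  rewrite ?(mem_cat, inE).
- by move/eqP ->.
- by move/eqP ->.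
- by move/eqP ->; rewrite leq_maxl.
- by move/eqP ->; rewrite leq_maxl.
- by move/eqP ->; rewrite leq_maxl.
- by move/eqP ->; rewrite leq_maxl.
- by move=> /orP[/IH1|/IH2] H; rewrite leq_max H ?orbT.
- by move=> /orP[/eqP->|/IH H]; rewrite !leq_max ?leqnn // H orbT.
Qed.

Lemma orcreg_cpow o k r : orcreg o (cpow k r).
Proof. by elim: k r => //= k IH r; rewrite IH. Qed.

Lemma orcreg_cterm kb o vm t r : orcreg o (cterm kb vm t r).
Proof.
elim: t r => //= [n r|t IHt u IHu r|t IHt u IHu r|t IHt r]; rewrite ?IHt ?IHu //.
  by elim: n => //= n ->.
by rewrite orcreg_cpow.
Qed.

Lemma orcreg_cfm kb o vm f r : orcreg o (cfm kb o vm f r).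
Proof.
elim: f vm r => [t u|i ts|t|f IHf g IHg|f IHf|t f IHf] vm r /=;
  rewrite ?orcreg_cterm ?IHf ?IHg ?eqxx //.
by rewrite andbT; elim: ts r.+1 => //= t ts IH r'; rewrite orcreg_cterm IH.
Qed.

(** * The complete scheme for an existential second-order formula *)

Section Program.
Variables (sigma : signature) (test : Type) (qt : qf sigma -> test) (ot : test).
(* Register [y] holds the argument and [o] is used for oracle queries; [fr] is
   the register read from the environment, if any. *)
Variables (kb : nat) (f : fm) (K P : nat) (g : var) (guard : option var) (y o fr : nat).
Hypotheses (K0 : 0 < K) (P3 : 3 < P) (gP : P.+1 * K <= g).
Hypotheses (yo : y != o) (y0 : 0 < y) (o0 : 0 < o) (y3 : y < 3) (o3 : o < 3).
Hypothesis Hfr : fr = y \/ P < fr.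

Definition evalc : cmd := cfm kb o (fun=> y) f 3.
Hypothesis HP : maxreg evalc < P.

Definition ios : seq var := [seq x <- iota 0 (P.+1 * K) | x %/ K != fr] ++ [:: g].

(** The guard diverges unless its variable is 0, which lets a test fail when it is evaluated again
    after an oracle call. [Max] in the last digit gives register 0 the value n - 1, the base.
    Register 3 is the index while the certificate is guessed and afterwards receives the truth
    value; the final assignments meet the acceptance condition. *)
Definition mkbody : seq (instr sigma test) :=
    (if guard is Some z then [:: While (qt (QNot (QEq (Var z) Zero))) [::]] else [::]) ++
    [:: Assign _ (0 * K + K.-1) Max] ++ gphase qt K P g 3 ++ sc qt ot K P g evalc ++
    [:: While (qt (qzs (regs sigma K 3))) [::]] ++ assigns test ios (nseq (size ios) Max).

Definition mkprog : prog sigma test := Prog ios mkbody.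

Lemma mem_ios x : (x \in ios) = (x < P.+1 * K) && (x %/ K != fr) || (x == g).
Proof. by rewrite mem_cat mem_filter mem_iota inE /= add0n [X in X || _]andbC. Qed.

Lemma uniq_ios : uniq ios.
Proof.
rewrite cat_uniq filter_uniq ?iota_uniq //= orbF andbT mem_filter mem_iota add0n /=.
by rewrite (ltnNge g) gP andbF.
Qed.

Lemma ios_size : ios != [::].
Proof. by rewrite /ios; case: [seq _ <- _ | _]. Qed.

Lemma fr_notin : [/\ fr \notin writes evalc, 3 != fr, P != fr & 0 != fr].
Proof.
split; try by case: Hfr => E; lia.
apply/negP => Hw; case: Hfr => E; last by have := writes_maxreg Hw; lia.
by move: Hw => /writes_cfm [|Eo]; [lia|move: yo; rewrite -Eo E eqxx].
Qed.

Lemma wfc_evalc : wfc evalc && noapp evalc.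
Proof. exact: wfc_cfm. Qed.

Section WF.
Variables (wft : seq var -> test -> bool) (omt : test -> bool) (F : seq var).
Let W := ios ++ F.
Hypotheses (HW : forall x, x < P.+1 * K -> x \in W)
  (Hz : forall z, guard = Some z -> z \in W)
  (wfqt : forall f, wf_qf W f -> wft W (qt f)) (wfot : wft W ot)
  (omqt : forall f, omt (qt f)) (omot : omt ot).

Lemma wf_mkprog : wf_prog wft F mkprog && onlymax_prog omt mkprog.
Proof.
have [f1 f2 f3 f4] := fr_notin.
have Hio x : x < P.+1 * K -> x %/ K != fr -> x \in ios by rewrite mem_ios => -> ->.
have gio : g \in ios by rewrite mem_ios eqxx orbT.
have gW : g \in W by rewrite mem_cat gio.
have frP : fr != P by rewrite eq_sym.
have /andP[A1 A2] := wf_gphase K0 HW gW Hio gio frP wfqt omqt P3 f2.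
have /andP[B1 B2] := wf_sc K0 HW gW Hio gio frP wfqt wfot omqt omot HP f1.
have io0 : 0 * K + K.-1 \in ios.
  apply: Hio; first exact: (reg_lt K0 (leq0n P) (ltac:(lia) : K.-1 < K)).
  by rewrite mul0n add0n divn_small //; lia.
rewrite /wf_prog /onlymax_prog -[inputs mkprog]/ios -[body mkprog]/mkbody ios_size uniq_ios -/W /mkbody.
move: (gphase _ _ _ _ _) (sc _ _ _ _ _ _) A1 A2 B1 B2 => i1 i2 A1 A2 B1 B2.
rewrite !all_cat A1 A2 B1 B2 om_assigns wf_assigns //; last by elim: (size ios).
have Hg : all (@wf_instr sigma test wft ios W)
    (if guard is Some z then [:: While (qt (QNot (QEq (Var z) Zero))) [::]] else [::]) &&
  all (@onlymax_instr sigma test omt)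
    (if guard is Some z then [:: While (qt (QNot (QEq (Var z) Zero))) [::]] else [::]).
  case E: guard => [z|//] /=; rewrite omqt wfqt //= (Hz E) //.
case/andP: Hg => -> ->; rewrite [all _ [:: Assign _ _ _]]/= io0.
rewrite [all _ [:: While _ _]]/= wfqt; last by rewrite wf_qzs (wf_regs sigma K0 HW) // ltnW.
by rewrite /= omqt.
Qed.

End WF.

Section Sem.
Variables (A : structure sigma) (b : builtins A) (rk : A -> nat).
Hypothesis Hrk : ranking b rk.
Variables (holdsT : test -> env A -> Prop) (W : seq var) (OR : nat -> bool).
Hypotheses (HW : forall x, x < P.+1 * K -> x \in W) (gW : g \in W)
  (Hz : forall z, guard = Some z -> z \in W /\ z \notin ios).
Hypothesis Hqt : forall f e, wf_qf W f -> (holdsT (qt f) e <-> qf_holds b f e).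
Hypothesis Hot : forall e, holdsT ot e <-> e g = bzero b /\ OR (regval rk K e o).
Let n := #|A|.
Let N := n ^ K.
Local Notation val := (regval rk K).
Local Notation rep := (rep rk K P).
Local Notation exec := (exec b holdsT).
Local Notation certS := (certS b rk K).

Definition init_env (e : env A) : env A := fun x => if x \in ios then bzero b else e x.

Definition rho0 (v : nat) (j : nat) : nat := if j == 0 then n.-1 else if j == y then v else 0.
Definition rho1 (v : nat) := upd (rho0 v) 3 N.-1.

Definition accrun (v : nat) : Prop :=
  exists C, (run (struct_inp rk) OR C evalc (N, rho1 v)).2 3 != 0.

Lemma val_zero e p : {in names K p, forall x, e x = bzero b} -> val e p = 0.
Proof.
move=> H; rewrite /regval (_ : map _ _ = nseq K 0) ?lexv_nseq0 //.
rewrite -{2}(size_names K p); elim: (names K p) H => //= x s IH H.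
rewrite H ?inE ?eqxx // (rk_zero Hrk) IH // => z zs; apply: H; by rewrite inE zs orbT.
Qed.

Lemma val_init e p : p <= P -> p != fr -> val (init_env e) p = 0.
Proof.
move=> pP pf; apply: val_zero => x xp; rewrite /init_env mem_ios.
rewrite (names_lt K0 pP xp) /=; move: xp; rewrite mem_names // => /eqP ->.
by rewrite pf.
Qed.

Lemma rep_init e : rep (set_var (init_env e) (0 * K + K.-1) (bmax b)) (rho0 (val (init_env e) y)).
Proof.
have [f1 f2 f3 f4] := fr_notin.
move=> p pP; rewrite /rho0; case: eqP => [->|/eqP p0].
  rewrite /regval (names_rcons K0) map_rcons lexv_rcons /set_var eqxx.
  rewrite (_ : map _ _ = nseq K.-1 0) ?lexv_nseq0.
    by have := rk_max Hrk; rewrite -/n; lia.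
  rewrite -[in RHS](size_iota 0 K.-1) -map_comp; apply: (@eq_from_nth _ 0).
    by rewrite size_map size_nseq.
  move=> i; rewrite size_map size_iota => iK; rewrite (nth_map 0) ?size_iota //= nth_nseq ?size_iota iK.
  rewrite nth_iota // add0n; case: eqP => [E|_]; first by lia.
  rewrite /init_env mem_ios (_ : i %/ K = 0) ?f4; last by rewrite divn_small //; lia.
  by rewrite (reg_lt K0 (leq0n P) (ltac:(lia) : i < K)) /= (rk_zero Hrk).
have -> : val (set_var (init_env e) (0 * K + K.-1) (bmax b)) p = val (init_env e) p.
  apply: val_ext => x; rewrite mem_names // /set_var => /eqP Ex; case: eqP => // E.
  by move: p0; rewrite -Ex E mul0n add0n divn_small //; lia.
case: eqP => [->//|py]; apply: val_init; first exact: ltnW.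
by apply/eqP => E; case: Hfr => E'; [apply: py; rewrite E|lia].
Qed.

Lemma N_pos : 1 < N.
Proof. by rewrite -(exp1n K) ltn_exp2r // dom_gt1. Qed.

Lemma rho1_lt e j : rho1 (val (init_env e) y) j < N.
Proof.
have N1 := N_pos; rewrite /rho1 /upd /rho0; case: eqP => _; first by lia.
case: eqP => _; last by case: eqP => _; [exact: (val_lt Hrk K0 gW gP)|lia].
have n1 : 1 < n := dom_gt1 A.
apply: (@leq_trans n); first by lia.
by rewrite -{1}(expn1 n) leq_exp2l.
Qed.

(** Every run produces some certificate, and every certificate is produced by some run as far as
    positions below the capacity are concerned, which suffices by [run_extC]. *)
Theorem mkprog_accepts e : prog_accepts b holdsT mkprog e <->
  (forall z, guard = Some z -> e z = bzero b) /\ accrun (val (init_env e) y).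
Proof.
have /andP[Hwf Hna] := wfc_evalc.
have Hor := orcreg_cfm kb o (fun=> y) f 3.
have Wq : wf_qf W (qzs (regs sigma K 3)) by rewrite wf_qzs (wf_regs sigma K0 HW) // ltnW.
have Hh e1 : holdsT (qt (qzs (regs sigma K 3))) e1 <-> val e1 3 = 0.
  rewrite Hqt // (holds_qzs Hrk) (val_rl b); by split=> [/eqP|->].
have N1 := N_pos.
set v := val (init_env e) y.
have Hr0 := rep_init e; rewrite -/v in Hr0.
have Hg e1 z : guard = Some z -> (~ holdsT (qt (QNot (QEq (Var z) Zero))) e1 <-> e1 z = bzero b).
  move=> E; have [zW _] := Hz E; rewrite Hqt /= ?zW //.
  by split=> [/negP|->]; [rewrite negbK => /eqP|rewrite eqxx].
split.
  case=> e' [S' [+ _]]; rewrite -[body mkprog]/mkbody -[inputs mkprog]/ios -/(init_env e) /mkbody => /exec_cat_inv [e1 [S1 [H1]]].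
  have [Eg E1 ES1] : [/\ forall z, guard = Some z -> e z = bzero b, e1 = init_env e & S1 = fun _ _ => bzero b].
    case Eg: guard H1 => [z|] /=; last by move/exec_inv => [-> ->].
    move=> H1; have [Hh1 H1'] := exec_loop H1; have [-> ->] := exec_inv H1'.
    split=> // z' [<-].
    have [zW zio] := Hz Eg.
    by have := proj1 (Hg _ _ Eg) Hh1; rewrite /init_env (negbTE zio).
  move=> H2; split=> //; rewrite E1 ES1 in H2.
  have := exec_inv H2 => /exec_cat_inv [e2 [S2 [H3 /exec_cat_inv [e3 [S3 [H4 H5']]]]]].
  have [H5 _] := exec_loop H5'.
  have R2 := gphase_sound K0 Hrk HW gW gP Hqt P3 Hr0 H3.
  have [_ Hsc] := hx_sc Hrk K0 HW gW gP Hqt Hot S2 Hwf Hna Hor HP R2.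
  have [_ R3] := Hsc _ _ H4.
  exists (certS S2); apply/eqP => Ez; apply: H5; apply/Hh.
  by rewrite R3.
case=> Eg [C HC].
pose S0 : store A := fun _ _ => bzero b.
have HS0 x : certS S0 x = false.
  apply/existsP => -[t /andP[_ /eqP E]].
  exact: (zero_max K0 Hrk gW gP E).
have [e2 [S2 [H3 R2 C2]]] := gphase_complete K0 Hrk HW gW gP Hqt C P3 Hr0 HS0.
have [[e3 [S3 [H4 [_ R3]]]] _] := hx_sc Hrk K0 HW gW gP Hqt Hot S2 Hwf Hna Hor HP R2.
have Erun : run (struct_inp rk) OR (certS S2) evalc (N, rho1 v) =
            run (struct_inp rk) OR C evalc (N, rho1 v).
  by apply: run_extC => // j; apply: rho1_lt.
have V3 : val e3 3 <> 0.
  rewrite R3 // Erun; exact/eqP.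
have [||| [e4 [S4 [H5 [_ [_ H6]]]]] _] := hx_assigns b holdsT e3 S3 (xs := ios) (ts := nseq (size ios) Max).
- by rewrite size_nseq.
- exact: uniq_ios.
- by rewrite all_nseq orbT.
exists e4, S4; split.
  rewrite -[body mkprog]/mkbody -[inputs mkprog]/ios -/(init_env e) /mkbody; apply: (@exec_cat _ _ _ _ _ _ _ _ _ (init_env e) S0).
    case E: guard => [z|]; last exact: exec_nil.
    apply: exec_while_false; last exact: exec_nil.
    apply/(Hg _ _ E); have [_ zio] := Hz E.
    by rewrite /init_env (negbTE zio) Eg.
  apply: exec_assign; apply: exec_cat H3 _; apply: exec_cat H4 _.
  by apply: exec_while_false H5; rewrite Hh.
move=> x xio.
have : e4 x \in [seq e4 z | z <- ios] by apply: map_f.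
by rewrite H6 map_nseq /= => /nseqP [].
Qed.

(* Correctness of the evaluated formula, for arguments below the capacity. *)
Lemma accrunE d v : v < n ^ d -> fdeg kb d f <= K -> v < N ->
  accrun v <-> exists F, (forall x, F x <= n ^ kb) /\
    holds (Ctx n.-1 (struct_inp rk) OR F) (fun=> v) f.
Proof.
move=> vd dK vN; have N1 := N_pos; have n1 : 1 < n := dom_gt1 A.
have En : n.-1.+1 = n by lia.
have b0 : 0 < n.-1 by lia.
have nN : n <= N by rewrite -{1}(expn1 n) leq_exp2l.
have Hok : okenv o N n.-1 (rho1 v) 3 (fun=> y) (fun=> v) d.
  split=> //.
    by move=> j; rewrite /rho1 /upd /rho0; case: eqP => _; [lia|case: eqP => _; [lia|case: eqP => _; lia]].
  move=> i; split=> //; last by rewrite En.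
  rewrite /rho1 /upd /rho0 (gtn_eqF y0) (ltn_eqF y3) eqxx //.
have HN : n.-1.+1 ^ fdeg kb d f <= N by rewrite En leq_exp2l.
have HC C : (run (struct_inp rk) OR C evalc (N, rho1 v)).2 3 =
   holds (Ctx n.-1 (struct_inp rk) OR (decode kb C n.-1)) (fun=> v) f.
  by have [e' [-> /= -> _ _]] := @computes_cfm kb o (struct_inp rk) OR C N n.-1 b0 N1 o0 f _ _ _ _ _ Hok HN.
split.
  case=> C; rewrite HC => Hh; exists (decode kb C n.-1); split.
    by move=> x; rewrite -{2}En; apply: decode_le.
  by case: (holds _ _ _) Hh.
case=> F [HF Hh]; have [|C EC] := @decode_surj kb n.-1 F; first by rewrite En.
exists C; rewrite HC (_ : decode kb C n.-1 = F) ?Hh //.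
exact: functional_extensionality.
Qed.

End Sem.
End Program.

Section OrcExt.
Variables (kb b : nat) (I : nat -> seq nat -> bool) (O O' : nat -> bool) (F : nat -> nat) (D : nat).
Hypotheses (b0 : 0 < b) (HF : forall x, F x <= b.+1 ^ kb)
  (HO : forall x, x < b.+1 ^ D -> O x = O' x).

Lemma teval_bound rho d t : (forall i, rho i < b.+1 ^ d) ->
  teval (Ctx b I O F) rho t < b.+1 ^ tdeg kb d t.
Proof.
move=> Hr; have [C HC] := decode_surj HF.
have -> : F = decode kb C b by apply: functional_extensionality.
exact: (@teval_deg kb 1 I O C 2 b b0).
Qed.

Lemma teval_orc rho t : teval (Ctx b I O F) rho t = teval (Ctx b I O' F) rho t.
Proof. by elim: t => //= [t -> u ->|t -> u ->|t ->]. Qed.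

(** The degree of a formula bounds the arguments of its oracle atoms. Two oracles need to be
    compared only there, because a scheme passes arguments in a register of bounded capacity. *)
Lemma holds_orc_ext f rho d : (forall i, rho i < b.+1 ^ d) -> fdeg kb d f <= D ->
  holds (Ctx b I O F) rho f = holds (Ctx b I O' F) rho f.
Proof.
elim: f rho d => [t u|i ts|t|f IHf g IHg|f IHf|t f IHf] rho d Hr /= HD.
- by rewrite !teval_orc.
- by congr I; apply: eq_map => t; apply: teval_orc.
- rewrite -teval_orc; apply: HO; apply: leq_trans (teval_bound t Hr) _.
  by rewrite leq_exp2l.
- by rewrite (IHf rho d) ?(IHg rho d) //; lia.
- by rewrite (IHf rho d).
- rewrite -teval_orc; apply: eq_in_has => x; rewrite mem_iota add0n => /= xt.
  apply: (IHf _ (maxn d (tdeg kb d t))); last by lia.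
  have H d' y : y < b.+1 ^ d' -> d' <= maxn d (tdeg kb d t) -> y < b.+1 ^ maxn d (tdeg kb d t).
    by move=> Hy Hd; apply: leq_trans Hy _; rewrite leq_exp2l.
  case=> [|i] /=; last by apply: (H d); rewrite ?Hr ?leq_maxl.
  by apply: (H (tdeg kb d t)); rewrite ?leq_maxr //; apply: ltn_trans xt (teval_bound t Hr).
Qed.
End OrcExt.

(** * From existential second-order formulas to schemes *)

Section Theorems.
Variable sigma : signature.

Definition eso_struct (kb : nat) (f : fm) (A : structure sigma) (rk : A -> nat)
    (OR : nat -> bool) (v : nat) : Prop :=
  exists F, (forall x, F x <= #|A| ^ kb) /\
    holds (Ctx #|A|.-1 (struct_inp rk) OR F) (fun=> v) f.

Theorem scheme1_of_eso kb f : exists r : odd_scheme sigma 0,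
  [/\ wf_odd [::] r, onlymax_odd r & forall (A : structure sigma) (b : builtins A) rk e,
    ranking b rk -> (odd_accepts b r e <-> eso_struct kb f rk (fun=> false) 0)].
Proof.
(* The capacity [#|A| ^ K] suffices for the evaluation, [P] lies above all registers that it uses,
   and [P.+1 * K], the first variable after register [P], serves as the flag. As [P.+1] is no
   register, nothing is read from the environment. *)
set K := maxn 1 (fdeg kb 0 f); set P := (maxn 3 (maxreg (evalc kb f 1 2))).+1.
have K0 : 0 < K by rewrite /K; lia.
have P3 : 3 < P by rewrite /P; lia.
have HP : maxreg (evalc kb f 1 2) < P by rewrite /P; lia.
have gP : P.+1 * K <= P.+1 * K by [].
have Hfr : P.+1 = 1 \/ P < P.+1 by right.
have HW x : x < P.+1 * K -> x \in ios K P (P.+1 * K) P.+1 ++ [::].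
  by move=> xP; rewrite cats0 mem_ios xP /= ltn_eqF // ltn_divLR.
have gW : P.+1 * K \in ios K P (P.+1 * K) P.+1 ++ [::] by rewrite cats0 mem_ios eqxx orbT.
pose r : odd_scheme sigma 0 := mkprog id (qfalse sigma) kb f K P (P.+1 * K) None 1 2 P.+1.
have HWF : wf_odd [::] r && onlymax_odd r.
  exact: (@wf_mkprog sigma (qf sigma) id (qfalse sigma) kb f K P (P.+1 * K) None 1 2 P.+1 K0 P3 gP isT isT isT isT isT Hfr HP (@wf_qf sigma) (fun=> true) [::] HW (fun z E => ltac:(discriminate E)) (fun f0 H => H) isT (fun=> isT) isT).
case/andP: HWF => H1 H2; exists r; split=> // A b rk e Hrk.
have Hot (e1 : env A) : even_accepts b (m := 0) (qfalse sigma) e1 <->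
    e1 (P.+1 * K) = bzero b /\ (fun=> false) (regval rk K e1 2).
  by rewrite /= eqxx; split=> [|[]].
have Hqt (f0 : qf sigma) (e1 : env A) : wf_qf (ios K P (P.+1 * K) P.+1 ++ [::]) f0 ->
   (even_accepts b (m := 0) f0 e1 <-> qf_holds b f0 e1) by [].
have Hz z : None = Some z -> z \in ios K P (P.+1 * K) P.+1 ++ [::] /\ z \notin ios K P (P.+1 * K) P.+1 by [].
have Hacc := @mkprog_accepts sigma (qf sigma) id (qfalse sigma) kb f K P (P.+1 * K) None 1 2 P.+1
   K0 P3 gP isT isT isT isT isT Hfr HP A b rk Hrk (@even_accepts sigma A b 0) _ (fun=> false) HW gW Hz Hqt Hot e.
rewrite /odd_accepts /r Hacc (val_init _ K0 Hrk) //.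
have N0 : 0 < #|A| ^ K by rewrite expn_gt0; have := dom_gt1 A; lia.
have HE := @accrunE sigma kb f K P (P.+1 * K) 1 2 P.+1 K0 P3 gP isT isT isT isT isT Hfr HP A rk _
  (fun=> false) gW 0 0 isT (leq_maxr 1 _) N0.
rewrite HE; by split=> [[]|].
Qed.


Lemma qf_holds_ext (A : structure sigma) (b : builtins A) W f (e e' : env A) :
  wf_qf W f -> (forall x, x \in W -> e x = e' x) -> qf_holds b f e = qf_holds b f e'.
Proof.
move=> + H.
have Ht t : wf_term W t -> eval b e t = eval b e' t by case: t => //= x /H.
elim: f => [t u|i ts|t u|f IH|f IHf g IHg|f IHf g IHg] /=.
- by move=> /andP[/Ht -> /Ht ->].
- move=> Hts; congr rel_of; apply: val_inj => /=.
  by move: (tval ts) Hts; elim=> //= u s IH /andP[/Ht -> /IH ->].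
- by move=> /andP[/Ht -> /Ht ->].
- by move/IH ->.
- by move=> /andP[/IHf -> /IHg ->].
- by move=> /andP[/IHf -> /IHg ->].
Qed.

(* A quantifier-free test as a scheme of the second level. *)
Definition qf_test (v : var) (f : qf sigma) : even_scheme sigma 1 :=
  UnivScheme [::] (Prog [:: v] [:: While (QNot f) [::]; Assign _ v Max]).

Lemma qf_testP (A : structure sigma) (b : builtins A) v W f (e : env A) :
  wf_qf W f -> (forall x, x \in W -> x != v) ->
  (@even_accepts sigma A b 1 (qf_test v f) e <-> qf_holds b f e).
Proof.
move=> Wf Hv.
pose e0 (e' : env A) : env A := fun x => if x \in [:: v] then bzero b else e' x.
have E0 e' : qf_holds b f (e0 e') = qf_holds b f e'.
  apply: qf_holds_ext Wf _ => x /Hv xv; by rewrite /e0 inE (negbTE xv).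
split.
  move=> /(_ e (fun _ _ => erefl)) [e' [S' [+ _]]].
  move=> Hx; have [Hh _] := exec_loop Hx.
  by move/negP: Hh; rewrite negbK -(E0 e).
move=> Hf e' He'; have -> : e' = e by apply: functional_extensionality => x; apply: He'.
exists (set_var (e0 e) v (bmax b)), (fun _ _ => bzero b); split.
  apply: exec_while_false; last by apply: exec_assign; apply: exec_nil.
  by apply/negP; rewrite negbK; move: Hf; rewrite -(E0 e).
by move=> x; rewrite inE /set_var => ->.
Qed.

(** The oracle is itself given by a scheme of the same construction. The two schemes share register
    2: it is the query register of the outer one and the argument, made of free variables, of the
    inner one; the other registers of the inner scheme are local. Quantifier-free tests are lifted
    by [qf_test]. *)
Theorem scheme3_of_eso kb f kb' f' : exists r : odd_scheme sigma 1,
  [/\ wf_odd [::] r, onlymax_odd r & forall (A : structure sigma) (b : builtins A) rk e,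
    ranking b rk -> (odd_accepts b r e <->
      eso_struct kb f rk (fun v => asb (eso_struct kb' f' rk (fun=> false) v)) 0)].
Proof.
set d := fdeg kb 0 f.
(* Queries are numbers below [#|A| ^ d], so the inner formula is evaluated with a variable of degree
   [d]; one capacity serves both schemes. *)
set K := maxn 1 (maxn d (maxn d.+1 (fdeg kb' d f'))).
set P := (maxn 3 (maxn (maxreg (evalc kb f 1 2)) (maxreg (evalc kb' f' 2 1)))).+1.
have K0 : 0 < K by rewrite /K; lia.
have P3 : 3 < P by rewrite /P; lia.
have HPo : maxreg (evalc kb f 1 2) < P by rewrite /P; lia.
have HPi : maxreg (evalc kb' f' 2 1) < P by rewrite /P; lia.
(* Three distinct variables after the registers: the flags of the outer and the inner scheme, and
   the input-output variable of lifted tests. The guard of the inner scheme is [go], which therefore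
   must stay free there. *)
set go := P.+1 * K; set gi := P.+2 * K; set v := P.+3 * K.
have gPo : P.+1 * K <= go by [].
have gPi : P.+1 * K <= gi by rewrite /gi mulSn leq_addl.
have Hfro : P.+1 = 1 \/ P < P.+1 by right.
have Hfri : 2 = 2 \/ P < 2 by left.
pose io := ios K P go P.+1.
have HWo x : x < P.+1 * K -> x \in io ++ [::].
  by move=> xP; rewrite cats0 mem_ios xP /= ltn_eqF // ltn_divLR.
have gWo : go \in io ++ [::] by rewrite cats0 mem_ios eqxx orbT.
have Hv x : x \in io ++ [::] -> x != v.
  by rewrite cats0 mem_ios => /orP[/andP[H _]|/eqP->]; rewrite neq_ltn /v /go; nia.
pose inner : prog sigma (qf sigma) := mkprog id (qfalse sigma) kb' f' K P gi (Some go) 2 1 2.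
pose ot : even_scheme sigma 1 := UnivScheme [::] inner.
pose qt := qf_test v.
pose r : odd_scheme sigma 1 := mkprog qt ot kb f K P go None 1 2 P.+1.
pose Fi := [::] ++ (io ++ [::]).
have HWi x : x < P.+1 * K -> x \in ios K P gi 2 ++ Fi.
  by move=> xP; rewrite mem_cat [_ \in Fi]HWo // orbT.
have gWi : gi \in ios K P gi 2 ++ Fi by rewrite mem_cat mem_ios eqxx orbT.
have Hzi z : Some go = Some z -> z \in ios K P gi 2 ++ Fi.
  by case=> <-; rewrite mem_cat [_ \in Fi]gWo orbT.
have Wot : wf_prog (@wf_qf sigma) Fi inner && onlymax_prog (fun=> true) inner.
  exact: (@wf_mkprog sigma (qf sigma) id (qfalse sigma) kb' f' K P gi (Some go) 2 1 2
    K0 P3 gPi isT isT isT isT isT Hfri HPi (@wf_qf sigma) (fun=> true) Fi HWi Hzi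
    (fun f0 H => H) isT (fun=> isT) isT).
case/andP: Wot => Wot1 Wot2.
have Wqt (f0 : qf sigma) : wf_qf (io ++ [::]) f0 -> @wf_even sigma 1 (io ++ [::]) (qt f0).
  move=> W0; rewrite /= /wf_prog /= inE eqxx !andbT.
  have : wf_qf (v :: (io ++ [::])) f0.
    have Ht (t : term sigma) : wf_term (io ++ [::]) t -> wf_term (v :: (io ++ [::])) t.
      by case: t => //= x xio; rewrite inE xio orbT.
    elim: f0 W0 => [t u|i ts|t u|f1 IH|f1 IHf g1 IHg|f1 IHf g1 IHg] /=.
    - by move=> /andP[/Ht -> /Ht ->].
    - by apply: sub_all.
    - by move=> /andP[/Ht -> /Ht ->].
    - exact: IH.
    - by move=> /andP[/IHf -> /IHg ->].
    - by move=> /andP[/IHf -> /IHg ->].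
  done.
have Wr : wf_odd [::] r && onlymax_odd r.
  exact: (@wf_mkprog sigma (even_scheme sigma 1) qt ot kb f K P go None 1 2 P.+1
    K0 P3 gPo isT isT isT isT isT Hfro HPo (@wf_even sigma 1) (@onlymax_even sigma 1) [::] HWo
    (fun z E => ltac:(discriminate E)) Wqt Wot1 (fun=> isT) Wot2).
case/andP: Wr => Wr1 Wr2; exists r; split=> // A b rk e Hrk.
pose ORi w := accrun kb' f' K 2 1 rk (fun=> false) w.
have Hinner (e1 : env A) : prog_accepts b (fun f0 e0 => qf_holds b f0 e0) inner e1 <->
    e1 go = bzero b /\ ORi (regval rk K e1 2).
  have Hot (e2 : env A) : qf_holds b (qfalse sigma) e2 <->
      e2 gi = bzero b /\ (fun=> false) (regval rk K e2 1).
    by rewrite /= eqxx; split=> [|[]].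
  have Hzi2 z : Some go = Some z -> z \in ios K P gi 2 ++ Fi /\ z \notin ios K P gi 2.
    move=> E; split; first exact: Hzi.
    case: E => <-; rewrite mem_ios /go ltnn /=; apply/eqP; rewrite /gi; nia.
  have Hqt (f0 : qf sigma) (e2 : env A) : wf_qf (ios K P gi 2 ++ Fi) f0 ->
     (qf_holds b f0 e2 <-> qf_holds b f0 e2) by [].
  have Hacc := @mkprog_accepts sigma (qf sigma) id (qfalse sigma) kb' f' K P gi (Some go) 2 1 2
    K0 P3 gPi isT isT isT isT isT Hfri HPi A b rk Hrk (fun f0 e0 => qf_holds b f0 e0) _ (fun=> false) HWi gWi Hzi2 Hqt Hot e1.
  rewrite Hacc.
  have -> : regval rk K (init_env K P gi 2 b e1) 2 = regval rk K e1 2.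
    apply: val_ext => x; rewrite (mem_names K0) => /eqP Ex; rewrite /init_env mem_ios Ex eqxx andbF /=.
    case: eqP => // Eg; move: Ex; rewrite Eg /gi mulnK //; lia.
  by split=> -[H1 H2]; split=> //; [apply: H1|move=> z [<-]].
pose OR w := asb (ORi w).
have Hot (e1 : env A) : @even_accepts sigma A b 1 ot e1 <->
    e1 go = bzero b /\ OR (regval rk K e1 2).
  rewrite /OR asbP -Hinner; split=> [/(_ e1 (fun _ _ => erefl))//|H e' He'].
  by have -> : e' = e1 by apply: functional_extensionality => x; apply: He'.
have Hqt (f0 : qf sigma) (e1 : env A) : wf_qf (io ++ [::]) f0 ->
    (@even_accepts sigma A b 1 (qt f0) e1 <-> qf_holds b f0 e1).
  by move=> W0; apply: qf_testP W0 Hv.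
have Hz z : None = Some z -> z \in io ++ [::] /\ z \notin io by [].
have Hacc := @mkprog_accepts sigma (even_scheme sigma 1) qt ot kb f K P go None 1 2 P.+1
   K0 P3 gPo isT isT isT isT isT Hfro HPo A b rk Hrk (@even_accepts sigma A b 1) _ OR HWo gWo Hz Hqt Hot e.
rewrite /odd_accepts /r Hacc (val_init _ K0 Hrk) //.
have n1 := dom_gt1 A.
have N0 : 0 < #|A| ^ K by rewrite expn_gt0; lia.
have dK : d <= K by rewrite /K; lia.
have HE := @accrunE sigma kb f K P go 1 2 P.+1 K0 P3 gPo isT isT isT isT isT Hfro HPo A rk _
  OR gWo 0 0 isT dK N0.
rewrite HE.
have En : #|A|.-1.+1 = #|A| by lia.
have b0 : 0 < #|A|.-1 by lia.
have HOR w : w < #|A|.-1.+1 ^ d -> OR w = asb (eso_struct kb' f' rk (fun=> false) w).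
  rewrite En => Hw.
  have wN : w < #|A| ^ K by apply: leq_trans Hw _; rewrite leq_exp2l.
  have dK' : fdeg kb' d f' <= K by rewrite /K; lia.
  have HEi := @accrunE sigma kb' f' K P gi 2 1 2 K0 P3 gPi isT isT isT isT isT Hfri HPi A rk _
    (fun=> false) gWi d w Hw dK' wN.
  rewrite /OR /asb; case: excluded_middle_informative => H1;
  case: excluded_middle_informative => H2 //; exfalso; [apply: H2|apply: H1]; exact/HEi.
rewrite /eso_struct.
have Heq F : (forall x, F x <= #|A| ^ kb) ->
   holds (Ctx #|A|.-1 (struct_inp rk) OR F) (fun=> 0) f =
   holds (Ctx #|A|.-1 (struct_inp rk) (fun v => asb (eso_struct kb' f' rk (fun=> false) v)) F) (fun=> 0) f.
  by move=> HF; apply: (@holds_orc_ext kb _ _ _ _ _ d b0 _ HOR f _ 0) => //; rewrite En.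
split.
  by case=> _ [F [HF Hh]]; exists F; split=> //; rewrite -Heq.
by case=> F [HF Hh]; split=> //; exists F; split=> //; rewrite Heq.
Qed.

End Theorems.

(** * String encodings *)

Section LexTuples.
Variable T : finType.

Definition erk (x : T) : nat := index x (enum T).

Lemma erk_lt x : erk x < #|T|.
Proof. by rewrite /erk cardE index_mem mem_enum. Qed.

Lemma erk_inj : injective erk.
Proof. by move=> x y H; apply: (@index_inj _ x (enum T)) => //; rewrite mem_enum. Qed.

Lemma size_lex_tuples k : size (lex_tuples T k) = #|T| ^ k.
Proof. by elim: k => //= k IH; rewrite size_allpairs IH -cardE expnS. Qed.

Lemma nth_allpairs (U V W : Type) (f : U -> V -> W) s t u v w i j :
  i < size s -> j < size t ->
  nth w [seq f x y | x <- s, y <- t] (i * size t + j) = f (nth u s i) (nth v t j).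
Proof.
elim: s i => //= x s IH i Hi Hj; rewrite nth_cat size_map.
case: i Hi => [|i] Hi /=; first by rewrite mul0n add0n Hj (nth_map v).
by rewrite mulSn ltnNge -addnA leq_addr /= addKn IH.
Qed.

Lemma nth_lex_tuples k (t d : k.-tuple T) :
  nth d (lex_tuples T k) (lexv #|T| (map erk t)) = t.
Proof.
elim: k t d => [|k IH] t d /=; first by rewrite [t]tuple0 [d]tuple0.
have Hl (t' : k.-tuple T) : lexv #|T| (map erk t') < size (lex_tuples T k).
  rewrite size_lex_tuples -{2}(size_tuple t') -(size_map erk); apply: lexv_lt.
    by apply: leq_ltn_trans (erk_lt (thead t)).
  by rewrite all_map; apply/allP => x _; apply: erk_lt.
case/tupleP: t d => x t d /=.
have Es : size (map erk t) = k by rewrite size_map size_tuple.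
rewrite Es -size_lex_tuples (@nth_allpairs _ _ _ _ _ _ x t) ?Hl //; last by rewrite -cardE erk_lt.
by rewrite IH /erk nth_index ?mem_enum.
Qed.

End LexTuples.

Section Encode.
Variable sigma : signature.

Definition rel_off (n i : nat) : nat :=
  sumn [seq n ^ @arity sigma j | j <- take i (enum 'I_(nrel sigma))].
Definition rel_pos (n : nat) (i : 'I_(nrel sigma)) (x : nat) : nat := n.+1 + (rel_off n i + x).
Definition cst_pos (n : nat) (c : nat) (x : nat) : nat :=
  n.+1 + (rel_off n (nrel sigma) + (c * n + x)).
Definition code_len (n : nat) : nat := n.+1 + (rel_off n (nrel sigma) + ncst sigma * n).

(** The encodings of structures of size [n], described by conditions on single bits ([coded_encode],
    [encode_wstruct]), so that a bounded formula can check them. *)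
Definition coded (w : seq bool) (n : nat) : Prop :=
  [/\ 1 < n, size w = code_len n, (forall x, x < n -> nth false w x), nth false w n = false
    & forall c : 'I_(ncst sigma), exists2 x, x < n & forall y, y < n ->
        nth false w (cst_pos n c y) = (y == x)].

Lemma nth_flatten_map (I U : Type) (F : I -> seq U) (s : seq I) u i0 j x :
  j < size s -> x < size (F (nth i0 s j)) ->
  nth u (flatten (map F s)) (sumn [seq size (F i) | i <- take j s] + x) = nth u (F (nth i0 s j)) x.
Proof.
elim: s j => // i s IH [|j] /= Hj Hx; rewrite nth_cat.
  by rewrite add0n Hx.
by rewrite ltnNge -addnA leq_addr /= addKn IH.
Qed.

Lemma size_flatten_map (I U : Type) (F : I -> seq U) (s : seq I) :
  size (flatten (map F s)) = sumn [seq size (F i) | i <- s].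
Proof. by rewrite size_flatten /shape -map_comp. Qed.

Section Bits.
Variable A : structure sigma.
Let n := #|A|.
Let rels := flatten [seq [seq rel_of t | t <- lex_tuples A (@arity sigma i)] | i <- enum 'I_(nrel sigma)].
Let csts := flatten [seq [seq x == cst_of A c | x <- enum A] | c <- enum 'I_(ncst sigma)].

Lemma size_rels : size rels = rel_off n (nrel sigma).
Proof.
rewrite /rels size_flatten_map /rel_off take_oversize ?size_enum_ord //.
by congr sumn; apply: eq_map => i; rewrite size_map size_lex_tuples.
Qed.

Lemma size_csts : size csts = ncst sigma * n.
Proof.
rewrite /csts size_flatten_map.
rewrite (eq_map (g := fun=> n)); last by move=> c; rewrite size_map -cardE.
rewrite -[in RHS](size_enum_ord (ncst sigma)).
by elim: (enum _) => //= c s ->; rewrite mulSn.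
Qed.

Lemma size_encode : size (encode A) = code_len n.
Proof. by rewrite /encode size_cat size_nseq /= size_cat size_rels size_csts /code_len addSnnS. Qed.

Lemma nth_encode_prefix x : x < n -> nth false (encode A) x.
Proof. by move=> xn; rewrite /encode nth_cat size_nseq xn nth_nseq xn. Qed.

Lemma nth_encode_sep : nth false (encode A) n = false.
Proof. by rewrite /encode nth_cat size_nseq ltnn subnn. Qed.

Lemma nth_encode_tail x : nth false (encode A) (n.+1 + x) = nth false (rels ++ csts) x.
Proof.
rewrite /encode nth_cat size_nseq ltnNge addSn -addnS leq_addr /= addKn.
by [].
Qed.

Lemma nth_encode_rel (i : 'I_(nrel sigma)) (t : (@arity sigma i).-tuple A) :
  nth false (encode A) (rel_pos n i (lexv n (map (@erk A) t))) = rel_of t.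
Proof.
rewrite nth_encode_tail nth_cat.
have Hx : lexv n (map (@erk A) t) < n ^ @arity sigma i.
  rewrite -{2}(size_tuple t) -(size_map (@erk A)); apply: lexv_lt; first by have := dom_gt1 A; lia.
  by rewrite all_map; apply/allP => x _; apply: erk_lt.
have E : rel_off n i = sumn [seq size [seq rel_of t | t <- lex_tuples A (@arity sigma j)] |
    j <- take i (enum 'I_(nrel sigma))].
  by congr sumn; apply: eq_map => j; rewrite size_map size_lex_tuples.
have Hn : nth i (enum 'I_(nrel sigma)) i = i by rewrite nth_ord_enum.
have H := @nth_flatten_map _ _ (fun j => [seq rel_of t | t <- lex_tuples A (@arity sigma j)])
  (enum 'I_(nrel sigma)) false i i (lexv n (map (@erk A) t)).
rewrite size_enum_ord Hn -E in H.
have Hsz : lexv n (map (@erk A) t) < size [seq rel_of t | t <- lex_tuples A (@arity sigma i)].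
  by rewrite size_map size_lex_tuples.
case: ltnP => [_|Hge].
  rewrite -/rels in H; rewrite H //.
  by rewrite (nth_map t) ?nth_lex_tuples // -(size_map (@rel_of sigma A i)).
have Hlt : rel_off n i + lexv n (map (@erk A) t) < size rels.
  rewrite size_rels; apply: (@leq_trans (rel_off n i.+1)).
    rewrite /rel_off (take_nth i) ?size_enum_ord // Hn map_rcons sumn_rcons ltn_add2l //.
  rewrite /rel_off [X in _ <= sumn (map _ X)]take_oversize ?size_enum_ord //.
  by rewrite -[X in _ <= sumn (map _ X)](cat_take_drop i.+1) map_cat sumn_cat leq_addr.
by rewrite ltnNge Hge in Hlt.
Qed.

Lemma nth_encode_cst (c : 'I_(ncst sigma)) x : x < n ->
  nth false (encode A) (cst_pos n c x) = (x == erk (cst_of A c)).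
Proof.
move=> xn; rewrite nth_encode_tail nth_cat size_rels ltnNge leq_addr /= addKn.
have H := @nth_flatten_map _ _ (fun c => [seq x == cst_of A c | x <- enum A])
  (enum 'I_(ncst sigma)) false c c x.
rewrite size_enum_ord nth_ord_enum size_map -cardE in H.
have E : sumn [seq size [seq x == cst_of A i | x <- enum A] | i <- take c (enum 'I_(ncst sigma))] = c * n.
  rewrite (eq_map (g := fun=> n)); last by move=> c'; rewrite size_map -cardE.
  have Es : size (take c (enum 'I_(ncst sigma))) = c by rewrite size_takel // size_enum_ord ltnW.
  rewrite -[in RHS]Es; elim: (take _ _) => //= c' s ->; by rewrite mulSn.
rewrite E in H; rewrite H //.
have [x0 _] : exists x0 : A, True by exists (cst_of A c).
rewrite (nth_map x0) -?cardE //.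
by rewrite /erk; apply/eqP/eqP => [<-|->]; rewrite ?index_uniq -?cardE ?enum_uniq // nth_index ?mem_enum.
Qed.

Lemma coded_encode : coded (encode A) n.
Proof.
split; [exact: dom_gt1|exact: size_encode|exact: nth_encode_prefix|exact: nth_encode_sep|].
move=> c; exists (erk (cst_of A c)); first exact: erk_lt.
by move=> y yn; apply: nth_encode_cst.
Qed.

End Bits.

(** ** The structure coded by a word *)

Section WordStruct.
Variables (w : seq bool) (n' : nat).
Let n := n'.+2.

Definition wcst (c : nat) : 'I_n := odflt ord0 [pick x : 'I_n | nth false w (cst_pos n c x)].

Lemma card_wdom : 1 < #|'I_n|.
Proof. by rewrite card_ord. Qed.

Definition wstruct : structure sigma :=
  @Structure sigma 'I_n card_wdom
    (fun i t => nth false w (rel_pos n i (lexv n (map val t)))) (fun c => wcst c).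

Lemma erk_ord (x : 'I_n) : erk x = x.
Proof. exact: index_enum_ord. Qed.

Lemma wcstP (c : 'I_(ncst sigma)) y : coded w n -> y < n ->
  nth false w (cst_pos n c y) = (y == wcst c).
Proof.
case=> _ _ _ _ /(_ c) [x xn Hx] yn; rewrite Hx // /wcst; case: pickP => [z|/(_ (Ordinal xn))].
  by rewrite Hx // => /eqP <-.
by rewrite Hx //= eqxx.
Qed.

Lemma rel_off_decomp p : p < rel_off n (nrel sigma) ->
  exists (i : 'I_(nrel sigma)) x, p = rel_off n i + x /\ x < n ^ @arity sigma i.
Proof.
suff H k : k <= nrel sigma -> p < rel_off n k ->
    exists (i : 'I_(nrel sigma)) x, p = rel_off n i + x /\ x < n ^ @arity sigma i by apply: H.
elim: k => [|k IH] Hk; first by rewrite /rel_off take0.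
pose i := Ordinal Hk.
have E : rel_off n k.+1 = rel_off n k + n ^ @arity sigma i.
  rewrite /rel_off (take_nth i) ?size_enum_ord // map_rcons sumn_rcons.
  by rewrite (_ : nth i (enum 'I_(nrel sigma)) k = i) //; apply: (@nth_ord_enum _ i i).
rewrite E; case: (ltnP p (rel_off n k)) => [H _|H1 H2]; first by apply: IH => //; apply: ltnW.
by exists i, (p - rel_off n k); split; [rewrite subnKC|rewrite ltn_subLR].
Qed.

Lemma encode_wstruct : coded w n -> encode wstruct = w.
Proof.
move=> Hc; case: (Hc) => n1 Hs Hp Hsep Hcst.
have En : #|wstruct| = n by rewrite card_ord.
apply: (@eq_from_nth _ false); first by rewrite size_encode En Hs.
rewrite size_encode En => p Hpl.
case: (ltngtP p n) => [pn|np|->].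
- by rewrite Hp // nth_encode_prefix // En.
- have [q Eq] : exists q, p = n.+1 + q by exists (p - n.+1); rewrite subnKC.
  rewrite Eq; move: Hpl; rewrite Eq /code_len ltn_add2l => Hq.
  case: (ltnP q (rel_off n (nrel sigma))) => Hr.
    have [i [x [-> Hx]]] := rel_off_decomp Hr.
    have [s [Ss Sa Sv]] := lexv_surj (isT : 0 < n) Hx.
    have Ht : size [seq inord y : 'I_n | y <- s] == @arity sigma i by rewrite size_map Ss.
    have Em : map val (Tuple Ht) = s.
      rewrite /= -map_comp -[RHS]map_id; apply/eq_in_map => y ys /=.
      by rewrite inordK //; apply: (allP Sa).
    have H := @nth_encode_rel wstruct i (Tuple Ht).
    rewrite En (_ : map _ _ = s) in H; last by rewrite -[RHS]Em; apply: eq_map => y; apply: erk_ord.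
    rewrite Sv in H; rewrite -[X in nth _ _ X = _]/(rel_pos n i x) H.
    by rewrite -[LHS]/(nth false w (rel_pos n i (lexv n (map val (Tuple Ht))))) Em Sv.
  have n0 : 0 < n by [].
  have [q' Eq'] : exists q', q = rel_off n (nrel sigma) + q' by exists (q - rel_off n (nrel sigma)); rewrite subnKC.
  rewrite Eq'; move: Hq; rewrite Eq' ltn_add2l => Hq'.
  have Hc' : q' %/ n < ncst sigma by rewrite ltn_divLR.
  have H := @nth_encode_cst wstruct (Ordinal Hc') (q' %% n).
  have H2 := @wcstP (Ordinal Hc') (q' %% n) Hc.
  rewrite En /cst_pos /= -divn_eq erk_ord in H; rewrite /cst_pos /= -divn_eq in H2.
  by rewrite H ?H2 ?ltn_mod.
- by have := nth_encode_sep wstruct; rewrite En Hsep.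
Qed.

End WordStruct.

Lemma isomorphic_sym (A B : structure sigma) : isomorphic A B -> isomorphic B A.
Proof.
case=> f [[g fg gf] Hr Hc]; exists g; split; first by exists f.
- move=> i t; rewrite -Hr; congr rel_of; apply: val_inj => /=.
  by rewrite -map_comp -[RHS]map_id; apply: eq_map => x /=.
- by move=> c; rewrite -Hc fg.
Qed.

Lemma isomorphic_wstruct (A : structure sigma) n' : #|A| = n'.+2 ->
  isomorphic A (wstruct (encode A) n').
Proof.
move=> En.
have Hc : coded (encode A) n'.+2 by rewrite -En; apply: coded_encode.
have Hlt (x : A) : erk x < n'.+2 by rewrite -En erk_lt.
pose f (x : A) : wstruct (encode A) n' := Ordinal (Hlt x).
have finj : injective f by move=> x y /(congr1 val) /= /erk_inj.
exists f; split.
- by apply: inj_card_bij => //; rewrite card_ord En.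
- move=> i t /=; rewrite -map_comp (eq_map (g := @erk A)) // -{1}En -{1}En.
  by rewrite nth_encode_rel.
- move=> c; apply: val_inj => /=; apply/eqP.
  rewrite -(wcstP c Hc) // -{1}En nth_encode_cst ?erk_lt //.
Qed.

(** Every structure is isomorphic to the structure on an initial segment that is read off from its
    encoding, and problems are closed under isomorphism. *)
Lemma encodingP (Omega : problem sigma) w :
  encoding Omega w <-> exists n', coded w n'.+2 /\ Omega (wstruct w n').
Proof.
split.
  case=> A [OA ->]; have := dom_gt1 A; case En: #|A| => [|[|n']] // _.
  exists n'; split; first by rewrite -En; apply: coded_encode.
  exact: (problem_iso (isomorphic_wstruct En) OA).
by case=> n' [Hc O]; exists (wstruct w n'); rewrite encode_wstruct.
Qed.

Lemma encoding_encode (Omega : problem sigma) A : encoding Omega (encode A) <-> Omega A.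
Proof.
split; last by exists A.
case=> B [OB E]; have [n' En] : exists n', #|A| = n'.+2.
  by have := dom_gt1 A; case: #|A| => [|[|k]] // _; exists k.
have EB : #|B| = n'.+2.
  have HA := nth_encode_prefix (A := A); have HB := nth_encode_prefix (A := B).
  have SA := nth_encode_sep A; have SB := nth_encode_sep B.
  case: (ltngtP #|A| #|B|) => [H|H|<-//].
  - by move: (HB _ H); rewrite -E SA.
  - by move: (HA _ H); rewrite E SB.
have IA := isomorphic_wstruct En; have IB := isomorphic_wstruct EB.
apply: (problem_iso (isomorphic_sym IA)); rewrite E.
exact: (problem_iso IB).
Qed.

(* The standard successor relation on the structure coded by a word. *)
Definition ord_builtins n' : builtins 'I_n'.+2 :=
  Builtins (fun x y : 'I_n'.+2 => val y == (val x).+1) ord0 ord_max.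

Lemma ord_builtins_successor n' : is_successor (ord_builtins n').
Proof.
exists (fun x y : 'I_n'.+2 => val x <= val y); split=> //=.
- split.
  + by move=> x /=.
  + by move=> x y /= H; apply: val_inj; apply/eqP; rewrite eqn_leq.
  + by move=> x y z /= H1 H2; apply: leq_trans H1 H2.
  + by move=> x y /=; apply: leq_total.
- by move=> x; rewrite -ltnS.
- move=> x y; apply/eqP/and3P => [E|[xy lexy /forallP Hz]].
    split; [by apply/eqP => xy; move: E; rewrite xy; lia|by rewrite E|].
    apply/forallP => z; apply/implyP => /andP[H1 H2].
    by rewrite -!val_eqE /=; move: H2; rewrite E; lia.
  have H1 : (val x).+1 < n'.+2.
    by apply: leq_ltn_trans (ltn_ord y); rewrite ltn_neqAle lexy andbT.
  have := Hz (Ordinal H1); rewrite /= leqnSn /=.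
  have xy' : val x != val y by rewrite val_eqE.
  have -> : x < val y by rewrite ltn_neqAle xy' lexy.
  by move=> /orP[/eqP/(congr1 val)|/eqP/(congr1 val)] //=; lia.
Qed.

End Encode.

(** * Accepting computations of nondeterministic machines *)

Definition frk (T : finType) (x : T) : nat := enum_rank x.

Lemma frk_inj (T : finType) : injective (@frk T).
Proof. by move=> x y /val_inj /enum_rank_inj. Qed.

Lemma frk_lt (T : finType) (x : T) : frk x < #|T|.
Proof. exact: ltn_ord. Qed.

Definition shifted (d : move) (h h' : nat) : Prop :=
  match d with
  | MLeft => h = h'.+1 \/ (h = 0 /\ h' = 0)
  | MStay => h' = h
  | MRight => h' = h.+1
  end.

Lemma shiftedP d h h' : shifted d h h' <-> h' = shift d h.
Proof. by case: d => /=; lia. Qed.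

Lemma df_shifted d g g' : dterm g -> dterm g' -> defin (fun c e => shifted d (g c e) (g' c e)).
Proof. by move=> Hg Hg'; case: d => /=; dfn. Qed.

Section Tableau.
Variable M : ntm.
Local Notation sym := (option (bool + n_extra M)).

(** Layout of the tableau: [pair 0 t] is the state, [pair 1 t] the head position and
    [pair 2 (pair t p)] the symbol in cell [p] at time [t]. Recording the cells below [B] is enough,
    since a run of fewer than [B] steps visits no others. *)
Definition ntm_next (B : nat) (f : nat -> nat) (t : nat) : Prop :=
  exists2 d, List.In d [:: MLeft; MStay; MRight] &
  exists x : n_state M * sym * n_state M * sym,
    n_trans x.1.1.1 x.1.1.2 x.1.2 x.2 d /\
    f (pair 0 t) = frk x.1.1.1 /\ f (pair 0 t.+1) = frk x.1.2 /\
    exists2 h, h < B & f (pair 1 t) = h /\ f (pair 2 (pair t h)) = frk x.1.1.2 /\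
      shifted d h (f (pair 1 t.+1)) /\ f (pair 2 (pair t.+1 h)) = frk x.2 /\
      forall p, p < B -> ~ p = h -> f (pair 2 (pair t.+1 p)) = f (pair 2 (pair t p)).

Definition ntm_tab (B l : nat) (U : nat -> Prop) (f : nat -> nat) : Prop :=
  exists2 T, T < B &
    f (pair 0 0) = frk (n_start M) /\ f (pair 1 0) = 0 /\
    (forall p, p < B ->
      (p < l -> U p -> f (pair 2 (pair 0 p)) = frk (Some (inl true) : sym)) /\
      (p < l -> ~ U p -> f (pair 2 (pair 0 p)) = frk (Some (inl false) : sym)) /\
      (l <= p -> f (pair 2 (pair 0 p)) = frk (None : sym))) /\
    (forall t, t < T -> ntm_next B f t) /\ f (pair 0 T) = frk (n_accept M).

Lemma df_ntm_tab B l U f : dterm B -> dterm l -> defp U -> deff f ->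
  defin (fun c e => ntm_tab (B c e) (l c e) (U c e) (f c e)).
Proof.
move=> HB Hl HU Hf; rewrite /ntm_tab /ntm_next.
by dfn; apply: df_shifted; dtm.
Qed.

Variables (u : seq bool) (B : nat).
Hypothesis HB : forall t c, ntm_run t (ntm_init M u) c -> t < B.
Variable U : nat -> Prop.
Hypothesis HU : forall p, p < size u -> (U p <-> nth false u p).

Definition tab_config (f : nat -> nat) t (c : ntm_config M) : Prop :=
  [/\ f (pair 0 t) = frk (nc_state c), f (pair 1 t) = nc_head c
    & forall p, p < B -> f (pair 2 (pair t p)) = frk (nc_tape c p)].

Lemma ntm_run_snoc t (c c' c'' : ntm_config M) : ntm_run t c c' -> ntm_step c' c'' -> ntm_run t.+1 c c''.
Proof.
elim=> {t c c'} [c|t c c1 c2 H1 H2 IH] H; first by apply: NRunS H _; constructor.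
by apply: NRunS H1 (IH H).
Qed.

Lemma ntm_tab_sound f : ntm_tab B (size u) U f -> ntm_accepts M u.
Proof.
case=> T TB [f0 [f1 [f2 [Hn fT]]]].
suff H t : t <= T -> exists c, ntm_run t (ntm_init M u) c /\ tab_config f t c.
  have [c [Hr [Hs _ _]]] := H T (leqnn _).
  by exists T, c; split=> //; apply: frk_inj; rewrite -Hs.
elim: t => [_|t IH tT].
  exists (ntm_init M u); split; first by constructor.
  split=> // p pB; have [P1 [P2 P3]] := f2 p pB; rewrite /ntm_init /=.
  case: ltnP => H; last exact: P3.
  case E: (nth false u p); first by apply: P1 => //; apply/HU.
  by apply: P2 => //; rewrite HU // E.
have [c [Hr [C1 C2 C3]]] := IH (ltnW tT).
have [d _ [[[[q a] q'] a'] /= [Htr [Q1 [Q2 [h hB [Hh [Ha [Hsh [Ha' Hp]]]]]]]]]] := Hn t tT.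
case: c Hr C1 C2 C3 => cq ctp ch Hr /= C1 C2 C3.
have Eq : cq = q by apply: frk_inj; rewrite -C1.
have Eh : ch = h by rewrite -C2.
have Ea : ctp h = a by apply: frk_inj; rewrite -C3.
exists (NConfig q' (write_cell ctp h a') (shift d h)); split.
  apply: ntm_run_snoc Hr _; rewrite Eq Eh; constructor; by rewrite Ea.
split=> //=; first exact/shiftedP.
move=> p pB; rewrite /write_cell; case: eqP => [->//|/Hp ->//]; exact: C3.
Qed.

Lemma ntm_run_seq t (c c' : ntm_config M) : ntm_run t c c' ->
  exists g : nat -> ntm_config M, [/\ g 0 = c, g t = c' & forall i, i < t -> ntm_step (g i) (g i.+1)].
Proof.
elim=> {t c c'} [c|t c c1 c2 H1 H2 [g [g0 gt Hg]]]; first by exists (fun=> c).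
exists (fun i => if i is j.+1 then g j else c); split=> //.
by case=> [|i] Hi; [rewrite g0|apply: Hg].
Qed.

Lemma ntm_tab_complete k : #|n_state M| <= k -> #|{: sym}| <= k -> B <= k ->
  ntm_accepts M u -> exists f, (forall x, f x <= k) /\ ntm_tab B (size u) U f.
Proof.
move=> k1 k2 k3 [T [c [Hr Hc]]].
have [g [g0 gT Hg]] := ntm_run_seq Hr.
have TB := HB Hr.
have Hh i : i <= T -> nc_head (g i) <= i.
  elim: i => [|i IH] Hi; first by rewrite g0.
  move: (IH (ltnW Hi)) (Hg i Hi); move=> H Hs.
  case: Hs H => q tp h q' a d _ /= H; by case: d => /=; lia.
have [G2 [E2 L2]] := @pack (fun t p => frk (nc_tape (g t) p)) k
  ltac:(by move=> t p; apply: leq_trans (ltnW (frk_lt _)) k2).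
(* The head position is cut off at [k] so that the table is bounded everywhere; up to time [T] this
   changes nothing. *)
have [|f [Ef Lf]] := @pack (fun i x => if i == 0 then frk (nc_state (g x)) else
    if i == 1 then minn (nc_head (g x)) k else if i == 2 then G2 x else 0) k.
  move=> i x; case: (i == 0); first by apply: leq_trans (ltnW (frk_lt _)) k1.
  by case: (i == 1); [exact: geq_minr|case: (i == 2)].
have Fh t : t <= T -> f (pair 1 t) = nc_head (g t).
  by move=> tT; rewrite Ef /=; apply/minn_idPl; have := Hh t tT; lia.
exists f; split=> //; exists T => //.
split; first by rewrite Ef /= g0.
split; first by rewrite Fh // g0.
split.
  move=> p pB; rewrite !Ef /= !E2 g0 /ntm_init /=; split; last split.
  - by move=> H /(HU H) E; rewrite H E.
  - by move=> H Hn; rewrite H; case E: (nth false u p) => //; case: Hn; apply/HU.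
  - by rewrite leqNgt => /negbTE ->.
split; last by rewrite Ef /= gT Hc.
move=> t tT; have := Hg t tT; have := Hh t (ltnW tT).
have := Fh t (ltnW tT); have := Fh t.+1 tT.
have Ft j p : f (pair 2 (pair j p)) = frk (nc_tape (g j) p) by rewrite Ef /= E2.
have Fs j : f (pair 0 j) = frk (nc_state (g j)) by rewrite Ef.
move: (Ft t) (Ft t.+1) (Fs t) (Fs t.+1); move: (g t) (g t.+1) => c1 c2 Ft0 Ft1 Fs0 Fs1 F2 F1 Hhd Hs.
case: c1 c2 / Hs Ft0 Ft1 Fs0 Fs1 F1 F2 Hhd => q tp h q' a d Htr /= Ft0 Ft1 Fs0 Fs1 F1 F2 Hhd.
exists d; first by case: (d) => /=; tauto.
exists (q, tp h, q', a); split=> //=; split=> //; split=> //.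
exists h; first by lia.
split=> //; split=> //; split; first exact/shiftedP.
split; first by rewrite Ft1 /write_cell eqxx.
by move=> p pB ph; rewrite Ft1 Ft0 /write_cell; case: eqP.
Qed.

End Tableau.

(** * Polynomial bounds *)

(** Structures have at least two elements, so coefficients and constants are absorbed by the
    exponent and a bound is a single power. *)
Definition polyb (h : nat -> nat) : Prop := exists a, forall n, 1 < n -> h n <= n ^ a.

Lemma polyb_id : polyb (fun n => n).
Proof. by exists 1 => n _; rewrite expn1. Qed.

Lemma polyb_const k : polyb (fun=> k).
Proof.
exists k => n n1; apply: leq_trans (ltnW (ltn_expl k (ltnSn 1))) _.
by case: k => [|k]; rewrite ?expn0 // leq_exp2r.
Qed.

Lemma polyb_add g h : polyb g -> polyb h -> polyb (fun n => g n + h n).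
Proof.
move=> [a Ha] [b Hb]; exists (maxn a b).+1 => n n1.
have H1 : n ^ a <= n ^ maxn a b by rewrite leq_exp2l // leq_maxl.
have H2 : n ^ b <= n ^ maxn a b by rewrite leq_exp2l // leq_maxr.
by have := Ha n n1; have := Hb n n1; rewrite expnS; nia.
Qed.

Lemma polyb_mul g h : polyb g -> polyb h -> polyb (fun n => g n * h n).
Proof.
move=> [a Ha] [b Hb]; exists (a + b) => n n1.
by rewrite expnD leq_mul ?Ha ?Hb.
Qed.

Lemma polyb_exp g k : polyb g -> polyb (fun n => g n ^ k).
Proof.
move=> Hg; elim: k => [|k IH]; first exact: (polyb_const 1).
by case: (polyb_mul Hg IH) => a Ha; exists a => n n1; rewrite expnS; apply: Ha.
Qed.

Lemma polyb_le g h : (forall n, 1 < n -> g n <= h n) -> polyb h -> polyb g.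
Proof. by move=> H [a Ha]; exists a => n n1; apply: leq_trans (H n n1) (Ha n n1). Qed.

Lemma polyb_sumn (T : Type) (F : T -> nat -> nat) (s : seq T) : (forall x, polyb (F x)) ->
  polyb (fun n => sumn [seq F x n | x <- s]).
Proof.
by move=> HF; elim: s => [|x s IH] /=; [exact: polyb_const|exact: polyb_add].
Qed.

Lemma dt_sumn (T : Type) (F : T -> ctx -> (nat -> nat) -> nat) (s : seq T) :
  (forall x, dterm (F x)) -> dterm (fun c e => sumn [seq F x c e | x <- s]).
Proof.
by move=> HF; elim: s => [|x s IH] /=; [exact: dt_num|apply: dt_add].
Qed.

(** * The bits of an encoding as a definable predicate *)

Section Code.
Variable sigma : signature.

Lemma polyb_rel_off i : polyb (fun n => rel_off sigma n i).
Proof. by apply: polyb_sumn => j; apply/polyb_exp/polyb_id. Qed.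

Lemma polyb_code_len : polyb (code_len sigma).
Proof.
apply: (@polyb_le _ (fun n => 1 + n + (rel_off sigma n (nrel sigma) + ncst sigma * n))).
  by move=> n _; rewrite /code_len add1n.
by repeat first [apply: polyb_add|apply: polyb_mul|apply: polyb_const|apply: polyb_id|apply: polyb_rel_off].
Qed.

Lemma dt_rel_off g i : dterm g -> dterm (fun c e => rel_off sigma (g c e) i).
Proof. by move=> Hg; apply: dt_sumn => j; apply: dt_exp. Qed.

Lemma dt_rel_pos g i h : dterm g -> dterm h -> dterm (fun c e => @rel_pos sigma (g c e) i (h c e)).
Proof. by move=> Hg Hh; apply: dt_add; [apply: dt_succ|apply: dt_add; first exact: dt_rel_off]. Qed.

Lemma dt_cst_pos g h x : dterm g -> dterm h -> dterm x ->
  dterm (fun c e => cst_pos sigma (g c e) (h c e) (x c e)).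
Proof.
move=> Hg Hh Hx; apply: dt_add; [exact: dt_succ|apply: dt_add; first exact: dt_rel_off].
by apply: dt_add => //; apply: dt_mul.
Qed.

Lemma dt_code_len g : dterm g -> dterm (fun c e => code_len sigma (g c e)).
Proof.
move=> Hg; apply: dt_add; [exact: dt_succ|apply: dt_add; first exact: dt_rel_off].
by apply: dt_mul => //; apply: dt_num.
Qed.

Lemma dt_lexv g (hs : seq (ctx -> (nat -> nat) -> nat)) : dterm g -> List.Forall dterm hs ->
  dterm (fun c e => lexv (g c e) [seq h c e | h <- hs]).
Proof.
move=> Hg; elim=> [|h hs' Hh _ [t Ht]] /=; first exact: dt_num.
apply: dt_add; last by exists t.
apply: dt_mul => //.
have [u Hu] := dt_exp (size hs') Hg.
by exists u => c e; rewrite size_map.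
Qed.

(* The bits of the encoding, from an input presenting relations and constants. *)
Fixpoint relbit (n : nat) (I : seq nat -> bool) (q k : nat) (acc : seq nat) : Prop :=
  if k is k'.+1 then exists2 x, x < n & relbit n I q k' (rcons acc x)
  else q = lexv n acc /\ I acc.

Lemma relbitP n I q k acc : relbit n I q k acc <->
  exists s, [/\ size s = k, all (fun x => x < n) s, q = lexv n (acc ++ s) & I (acc ++ s)].
Proof.
elim: k acc => [|k IH] acc /=.
  split=> [[-> HI]|[[|x s] [] //]]; first by exists [::]; rewrite cats0.
  by rewrite cats0.
split.
  case=> x xn /IH [s [S1 S2 S3 S4]]; exists (x :: s).
  by rewrite -cat_rcons /= S1 xn S2.
case=> [[|x s] [] //= [S1] /andP[xn S2] S3 S4]; exists x => //; apply/IH; exists s.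
by rewrite cat_rcons.
Qed.

Lemma df_relbit g i q k (hs : seq (ctx -> (nat -> nat) -> nat)) : dterm g -> dterm q ->
  List.Forall dterm hs ->
  defin (fun c e => relbit (g c e) (inp c i) (q c e) k [seq h c e | h <- hs]).
Proof.
elim: k g q hs => [|k IH] g q hs Hg Hq Hs /=.
  apply: df_and; first by apply: df_eq => //; apply: dt_lexv.
  exact: df_inp.
apply: df_ex => //.
have Hs' : List.Forall dterm (rcons [seq (fun c e => h c (fun j => e j.+1)) | h <- hs] (fun _ e => e 0)).
  elim: Hs => [|h hs' Hh _ IHs] /=; first by constructor; [exact: dt_var|].
  by constructor=> //; exact: (@dt_ren h S).
have := IH (fun c e => g c (fun j => e j.+1)) (fun c e => q c (fun j => e j.+1)) _
  (@dt_ren g S Hg) (@dt_ren q S Hq) Hs'.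
apply: df_ext => c e; rewrite map_rcons -map_comp.
by [].
Qed.

(** The separator at position [n] falls under none of the three cases and is thus 0. *)
Definition encbit (n : nat) (I : nat -> seq nat -> bool) (p : nat) : Prop :=
  p < n \/
  (exists i : 'I_(nrel sigma), exists2 q, q < n ^ @arity sigma i &
     p = rel_pos n i q /\ relbit n (I i) q (@arity sigma i) [::]) \/
  (exists c : 'I_(ncst sigma), exists2 x, x < n &
     p = cst_pos sigma n c x /\ I (nrel sigma + c) [:: x]).

Lemma df_encbit g p : dterm g -> dterm p -> defin (fun c e => encbit (g c e) (inp c) (p c e)).
Proof.
move=> Hg Hp; apply: df_or; first exact: df_lt.
apply: df_or.
  apply: df_exf => i; apply: df_ex; first exact: dt_exp.
  apply: df_and.
    by apply: df_eq; [dtm|apply: dt_rel_pos; dtm].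
  apply: (@df_relbit _ _ _ _ [::]); dtm; constructor.
apply: df_exf => k; apply: df_ex => //; apply: df_and.
  by apply: df_eq; [dtm|apply: dt_cst_pos; dtm].
by apply: df_inp1; dtm.
Qed.

Lemma code_cases n p : 0 < n -> p < code_len sigma n ->
  [\/ p < n, p = n,
      exists (i : 'I_(nrel sigma)) s, [/\ size s = @arity sigma i, all (fun x => x < n) s & p = rel_pos n i (lexv n s)]
    | exists (c : 'I_(ncst sigma)) x, x < n /\ p = cst_pos sigma n c x].
Proof.
move=> n0 Hp; case: (ltngtP p n) => [pn|np|->]; [by constructor 1| |by constructor 2].
have [q Eq] : exists q, p = n.+1 + q by exists (p - n.+1); rewrite subnKC.
rewrite Eq; move: Hp; rewrite Eq /code_len ltn_add2l => Hq.
case: (ltnP q (rel_off sigma n (nrel sigma))) => Hr.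
  constructor 3.
  suff H k : k <= nrel sigma -> q < rel_off sigma n k ->
      exists (i : 'I_(nrel sigma)) x, q = rel_off sigma n i + x /\ x < n ^ @arity sigma i.
    have [i [x [-> Hx]]] := H _ (leqnn _) Hr.
    by have [s [S1 S2 <-]] := lexv_surj n0 Hx; exists i, s.
  elim: k => [|k IH] Hk; first by rewrite /rel_off take0.
  pose i := Ordinal Hk.
  have E : rel_off sigma n k.+1 = rel_off sigma n k + n ^ @arity sigma i.
    rewrite /rel_off (take_nth i) ?size_enum_ord // map_rcons sumn_rcons.
    by rewrite (_ : nth i (enum 'I_(nrel sigma)) k = i) //; apply: (@nth_ord_enum _ i i).
  rewrite E; case: (ltnP q (rel_off sigma n k)) => [H _|H1 H2]; first by apply: IH => //; apply: ltnW.
  by exists i, (q - rel_off sigma n k); split; [rewrite subnKC|rewrite ltn_subLR].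
constructor 4.
have [q' Eq'] : exists q', q = rel_off sigma n (nrel sigma) + q'.
  by exists (q - rel_off sigma n (nrel sigma)); rewrite subnKC.
move: Hq; rewrite Eq' ltn_add2l => Hq'.
have Hc' : q' %/ n < ncst sigma by rewrite ltn_divLR.
exists (Ordinal Hc'), (q' %% n); split; first by rewrite ltn_mod.
by rewrite /cst_pos /= -divn_eq.
Qed.

(* An isomorphic copy on an initial segment, ordered by the ranks. *)
Section Transport.
Variables (A : structure sigma) (b : builtins A) (rk : A -> nat) (n' : nat).
Hypotheses (Hrk : ranking b rk) (En : #|A| = n'.+2).

Definition tstruct : structure sigma :=
  @Structure sigma 'I_n'.+2 (card_wdom n')
    (fun i t => struct_inp rk i (map val t)) (fun c => inord (rk (cst_of A c))).

Lemma iso_tstruct : isomorphic A tstruct.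
Proof.
have Hlt (x : A) : rk x < n'.+2 by rewrite -En; apply: rk_lt Hrk _.
pose f (x : A) : tstruct := Ordinal (Hlt x).
have finj : injective f by move=> x y /(congr1 val) /= /(rk_inj Hrk).
exists f; split.
- by apply: inj_card_bij => //; rewrite card_ord En.
- move=> i t; rewrite /= /struct_inp valK -map_comp.
  apply/existsP/idP => [[t' /andP[/eqP E H]]|H]; last by exists t; rewrite H andbT.
  suff -> : t = t' by [].
  apply/val_inj/(inj_map (rk_inj Hrk)); rewrite E; exact: eq_map.
- by move=> c; apply: val_inj; rewrite /= inordK.
Qed.

Lemma encbitP p : p < code_len sigma n'.+2 ->
  (encbit n'.+2 (struct_inp rk) p <-> nth false (encode tstruct) p).
Proof.
move=> Hp; have Et : #|tstruct| = n'.+2 by rewrite card_ord.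
have Hrel (i : 'I_(nrel sigma)) s : size s = @arity sigma i -> all (fun x => x < n'.+2) s ->
    nth false (encode tstruct) (rel_pos n'.+2 i (lexv n'.+2 s)) = struct_inp rk i s.
  move=> Ss Sa.
  have Ht : size [seq inord y : 'I_n'.+2 | y <- s] == @arity sigma i by rewrite size_map Ss.
  have Em : map val (Tuple Ht) = s.
    rewrite /= -map_comp -[RHS]map_id; apply/eq_in_map => y ys /=.
    by rewrite inordK //; apply: (allP Sa).
  have H := @nth_encode_rel sigma tstruct i (Tuple Ht).
  rewrite Et (_ : map _ _ = s) in H; last by rewrite -[RHS]Em; apply: eq_map => y; apply: erk_ord.
  by rewrite H -[LHS]/(struct_inp rk i (map val (Tuple Ht))) Em.
have Hcst (c : 'I_(ncst sigma)) x : x < n'.+2 ->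
    nth false (encode tstruct) (cst_pos sigma n'.+2 c x) = struct_inp rk (nrel sigma + c) [:: x].
  move=> xn; have H := @nth_encode_cst sigma tstruct c x; rewrite Et in H; rewrite H //.
  have Hc : nrel sigma + c - nrel sigma = c by rewrite addKn.
  rewrite /struct_inp insubN ?Hc ?valK; last by rewrite -leqNgt leq_addr.
  by rewrite erk_ord /= inordK ?eqseq_cons ?andbT // -En; apply: rk_lt Hrk _.
split.
  case=> [pn|[[i [q _ [-> /relbitP [s [S1 S2 -> HI]]]]]|[c [x xn [-> HI]]]]].
  - by apply: nth_encode_prefix; rewrite Et.
  - by rewrite cat0s in HI *; rewrite Hrel.
  - by rewrite Hcst.
case: (code_cases (isT : 0 < n'.+2) Hp) => [pn|->|[i [s [S1 S2 ->]]]|[c [x [xn ->]]]] H.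
- by left.
- by move: H; have := nth_encode_sep tstruct; rewrite Et => ->.
- right; left; exists i, (lexv n'.+2 s).
    by rewrite -S1; apply: lexv_lt.
  by split=> //; apply/relbitP; exists s; rewrite -Hrel.
- by right; right; exists c, x => //; rewrite -Hcst.
Qed.

End Transport.

End Code.

(** * NP is contained in the first level *)

Lemma rank_of (sigma : signature) (A : structure sigma) (b : builtins A) : is_successor b ->
  exists rk n', ranking b rk /\ #|A| = n'.+2.
Proof.
move=> /ranking_exists [rk Hrk]; exists rk.
by have := dom_gt1 A; case: #|A| => [|[|n']] // _; exists n'.
Qed.

Lemma pow_le2 (n x a c : nat) : 1 < n -> x <= n ^ a -> a <= c -> x <= n ^ c.
Proof. by move=> n1 H1 H2; apply: leq_trans H1 _; rewrite leq_exp2l. Qed.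

(** The scheme guesses the tableau of a run on the encoding of the copy [tstruct], ordered by the
    given successor relation. Closure under isomorphism makes the answer the same for every
    successor relation. *)
Theorem NP_scheme1 (sigma : signature) (Omega : problem sigma) : NP Omega -> NPSB_s 1 Omega.
Proof.
case=> M [[k Hk] HM].
(* One exponent for the running time and for all entries of the tableau: times, positions, states
   and symbols. *)
have [a Ha] : polyb (fun n => (code_len sigma n) ^ k + k + 2 + #|n_state M| + #|{: option (bool + n_extra M)}|).
  by repeat first [apply: polyb_add|apply: polyb_const|apply/polyb_exp/polyb_code_len].
have [f Hf] : defin (fun c e => ntm_tab M ((base c).+1 ^ a) (code_len sigma (base c).+1)
    (encbit sigma (base c).+1 (inp c)) (fn c)).
  apply: (@df_ntm_tab M (fun c _ => (base c).+1 ^ a) (fun c _ => code_len sigma (base c).+1)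
    (fun c _ => encbit sigma (base c).+1 (inp c)) (fun c _ => fn c)).
  - by dtm.
  - by apply: dt_code_len; dtm.
  - by move=> r g Hg; apply: df_encbit; dtm.
  - exact: deff_fn.
have [r [Hw Ho Hr]] := scheme1_of_eso sigma a f.
exists r; split=> // A b Hb.
have [rk [n' [Hrk En]]] := rank_of Hb.
rewrite (Hr _ _ _ _ Hrk) -(encoding_encode Omega A).
have Hiso := iso_tstruct Hrk En.
have -> : encoding Omega (encode A) <-> encoding Omega (encode (tstruct rk n')).
  rewrite !encoding_encode; split; first exact: (problem_iso Hiso).
  exact: (problem_iso (isomorphic_sym Hiso)).
have n1 : 1 < n'.+2 by [].
have Hs : size (encode (tstruct rk n')) = code_len sigma n'.+2 by rewrite size_encode card_ord.
rewrite HM /eso_struct En.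
set u := encode _ in Hs *.
have HB t c : ntm_run t (ntm_init M u) c -> t < n'.+2 ^ a.
  by move=> /Hk; have := Ha _ n1; rewrite Hs; lia.
have HU p : p < size u -> (encbit sigma n'.+2 (struct_inp rk) p <-> nth false u p).
  by rewrite Hs; exact: (encbitP Hrk En).
have Hd F := Hf (Ctx n'.+1 (struct_inp rk) (fun=> false) F) (fun=> 0).
rewrite /= in Hd; split.
  by case=> F [_ /Hd]; rewrite -Hs => HT; apply: (ntm_tab_sound HU); exact: HT.
move/(ntm_tab_complete HB HU (k := n'.+2 ^ a)).
case=> [|||F [HF HT]]; try by have := Ha _ n1; lia.
by exists F; split=> //; apply/Hd; rewrite -Hs.
Qed.

(** * Small-step semantics of program schemes *)

Section Conts.
Variables (sigma : signature) (test : Type).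
Local Notation ins := (instr sigma test).

Lemma instr_ind' (P : ins -> Prop) :
  (forall x y, P (Assign _ x y)) ->
  (forall x (R : arrsym) (ys : (R.2).-tuple (term sigma)), P (ARead _ x ys)) ->
  (forall (R : arrsym) (ys : (R.2).-tuple (term sigma)) y, P (AWrite _ ys y)) ->
  (forall x, P (Guess _ _ x)) ->
  (forall t q, (forall j, List.In j q -> P j) -> P (While t q)) ->
  forall i, P i.
Proof.
move=> H1 H2 H3 H4 H5; fix IH 1 => -[x y|x R ys|R ys y|x|t q]; [exact: H1|exact: H2|exact: H3|exact: H4|].
apply: H5; elim: q => [|j q IHq] k /=; first by case.
by case=> [<-|]; [exact: IH|exact: IHq].
Qed.

(** The continuations that occur while [i] is executed and [k] is to follow; the body of a loop is
    followed by the loop itself. The function [cs] is repeated as a nested [fix], since the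
    recursion passes through the list of instructions in the body. *)
Fixpoint ci (i : ins) (k : seq ins) : seq (seq ins) :=
  (i :: k) ::
  match i with
  | While t q =>
      (fix cs (q k : seq ins) : seq (seq ins) :=
         if q is j :: q' then ci j (q' ++ k) ++ cs q' k else [::]) q (i :: k)
  | _ => [::]
  end.

Fixpoint cs (q k : seq ins) : seq (seq ins) :=
  if q is j :: q' then ci j (q' ++ k) ++ cs q' k else [::].

Definition conts (p : seq ins) : seq (seq ins) := cs p [::] ++ [:: [::]].

Definition succs (x y : seq ins) : Prop :=
  match x with
  | [::] => False
  | i :: p => y = p \/ match i with While t q => y = q ++ x | _ => False end
  end.

Lemma In_cat (T : Type) (x : T) s t : List.In x (s ++ t) <-> List.In x s \/ List.In x t.
Proof. by elim: s => [|y s IH] /=; [tauto|rewrite IH; tauto]. Qed.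

Lemma In_nth (T : Type) (d x : T) s : List.In x s -> exists j, j < size s /\ nth d s j = x.
Proof.
elim: s => //= y s IH [<-|/IH [j [H1 H2]]]; first by exists 0.
by exists j.+1.
Qed.

Lemma nth_In (T : Type) (d : T) s j : j < size s -> List.In (nth d s j) s.
Proof. by elim: s j => //= y s IH [|j] Hj; [left|right; apply: IH]. Qed.

Lemma In_iota j m n : List.In j (iota m n) <-> m <= j < m + n.
Proof.
elim: n m => [|n IH] m /=; first by lia.
by rewrite IH; lia.
Qed.

Lemma ci_head i k : List.In (i :: k) (ci i k).
Proof. by case: i => *; left. Qed.

Lemma cs_head p k : List.In (p ++ k) (cs p k) \/ p = [::].
Proof. by case: p => [|i p]; [right|left; rewrite /= In_cat; left; exact: ci_head]. Qed.

Lemma cs_closed q k : (forall j, List.In j q -> forall k x y, List.In x (ci j k) -> succs x y ->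
    List.In y (ci j k) \/ y = k) ->
  forall x y, List.In x (cs q k) -> succs x y -> List.In y (cs q k) \/ y = k.
Proof.
elim: q => //= j q IH Hq x y; rewrite !In_cat => -[Hx|Hx] Hs.
  case: (Hq j (or_introl erefl) _ _ _ Hx Hs) => [H|->]; first by left; left.
  by case: (cs_head q k) => [H|->]; [left; right|right].
by case: (IH (fun j' H => Hq j' (or_intror H)) _ _ Hx Hs); tauto.
Qed.

Lemma ci_closed i : forall k x y, List.In x (ci i k) -> succs x y -> List.In y (ci i k) \/ y = k.
Proof.
elim/instr_ind': i => [x0 y0|x0 R ys|R ys y0|x0|t q IH] k x y /=;
  try by case=> [<- /= [->|//]|//]; right.
change (While t q :: k = x \/ List.In x (cs q (While t q :: k)) -> succs x y ->
  (While t q :: k = y \/ List.In y (cs q (While t q :: k))) \/ y = k).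
case=> [<- /= [->|->]|Hx Hs]; first by right.
  left; case: (cs_head q (While t q :: k)) => [H|->]; [by right|by left].
case: (cs_closed IH Hx Hs) => [H|->]; left; [by right|by left].
Qed.

(** So a run meets only finitely many continuations, independently of the structure, and an index
    into [conts] serves as program counter. *)
Lemma conts_closed p x y : List.In x (conts p) -> succs x y -> List.In y (conts p).
Proof.
rewrite /conts !In_cat /= => -[Hx|[<-|//]] Hs //.
case: (cs_closed (fun j _ => @ci_closed j) Hx Hs) => [H|->]; [by left|by right; left].
Qed.

Lemma conts_self p : List.In p (conts p).
Proof.
by rewrite /conts In_cat /=; case: (cs_head p [::]) => [|->]; [rewrite cats0; left|right; left].
Qed.

Lemma conts_nil p : List.In [::] (conts p).
Proof. by rewrite /conts In_cat /=; right; left. Qed.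

Lemma all_conts (P : ins -> bool) p :
  (forall t q, P (While t q) -> all P q) -> all P p ->
  forall x, List.In x (conts p) -> all P x.
Proof.
move=> HP Hp.
have Hcs q k : (forall j, List.In j q -> forall k, P j -> all P k -> forall x, List.In x (ci j k) -> all P x) ->
    all P q -> all P k -> forall x, List.In x (cs q k) -> all P x.
  elim: q => //= j q IH Hq /andP[Pj Pq] Pk x; rewrite In_cat => -[].
    by apply: (Hq j (or_introl erefl)) => //; rewrite all_cat Pq.
  by apply: IH => // j' H; apply: Hq; right.
have Hci i : forall k, P i -> all P k -> forall x, List.In x (ci i k) -> all P x.
  elim/instr_ind': i => [x0 y0|x0 R ys|R ys y0|x0|t q IH] k Pi Pk x /=;
    try by case=> [<-|//]; rewrite /= Pi.
  change (While t q :: k = x \/ List.In x (cs q (While t q :: k)) -> all P x).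
  case=> [<-|]; first by rewrite /= Pi.
  by apply: Hcs => //; [exact: HP Pi|rewrite /= Pi].
move=> x; rewrite /conts In_cat /= => -[|[<-|//]] //.
by apply: Hcs => // j _; exact: Hci.
Qed.

(* The while-tests of [p], each with the continuation at which it is evaluated. *)
Definition ctests (p : seq ins) : seq test :=
  pmap (fun x => if x is While t _ :: _ then Some t else None) (conts p).

Lemma ctestsP p t q k : List.In (While t q :: k) (conts p) -> List.In t (ctests p).
Proof.
rewrite /ctests; elim: (conts p) => //= x s IH [->|/IH H] /=; first by left.
by case: x => [|[] *] //=; right.
Qed.

End Conts.

Section Fits.
Variables (sigma : signature).

(** All names that can change, and the array dimensions, are below [v]. Variables that are merely
    read may be larger; they keep the value 0, with which the runs considered later start. *)
Fixpoint fit_instr (test : Type) (ft : nat -> test -> bool) (v : nat) (i : instr sigma test) : bool :=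
  match i with
  | Assign x _ => x < v
  | ARead x R _ => [&& x < v, R.1 < v & R.2 < v]
  | AWrite R _ _ => (R.1 < v) && (R.2 < v)
  | Guess x => x < v
  | While t q => ft v t && all (fit_instr ft v) q
  end.

Definition fit_prog (test : Type) (ft : nat -> test -> bool) (v : nat) (r : prog sigma test) : bool :=
  all (fun x => x < v) (inputs r) && all (fit_instr ft v) (body r).

Fixpoint fit_even (m : nat) : nat -> even_scheme sigma m -> bool :=
  match m with
  | 0 => fun _ _ => true
  | m'.+1 => fun v r => all (fun x => x < v) (uvars r) && fit_prog (@fit_even m') v (uprog r)
  end.

Definition evt (P : nat -> bool) := exists v0, forall v, v0 <= v -> P v.

Lemma evt_and P Q : evt P -> evt Q -> evt (fun v => P v && Q v).
Proof.
move=> [a Ha] [b Hb]; exists (maxn a b) => v; rewrite geq_max => /andP[H1 H2].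
by rewrite Ha ?Hb.
Qed.

Lemma evt_lt x : evt (fun v => x < v).
Proof. by exists x.+1. Qed.

Lemma evt_all (T : Type) (P : nat -> T -> bool) (s : seq T) :
  (forall x, List.In x s -> evt (P^~ x)) -> evt (fun v => all (P v) s).
Proof.
elim: s => [|x s IH] H; first by exists 0.
apply: evt_and; first by apply: H; left.
by apply: IH => y Hy; apply: H; right.
Qed.

Lemma evt_instr (test : Type) (ft : nat -> test -> bool) : (forall t, evt (ft^~ t)) ->
  forall i, evt (fun v => fit_instr ft v i).
Proof.
move=> Ht; elim/instr_ind' => [x y|x R ys|R ys y|x|t q IH] /=; try exact: evt_lt.
- by apply: evt_and; [exact: evt_lt|apply: evt_and; exact: evt_lt].
- by apply: evt_and; exact: evt_lt.
- by apply: evt_and => //; apply: evt_all.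
Qed.

Lemma evt_prog (test : Type) (ft : nat -> test -> bool) : (forall t, evt (ft^~ t)) ->
  forall r, evt (fun v => fit_prog ft v r).
Proof.
move=> Ht r; apply: evt_and; apply: evt_all => x _; first exact: evt_lt.
exact: evt_instr.
Qed.

Lemma evt_even m (t : even_scheme sigma m) : evt (fun v => fit_even v t).
Proof.
elim: m t => [|m IH] t /=; first by exists 0.
by apply: evt_and; [apply: evt_all => x _; exact: evt_lt|exact: evt_prog].
Qed.

End Fits.

Section Steps.
Variables (sigma : signature) (A : structure sigma) (b : builtins A).
Variables (test : Type) (holdsT : test -> env A -> Prop).
Local Notation ins := (instr sigma test).

Record cfg := Cfg { ck : seq ins; ce : env A; cS : store A }.

Definition sstep (c c' : cfg) : Prop :=
  let: Cfg k e St := c in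
  match k with
  | [::] => False
  | i :: p =>
    match i with
    | Assign x y => c' = Cfg p (set_var e x (eval b e y)) St
    | ARead x R ys => c' = Cfg p (set_var e x (St R (map (eval b e) ys))) St
    | AWrite R ys y => c' = Cfg p e (set_arr St R (map (eval b e) ys) (eval b e y))
    | Guess x => exists a, c' = Cfg p (set_var e x a) St
    | While t q => (holdsT t e /\ c' = Cfg (q ++ k) e St) \/ (~ holdsT t e /\ c' = Cfg p e St)
    end
  end.

Definition srun (T : nat) (g : nat -> cfg) : Prop := forall t, t < T -> sstep (g t) (g t.+1).

Definition reach (c c' : cfg) : Prop := exists T g, [/\ g 0 = c, g T = c' & srun T g].

Lemma srun_cat T1 g1 T2 g2 : srun T1 g1 -> srun T2 g2 -> g1 T1 = g2 0 ->
  srun (T1 + T2) (fun t => if t <= T1 then g1 t else g2 (t - T1)).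
Proof.
move=> H1 H2 E t Ht; case: (ltngtP t T1) => H.
- exact: H1.
- by rewrite subSn ?(ltnW H) //; apply: H2; lia.
- by rewrite H E (_ : T1.+1 - T1 = 1) ?subSnn //; apply: H2; lia.
Qed.

Lemma reach_trans c1 c2 c3 : reach c1 c2 -> reach c2 c3 -> reach c1 c3.
Proof.
move=> [T1 [g1 [A1 B1 C1]]] [T2 [g2 [A2 B2 C2]]].
exists (T1 + T2), (fun t => if t <= T1 then g1 t else g2 (t - T1)); split=> //.
  rewrite addKn; case: leqP => // H; have E : T2 = 0 by lia.
  by rewrite E addn0 B1 -A2 -B2 E.
by apply: srun_cat => //; rewrite B1.
Qed.

Lemma reach_refl c : reach c c.
Proof. by exists 0, (fun=> c). Qed.

Lemma reach_step c c' c'' : sstep c c' -> reach c' c'' -> reach c c''.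
Proof.
move=> H; apply: reach_trans; exists 1, (fun t => if t == 0 then c else c'); split=> //.
by case.
Qed.

Lemma exec_reach p e S e' S' : exec b holdsT p e S e' S' ->
  forall k, reach (Cfg (p ++ k) e S) (Cfg k e' S').
Proof.
elim=> {p e S e' S'} /=.
- by move=> e S k; exact: reach_refl.
- by move=> x y p e S e' S' _ IH k; apply: reach_step (IH k).
- by move=> x R ys p e S e' S' _ IH k; apply: reach_step (IH k).
- by move=> R ys y p e S e' S' _ IH k; apply: reach_step (IH k).
- by move=> x a p e S e' S' _ IH k; apply: reach_step (IH k); exists a.
- move=> t q p e S e1 S1 e' S' Ht _ IH1 _ IH2 k.
  apply: (@reach_step _ (Cfg (q ++ (While t q :: p ++ k)) e S)); first by left.
  exact: reach_trans (IH1 _) (IH2 _).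
- by move=> t q p e S e' S' Ht _ IH k; apply: reach_step (IH k); right.
Qed.

Lemma sstep_exec c c' e' S' : sstep c c' -> exec b holdsT (ck c') (ce c') (cS c') e' S' ->
  exec b holdsT (ck c) (ce c) (cS c) e' S'.
Proof.
case: c => [[|[x y|x R ys|R ys y|x|t q] p] e S] //=.
- by move=> -> /= H; apply: exec_assign.
- by move=> -> /= H; apply: exec_read.
- by move=> -> /= H; apply: exec_write.
- by move=> [a ->] /= H; apply: exec_guess H.
- case=> -[Ht ->] /= H; last exact: exec_while_false.
  by have [e1 [S1 [H1 H2]]] := exec_cat_inv H; apply: exec_while_true Ht H1 H2.
Qed.

Lemma reach_exec p e S e' S' : reach (Cfg p e S) (Cfg [::] e' S') <-> exec b holdsT p e S e' S'.
Proof.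
split; last by move/exec_reach => /(_ [::]); rewrite cats0.
case=> T [g [E1 E2 Hg]].
suff H d t : t + d = T -> exec b holdsT (ck (g t)) (ce (g t)) (cS (g t)) e' S'.
  by have := H T 0 erefl; rewrite E1.
elim: d t => [|d IH] t; first by rewrite addn0 => ->; rewrite E2 /=; constructor.
by move=> Et; apply: sstep_exec (Hg t _) (IH t.+1 _); lia.
Qed.

Lemma sstep_succs c c' : sstep c c' -> succs (ck c) (ck c').
Proof.
case: c => [[|[x y|x R ys|R ys y|x|t q] p] e S] //=; try by move=> ->; left.
- by case=> a ->; left.
- by case=> -[_ ->]; [right|left].
Qed.

(* A shortest run visits every value of an injective measure at most once. *)
Lemma srun_short (F : finType) (key : cfg -> F) T g :
  srun T g -> (forall t, t <= T -> forall t', t <= t' -> t' <= T -> key (g t) = key (g t') -> g t = g t') ->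
  exists T' g', [/\ T' < #|F|, srun T' g', g' 0 = g 0 & g' T' = g T].
Proof.
elim/ltn_ind: T g => T IH g Hg Hk.
case: (ltnP T #|F|) => HT; first by exists T, g.
have Hni : ~ injective (fun t : 'I_T.+1 => key (g t)).
  by move=> Hi; have := leq_card _ Hi; rewrite card_ord; lia.
have [t [t' [H1 [H2 H3]]]] : exists t t', t < t' /\ t' <= T /\ key (g t) = key (g t').
  apply: NNPP => Hn; apply: Hni => x y E; apply: val_inj.
  case: (ltngtP (val x) (val y)) => // H; case: Hn.
    by exists x, y; split=> //; split=> //; rewrite -ltnS.
  by exists y, x; split=> //; split=> //; rewrite -ltnS.
have E := Hk t ltac:(lia) t' ltac:(lia) H2 H3.
(* Reindexing that cuts out the part of the run between the two equal configurations. *)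
pose s := fun i => if i <= t then i else i + (t' - t).
have Hss i j : i <= j -> s i <= s j by rewrite /s; case: (leqP i t); case: (leqP j t); lia.
have Hg' : srun (T - (t' - t)) (fun i => g (s i)).
  move=> i Hi; case: (ltngtP i t) => H.
  - by rewrite /s H (ltnW H); apply: Hg; lia.
  - by rewrite /s leqNgt H /= ltnNge (ltnW H) /= addSn; apply: Hg; lia.
  - rewrite /s H leqnn ltnn E (_ : t.+1 + (t' - t) = t'.+1); last by lia.
    by apply: Hg; lia.
have sT i : i <= T - (t' - t) -> s i <= T by rewrite /s; case: (leqP i t); lia.
have [|i Hi j Hij Hj|T' [g' [A1 A2 A3 A4]]] := IH (T - (t' - t)) _ (fun i => g (s i)) Hg'; first by lia.
  exact: (Hk _ (sT _ Hi) _ (Hss _ _ Hij) (sT _ Hj)).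
exists T', g'; split=> //; rewrite A4 /s.
case: leqP => H; last by congr g; lia.
rewrite (_ : T - (t' - t) = t); last by lia.
by rewrite E; congr g; lia.
Qed.

End Steps.

(** * Accepting computations of program schemes *)

Lemma dt_lexv_map (T : Type) g (F : T -> ctx -> (nat -> nat) -> nat) (s : seq T) :
  dterm g -> (forall x, dterm (F x)) ->
  dterm (fun c e => lexv (g c e) [seq F x c e | x <- s]).
Proof.
move=> Hg HF; elim: s => [|x s IH] /=; first exact: dt_num.
apply: dt_add => //; apply: dt_mul => //.
have [u Hu] := dt_exp (size s) Hg.
by exists u => c e; rewrite size_map.
Qed.

Section Terms.
Variable sigma : signature.

Definition tvn (N : nat) (cst rho : nat -> nat) (y : term sigma) : nat :=
  match y with Var x => rho x | Cst c => cst c | Zero => 0 | Max => N end.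

Lemma dt_tvn N cst (rho : nat -> ctx -> (nat -> nat) -> nat) r y :
  dterm N -> deff cst -> (forall x, dterm (rho x)) ->
  dterm (fun c e => tvn (N c e) (cst c (fun i => e (r i))) (fun x => rho x c e) y).
Proof. by move=> HN Hc Hr; case: y => [x|x||] //=; [apply: dt_app => //; apply: dt_num|apply: dt_num]. Qed.

Fixpoint qfn (N : nat) (bit : nat -> Prop) (cst rho : nat -> nat) (phi : qf sigma) : Prop :=
  match phi with
  | QEq y z => tvn N cst rho y = tvn N cst rho z
  | QRel i ys => bit (rel_pos N.+1 i (lexv N.+1 [seq tvn N cst rho y | y <- ys]))
  | QSucc y z => tvn N cst rho z = (tvn N cst rho y).+1
  | QNot p => ~ qfn N bit cst rho p
  | QAnd p q => qfn N bit cst rho p /\ qfn N bit cst rho q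
  | QOr p q => qfn N bit cst rho p \/ qfn N bit cst rho q
  end.

Lemma df_qfn N bit cst (rho : nat -> ctx -> (nat -> nat) -> nat) r phi :
  dterm N -> defp bit -> deff cst -> (forall x, dterm (rho x)) ->
  defin (fun c e => qfn (N c e) (bit c (fun i => e (r i))) (cst c (fun i => e (r i))) (fun x => rho x c e) phi).
Proof.
move=> HN Hb Hc Hr; elim: phi => [y z|i ys|y z|p IHp|p IHp q IHq|p IHp q IHq] /=.
- by apply: df_eq; apply: dt_tvn.
- apply: df_app => //; apply: dt_rel_pos; first exact: dt_succ.
  by apply: dt_lexv_map; [exact: dt_succ|move=> y; apply: dt_tvn].
- by apply: df_eq; [|apply: dt_succ]; apply: dt_tvn.
- exact: df_not.
- exact: df_and.
- exact: df_or.
Qed.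

End Terms.

Section Table.
Variables (sigma : signature) (test : Type) (v : nat).
Local Notation ins := (instr sigma test).

Section Def.
Variables (N : nat) (cst : nat -> nat) (tst : test -> (nat -> nat) -> Prop) (K : seq (seq ins)).
Variable f : nat -> nat.

(** Layout of a recorded run: [pair 0 t] is the index of the continuation in [K], [pair x.+1 t] the
    value of variable [x], and first component [v.+1] the array cells. A bit per cell suffices,
    because cells hold only 0 or [max]. *)
Definition regs_at (t x : nat) : nat := if x < v then f (pair x.+1 t) else 0.

Definition cell_at (t a d c : nat) : nat := f (pair v.+1 (pair t (pair (pair a d) c))).

Definition at_pc (t : nat) (k : seq ins) : Prop :=
  exists2 j, List.In j (iota 0 (size K)) & nth [::] K j = k /\ f (pair 0 t) = j.

Definition keep_regs (t x0 : nat) : Prop :=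
  forall x : 'I_v, nat_of_ord x <> x0 -> f (pair x.+1 t.+1) = f (pair x.+1 t).

Definition keep_cells (t : nat) : Prop :=
  forall a d : 'I_v, forall c, c < N.+1 ^ v -> cell_at t.+1 a d c = cell_at t a d c.

Definition tab_step (t : nat) (k : seq ins) : Prop :=
  let tv := tvn N cst (regs_at t) in
  match k with
  | [::] => False
  | i :: p =>
    match i with
    | Assign x y => at_pc t.+1 p /\ f (pair x.+1 t.+1) = tv y /\ keep_regs t x /\ keep_cells t
    | ARead x R ys =>
        at_pc t.+1 p /\
        ((cell_at t R.1 R.2 (lexv N.+1 [seq tv y | y <- ys]) = 1 /\ f (pair x.+1 t.+1) = N) \/
         (~ cell_at t R.1 R.2 (lexv N.+1 [seq tv y | y <- ys]) = 1 /\ f (pair x.+1 t.+1) = 0)) /\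
        keep_regs t x /\ keep_cells t
    | AWrite R ys y =>
        at_pc t.+1 p /\ keep_regs t v /\
        forall a d : 'I_v, forall c, c < N.+1 ^ v ->
          ((nat_of_ord a, nat_of_ord d) = R /\ c = lexv N.+1 [seq tv y | y <- ys] -> cell_at t.+1 a d c = 1) /\
          (~ ((nat_of_ord a, nat_of_ord d) = R /\ c = lexv N.+1 [seq tv y | y <- ys]) ->
             cell_at t.+1 a d c = cell_at t a d c)
    | Guess x => at_pc t.+1 p /\ f (pair x.+1 t.+1) <= N /\ keep_regs t x /\ keep_cells t
    | While s q =>
        ((tst s (regs_at t) /\ at_pc t.+1 (q ++ k)) \/ (~ tst s (regs_at t) /\ at_pc t.+1 p)) /\
        keep_regs t v /\ keep_cells t
    end
  end.

Definition tab_run (B : nat) (r : prog sigma test) (rho : nat -> nat) : Prop :=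
  exists2 T, T < B &
    at_pc 0 (body r) /\
    (forall x : 'I_v, ((nat_of_ord x \in inputs r) -> f (pair x.+1 0) = 0) /\
                      ((nat_of_ord x \notin inputs r) -> f (pair x.+1 0) = rho x)) /\
    (forall a d : 'I_v, forall c, c < N.+1 ^ v -> cell_at 0 a d c = 0) /\
    (forall t, t < T -> exists2 j, List.In j (iota 0 (size K)) & f (pair 0 t) = j /\ tab_step t (nth [::] K j)) /\
    at_pc T [::] /\
    forall x : 'I_v, nat_of_ord x \in inputs r -> f (pair x.+1 T) = N.

End Def.

Definition deft (tst : ctx -> (nat -> nat) -> test -> (nat -> nat) -> Prop) : Prop :=
  forall r s (rho : nat -> ctx -> (nat -> nat) -> nat), (forall x, dterm (rho x)) ->
    defin (fun c e => tst c (fun i => e (r i)) s (fun x => rho x c e)).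

Section Definable.
Variables (N : ctx -> (nat -> nat) -> nat) (cst f : ctx -> (nat -> nat) -> nat -> nat).
Variable tst : ctx -> (nat -> nat) -> test -> (nat -> nat) -> Prop.
Hypotheses (HN : dterm N) (Hcst : deff cst) (Hf : deff f) (Htst : deft tst).
Variable K : seq (seq ins).

Lemma dt_regs_at r t x : dterm t -> dterm (fun c e => regs_at (f c (fun i => e (r i))) (t c e) x).
Proof. by move=> Ht; apply: dt_if; dtm. Qed.

Lemma dt_cell_at r t a d g : dterm t -> dterm g ->
  dterm (fun c e => cell_at (f c (fun i => e (r i))) (t c e) a d (g c e)).
Proof. by move=> Ht Hg; rewrite /cell_at; dtm. Qed.

Lemma df_at_pc r t k : dterm t -> defin (fun c e => at_pc K (f c (fun i => e (r i))) (t c e) k).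
Proof. by move=> Ht; rewrite /at_pc; dfn. Qed.

Lemma df_keep_regs r t x : dterm t -> defin (fun c e => keep_regs (f c (fun i => e (r i))) (t c e) x).
Proof. by move=> Ht; rewrite /keep_regs; dfn. Qed.

Lemma df_keep_cells r t : dterm t ->
  defin (fun c e => keep_cells (N c (fun i => e (r i))) (f c (fun i => e (r i))) (t c e)).
Proof. by move=> Ht; rewrite /keep_cells /cell_at; dfn. Qed.

Lemma df_tab_step r t k : dterm t ->
  defin (fun c e => tab_step (N c (fun i => e (r i))) (cst c (fun i => e (r i)))
    (tst c (fun i => e (r i))) K (f c (fun i => e (r i))) (t c e) k).
Proof.
move=> Ht.
have HN' : dterm (fun c e => N c (fun i => e (r i))) by exact: dt_ren.
have Hregs x : dterm (fun c e => regs_at (f c (fun i => e (r i))) (t c e) x) by exact: dt_regs_at.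
have Htv y : dterm (fun c e => tvn (N c (fun i => e (r i))) (cst c (fun i => e (r i)))
    (regs_at (f c (fun i => e (r i))) (t c e)) y) by exact: (dt_tvn r (rho := fun x c e => regs_at (f c (fun i => e (r i))) (t c e) x)).
have Hlex (ys : seq (term sigma)) : dterm (fun c e => lexv (N c (fun i => e (r i))).+1
    [seq tvn (N c (fun i => e (r i))) (cst c (fun i => e (r i)))
    (regs_at (f c (fun i => e (r i))) (t c e)) y | y <- ys]).
  by apply: dt_lexv_map => //; exact: dt_succ.
have Hpc k' : defin (fun c e => at_pc K (f c (fun i => e (r i))) (t c e).+1 k').
  by apply: df_at_pc; exact: dt_succ.
have Hkr x : defin (fun c e => keep_regs (f c (fun i => e (r i))) (t c e) x) by exact: df_keep_regs.
have Hkc : defin (fun c e => keep_cells (N c (fun i => e (r i))) (f c (fun i => e (r i))) (t c e)).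
  exact: df_keep_cells.
case: k => [|[x y|x R ys|R ys y|x|s q] p] /=; first exact: df_const.
- by do ?[apply: df_and => //]; apply: df_eq => //; dtm.
- have Hcell := dt_cell_at r R.1 R.2 Ht (Hlex ys).
  have Hc := df_eq Hcell (dt_num 1).
  have Hx : dterm (fun c e => f c (fun i => e (r i)) (pair x.+1 (t c e).+1)) by dtm.
  apply: df_and => //; apply: df_and; last by apply: df_and.
  apply: df_or; apply: df_and; [exact: Hc|exact: (df_eq Hx)|exact: (df_not Hc)|exact: (df_eq Hx (dt_num 0))].
- apply: df_and => //; apply: df_and => //; apply: df_allf => a; apply: df_allf => d.
  apply: df_all; first by dtm.
  have Hlex' := @dt_ren _ S (Hlex ys); have Ht' := @dt_ren _ S Ht.
  have HC : defin (fun (c : ctx) e => (nat_of_ord a, nat_of_ord d) = R /\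
      e 0 = lexv (N c (fun i => e (r i).+1)).+1 [seq tvn (N c (fun i => e (r i).+1)) (cst c (fun i => e (r i).+1))
    (regs_at (f c (fun i => e (r i).+1)) (t c (fun i => e i.+1))) y | y <- ys]).
    by apply: df_and; [exact: df_const|apply: df_eq; [exact: dt_var|exact: Hlex']].
  have Hc1 : dterm (fun c e => cell_at (f c (fun i => e (r i).+1)) (t c (fun i => e i.+1)).+1 a d (e 0)).
    by apply: (dt_cell_at (fun i => (r i).+1)); dtm.
  have Hc0 : dterm (fun c e => cell_at (f c (fun i => e (r i).+1)) (t c (fun i => e i.+1)) a d (e 0)).
    by apply: (dt_cell_at (fun i => (r i).+1)); dtm.
  apply: df_and; apply: df_imp; [exact: HC|by apply: df_eq; dtm|exact: (df_not HC)|exact: df_eq].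
- by do ?[apply: df_and => //]; apply: df_le => //; dtm.
- have Hs : defin (fun c e => tst c (fun i => e (r i)) s (regs_at (f c (fun i => e (r i))) (t c e))).
    exact: (@Htst r s (fun x c e => regs_at (f c (fun i => e (r i))) (t c e) x)).
  do ?[apply: df_and => //]; apply: df_or; apply: df_and => //; exact: df_not.
Qed.

Lemma df_tab_run B r rp (rho : nat -> ctx -> (nat -> nat) -> nat) : dterm B -> (forall x, dterm (rho x)) ->
  defin (fun c e => tab_run (N c (fun i => e (r i))) (cst c (fun i => e (r i)))
    (tst c (fun i => e (r i))) K (f c (fun i => e (r i))) (B c e) rp (fun x => rho x c e)).
Proof.
move=> HB Hrho; rewrite /tab_run; apply: df_ex => //.
pose r1 i := (r i).+1; pose r2 i := (r i).+2.
apply: df_and; first by apply: (df_at_pc r1); exact: dt_num.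
apply: df_and.
  apply: df_allf => x; apply: df_and; apply: df_imp; try exact: df_const.
    by apply: df_eq; dtm.
  by apply: df_eq; [|exact: (@dt_ren _ S)]; dtm.
apply: df_and.
  apply: df_allf => a; apply: df_allf => d; apply: df_all; first by dtm.
  by apply: df_eq; [apply: (dt_cell_at r2); dtm|dtm].
apply: df_and.
  apply: df_all; first exact: dt_var.
  apply: df_exs => j; apply: df_and; first by apply: df_eq; dtm.
  by apply: (df_tab_step r2); exact: dt_var.
apply: df_and; first by apply: (df_at_pc r1); exact: dt_var.
apply: df_allf => x; apply: df_imp; first exact: df_const.
by apply: df_eq; dtm.
Qed.

End Definable.

End Table.

(** * Recorded steps against steps of the scheme *)

Section Sem.
Variables (sigma : signature) (test : Type) (v : nat) (w : seq bool) (n' : nat).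
Local Notation A := (wstruct sigma w n').
Local Notation b := (ord_builtins n').
Local Notation N := n'.+1.
Local Notation ins := (instr sigma test).
Local Notation cfgA := (@cfg sigma A test).

Definition cstn (c : nat) : nat := nat_of_ord (wcst sigma w n' c).
Definition nenv (e : env A) : nat -> nat := fun x => nat_of_ord (e x).

Variables (cst : nat -> nat) (Hcst : forall c : 'I_(ncst sigma), cst c = cstn c).

Lemma tvn_eval (e : env A) y : tvn N cst (nenv e) y = nat_of_ord (eval (b : builtins A) e y).
Proof. by case: y => //= c; rewrite Hcst. Qed.

Lemma map_tvn (e : env A) (ys : seq (term sigma)) :
  [seq tvn N cst (nenv e) y | y <- ys] = [seq nat_of_ord x | x <- map (eval (b : builtins A) e) ys].
Proof. by rewrite -map_comp; apply: eq_map => y; rewrite tvn_eval. Qed.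

Lemma qfn_holds (bit : nat -> Prop) (e : env A) phi :
  (forall p, p < code_len sigma N.+1 -> bit p <-> nth false w p) ->
  (qfn N bit cst (nenv e) phi <-> qf_holds (b : builtins A) phi e).
Proof.
move=> Hbit; elim: phi => [y z|i ys|y z|p IH|p IHp q IHq|p IHp q IHq] /=.
- by rewrite !tvn_eval; split=> [/val_inj ->|/eqP ->//].
- rewrite map_tvn Hbit //.
  rewrite /rel_pos /code_len ltn_add2l.
  have H : lexv n'.+2 [seq nat_of_ord x | x <- map (eval (b : builtins A) e) ys] < n'.+2 ^ @arity sigma i.
    rewrite -[X in _ ^ X](size_tuple ys) -(size_map (eval (b : builtins A) e)) -(size_map (@nat_of_ord n'.+2)).
    by apply: lexv_lt => //; apply/allP => x /mapP [z _ ->]; apply: ltn_ord.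
  apply: (@leq_trans (rel_off sigma n'.+2 (nrel sigma))); last exact: leq_addr.
  apply: (@leq_trans (rel_off sigma n'.+2 i.+1)).
    rewrite /rel_off (take_nth i) ?size_enum_ord // map_rcons sumn_rcons ltn_add2l.
    by rewrite (_ : nth i (enum 'I_(nrel sigma)) i = i) // nth_ord_enum.
  rewrite /rel_off [X in _ <= sumn (map _ X)]take_oversize ?size_enum_ord //.
  by rewrite -[X in _ <= sumn (map _ X)](cat_take_drop i.+1) map_cat sumn_cat leq_addr.
- by rewrite !tvn_eval; split=> [/eqP|/eqP].
- by rewrite IH; split=> /negP.
- by rewrite IHp IHq; split=> [[-> ->]|/andP].
- by rewrite IHp IHq; split=> [/orP|/orP].
Qed.

Definition bitof (St : store A) (a d c : nat) : nat :=
  asb (exists ix : seq A, size ix = d /\ lexv N.+1 [seq nat_of_ord x | x <- ix] = c /\ St (a, d) ix <> ord0).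

Lemma lexv_ord_inj (ix ix' : seq A) : size ix = size ix' ->
  lexv N.+1 [seq nat_of_ord x | x <- ix] = lexv N.+1 [seq nat_of_ord x | x <- ix'] -> ix = ix'.
Proof.
move=> Hs /lexv_inj H; apply: (inj_map val_inj); apply: H; rewrite ?size_map //;
  by apply/allP => x /mapP [z _ ->]; apply: ltn_ord.
Qed.

Lemma bitofP (St : store A) R (ix : seq A) : size ix = R.2 ->
  (bitof St R.1 R.2 (lexv N.+1 [seq nat_of_ord x | x <- ix]) = 1 <-> St R ix <> ord0).
Proof.
move=> Hs; rewrite /bitof; case: R Hs => a d /= Hs; split=> [|H].
  case E: (asb _) => // _; move/asbP: E => [ix' [S' [/lexv_ord_inj -> //]]].
  by rewrite Hs.
by have /asbP -> : exists ix' : seq A, size ix' = d /\ lexv N.+1 [seq nat_of_ord x | x <- ix'] =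
    lexv N.+1 [seq nat_of_ord x | x <- ix] /\ St (a, d) ix' <> ord0 by exists ix.
Qed.

Lemma bitof_set (St : store A) R (ix : seq A) a d c : size ix = R.2 ->
  bitof (set_arr St R ix (ord_max : A)) a d c =
  if asb ((a, d) = R /\ c = lexv N.+1 [seq nat_of_ord x | x <- ix]) then 1 else bitof St a d c.
Proof.
move=> Hs; case E: (asb _).
  move/asbP: E => [Er ->]; rewrite -Er in Hs *; apply/(@bitofP _ (a, d) ix Hs).
  by rewrite /set_arr !eqxx.
have En : ~ ((a, d) = R /\ c = lexv N.+1 [seq nat_of_ord x | x <- ix]) by move/asbP; rewrite E.
rewrite /bitof; congr nat_of_bool; apply/idP/idP => /asbP [ix' [H1 [H2 H3]]]; apply/asbP; exists ix';
  split=> //; split=> //.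
  move: H3; rewrite /set_arr; case: ifP => // /andP[/eqP E1 /eqP E2]; case: En; split=> //.
  by rewrite -H2 E2.
by rewrite /set_arr; case: ifP.
Qed.

Variable tst : test -> (nat -> nat) -> Prop.
Variable holdsT : test -> env A -> Prop.
Variables (K : seq (seq ins)) (f : nat -> nat).
Variables (ft : nat -> test -> bool) (om : test -> bool).

(** The invariant behind the bit table; its second half is preserved because array assignments write
    only [max] and respect the bounds of [fit_instr]. *)
Definition good (c : cfgA) : Prop :=
  (forall x, v <= x -> ce c x = ord0) /\
  (forall R ix, cS c R ix = ord0 \/ (cS c R ix = ord_max /\ [/\ R.1 < v, R.2 < v & size ix = R.2])).

Definition snap (t : nat) (c : cfgA) : Prop :=
  [/\ at_pc K f t (ck c), forall x : 'I_v, f (pair x.+1 t) = nat_of_ord (ce c x)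
    & forall a d : 'I_v, forall i, i < N.+1 ^ v -> cell_at v f t a d i = bitof (cS c) a d i].

Definition okk (k : seq ins) : Prop :=
  [/\ List.In k K, (forall k', succs k k' -> List.In k' K), all (fit_instr ft v) k & all (onlymax_instr om) k].

Lemma snap_regs t c : good c -> snap t c -> regs_at v f t = nenv (ce c).
Proof.
move=> [H1 _] [_ H2 _]; apply: functional_extensionality => x; rewrite /regs_at /nenv.
by case: ltnP => Hx; [exact: (H2 (Ordinal Hx))|rewrite H1].
Qed.

Lemma set_var_rank (e : env A) x a y :
  nat_of_ord (set_var e x a y) = if y == x then nat_of_ord a else nat_of_ord (e y).
Proof. by rewrite /set_var; case: eqP. Qed.

Lemma good_step c c' : okk (ck c) -> good c -> sstep (b : builtins A) holdsT c c' -> good c'.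
Proof.
case: c => [[|i p] e St] [_ _ Hf Ho] [/= G1 G2] //; move: Hf Ho => /= /andP[Fi _] /andP[Oi _].
have Gv x a : x < v -> forall y, v <= y -> set_var e x a y = ord0.
  by move=> xv y vy; rewrite /set_var; case: eqP => [E|_]; [lia|exact: G1].
case: i Fi Oi => [x y|x R ys|R ys y|x|s q] /=.
- by move=> xv _ ->; split=> //=; apply: Gv.
- by move=> /andP[xv _] _ ->; split=> //=; apply: Gv.
- move=> /andP[R1 R2]; case: y => // _ ->; split=> //= R' ix; rewrite /set_arr.
  by case: ifP => // /andP[/eqP -> /eqP ->]; right; rewrite size_map size_tuple.
- by move=> xv _ [a ->]; split=> //=; apply: Gv.
- by move=> _ _ [] [_ ->].
Qed.

Hypothesis Htst : forall s e q k, (forall x, v <= x -> e x = ord0) -> List.In (While s q :: k) K ->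
  (tst s (nenv e) <-> holdsT s e).

Lemma lexv_bound (ix : seq A) (d : nat) : size ix = d -> d < v ->
  lexv N.+1 [seq nat_of_ord x | x <- ix] < N.+1 ^ v.
Proof.
move=> <- Hd; apply: (@leq_trans (N.+1 ^ size [seq nat_of_ord x | x <- ix])).
  by apply: lexv_lt => //; apply/allP => x /mapP [z _ ->]; apply: ltn_ord.
by rewrite leq_exp2l // size_map ltnW.
Qed.

Lemma tab_step_of t c c' : okk (ck c) -> good c -> snap t c -> sstep (b : builtins A) holdsT c c' ->
  snap t.+1 c' -> tab_step v N cst tst K f t (ck c).
Proof.
move=> Hok Hg Hs; have Er := snap_regs Hg Hs; move: Hok Hg Hs Er.
case: c => [[|i p] e St] [HK _ Hf Ho] [/= G1 G2] [Pk Pr Pc] Er //= ; move: Hf Ho Pr Pc Er => /= /andP[Fi _] /andP[Oi _] Pr Pc Er.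
have Hkeep x a : (forall y : 'I_v, f (pair y.+1 t.+1) = nat_of_ord (set_var e x a y)) -> keep_regs v f t x.
  by move=> H y yx; rewrite H set_var_rank; case: eqP => // _; rewrite Pr.
have Hkeep0 : (forall y : 'I_v, f (pair y.+1 t.+1) = nat_of_ord (e y)) -> keep_regs v f t v.
  by move=> H y yx; rewrite H Pr.
have Hkc : (forall a d : 'I_v, forall i, i < N.+1 ^ v -> cell_at v f t.+1 a d i = bitof St a d i) -> keep_cells v N f t.
  by move=> H a d j Hj; rewrite H // Pc.
rewrite Er; case: i HK Pk Fi Oi => [x y|x R ys|R ys y|x|s q] HK Pk /=.
- move=> xv _ -> [/= Q1 Q2 Q3]; split=> //; split; last by split; [exact: Hkeep Q2|exact: Hkc].
  by rewrite (Q2 (Ordinal xv)) set_var_rank eqxx tvn_eval.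
- move=> /and3P[xv R1 R2] _ -> [/= Q1 Q2 Q3]; split=> //; split; last by split; [exact: Hkeep Q2|exact: Hkc].
  have Hsz : size (map (eval (b : builtins A) e) ys) = R.2 by rewrite size_map size_tuple.
  rewrite map_tvn (Pc (Ordinal R1) (Ordinal R2)) ?(lexv_bound Hsz) // (Q2 (Ordinal xv)) set_var_rank eqxx.
  have HB := bitofP St Hsz.
  case: (classic (St R (map (eval (b : builtins A) e) ys) = ord0)) => E.
    by right; split; [move/HB|rewrite E].
  left; split; first exact/HB.
  by case: (G2 R (map (eval (b : builtins A) e) ys)) => [//|[-> _]].
- move=> /andP[R1 R2]; case: y HK Pk => // HK Pk _ -> [/= Q1 Q2 Q3]; split=> //; split; first exact: Hkeep0.
  move=> a d j Hj; rewrite map_tvn Q3 // Pc //.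
  have Hsz : size (map (eval (b : builtins A) e) ys) = R.2 by rewrite size_map size_tuple.
  rewrite (bitof_set _ _ _ _ Hsz); split=> [/asbP -> //|H].
  by case E: (asb _) => //; move/asbP: E.
- move=> xv _ [a ->] [/= Q1 Q2 Q3]; split=> //; split; last by split; [exact: Hkeep Q2|exact: Hkc].
  by rewrite (Q2 (Ordinal xv)) set_var_rank eqxx -ltnS.
- move=> _ _ H [Q1 Q2 Q3].
  have Ht := Htst G1 HK; case: H Q1 Q2 Q3 => -[Hh ->] /= Q1 Q2 Q3; (split; last by split; [exact: Hkeep0|exact: Hkc]).
    by left; split=> //; apply/Ht.
  by right; split=> //; rewrite Ht.
Qed.

Lemma tab_step_run t c : okk (ck c) -> good c -> snap t c -> tab_step v N cst tst K f t (ck c) ->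
  exists c', sstep (b : builtins A) holdsT c c' /\ snap t.+1 c'.
Proof.
move=> Hok Hg Hs; have Er := snap_regs Hg Hs; move: Hok Hg Hs Er.
case: c => [[|i p] e St] [HK _ Hf Ho] [/= G1 G2] [Pk Pr Pc] Er //= ; move: Hf Ho Pr Pc Er => /= /andP[Fi _] /andP[Oi _] Pr Pc Er.
have Hkeep x a : f (pair x.+1 t.+1) = nat_of_ord a -> keep_regs v f t x ->
    forall y : 'I_v, f (pair y.+1 t.+1) = nat_of_ord (set_var e x a y).
  by move=> H1 H2 y; rewrite set_var_rank; case: eqP => [->//|/H2 ->]; rewrite Pr.
have Hkeep0 : keep_regs v f t v -> forall y : 'I_v, f (pair y.+1 t.+1) = nat_of_ord (e y).
  by move=> H y; rewrite H ?Pr //; have := ltn_ord y; lia.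
have Hkc : keep_cells v N f t ->
    forall a d : 'I_v, forall i, i < N.+1 ^ v -> cell_at v f t.+1 a d i = bitof St a d i.
  by move=> H a d j Hj; rewrite H // Pc.
rewrite Er; case: i HK Pk Fi Oi => [x y|x R ys|R ys y|x|s q] HK Pk /=.
- move=> xv _ [Q1 [Q2 [Q3 Q4]]]; eexists; split; first by reflexivity.
  by split=> //=; [apply: Hkeep => //; rewrite Q2 tvn_eval|exact: Hkc].
- move=> /and3P[xv R1 R2] _ [Q1 [Q2 [Q3 Q4]]]; eexists; split; first by reflexivity.
  split=> //=; [apply: Hkeep => //|exact: Hkc].
  have Hsz : size (map (eval (b : builtins A) e) ys) = R.2 by rewrite size_map size_tuple.
  move: Q2; rewrite map_tvn (Pc (Ordinal R1) (Ordinal R2)) ?(lexv_bound Hsz) //.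
  have HB := bitofP St Hsz; rewrite HB => -[[Q ->]|[Q ->]].
    by case: (G2 R (map (eval (b : builtins A) e) ys)) => [//|[-> _]].
  by move/NNPP: Q => ->.
- move=> /andP[R1 R2]; case: y HK Pk => // HK Pk _ [Q1 [Q2 Q3]]; eexists; split; first by reflexivity.
  split=> //=; first exact: Hkeep0.
  move=> a d j Hj.
  have Hsz : size (map (eval (b : builtins A) e) ys) = R.2 by rewrite size_map size_tuple.
  have [Z1 Z2] := Q3 a d j Hj.
  rewrite (bitof_set _ _ _ _ Hsz); case E: (asb _).
    by move/asbP: E => E; apply: Z1; rewrite map_tvn.
  by rewrite Z2 ?Pc // map_tvn => E'; move/asbP: E'; rewrite E.
- move=> xv _ [Q1 [Q2 [Q3 Q4]]]; exists (Cfg p (set_var e x (inord (f (pair x.+1 t.+1)))) St); split.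
    by exists (inord (f (pair x.+1 t.+1))).
  by split=> //=; [apply: Hkeep => //; rewrite inordK|exact: Hkc].
- have Ht := Htst G1 HK.
  move=> _ _ [[[Q1 Q2]|[Q1 Q2]] [Q3 Q4]].
    exists (Cfg (q ++ While s q :: p) e St); split; first by left; split=> //; apply/Ht.
    by split=> //=; [exact: Hkeep0|exact: Hkc].
  exists (Cfg p e St); split; first by right; split=> //; rewrite -Ht.
  by split=> //=; [exact: Hkeep0|exact: Hkc].
Qed.

End Sem.

(** The number of keys: a continuation, the values of [v] variables, and how many array cells are
    set. Counting these cells instead of recording which ones they are makes the bound
    polynomial. *)
Definition run_bound (sz v n : nat) : nat := sz.+1 * (n ^ v * (v * v * n ^ v).+1).

(** * Accepting runs of polynomial length *)

Section Run.
Variables (sigma : signature) (test : Type) (v : nat) (w : seq bool) (n' : nat).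
Local Notation A := (wstruct sigma w n').
Local Notation b := (ord_builtins n' : builtins A).
Local Notation N := n'.+1.
Local Notation ins := (instr sigma test).
Local Notation cfgA := (@cfg sigma A test).
Variables (cst : nat -> nat) (Hcst : forall c : 'I_(ncst sigma), cst c = cstn sigma w n' c).
Variables (tst : test -> (nat -> nat) -> Prop) (holdsT : test -> env A -> Prop).
Variables (ft : nat -> test -> bool) (om : test -> bool).
Variable r : prog sigma test.
Local Notation K := (conts (body r)).
Hypotheses (Hfit : fit_prog ft v r) (Hom : onlymax_prog om r).
Hypothesis Htst : forall s e, (forall x, v <= x -> e x = ord0) -> List.In s (ctests (body r)) ->
  (tst s (@nenv sigma w n' e) <-> holdsT s e).
Variable e : env A.
Hypothesis He : forall x, v <= x -> e x = ord0.

Let c0 : cfgA := Cfg (body r) ((fun x => if x \in inputs r then bzero b else e x) : env A) ((fun _ _ => bzero b) : store A).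

Lemma okk_conts k : List.In k K -> okk v K ft om k.
Proof.
move=> Hk; split=> //.
- by move=> k'; apply: conts_closed Hk.
- apply: all_conts Hk => [t q /andP[]//|]; by case/andP: Hfit.
- by apply: all_conts Hk => [t q /andP[]//|].
Qed.

Lemma okk_step c c' : List.In (ck c) K -> sstep b holdsT c c' -> List.In (ck c') K.
Proof. by move=> H /sstep_succs; apply: conts_closed. Qed.

Lemma good0 : good v c0.
Proof. by split=> [x vx|R ix] /=; [rewrite He //; case: ifP|left]. Qed.

Lemma srun_good T g t : g 0 = c0 -> srun b holdsT T g -> t <= T -> good v (g t) /\ List.In (ck (g t)) K.
Proof.
move=> E Hg; elim: t => [_|t IH tT]; first by rewrite E; split; [exact: good0|exact: conts_self].
have [H1 H2] := IH (ltnW tT); split; last exact: okk_step (Hg t tT).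
exact: (good_step (okk_conts H2) H1 (Hg t tT)).
Qed.

Lemma kidx_ex k : {j | List.In k K -> j < size K /\ nth [::] K j = k}.
Proof.
apply: constructive_indefinite_description.
case: (classic (List.In k K)) => [/(In_nth [::]) [j Hj]|]; first by exists j.
by exists 0.
Qed.

Let kidx k := proj1_sig (kidx_ex k).

Let cells (c : cfgA) : {set 'I_v * 'I_v * 'I_(N.+1 ^ v)} :=
  [set i : 'I_v * 'I_v * 'I_(N.+1 ^ v) | bitof (cS c) i.1.1 i.1.2 i.2 != 0].

(** Along a run the set of nonzero cells only grows ([cells_mono]), so equal cardinalities mean
    equal sets, and configurations of one run with equal keys coincide ([key_inj]). *)
Let key (c : cfgA) : 'I_(size K).+1 * {ffun 'I_v -> 'I_n'.+2} * 'I_(v * v * N.+1 ^ v).+1 :=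
  (inord (kidx (ck c)), [ffun x : 'I_v => ce c x], inord #|cells c|).

Lemma card_key : #|{: 'I_(size K).+1 * {ffun 'I_v -> 'I_n'.+2} * 'I_(v * v * N.+1 ^ v).+1}| = run_bound (size K) v N.+1.
Proof. by rewrite !card_prod card_ffun !card_ord /run_bound mulnA. Qed.

Lemma cells_mono c c' : List.In (ck c) K -> sstep b holdsT c c' -> cells c \subset cells c'.
Proof.
move=> HK; suff H : sstep b holdsT c c' -> forall R ix, cS c R ix <> ord0 -> cS c' R ix <> ord0.
  move=> /H {}H; apply/subsetP => i; rewrite /cells !inE /bitof.
  set P := (X in asb X); set P' := (X in _ -> nat_of_bool (asb X) != 0).
  have H' : P -> P'; last by case E: (asb P) => // _; move/asbP: E => /H' /asbP ->.
  case=> ix [H1 [H2 H3]]; by exists ix; split=> //; split=> //; apply: H.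
have [_ _ _] := okk_conts HK.
case: c {HK} => [[|[x y|x R ys|R ys y|x|t q] p] e1 St] //=.
- by move=> _ ->.
- by move=> _ ->.
- by case: y => //= _ -> R' ix H /=; rewrite /set_arr; case: ifP.
- by move=> _ [a ->].
- by move=> _ [] [_ ->].
Qed.

Lemma key_inj c c' : good v c -> good v c' -> List.In (ck c) K -> List.In (ck c') K ->
  cells c \subset cells c' -> key c = key c' -> c = c'.
Proof.
move=> [G1 G2] [G1' G2'] HK HK' Hsub [/(congr1 val) /= E1 /ffunP E2 /(congr1 val) /= E3].
have [J1 J2] := proj2_sig (kidx_ex (ck c)) HK.
have [J1' J2'] := proj2_sig (kidx_ex (ck c')) HK'.
rewrite !inordK ?ltnS /kidx in E1; try by apply: ltnW.
have Ek : ck c = ck c' by rewrite -J2 -J2' E1.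
have Ee : ce c = ce c'.
  apply: functional_extensionality => x; case: (ltnP x v) => Hx; last by rewrite G1 ?G1'.
  by have := E2 (Ordinal Hx); rewrite !ffunE.
have Hle (Z : {set 'I_v * 'I_v * 'I_(N.+1 ^ v)}) : #|Z| < (v * v * N.+1 ^ v).+1.
  by rewrite ltnS; apply: leq_trans (max_card _) _; rewrite !card_prod !card_ord.
rewrite !inordK // in E3.
have EZ : cells c = cells c' by apply/eqP; rewrite eqEcard Hsub E3 leqnn.
have ES : cS c = cS c'.
  apply: functional_extensionality => R; apply: functional_extensionality => ix.
  case: (classic ([/\ R.1 < v, R.2 < v & size ix = R.2])) => [[R1 R2 Hs]|Hn]; last first.
    by case: (G2 R ix) => [->|[_ //]]; case: (G2' R ix) => [->|[_ //]].
  have Hb : lexv N.+1 [seq nat_of_ord x | x <- ix] < N.+1 ^ v by exact: (lexv_bound Hs R2).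
  have := congr1 (fun Z : {set 'I_v * 'I_v * 'I_(N.+1 ^ v)} => ((Ordinal R1, Ordinal R2), Ordinal Hb) \in Z) EZ; rewrite /cells !inE /=.
  have P1 := bitofP (cS c) Hs; have P2 := bitofP (cS c') Hs.
  move: P1 P2; set b1 := bitof _ _ _ _; set b2 := bitof _ _ _ _ => P1 P2 Eb.
  case: (G2 R ix) => [Z1|[Z1 _]]; case: (G2' R ix) => [Z2|[Z2 _]]; rewrite Z1 Z2 //.
  - have B2 : b2 = 1 by apply/P2; rewrite Z2.
    by move: Eb; rewrite B2 => /idP/idP; move: P1; rewrite Z1 /b1 /bitof; case: (asb _) => // -[/(_ erefl)].
  - have B1 : b1 = 1 by apply/P1; rewrite Z1.
    by move: Eb; rewrite B1 => /esym/idP/idP; move: P2; rewrite Z2 /b2 /bitof; case: (asb _) => // -[/(_ erefl)].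
by case: c c' Ek Ee ES {G1 G2 G1' G2' HK HK' Hsub E1 E2 E3 J1 J2 J1' J2' EZ} => [k1 e1 s1] [k2 e2 s2] /= -> -> ->.
Qed.

Lemma at_pc_inj f t k k' : at_pc K f t k -> at_pc K f t k' -> k = k'.
Proof. by move=> [j _ [<- <-]] [j' _ [<- <-]]. Qed.

Variables (k B : nat).
Hypotheses (HB : run_bound (size K) v N.+1 <= B) (HkK : size K <= k) (HkN : N <= k).

(** A shortened accepting run fits into a table with entries at most [k]; conversely a table is
    replayed step by step. *)
Lemma tab_runP : prog_accepts b holdsT r e <->
  exists f, (forall x, f x <= k) /\ tab_run v N cst tst K f B r (@nenv sigma w n' e).
Proof using Hcst Hfit Hom Htst He HB HkK HkN.
have Htst' s (e1 : env A) q p : (forall x, v <= x -> e1 x = ord0) -> List.In (While s q :: p) K ->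
    (tst s (@nenv sigma w n' e1) <-> holdsT s e1).
  by move=> H H2; apply: (Htst H); exact: (ctestsP H2).
have Hinp : all (fun x => x < v) (inputs r) by case/andP: Hfit.
rewrite /prog_accepts; split.
  case=> e' [S' [/reach_exec [T0 [g0 [E0 ET0 Hg0]]] Hmax]].
  have Hg0G t : t <= T0 -> good v (g0 t) /\ List.In (ck (g0 t)) K by apply: srun_good.
  (* The given run is replaced by one with fewer steps than there are keys. *)
  have [|T [g [TF Hg Eg EgT]]] := @srun_short _ _ _ _ _ _ key T0 g0 Hg0.
    move=> t tT t' tt' tT'; apply: key_inj; try by case: (Hg0G _ tT); case: (Hg0G _ tT').
    elim: t' tt' tT' => [|t' IH]; first by rewrite leqn0 => /eqP ->.
    rewrite leq_eqVlt => /orP[/eqP -> //|tt'] tT'.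
    apply: subset_trans (IH tt' (ltnW tT')) _; apply: cells_mono (Hg0 _ tT').
    by case: (Hg0G t' (ltnW tT')).
  rewrite E0 in Eg; rewrite ET0 in EgT; rewrite card_key in TF.
  have HG t : t <= T -> good v (g t) /\ List.In (ck (g t)) K by apply: srun_good.
  have H2a t y : asb (exists a d i, y = pair (pair a d) i /\ bitof (cS (g t)) a d i = 1) <= 1 by case: (asb _).
  have [F1 [F1E F1L]] := @pack (fun t y => asb (exists a d i, y = pair (pair a d) i /\ bitof (cS (g t)) a d i = 1)) 1 H2a.
  have [|f [fE fL]] := @pack (fun i t => if i == 0 then (if kidx (ck (g t)) <= size K then kidx (ck (g t)) else 0)
      else if i <= v then nat_of_ord (ce (g t) i.-1) else F1 t) k.
    move=> i t; case: (i == 0); first by case: (leqP (kidx (ck (g t))) (size K)) => [H|_ //]; exact: leq_trans H HkK.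
    by case: (i <= v); [have := ltn_ord (ce (g t) i.-1); lia|have := F1L t; lia].
  exists f; split=> //.
  have Hsnap t : t <= T -> snap v K f t (g t).
    move=> tT; have [HGt HKt] := HG t tT; split.
    - have [J1 J2] := proj2_sig (kidx_ex (ck (g t))) HKt.
      exists (kidx (ck (g t))); first by rewrite In_iota.
      by rewrite fE /= ltnW.
    - by move=> x; rewrite fE /= ltn_ord.
    - move=> a d i Hi; rewrite /cell_at fE /= ltnn F1E /bitof; congr nat_of_bool.
      apply/idP/idP => /asbP.
        case=> a' [d' [i' [/pair_inj [/pair_inj [<- <-] <-] H]]].
        by move: H; rewrite /bitof; case: (asb _).
      move=> H; apply/asbP; exists a, d, i; split=> //.
      by rewrite /bitof; move/asbP: H => ->.
  have [P0 R0 C0] := Hsnap 0 (leq0n _); have [PT RT CT] := Hsnap T (leqnn _).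
  exists T; first by lia.
  split; first by move: P0; rewrite Eg.
  split.
    move=> x; rewrite R0 Eg /=; split=> [->//|/negbTE ->//].
  split.
    move=> a d i Hi; rewrite C0 // Eg /bitof; case Ea: (asb _) => //.
    by move/asbP: Ea => [ix [_ [_ //]]].
  split.
    move=> t tT; have [HGt HKt] := HG t (ltnW tT).
    have [[j Hj [Ej Fj]] _ _] := Hsnap t (ltnW tT).
    exists j => //; split=> //; rewrite Ej.
    exact: (tab_step_of Hcst Htst' (okk_conts HKt) HGt (Hsnap t (ltnW tT)) (Hg t tT) (Hsnap t.+1 tT)).
  split; first by move: PT; rewrite EgT.
  by move=> x xi; rewrite RT EgT /= Hmax.
case=> f [Hf [T TB [P0 [R0 [C0 [Hst [PT RT]]]]]]].
have H t : t <= T -> exists c, [/\ reach b holdsT c0 c, good v c, List.In (ck c) K & snap v K f t c].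
  elim: t => [_|t IH tT].
    exists c0; split; [exact: reach_refl|exact: good0|exact: conts_self|].
    split=> //=.
    - move=> x; have [Q1 Q2] := R0 x; case: ifP => [/Q1 ->//|/negbT/Q2 ->//].
    - move=> a d i Hi; rewrite C0 // /bitof; case Ea: (asb _) => //.
      by move/asbP: Ea => [ix [_ [_ //]]].
  have [c [Hr Hg HK Hs]] := IH (ltnW tT).
  have [j Hj [Fj Hstep]] := Hst t tT.
  have Ek : nth [::] K j = ck c by case: (Hs) => Hp _ _; apply: (at_pc_inj (t := t) _ Hp); exists j.
  rewrite Ek in Hstep.
  have [c' [Hc' Hs']] := tab_step_run Hcst Htst' (okk_conts HK) Hg Hs Hstep.
  exists c'; split=> //.
  - by apply: reach_trans Hr _; apply: reach_step Hc' (reach_refl _ _ _).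
  - exact: (good_step (okk_conts HK) Hg Hc').
  - exact: okk_step Hc'.
have [[ckT ceT cST] [Hr Hg HK [Hp Hv _]]] := H T (leqnn _).
have Ek : ckT = [::] by apply: (at_pc_inj Hp PT).
rewrite Ek in Hr; exists ceT, cST; split; first exact/reach_exec.
move=> x xi; have xv := allP Hinp x xi; apply: val_inj.
by have := Hv (Ordinal xv); rewrite (RT (Ordinal xv) xi) /= => <-.
Qed.

End Run.

(** * Nested tests *)

Section Levels.
Variables (sigma : signature) (v : nat).

Lemma ctests_inv (test : Type) (p : seq (instr sigma test)) t : List.In t (ctests p) ->
  exists q k, List.In (While t q :: k) (conts p).
Proof.
rewrite /ctests; elim: (conts p) => //= x s IH.
case: x => [|[x0 y0|x0 R ys|R ys y0|x0|t' q] x] /=; try by move=> /IH [q' [k H]]; exists q', k; right.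
case=> [->|/IH [q' [k H]]]; first by exists q, x; left.
by exists q', k; right.
Qed.

Definition subtests (m : nat) (L : seq (even_scheme sigma m.+1)) : seq (even_scheme sigma m) :=
  flatten [seq ctests (body (uprog u)) | u <- L].

Lemma In_subtests m (L : seq (even_scheme sigma m.+1)) u s :
  List.In u L -> List.In s (ctests (body (uprog u))) -> List.In s (subtests L).
Proof.
rewrite /subtests; elim: L => //= u' L IH; rewrite In_cat => -[->|/IH H] Hs; [by left|by right; apply: H].
Qed.

Lemma subtests_inv m (L : seq (even_scheme sigma m.+1)) s : List.In s (subtests L) ->
  exists2 u, List.In u L & List.In s (ctests (body (uprog u))).
Proof.
rewrite /subtests; elim: L => //= u' L IH; rewrite In_cat => -[H|/IH [u H1 H2]].
  by exists u' => //; left.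
by exists u => //; right.
Qed.

Definition okL m (L : seq (even_scheme sigma m)) : Prop :=
  forall u, List.In u L -> fit_even v u /\ onlymax_even u.

Lemma okL_sub m (L : seq (even_scheme sigma m.+1)) : okL L -> okL (subtests L).
Proof.
move=> HL s /subtests_inv [u Lu us]; have [Hu Ho] := HL u Lu.
have [q [k Hk]] := ctests_inv us.
move: Hu => /= /andP[_ /andP[_ Hf]].
have F : all (fit_instr (@fit_even sigma m) v) (While s q :: k).
  by apply: all_conts Hk => // t q' /andP[].
have O : all (onlymax_instr (@onlymax_even sigma m)) (While s q :: k).
  by apply: all_conts Hk => // t q' /andP[].
by move: F O => /= /andP[/andP[F _] _] /andP[/andP[O _] _].
Qed.

Fixpoint szL (c : nat) (m : nat) : seq (even_scheme sigma m) -> bool :=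
  match m with
  | 0 => fun=> true
  | m'.+1 => fun L =>
      all (fun u => size (conts (body (uprog u))) <= c) L && (size L <= c) && @szL c m' (subtests L)
  end.

Lemma evt_szL m (L : seq (even_scheme sigma m)) : evt (fun c => szL c L).
Proof.
elim: m L => [|m IH] L /=; first by exists 0.
apply: evt_and => //; apply: evt_and; last by exists (size L).
by apply: evt_all => u _; exists (size (conts (body (uprog u)))).
Qed.

Section Def.
Variables (N B : nat) (bit : nat -> Prop) (cst dig : nat -> nat).
Variables (S : nat -> nat -> Prop) (R : nat -> nat -> nat -> nat).
Local Notation P := (N.+1 ^ v).

Definition code (rho : nat -> nat) : nat := lexv N.+1 [seq rho x | x <- iota 0 v].

(** A test of positive level is looked up among the claims [S] instead of being evaluated: claim
    [j * P + y] says that the [j]-th scheme of the list accepts the values coded by [y]. *)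
Definition tstn (m : nat) : seq (even_scheme sigma m) -> even_scheme sigma m -> (nat -> nat) -> Prop :=
  match m with
  | 0 => fun _ phi rho => qfn N bit cst rho phi
  | m'.+1 => fun L u rho =>
      exists2 j, List.In j (iota 0 (size L)) & onth L j = Some u /\ S m'.+1 (j * P + code rho)
  end.

(** Claim [z] is backed by one recorded run for every choice [y'] of the quantified variables.
    Digits come from the table [dig], since terms contain no division. *)
Definition valid (m : nat) (L' : seq (even_scheme sigma m)) (u : even_scheme sigma m.+1) (z y : nat) : Prop :=
  forall y', y' < P ->
    (forall x : 'I_v, nat_of_ord x \notin uvars u -> dig (pair x y') = dig (pair x y)) ->
    tab_run v N cst (tstn L') (conts (body (uprog u))) (R m.+1 (pair z y')) B (uprog u)
      (fun x => if x < v then dig (pair x y') else 0).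

(** Only claims are backed; nothing here prevents a true claim from being left out, and comparing
    totals has to exclude that. *)
Fixpoint wit (m : nat) : seq (even_scheme sigma m) -> Prop :=
  match m with
  | 0 => fun=> True
  | m'.+1 => fun L =>
      wit (subtests L) /\
      forall j, List.In j (iota 0 (size L)) -> forall y, y < P -> S m'.+1 (j * P + y) ->
        match onth L j with
        | Some u => valid (subtests L) u (j * P + y) y
        | None => False
        end
  end.

Definition csum (m sz : nat) : nat := \sum_(i < sz) asb (S m i).

(** The factor exceeds every possible count on the current level, so totals compare the counts
    lexicographically, the innermost tests first. *)
Fixpoint tot (m : nat) : seq (even_scheme sigma m) -> nat :=
  match m with
  | 0 => fun=> 0
  | m'.+1 => fun L => tot (subtests L) * (size L * P).+1 + csum m'.+1 (size L * P)
  end.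

Definition digok : Prop := forall y, y < P ->
  (forall x : 'I_v, dig (pair x y) <= N) /\ code (fun x => dig (pair x y)) = y.

End Def.

Lemma csum_le S m sz : csum S m sz <= sz.
Proof. by rewrite /csum -[leqRHS]card_ord -sum1_card leq_sum // => i _; case: (asb _). Qed.

Lemma leq_add_eq (x y x' y' : nat) : x <= y -> x' <= y' -> x + x' = y + y' -> x = y /\ x' = y'.
Proof using. lia. Qed.

Section Sem.
Variables (w : seq bool) (n' : nat).
Local Notation A := (wstruct sigma w n').
Local Notation b := (ord_builtins n' : builtins A).
Local Notation N := n'.+1.
Local Notation P := (N.+1 ^ v).
Variables (B k c : nat) (bit : nat -> Prop) (cst dig : nat -> nat).
Hypothesis Hcst : forall i : 'I_(ncst sigma), cst i = cstn sigma w n' i.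
Hypothesis Hbit : forall p, p < code_len sigma N.+1 -> bit p <-> nth false w p.
Hypothesis Hdig : digok N dig.
Hypotheses (HB : run_bound c v N.+1 <= B) (Hkc : c <= k) (HkN : N <= k).

Definition zoff (e : env A) : Prop := forall x, v <= x -> e x = ord0.

Lemma nenv_lt (e : env A) s : all (fun x => x < N.+1) [seq nenv e x | x <- s].
Proof. by apply/allP => x /mapP [z _ ->]; apply: ltn_ord. Qed.

Lemma code_lt (e : env A) : code N (nenv e) < P.
Proof.
have : code N (nenv e) < N.+1 ^ size [seq nenv e x | x <- iota 0 v] by apply: lexv_lt => //; exact: nenv_lt.
by rewrite size_map size_iota.
Qed.

Lemma code_env y : y < P -> exists2 e : env A, zoff e &
  code N (nenv e) = y /\ (fun x => if x < v then dig (pair x y) else 0) = nenv e.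
Proof.
move=> yP; have [D1 D2] := Hdig yP.
have E : (fun x => if x < v then dig (pair x y) else 0) =
    @nenv sigma w n' (fun x => if x < v then inord (dig (pair x y)) else ord0).
  apply: functional_extensionality => x; rewrite /nenv; case: ltnP => xv //.
  by rewrite inordK // ltnS; exact: (D1 (Ordinal xv)).
exists (fun x => if x < v then inord (dig (pair x y)) else ord0); first by move=> x; rewrite leqNgt => /negbTE ->.
split; last exact: E.
rewrite -E -[RHS]D2 /code; congr lexv; apply/eq_in_map => x; rewrite mem_iota /= => ->.
by [].
Qed.

Lemma code_inj (rho rho' : nat -> nat) : (forall x, x < v -> rho x <= N) -> (forall x, x < v -> rho' x <= N) ->
  code N rho = code N rho' -> forall x, x < v -> rho x = rho' x.
Proof.
move=> H H' /lexv_inj E x xv.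
have Ea (r : nat -> nat) : (forall x, x < v -> r x <= N) -> all (fun x => x < N.+1) [seq r x | x <- iota 0 v].
  by move=> Hr; apply/allP => z /mapP [y]; rewrite mem_iota ltnS => /andP[_ /Hr] ? ->.
have /(congr1 (fun s => nth 0 s x)) := E ltac:(by rewrite !size_map) (Ea _ H) (Ea _ H').
by rewrite !(nth_map 0) ?size_iota // nth_iota.
Qed.

Lemma nenv_le (e : env A) x : nenv e x <= N.
Proof. by rewrite -ltnS; apply: ltn_ord. Qed.

Lemma code_nenv_inj (e e' : env A) : zoff e -> zoff e' -> code N (nenv e) = code N (nenv e') -> e = e'.
Proof.
move=> He He' /code_inj E; apply: functional_extensionality => x.
case: (ltnP x v) => xv; last by rewrite He ?He'.
by apply: val_inj; apply: E xv => y _; exact: nenv_le.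
Qed.

Lemma dig_code (e : env A) x : x < v -> dig (pair x (code N (nenv e))) = nenv e x.
Proof.
move=> xv; have [D1 D2] := Hdig (code_lt e).
apply: (code_inj (rho := fun x => dig (pair x (code N (nenv e))))) D2 _ xv => y yv; last exact: nenv_le.
exact: (D1 (Ordinal yv)).
Qed.

Definition Tset (m : nat) (L : seq (even_scheme sigma m)) (z : nat) : Prop :=
  exists j u (e : env A), [/\ z = j * P + code N (nenv e), onth L j = Some u, zoff e & even_accepts b u e].

Fixpoint agree (S : nat -> nat -> Prop) (m : nat) : seq (even_scheme sigma m) -> Prop :=
  match m with
  | 0 => fun=> True
  | m'.+1 => fun L => agree S (subtests L) /\ forall z, z < size L * P -> S m'.+1 z <-> Tset L z
  end.

Lemma onth_In (T : Type) (s : seq T) j x : onth s j = Some x -> List.In x s /\ j < size s.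
Proof.
elim: s j => [|y s IH] [|j] //=; first by case=> ->; split; [left|].
by move/IH => [H1 H2]; split; [right|].
Qed.

Lemma onth_some (T : Type) (s : seq T) j : j < size s -> exists x, onth s j = Some x.
Proof. by elim: s j => //= x s IH [|j] Hj; [exists x|exact: IH]. Qed.

Lemma In_onth (T : Type) (s : seq T) x : List.In x s -> exists j, onth s j = Some x.
Proof. by elim: s => //= y s IH [->|/IH [j Hj]]; [exists 0|exists j.+1]. Qed.

Lemma divP j y j' y' : y < P -> y' < P -> j * P + y = j' * P + y' -> j = j' /\ y = y'.
Proof using.
move=> H H' E; have Ej : j = j'.
  have := congr1 (divn^~ P) E; by rewrite !divnMDl ?expn_gt0 // !divn_small // !addn0.
by split=> //; move: E; rewrite Ej => /addnI.
Qed.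

Lemma jP_lt j y sz : j < sz -> y < P -> j * P + y < sz * P.
Proof using. by move=> Hj Hy; have : j.+1 * P <= sz * P by [rewrite leq_mul2r Hj orbT]; rewrite mulSn; apply: leq_trans; rewrite addnC ltn_add2r. Qed.

Lemma Tset_onth m (L : seq (even_scheme sigma m)) j u (e : env A) : onth L j = Some u -> zoff e ->
  (Tset L (j * P + code N (nenv e)) <-> even_accepts b u e).
Proof.
move=> Hu He; split; last by exists j, u, e.
case=> j' [u' [e' [/divP [] //]]]; try exact: code_lt.
move=> <- /(code_nenv_inj He) E Hu' /E <-.
by move: Hu'; rewrite Hu => -[->].
Qed.

Lemma tstn_agree S m (L : seq (even_scheme sigma m)) s (e : env A) : agree S L -> List.In s L -> zoff e ->
  (tstn N bit cst S L s (nenv e) <-> even_accepts b s e).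
Proof.
case: m L s => [|m] L s /= HS HL He; first exact: qfn_holds.
case: HS => _ HS.
have Hz j u : onth L j = Some u -> (S m.+1 (j * P + code N (nenv e)) <-> even_accepts b u e).
  move=> Hj; rewrite HS ?(Tset_onth Hj) //; apply: jP_lt (code_lt e).
  by have [] := onth_In Hj.
split; first by case=> j _ [Hj]; rewrite (Hz j s Hj).
move=> Hacc; have [j Hj] := In_onth HL; exists j; first by rewrite In_iota; have [_] := onth_In Hj.
by split=> //; apply/(Hz j s Hj).
Qed.

Lemma run_bound_mono sz : sz <= c -> run_bound sz v N.+1 <= B.
Proof. by move=> H; apply: leq_trans HB; rewrite leq_mul2r ltnS H orbT. Qed.

Lemma szL_In m (L : seq (even_scheme sigma m.+1)) u : szL c L -> List.In u L -> size (conts (body (uprog u))) <= c.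
Proof.
move=> /= /andP[/andP[H _] _]; elim: L H => //= u' L IH /andP[H1 H2] [<- //|]; exact: IH.
Qed.

Lemma tab_run_even S m (L : seq (even_scheme sigma m.+1)) u (e : env A) :
  okL L -> szL c L -> agree S (subtests L) -> List.In u L -> zoff e ->
  (prog_accepts b (@even_accepts sigma A b m) (uprog u) e <->
   exists f, (forall x, f x <= k) /\
     tab_run v N cst (tstn N bit cst S (subtests L)) (conts (body (uprog u))) f B (uprog u) (nenv e)).
Proof.
move=> HL Hc HS Hu He.
have [/= /andP[_ Hf] Ho] := HL u Hu; have Hsz := szL_In Hc Hu.
apply: (tab_runP Hcst Hf Ho) => //.
- move=> s e1 He1 Hs; apply: tstn_agree => //; exact: In_subtests Hs.
- exact: run_bound_mono.
- exact: leq_trans Hsz Hkc.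
Qed.

(** If the claims below are exactly the truth, the recorded runs branch correctly at every test,
    whether it succeeds or fails; they are then genuine accepting runs. *)
Lemma wit_sound S R m (L : seq (even_scheme sigma m.+1)) :
  (forall a b' q, R a b' q <= k) -> okL L -> szL c L -> wit N B bit cst dig S R L -> agree S (subtests L) ->
  forall z, z < size L * P -> S m.+1 z -> Tset L z.
Proof.
move=> HR HL Hc [_ HW] HS z Hz Sz.
have P0 : 0 < P by rewrite expn_gt0.
have Hj : z %/ P < size L by rewrite ltn_divLR.
have Hy : z %% P < P by rewrite ltn_mod.
have Ez := divn_eq z P; rewrite Ez in Sz.
have := HW (z %/ P) _ _ Hy Sz; case Eu: (onth _ _) => [u|] Hv; last by case: Hv; rewrite In_iota.
have {}Hv := Hv ltac:(by rewrite In_iota).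
have [e He [Ec Ee]] := code_env Hy.
exists (z %/ P), u, e; split=> //; first by rewrite Ec.
have [Hu _] := onth_In Eu.
move=> e' He'; have [/= /andP[Huv _] _] := HL u Hu.
have He'z : zoff e'.
  move=> x vx; rewrite He' ?He //; apply/negP => xu.
  by have := allP Huv x xu; lia.
apply/(tab_run_even HL Hc HS Hu He'z).
exists (R m.+1 (pair (z %/ P * P + z %% P) (code N (nenv e')))); split=> //.
have := Hv (code N (nenv e')) (code_lt e').
rewrite (_ : (fun x => if x < v then _ else 0) = nenv e'); last first.
  apply: functional_extensionality => x; case: ltnP => xv; first exact: dig_code.
  by rewrite /nenv He'z.
by apply=> x xu; rewrite dig_code // -Ec dig_code // /nenv He'.
Qed.

Lemma csum_mono S S' m sz : (forall z, z < sz -> S m z -> S' m z) ->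
  csum S m sz <= csum S' m sz /\ (csum S m sz = csum S' m sz -> forall z, z < sz -> S m z <-> S' m z).
Proof using.
rewrite /csum; elim: sz => [|sz IH] H; first by rewrite !big_ord0.
rewrite !big_ord_recr /=.
have [I1 I2] := IH (fun z Hz => H z (ltnW Hz)).
have Hs := H sz (ltnSn _).
have Hb : (asb (S m sz) : nat) <= asb (S' m sz).
  by case E: (asb (S m sz)) => //; move/asbP: E => /Hs /asbP ->.
split; first exact: leq_add.
move=> E; have [E1 E2] := leq_add_eq I1 Hb E.
move=> z; rewrite ltnS leq_eqVlt => /orP[/eqP ->|Hz]; last exact: I2.
split=> // /asbP; move: E2; case: (asb (S' m sz)) => // E2 _; apply/asbP.
by move: E2; case: (asb _).
Qed.

(* Earlier levels dominate: the weighted count is largest exactly when every level is complete. *)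
Lemma tot_max S R St m (L : seq (even_scheme sigma m)) :
  (forall a b' q, R a b' q <= k) -> okL L -> szL c L -> wit N B bit cst dig S R L -> agree St L ->
  tot N S L <= tot N St L /\ (tot N S L = tot N St L -> agree S L).
Proof.
move=> HR; elim: m L => [|m IH] L HL Hc HW HSt //.
case: (HSt) => HSt1 HSt2; case: (HW) => HW1 _; have /= /andP[_ Hc1] := Hc.
have [I1 I2] := IH _ (okL_sub HL) Hc1 HW1 HSt1.
rewrite /=; set W := (size L * P).+1.
have C1 : csum S m.+1 (size L * P) < W by rewrite ltnS csum_le.
move: I1; rewrite leq_eqVlt => /orP[/eqP E|Hlt]; last first.
  have Hmul : (tot N S (subtests L)).+1 * W <= tot N St (subtests L) * W by rewrite leq_mul2r Hlt orbT.
  rewrite mulSn in Hmul.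
  have Hlt' : tot N S (subtests L) * W + csum S m.+1 (size L * P) < tot N St (subtests L) * W + csum St m.+1 (size L * P).
    by apply: (@leq_trans (W + tot N S (subtests L) * W)); [rewrite addnC ltn_add2r|apply: leq_trans Hmul (leq_addr _ _)].
  by split; [exact: ltnW|move=> E; rewrite E ltnn in Hlt'].
have HS := I2 E.
have Hsub z : z < size L * P -> S m.+1 z -> St m.+1 z.
  by move=> Hz Sz; apply/HSt2 => //; apply: wit_sound HW HS _ Hz Sz.
have [M1 M2] := csum_mono Hsub; rewrite E; split; first by rewrite leq_add2l.
move=> /addnI /M2 HE; split=> // z Hz; rewrite -HSt2 //; exact: HE.
Qed.

Lemma wit_ext S R R' m (L : seq (even_scheme sigma m)) : (forall l, l <= m -> R l = R' l) ->
  wit N B bit cst dig S R L -> wit N B bit cst dig S R' L.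
Proof.
elim: m L => [|m IH] L HR //= [H1 H2]; split; first by apply: IH H1 => l lm; apply: HR; lia.
move=> j Hj y Hy Sz; have := H2 j Hj y Hy Sz; case: (onth L j) => // u Hv y' Hy' Hd.
by have := Hv y' Hy' Hd; rewrite HR.
Qed.

Lemma wit_complete S m (L : seq (even_scheme sigma m)) : okL L -> szL c L -> agree S L ->
  exists R, (forall a b' q, R a b' q <= k) /\ wit N B bit cst dig S R L.
Proof.
elim: m L => [|m IH] L HL Hc HS; first by exists (fun _ _ _ => 0).
case: (HS) => HS1 HS2; have /= /andP[_ Hc1] := Hc.
have [R0 [HR0 HW0]] := IH _ (okL_sub HL) Hc1 HS1.
(* A table is chosen for each pair of a claim and a choice of values for which some recorded run
   exists; injectivity of [pair] and uniqueness of quotient and remainder make the scheme [u] a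
   function of [zy]. *)
pose good zy f := forall j u y' z, zy = pair z y' -> onth L j = Some u ->
  (exists y, y < P /\ z = j * P + y) -> y' < P ->
  (exists f0, (forall x, f0 x <= k) /\ tab_run v N cst (tstn N bit cst S (subtests L)) (conts (body (uprog u))) f0 B (uprog u)
    (fun x => if x < v then dig (pair x y') else 0)) ->
  tab_run v N cst (tstn N bit cst S (subtests L)) (conts (body (uprog u))) f B (uprog u)
    (fun x => if x < v then dig (pair x y') else 0).
have Hex zy : {f | (forall x, f x <= k) /\ good zy f}.
  apply: constructive_indefinite_description.
  case: (classic (exists j u y' z f0, [/\ zy = pair z y', onth L j = Some u, (exists y, y < P /\ z = j * P + y),
    (forall x, f0 x <= k) & tab_run v N cst (tstn N bit cst S (subtests L)) (conts (body (uprog u))) f0 B (uprog u)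
    (fun x => if x < v then dig (pair x y') else 0)])).
    case=> j [u [y' [z [f0 [Ezy Eu [y [yP Ez]] Hf0 HT]]]]]; exists f0; split=> // j1 u1 y1 z1.
    rewrite Ezy => /pair_inj [<- <-] Hu1 [y2 [y2P E2]] _ _.
    have [Ej _] := divP yP y2P (etrans (esym Ez) E2).
    by move: Hu1; rewrite -Ej Eu => -[<-].
  move=> Hn; exists (fun=> 0); split=> // j u y' z Ez Eu Ey _ [f0 [Hf0 HT]].
  by case: Hn; exists j, u, y', z, f0.
exists (fun l zy => if l == m.+1 then proj1_sig (Hex zy) else R0 l zy); split.
  move=> a b' q; case: eqP => _; last exact: HR0.
  by have [] := proj2_sig (Hex b').
split.
  apply: (wit_ext (R := R0)) HW0 => l lm; apply: functional_extensionality => zy.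
  by case: eqP => // E; lia.
move=> j Hj y Hy Sz; have {}Hj : j < size L by move: Hj; rewrite In_iota.
have HT := proj1 (HS2 _ (jP_lt Hj Hy)) Sz.
have [u0 Hu0] := onth_some Hj; case Eu: (onth L j) => [u|]; last by rewrite Hu0 in Eu.
move=> y' Hy' Hd; rewrite eqxx.
have [_ Hgood] := proj2_sig (Hex (pair (j * P + y) y')).
apply: (Hgood _ _ _ _ erefl Eu) => //; first by exists y.
have [e He [Ec Ee]] := code_env Hy; have [e' He' [Ec' Ee']] := code_env Hy'.
rewrite Ee'; have [Hu _] := onth_In Eu.
apply/(tab_run_even HL Hc HS1 Hu He').
have : even_accepts b u e by apply/(Tset_onth Eu He); rewrite Ec.
apply=> x xu; apply: val_inj.
case: (ltnP x v) => xv; last by rewrite He ?He'.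
have := Hd (Ordinal xv) xu; rewrite /= -Ec -Ec' !dig_code //.
Qed.

Fixpoint Strue (m : nat) : seq (even_scheme sigma m) -> nat -> nat -> Prop :=
  match m with
  | 0 => fun _ _ _ => False
  | m'.+1 => fun L l z => if l == m'.+1 then Tset L z else Strue (subtests L) l z
  end.

Lemma agree_ext S S' m (L : seq (even_scheme sigma m)) : (forall l, l <= m -> S l = S' l) -> agree S L -> agree S' L.
Proof using.
elim: m L => [|m IH] L H //= [H1 H2]; split; first by apply: IH H1 => l lm; apply: H; exact: leqW.
by rewrite -H.
Qed.

Lemma agree_true m (L : seq (even_scheme sigma m)) : agree (Strue L) L.
Proof using.
elim: m L => [|m IH] L //=; split; last by move=> z _; rewrite eqxx.
apply: agree_ext (IH (subtests L)) => l lm; apply: functional_extensionality => z.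
by case: eqP => // E; rewrite E ltnn in lm.
Qed.

End Sem.

End Levels.

Lemma deff_ren h s : deff h -> deff (fun c e => h c (fun i => e (s i))).
Proof. by move=> H r g Hg; exact: (H (fun i => r (s i)) g Hg). Qed.

Lemma defp_ren h s : defp h -> defp (fun c e => h c (fun i => e (s i))).
Proof. by move=> H r g Hg; exact: (H (fun i => r (s i)) g Hg). Qed.

(** * Census certificates as one function *)

Section Cert.
Variables (sigma : signature) (v c : nat).

Section Def.
Variables (len : nat) (bit : nat -> Prop) (F : nat -> nat).

(** The first component selects a table: 0 the largest element, 1 the constants, 2 the digits of
    codes, 3 the claims, 4 the recorded runs, 5 the partial counts of claims. *)
Definition cN := F (pair 0 0).
Definition ccst x := F (pair 1 x).
Definition cdig x := F (pair 2 x).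
Definition ctrue (m z : nat) : Prop := F (pair 3 (pair m z)) = 1.
Definition cR (m zy q : nat) : nat := F (pair 4 (pair m (pair zy q))).
Definition ccnt (m z : nat) : nat := F (pair 5 (pair m z)).
Local Notation P := (cN.+1 ^ v).

Definition coded_cert : Prop :=
  0 < cN /\ len = code_len sigma cN.+1 /\ (forall x, x < cN.+1 -> bit x) /\ ~ bit cN.+1 /\
  forall i : 'I_(ncst sigma), ccst i < cN.+1 /\
    forall y, y < cN.+1 -> (bit (cst_pos sigma cN.+1 i y) <-> y = ccst i).

(** Terms contain no counting, so the certificate tabulates the number of claims below each [z]. *)
Fixpoint cnt_cert (m : nat) : seq (even_scheme sigma m) -> Prop :=
  match m with
  | 0 => fun=> True
  | m'.+1 => fun L => cnt_cert (subtests L) /\ ccnt m'.+1 0 = 0 /\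
      forall z, z < size L * P -> (ctrue m'.+1 z -> ccnt m'.+1 z.+1 = (ccnt m'.+1 z).+1) /\
                                  (~ ctrue m'.+1 z -> ccnt m'.+1 z.+1 = ccnt m'.+1 z)
  end.

Fixpoint ctot (m : nat) : seq (even_scheme sigma m) -> nat :=
  match m with
  | 0 => fun=> 0
  | m'.+1 => fun L => ctot (subtests L) * (size L * P).+1 + ccnt m'.+1 (size L * P)
  end.

Definition cert (m : nat) (L : seq (even_scheme sigma m)) : Prop :=
  coded_cert /\ digok v cN cdig /\
  wit v cN (run_bound c v cN.+1) bit ccst cdig ctrue cR L /\ cnt_cert L.

End Def.

Section Definable.

Lemma dt_cN (F : ctx -> (nat -> nat) -> nat -> nat) : deff F -> dterm (fun c e => cN (F c e)).
Proof. by move=> HF; apply: (HF id); dtm. Qed.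

Lemma dt_run_bound sz g : dterm g -> dterm (fun c e => run_bound sz v (g c e)).
Proof. by move=> Hg; rewrite /run_bound; dtm. Qed.

Lemma dt_code N (rho : nat -> ctx -> (nat -> nat) -> nat) : dterm N -> (forall x, dterm (rho x)) ->
  dterm (fun c e => code v (N c e) (fun x => rho x c e)).
Proof. by move=> HN Hr; apply: dt_lexv_map => //; exact: dt_succ. Qed.

Lemma deft_tstn bit F m (L : seq (even_scheme sigma m)) : defp bit -> deff F ->
  deft (fun c e => tstn v (cN (F c e)) (bit c e) (ccst (F c e)) (ctrue (F c e)) L).
Proof.
move=> Hb HF; case: m L => [|m] L r s rho Hr /=.
  have H1 : dterm (fun c e => cN (F c (fun i => e (r i)))) by exact: (dt_cN (deff_ren r HF)).
  have H2 : deff (fun c e => ccst (F c (fun i => e (r i)))).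
    by move=> r' g Hg; apply: (HF (fun i => r' (r i))); dtm.
  exact: (df_qfn id s H1 (defp_ren r Hb) H2 Hr).
have HN : dterm (fun c e => cN (F c (fun i => e (r i)))) by exact: (dt_cN (deff_ren r HF)).
apply: df_exs => j; apply: df_and; first exact: df_const.
apply: df_eq; last exact: dt_num.
apply: (HF r); apply: dt_pair; first exact: dt_num.
apply: dt_pair; first exact: dt_num.
apply: dt_add; last exact: dt_code.
by apply: dt_mul; [exact: dt_num|apply: dt_exp; exact: dt_succ].
Qed.

Lemma df_valid bit F m (L' : seq (even_scheme sigma m)) u z y : defp bit -> deff F -> dterm z -> dterm y ->
  defin (fun c' e => valid v (cN (F c' e)) (run_bound c v (cN (F c' e)).+1) (bit c' e) (ccst (F c' e)) (cdig (F c' e))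
    (ctrue (F c' e)) (cR (F c' e)) L' u (z c' e) (y c' e)).
Proof.
move=> Hb HF Hz Hy; rewrite /valid.
have HN := dt_cN HF.
have Hb1 := @defp_ren _ S Hb; have HF1 := @deff_ren _ S HF; have HN1 := dt_cN HF1.
apply: df_all; first by apply: dt_exp; exact: dt_succ.
apply: df_imp.
  apply: df_allf => x; apply: df_imp; first exact: df_const.
  apply: df_eq; apply: (HF S); dtm.
pose f1 := fun (c' : ctx) (e : nat -> nat) q => cR (F c' (fun i => e i.+1)) m.+1 (pair (z c' (fun i => e i.+1)) (e 0)) q.
have Hf1 : deff f1.
  by move=> r g Hg; apply: (HF1 r); dtm; exact: (@dt_ren z (fun i => r i.+1)).
have Hcst : deff (fun c' e => ccst (F c' (fun i => e i.+1))).
  by move=> r g Hg; apply: (HF (fun i => r i.+1)); dtm.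
have HB : dterm (fun c' e => run_bound c v (cN (F c' (fun i => e i.+1))).+1).
  by apply: dt_run_bound; exact: dt_succ.
have Hrho x : dterm (fun c' e => if x < v then cdig (F c' (fun i => e i.+1)) (pair x (e 0)) else 0).
  by apply: dt_if; [apply: (HF S)|]; dtm.
have X := (@df_tab_run _ _ v _ _ _ _ HN1 Hcst Hf1 (deft_tstn L' Hb1 HF1) (conts (body (uprog u))) _ id (uprog u) _ HB Hrho).
exact: X.
Qed.

Lemma df_wit bit F m (L : seq (even_scheme sigma m)) : defp bit -> deff F ->
  defin (fun c' e => wit v (cN (F c' e)) (run_bound c v (cN (F c' e)).+1) (bit c' e) (ccst (F c' e)) (cdig (F c' e))
    (ctrue (F c' e)) (cR (F c' e)) L).
Proof.
move=> Hb HF; have HN := dt_cN HF.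
elim: m L => [|m IH] L /=; first exact: df_const.
apply: df_and; first exact: IH.
apply: df_alls => j; apply: df_all; first by apply: dt_exp; exact: dt_succ.
have Hb1 := @defp_ren _ S Hb; have HF1 := @deff_ren _ S HF; have HN1 := dt_cN HF1.
have Hz : dterm (fun c' e => j * (cN (F c' (fun i => e i.+1))).+1 ^ v + e 0) by dtm.
apply: df_imp.
  by apply: df_eq; [apply: (HF S)|]; dtm.
case: (onth L j) => [u|]; last exact: df_const.
exact: (df_valid _ _ Hb1 HF1 Hz (dt_var 0)).
Qed.

Lemma dt_ctot F m (L : seq (even_scheme sigma m)) : deff F -> dterm (fun c e => ctot (F c e) L).
Proof.
move=> HF; have HN := dt_cN HF; elim: m L => [|m IH] L /=; first exact: dt_num.
by apply: dt_add; [apply: dt_mul => //|apply: (HF id)]; dtm.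
Qed.

Lemma df_cert len bit F m (L : seq (even_scheme sigma m)) : dterm len -> defp bit -> deff F ->
  defin (fun c' e => cert (len c' e) (bit c' e) (F c' e) L).
Proof.
move=> Hl Hb HF; have HN := dt_cN HF; have HF1 := @deff_ren _ S HF; have HN1 := dt_cN HF1.
apply: df_and.
  apply: df_and; first by apply: df_lt; dtm.
  apply: df_and; first by apply: df_eq => //; apply: dt_code_len; dtm.
  apply: df_and; first by apply: df_all; dtm; apply: (Hb S); dtm.
  apply: df_and; first by apply: df_not; apply: (Hb id); dtm.
  apply: df_allf => i; apply: df_and; first by apply: df_lt; [apply: (HF id)|]; dtm.
  apply: df_all; first by dtm.
  apply: df_iff; first by apply: (Hb S); apply: dt_cst_pos; dtm.
  by apply: df_eq; [|apply: (HF S)]; dtm.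
apply: df_and.
  apply: df_all; first by dtm.
  apply: df_and; first by apply: df_allf => x; apply: df_le; [apply: (HF S)|]; dtm.
  apply: df_eq; last exact: dt_var.
  by apply: (dt_code (rho := fun x c' e => cdig (F c' (fun i => e i.+1)) (pair x (e 0)))) => // x; apply: (HF S); dtm.
apply: df_and; first exact: df_wit.
elim: m L => [|m IH] L /=; first exact: df_const.
apply: df_and; first exact: IH.
apply: df_and; first by apply: df_eq; [apply: (HF id)|]; dtm.
apply: df_all; first by dtm.
have HS : defin (fun c' e => ctrue (F c' (fun i => e i.+1)) m.+1 (e 0)).
  by apply: df_eq; [apply: (HF S)|]; dtm.
have H1 : dterm (fun c' e => ccnt (F c' (fun i => e i.+1)) m.+1 (e 0)) by apply: (HF S); dtm.
have H2 : dterm (fun c' e => ccnt (F c' (fun i => e i.+1)) m.+1 (e 0).+1) by apply: (HF S); dtm.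
apply: df_and; apply: df_imp; [exact: HS|by apply: df_eq; [exact: H2|exact: dt_succ]|exact: (df_not HS)|exact: df_eq].
Qed.

End Definable.

Section Sem.
Variables (w : seq bool) (bit : nat -> Prop) (k m : nat) (L : seq (even_scheme sigma m)).
Hypothesis Hbit : forall p, p < size w -> bit p <-> nth false w p.
Hypotheses (HL : okL v L) (Hc : szL c L).

Lemma coded_certP F : coded_cert (size w) bit F <-> exists n',
  [/\ coded sigma w n'.+2, cN F = n'.+1 & forall i : 'I_(ncst sigma), ccst F i = cstn sigma w n' i].
Proof.
have Hcp N (i : 'I_(ncst sigma)) y : size w = code_len sigma N -> y < N -> cst_pos sigma N i y < size w.
  move=> -> yN; rewrite /cst_pos /code_len ltn_add2l ltn_add2l.
  have : i.+1 * N <= ncst sigma * N by rewrite leq_mul2r ltn_ord orbT.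
  by rewrite mulSn; lia.
have Hp N : size w = code_len sigma N -> N < size w by move=> ->; rewrite /code_len ltnS leq_addr.
split.
  rewrite /coded_cert; case EN: (cN F) => [|n'] [// _ [Hs [H1 [H2 H3]]]]; exists n'.
  have Hcod : coded sigma w n'.+2.
    split=> //.
    - by move=> x xn; apply/Hbit; [apply: ltn_trans (Hp _ Hs)|apply: H1].
    - by apply/negbTE/negP => H; apply: H2; apply/Hbit => //; apply: Hp.
    - move=> i; have [Hi Hi2] := H3 i; exists (ccst F i) => // y yn.
      apply/idP/eqP => [|E]; last by apply/Hbit; [exact: Hcp|apply/Hi2].
      by move=> H; apply/Hi2 => //; apply/Hbit => //; exact: Hcp.
  split=> // i; have [Hi Hi2] := H3 i.
  have := wcstP i Hcod Hi; have /Hbit : cst_pos sigma n'.+2 i (ccst F i) < size w by exact: Hcp.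
  case=> HA _; rewrite HA; last exact/Hi2.
  by move/esym/eqP.
case=> n' [Hcod EN Hcst]; case: (Hcod) => n1 Hs H1 H2 H3; rewrite /coded_cert EN.
split=> //; split=> //; split.
  by move=> x xn; apply/Hbit; [apply: ltn_trans (Hp _ Hs)|apply: H1].
split; first by move=> /Hbit => /(_ (Hp _ Hs)); rewrite H2.
move=> i; rewrite Hcst; split; first exact: ltn_ord.
move=> y yn; rewrite Hbit ?(wcstP i Hcod) //; last exact: Hcp.
by split=> [/eqP|/eqP].
Qed.

Lemma cnt_certP F m' (L' : seq (even_scheme sigma m')) : cnt_cert F L' -> ctot F L' = tot v (cN F) (ctrue F) L'.
Proof.
elim: m' L' => [|m' IH] L' //= [/IH -> [H0 Hz]]; congr (_ + _).
suff H z : z <= size L' * (cN F).+1 ^ v -> ccnt F m'.+1 z = csum (ctrue F) m'.+1 z by apply: H.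
rewrite /csum; elim: z => [|z IHz] zs; first by rewrite big_ord0.
rewrite big_ord_recr /= -IHz 1?ltnW //; have [Z1 Z2] := Hz z zs.
case E: (asb _); first by rewrite addn1 Z1 //; apply/asbP.
by rewrite addn0 Z2 // => H; move/asbP: H; rewrite E.
Qed.

Lemma cert_sound F St n' : (forall x, F x <= k) -> c <= k -> cert (size w) bit F L -> coded sigma w n'.+2 ->
  agree v w n' St L ->
  [/\ cN F = n'.+1, ctot F L <= tot v n'.+1 St L
    & ctot F L = tot v n'.+1 St L -> agree v w n' (ctrue F) L].
Proof.
move=> HF ck [/coded_certP [n1 [Hcod EN Hcst]] [Hdig [HW /cnt_certP Etot]]] Hcod' HSt.
have En : n1 = n'.
  case: Hcod => _ _ P1 S1 _; case: Hcod' => _ _ P2 S2 _.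
  by case: (ltngtP n1 n') => // H; [move: (P2 n1.+2 H); rewrite S1|move: (P1 n'.+2 H); rewrite S2].
rewrite En in EN Hcst Hcod; rewrite EN in Hdig HW Etot.
have Hb p : p < code_len sigma n'.+2 -> bit p <-> nth false w p.
  by case: Hcod => _ <- _ _ _; apply: Hbit.
have Nk : n'.+1 <= k by rewrite -EN; apply: HF.
have HR a b q : cR F a b q <= k by apply: HF.
have [T1 T2] := tot_max Hcst Hb Hdig (leqnn _) ck Nk HR HL Hc HW HSt.
by rewrite Etot; split.
Qed.

Lemma agree_tot S S' n' m' (L' : seq (even_scheme sigma m')) : agree v w n' S L' -> agree v w n' S' L' ->
  tot v n'.+1 S L' = tot v n'.+1 S' L'.
Proof.
elim: m' L' => [|m' IH] L' //= [H1 H2] [H1' H2']; rewrite (IH _ H1 H1'); congr (_ + _).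
have [M1 _] := @csum_mono S S' m'.+1 _ (fun z Hz Sz => proj2 (H2' z Hz) (proj1 (H2 z Hz) Sz)).
have [M2 _] := @csum_mono S' S m'.+1 _ (fun z Hz Sz => proj2 (H2 z Hz) (proj1 (H2' z Hz) Sz)).
by apply/eqP; rewrite eqn_leq M1 M2.
Qed.

Lemma agree_iff S S' n' m' (L' : seq (even_scheme sigma m')) : (forall l z, S l z <-> S' l z) ->
  agree v w n' S L' -> agree v w n' S' L'.
Proof.
move=> HS; elim: m' L' => [|m' IH] L' //= [H1 H2]; split; first exact: IH.
by move=> z Hz; rewrite -HS; apply: H2.
Qed.

Lemma cnt_certI F n' m' (L' : seq (even_scheme sigma m')) : cN F = n'.+1 -> szL c L' -> c * n'.+2 ^ v <= k ->
  (forall l z, ccnt F l z = minn (csum (ctrue F) l z) k) -> cnt_cert F L'.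
Proof.
move=> EN + Hk HF; elim: m' L' => [|m' IH] L' //= /andP[/andP[_ Hs] Hc']; split; first exact: IH.
rewrite !HF EN; split; first by rewrite /csum big_ord0 min0n.
have Hle z : z <= size L' * n'.+2 ^ v -> minn (csum (ctrue F) m'.+1 z) k = csum (ctrue F) m'.+1 z.
  move=> Hz; apply/minn_idPl; apply: leq_trans (csum_le _ _ _) _; apply: leq_trans Hz _.
  by apply: leq_trans Hk; rewrite leq_mul2r Hs orbT.
move=> z Hz; rewrite !HF !Hle //; last exact: ltnW.
rewrite /csum big_ord_recr /=; split=> H.
  by have /asbP -> := H; rewrite addn1.
by case E: (asb _); [move/asbP: E|rewrite addn0].
Qed.

(** The true claims with their runs form a certificate, and it attains the largest total. *)
Lemma cert_complete n' : coded sigma w n'.+2 -> c * n'.+2 ^ v + c + n'.+2 <= k ->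
  exists F, [/\ forall x, F x <= k, cert (size w) bit F L, cN F = n'.+1,
    agree v w n' (ctrue F) L & ctot F L = tot v n'.+1 (@Strue sigma v w n' m L) L].
Proof.
move=> Hcod Hk.
have Hb p : p < code_len sigma n'.+2 -> bit p <-> nth false w p.
  by case: Hcod => _ <- _ _ _; apply: Hbit.
have ck : c <= k by lia.
have Nk : n'.+1 <= k by lia.
have [dig [Hdig Hdigk]] : exists dig, digok v n'.+1 dig /\ forall x, dig x <= n'.+1.
  have H y : exists s, y < n'.+2 ^ v -> [/\ size s = v, all (fun x => x < n'.+2) s & lexv n'.+2 s = y].
    case: (ltnP y (n'.+2 ^ v)) => [/(lexv_surj (isT : 0 < n'.+2)) [s Hs]|]; [by exists s|by exists [::]].
  pose g x y := minn (nth 0 (proj1_sig (constructive_indefinite_description _ (H y))) x) n'.+1.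
  have [dig [D1 D2]] := @pack g n'.+1 (fun x y => geq_minr _ _).
  exists dig; split=> // y yP; split=> //.
  have [S1 S2 S3] := proj2_sig (constructive_indefinite_description _ (H y)) yP.
  rewrite -[RHS]S3 /code; congr lexv; apply: (@eq_from_nth _ 0); rewrite size_map size_iota // => x xv.
  rewrite (nth_map 0) ?size_iota // nth_iota // D1 /g; apply/minn_idPl.
  by rewrite -ltnS; apply: (allP S2); rewrite mem_nth // S1.
pose cst x := minn (cstn sigma w n' x) k.
have Hcst (i : 'I_(ncst sigma)) : cst i = cstn sigma w n' i.
  by apply/minn_idPl; have := ltn_ord (wcst sigma w n' i); rewrite /cstn; lia.
pose St := @Strue sigma v w n' m L.
have [F3 [E3 L3]] := @pack (fun l z => asb (St l z)) k (fun l z => leq_trans (leq_b1 _) (leq_trans (isT : 0 < n'.+1) Nk)).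
pose S0 l z := F3 (pair l z) = 1.
have HS0 : agree v w n' S0 L.
  apply: agree_iff (agree_true v w n' L) => l z; rewrite /S0 E3; split=> [/asbP -> //|].
  by case E: (asb _) => // _; move/asbP: E.
have [R [HR HW]] := wit_complete Hcst Hb Hdig (leqnn (run_bound c v n'.+2)) ck Nk HL Hc HS0.
have HG l := @pack (R l) k (HR l).
pose G l := proj1_sig (constructive_indefinite_description _ (HG l)).
have GE l zy q : G l (pair zy q) = R l zy q by have [H1 _] := proj2_sig (constructive_indefinite_description _ (HG l)); exact: H1.
have GL l x : G l x <= k by have [_ H2] := proj2_sig (constructive_indefinite_description _ (HG l)); exact: H2.
have [F4 [E4 L4]] := @pack G k GL.
have [F5 [E5 L5]] := @pack (fun l z => minn (csum S0 l z) k) k (fun l z => geq_minr _ _).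
have [|F [EF LF]] := @pack (fun i x => match i with 0 => n'.+1 | 1 => cst x | 2 => dig x | 3 => F3 x | 4 => F4 x | _ => F5 x end) k.
  case=> [|[|[|[|[|i]]]]] x //; first [exact: geq_minr|exact: leq_trans (Hdigk x) Nk].
have FN : cN F = n'.+1 by rewrite /cN EF.
have Fc : ccst F = cst by apply: functional_extensionality => x; rewrite /ccst EF.
have Fd : cdig F = dig by apply: functional_extensionality => x; rewrite /cdig EF.
have FS : ctrue F = S0.
  by apply: functional_extensionality => l; apply: functional_extensionality => z; rewrite /ctrue EF.
have FR : cR F = R.
  apply: functional_extensionality => l; apply: functional_extensionality => z.
  by apply: functional_extensionality => q; rewrite /cR EF E4 GE.
have Hcc : cnt_cert F L.
  by apply: (cnt_certI FN Hc) => [|l z]; [lia|rewrite /ccnt EF E5 FS].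
exists F; split=> //.
- split; first by apply/coded_certP; exists n'; rewrite Fc.
  by rewrite FN Fc Fd FS FR.
- by rewrite FS.
- by rewrite (cnt_certP Hcc) FN FS; apply: agree_tot HS0 (agree_true _ _ _ _).
Qed.

End Sem.

End Cert.

(** * The second level is contained in NP *)

Lemma code0 v N w n' sigma : code v N (@nenv sigma w n' (fun=> ord0)) = 0.
Proof. by rewrite /code; elim: (iota 0 v) => //= x s ->. Qed.

Lemma Tset0 sigma v w n' m (L : seq (even_scheme sigma m)) u : onth L 0 = Some u ->
  (Tset v w n' L 0 <-> even_accepts (ord_builtins n' : builtins (wstruct sigma w n')) u (fun=> ord0)).
Proof.
move=> Hu; have H : zoff v (fun=> ord0 : wstruct sigma w n') by [].
by have := Tset_onth Hu H; rewrite mul0n code0.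
Qed.

Section Cert1.
Variables (sigma : signature) (v c : nat) (w : seq bool) (bit : nat -> Prop) (k : nat).
Variable L : seq (even_scheme sigma 1).
Hypothesis Hbit : forall p, p < size w -> bit p <-> nth false w p.
Hypotheses (HL : okL v L) (Hc : szL c L).

Lemma cert_sound1 F : (forall x, F x <= k) -> c <= k -> 0 < size L -> cert v c (size w) bit F L -> ctrue F 1 0 ->
  exists n', coded sigma w n'.+2 /\ Tset v w n' L 0.
Proof.
move=> HF ck HL0 [HCC [Hdig [HW _]]] HS.
have [n' [Hcod EN Hcst]] := proj1 (coded_certP Hbit Hc F) HCC.
exists n'; split=> //; rewrite EN in Hdig HW.
have Hb p : p < code_len sigma n'.+2 -> bit p <-> nth false w p.
  by case: Hcod => _ <- _ _ _; apply: Hbit.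
have Nk : n'.+1 <= k by rewrite -EN; apply: HF.
have HR a b q : cR F a b q <= k by apply: HF.
apply: (wit_sound Hcst Hb Hdig (leqnn _) ck Nk HR HL Hc HW) HS => //.
by rewrite muln_gt0 HL0 expn_gt0.
Qed.

End Cert1.

Theorem NPSB2_NP (sigma : signature) (Omega : problem sigma) : NPSB_s 2 Omega -> NP Omega.
Proof.
case=> r [_ Ho Hr].
have [v /(_ v (leqnn v)) Hf] := evt_even r.
pose L : seq (even_scheme sigma 1) := [:: r].
have HL : okL v L by move=> u [<-|].
have [c /(_ c (leqnn c)) Hc] := evt_szL L.
have [a Ha] : polyb (fun n => c * n ^ v + c + n).
  by repeat first [apply: polyb_add|apply: polyb_mul|apply: polyb_const|apply/polyb_exp|apply: polyb_id].
(* On words the base is the length plus one, and subtraction is no term; so the length [l] is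
   quantified. *)
have [f Hfm] : defin (fun x e => exists2 l, l < base x & base x = l.+1 /\
    (cert v c l (fun p => inp x 0 [:: p]) (fn x) L /\ ctrue (fn x) 1 0)).
  apply: df_ex; first exact: dt_base.
  apply: df_and; first by apply: df_eq; dtm.
  apply: df_and.
    apply: (@df_cert sigma v c (fun _ e => e 0) (fun x _ p => inp x 0 [:: p]) (fun x _ => fn x)).
    - exact: dt_var.
    - by move=> s g Hg; apply: df_inp1.
    - exact: deff_fn.
  by apply: df_eq; dtm.
case: (word_eso_NP a f) => M [HM1 HM2]; exists M; split=> // w; rewrite -HM2 {HM1 HM2 M}.
have Hbit p : p < size w -> word_inp w 0 [:: p] <-> nth false w p.
  by move=> Hp; rewrite /word_inp /= /word_fun Hp; case: (nth _ _ _).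
have HT n' : Omega (wstruct sigma w n') <-> Tset v w n' L 0.
  have X1 := @Tset0 sigma v w n' 1 L r erefl.
  have X2 := Hr (wstruct sigma w n') _ (ord_builtins_successor n').
  exact: iff_trans (iff_sym X2) (iff_sym X1).
rewrite encodingP; split.
  case=> n' [Hcod /HT HO]; have n1 : n'.+2 <= size w.
    by case: Hcod => _ -> _ _ _; rewrite /code_len; lia.
  have Hk : c * n'.+2 ^ v + c + n'.+2 <= (size w).+2 ^ a.
    apply: leq_trans (Ha _ _) _ => //; apply: leq_exp2; lia.
  have [F [F1 F2 F3 F4 _]] := cert_complete Hbit HL Hc Hcod Hk.
  exists F; split=> //; apply/Hfm; exists (size w) => //=; split=> //; split=> //.
  case: F4 => _ F4; apply/F4 => //=.
  by rewrite muln_gt0 expn_gt0.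
case=> F [HF /Hfm [l _ [/= [<-] [HC HS]]]].
pose k := c + (size w).+2 ^ a.
have HFk x : F x <= k by apply: leq_trans (HF x) (leq_addl _ _).
have [n' [Hcod /HT HO]] := cert_sound1 Hbit HL Hc HFk (leq_addr _ _) isT HC HS.
by exists n'.
Qed.

Lemma NPSB_odd_even (sigma : signature) (Omega : problem sigma) m : NPSB_s m.*2.+1 Omega -> NPSB_s m.*2.+2 Omega.
Proof.
rewrite /NPSB_s /= odd_double /= doubleK uphalf_double.
case=> r [Hw Ho Hr]; exists (UnivScheme [::] r); split=> // A b Hb.
rewrite -(Hr A b Hb) /=; split; first by apply.
move=> H e' He; rewrite (_ : e' = fun=> bzero b) //.
by apply: functional_extensionality => x; apply: He.
Qed.

(** * Adaptive bisection by an oracle machine *)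

(** In a query each bit is preceded by a mark that tells the input from the answers, so the border
    between them can be recognised. *)
Definition markw (m : bool) (w : seq bool) : seq bool := flatten [seq [:: m; x] | x <- w].

Definition encq (k1 k2 : bool) (w v : seq bool) : seq bool := k1 :: k2 :: markw true w ++ markw false v.

Section Spec.
Variables (M : otm) (O : language) (w : seq bool) (B : nat).
Local Notation step := (@otm_step M O w).

Lemma ostep_inv c c1 : step c c1 ->
  let: OConfig q i tp h z := c in
  q != o_accept M /\
  ((q != o_query M /\ exists q' di a d ob, o_trans q (in_symbol w i) (tp h) = (q', di, a, d, ob) /\
      c1 = OConfig q' (shift_in w di i) (write_cell tp h a) (shift d h) (if ob is Some x then rcons z x else z)) \/
   (q = o_query M /\ c1 = OConfig (if asb (O z) then o_yes M else o_no M) i tp h [::])).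
Proof.
case=> [q i tp h z q' di a d ob Ha Hq E|i tp h z Ha Hz|i tp h z Ha Hz]; split=> //.
- by left; split=> //; exists q', di, a, d, ob.
- by right; have /asbP -> := Hz.
- by right; case E: (asb _) => //; move/asbP: E.
Qed.

Definition ospec (c : otm_config M) (X : Prop) : Prop :=
  (forall c', clos_refl_trans _ step c c' -> oc_head c' <= B) /\
  ((exists c', clos_refl_trans _ step c c' /\ oc_state c' = o_accept M) <-> X).

Lemma rt_inv c c' : clos_refl_trans _ step c c' -> c = c' \/ exists c1, step c c1 /\ clos_refl_trans _ step c1 c'.
Proof.
move=> H; have {H} := clos_rt_rt1n _ _ _ _ H; case=> [|c1 c2 H1 H2]; first by left.
by right; exists c1; split=> //; apply: clos_rt1n_rt.
Qed.

Lemma ospec_step c c' X : (forall c1, step c c1 -> c1 = c') -> step c c' -> oc_state c <> o_accept M ->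
  oc_head c <= B -> ospec c' X -> ospec c X.
Proof.
move=> Hd Hs Ha Hh [H1 H2]; split.
  by move=> c1 /rt_inv [<-//|[c2 [/Hd -> H]]]; apply: H1.
rewrite -H2; split=> -[c1 [H E]].
  case: (rt_inv H) => [Ec|[c2 [/Hd Ec Hc]]]; first by rewrite Ec in Ha.
  by exists c1; split=> //; rewrite -Ec.
by exists c1; split=> //; apply: rt_trans H; apply: rt_step.
Qed.

Lemma ospec_trans q i tp h z q' di a d ob X :
  o_trans q (in_symbol w i) (tp h) = (q', di, a, d, ob) -> q != o_accept M -> q != o_query M -> h <= B ->
  ospec (OConfig q' (shift_in w di i) (write_cell tp h a) (shift d h) (if ob is Some x then rcons z x else z)) X ->
  ospec (OConfig q i tp h z) X.
Proof.
move=> E Ha Hq Hh; apply: ospec_step => //.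
- move=> c1 /ostep_inv [_ [[_ [q1 [di1 [a1 [d1 [ob1 [E1 ->]]]]]]]|[E1 _]]].
    by move: E1; rewrite E => -[<- <- <- <- <-].
  by rewrite E1 eqxx in Hq.
- by constructor.
- by apply/eqP.
Qed.

Lemma ospec_iff c X Y : (X <-> Y) -> ospec c X -> ospec c Y.
Proof. by move=> H [H1 H2]; split=> //; rewrite H2. Qed.

Lemma ospec_query i tp h z X : o_query M != o_accept M -> h <= B ->
  ospec (OConfig (if asb (O z) then o_yes M else o_no M) i tp h [::]) X ->
  ospec (OConfig (o_query M) i tp h z) X.
Proof.
move=> Ha Hh; apply: ospec_step => //; last exact/eqP.
- by move=> c1 /ostep_inv [_ [[/eqP //]|[_ ->]]].
- by case E: (asb _); constructor=> //; [apply/asbP|move/asbP; rewrite E].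
Qed.

Lemma ospec_accept i tp h z : h <= B -> ospec (OConfig (o_accept M) i tp h z) True.
Proof.
move=> Hh; split; last first.
  by split=> // _; exists (OConfig (o_accept M) i tp h z); split=> //; apply: rt_refl.
by move=> c' /rt_inv [<-//|[c1 [/ostep_inv [/eqP]]]].
Qed.

Lemma ospec_loop c : (forall c1, step c c1 -> c1 = c) -> oc_state c <> o_accept M -> oc_head c <= B -> ospec c False.
Proof.
move=> Hd Ha Hh.
have H c' : clos_refl_trans _ step c c' -> c' = c.
  move=> Hr; have {}Hr := clos_rt_rt1n _ _ _ _ Hr; move: Hd Ha Hh; elim: Hr => // x y z H1 _ IH Hd Ha Hh.
  have E := Hd _ H1; rewrite E in IH; exact: IH.
split; first by move=> c' /H ->.
by split=> // -[c' [/H -> ]].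
Qed.

End Spec.

(* Cell 0 of the work tape holds the kind of the pending query, the other cells the
   answers obtained so far; the oracle is asked about the input and these answers. *)
Definition cwork := ((bool * bool) + bool)%type.

Inductive cstate_ := QStart | QE0 | QE1 | QE2 | QE3 | QE4 | QE5 | QQuery | QYes | QNo
  | QBack of bool | QApp of bool | QWk | QIn | QAcc | QRej.

Definition cstate_code (q : cstate_) : nat :=
  match q with
  | QStart => 0 | QE0 => 1 | QE1 => 2 | QE2 => 3 | QE3 => 4 | QE4 => 5 | QE5 => 6 | QQuery => 7 | QYes => 8 | QNo => 9
  | QBack b => 10 + b | QApp b => 12 + b | QWk => 14 | QIn => 15 | QAcc => 16 | QRej => 17
  end.

Definition cstate_decode (n : nat) : cstate_ :=
  match n with
  | 0 => QStart | 1 => QE0 | 2 => QE1 | 3 => QE2 | 4 => QE3 | 5 => QE4 | 6 => QE5 | 7 => QQuery | 8 => QYes | 9 => QNo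
  | 10 => QBack false | 11 => QBack true | 12 => QApp false | 13 => QApp true | 14 => QWk | 15 => QIn | 16 => QAcc
  | _ => QRej
  end.

Lemma cstate_lt q : cstate_code q < 18.
Proof. by case: q => // -[]. Qed.

Lemma cstate_codeK : cancel (fun q => Ordinal (cstate_lt q)) (fun i : 'I_18 => cstate_decode i).
Proof. by case=> // -[]. Qed.

HB.instance Definition _ := Equality.copy cstate_ (can_type cstate_codeK).
HB.instance Definition _ := Choice.copy cstate_ (can_type cstate_codeK).
HB.instance Definition _ := Countable.copy cstate_ (can_type cstate_codeK).
HB.instance Definition _ := Finite.copy cstate_ (can_type cstate_codeK).

(** Kind [(false, true)] asks whether there are enough answers, [(false, false)] for the next
    answer, and [(true, true)] for the decision. A query erases the oracle tape, so [QE0] to [QE5]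
    write kind, input and answers anew each time. [QBack] goes to cell 0 and acts on the reply
    according to the kind found there: it sets the next kind, appends the reply through [QApp], or
    halts the protocol; [QWk] and [QIn] rewind the two heads. *)
Definition ctrans (q : cstate_) (s : insym) (a : option cwork) :
    cstate_ * move * option cwork * move * option bool :=
  match q with
  | QStart => (QE0, MStay, Some (inl (false, true)), MStay, None)
  | QE0 => (QE1, MStay, a, MStay, if a is Some (inl k) then Some k.1 else None)
  | QE1 => (QE2, MRight, a, MStay, if a is Some (inl k) then Some k.2 else None)
  | QE2 => if s is Bit x then (QE3, MStay, a, MStay, Some true) else (QE4, MStay, a, MRight, None)
  | QE3 => (QE2, MRight, a, MStay, if s is Bit x then Some x else None)
  | QE4 => if a is Some (inr x) then (QE5, MStay, a, MStay, Some false) else (QQuery, MStay, a, MStay, None)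
  | QE5 => (QE4, MStay, a, MRight, if a is Some (inr x) then Some x else None)
  | QYes => (QBack true, MStay, a, MStay, None)
  | QNo => (QBack false, MStay, a, MStay, None)
  | QBack ans =>
      match a with
      | Some (inl (false, false)) => (QApp ans, MStay, Some (inl (false, true)), MRight, None)
      | Some (inl (false, true)) => (QIn, MStay, Some (inl (ans, ans)), MStay, None)
      | Some (inl _) => (if ans then QAcc else QRej, MStay, a, MStay, None)
      | _ => (QBack ans, MStay, a, MLeft, None)
      end
  | QApp ans => if a is None then (QWk, MStay, Some (inr ans), MStay, None) else (QApp ans, MStay, a, MRight, None)
  | QWk => if a is Some (inl _) then (QIn, MStay, a, MStay, None) else (QWk, MStay, a, MLeft, None)
  | QIn => if s is LeftEnd then (QE0, MStay, a, MStay, None) else (QIn, MLeft, a, MStay, None)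
  | _ => (QRej, MStay, a, MStay, None)
  end.

Definition cmach : otm := @OTM cstate_ cwork QStart QAcc QQuery QYes QNo ctrans.

Section Machine.
Variables (O : language) (w : seq bool).

Definition ctape (kd : bool * bool) (v : seq bool) (i : nat) : option cwork :=
  if i is j.+1 then if j < size v then Some (inr (nth false v j)) else None else Some (inl kd).

Lemma write_same' (T : Type) (tp : nat -> T) h : write_cell tp h (tp h) = tp.
Proof. by apply: functional_extensionality => i; rewrite /write_cell; case: eqP => [->|]. Qed.

Lemma min_l x y : x <= y -> minn x y = x.
Proof. by move/minn_idPl. Qed.

Lemma write_kind kd kd' v : write_cell (ctape kd v) 0 (Some (inl kd')) = ctape kd' v.
Proof. by apply: functional_extensionality => -[|i]. Qed.

Lemma write_ans kd v b : write_cell (ctape kd v) (size v).+1 (Some (inr b)) = ctape kd (rcons v b).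
Proof.
apply: functional_extensionality => -[|i] //=; rewrite /write_cell eqSS size_rcons ltnS nth_rcons /=.
by case: ltngtP.
Qed.

Lemma markw_take m s j : j < size s -> markw m (take j.+1 s) = rcons (rcons (markw m (take j s)) m) (nth false s j).
Proof.
move=> Hj; rewrite (take_nth false Hj) /markw map_rcons flatten_rcons.
by rewrite -!cats1 -catA.
Qed.

Variable B : nat.
Local Notation spec := (@ospec cmach O w B).
Local Notation conf := (@OConfig cmach).

Lemma spec_in kd v i X : 0 <= B -> spec (conf QE0 0 (ctape kd v) 0 [::]) X ->
  i <= (size w).+1 -> spec (conf QIn i (ctape kd v) 0 [::]) X.
Proof.
move=> B0 H; elim: i => [|i IH] Hi.
  apply: ospec_trans => //=.
  by rewrite write_same' /shift_in /= min0n.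
apply: (@ospec_trans cmach O w B _ _ _ _ _ QIn MLeft) => //=.
  by case: (i < size w).
rewrite (write_same' (ctape kd v)) /shift_in /= min_l; last by lia.
by apply: IH; lia.
Qed.

Lemma spec_wk kd v i h X : h <= (size v).+1 -> (size v).+1 <= B -> i <= (size w).+1 ->
  spec (conf QE0 0 (ctape kd v) 0 [::]) X -> spec (conf QWk i (ctape kd v) h [::]) X.
Proof.
move=> Hh HB Hi H; elim: h Hh => [|h IH] Hh.
  apply: ospec_trans => //=.
  rewrite (write_same' (ctape kd v)) /shift_in /= min_l //.
  exact: spec_in.
apply: (@ospec_trans cmach O w B _ _ _ _ _ QWk MStay (ctape kd v h.+1) MLeft None) => //=.
- by case: ifP; reflexivity.
- by lia.
- rewrite (write_same' (ctape kd v) h.+1) /shift_in /= min_l //.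
  by apply: IH; lia.
Qed.

Lemma spec_back kd v i h ans X : h <= (size v).+1 -> (size v).+1 <= B -> i <= (size w).+1 ->
  spec (conf (QBack ans) i (ctape kd v) 0 [::]) X -> spec (conf (QBack ans) i (ctape kd v) h [::]) X.
Proof.
move=> Hh HB Hi H; elim: h Hh => [|h IH] Hh //.
apply: (@ospec_trans cmach O w B _ _ _ _ _ (QBack ans) MStay (ctape kd v h.+1) MLeft None) => //=; try by case: (ans).
- by case: ifP; reflexivity.
- by lia.
- rewrite (write_same' (ctape kd v) h.+1) /shift_in /= min_l //.
  by apply: IH; lia.
Qed.

Lemma spec_app kd v i ans d X : d <= size v -> (size v).+1 <= B -> i <= (size w).+1 ->
  spec (conf QWk i (ctape kd (rcons v ans)) (size v).+1 [::]) X ->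
  spec (conf (QApp ans) i (ctape kd v) (size v - d).+1 [::]) X.
Proof.
move=> Hd HB Hi H; elim: d Hd => [|d IH] Hd.
  rewrite subn0; apply: (@ospec_trans cmach O w B _ _ _ _ _ QWk MStay (Some (inr ans)) MStay None);
    [by rewrite /= ltnn|by case: (ans)|by case: (ans)|by []|].
  by rewrite write_ans /shift_in /= min_l.
have Hlt : size v - d.+1 < size v by lia.
apply: (@ospec_trans cmach O w B _ _ _ _ _ (QApp ans) MStay (ctape kd v (size v - d.+1).+1) MRight None) => //=; try by case: (ans).
- by rewrite Hlt.
- by lia.
- rewrite (write_same' (ctape kd v) (size v - d.+1).+1) /shift_in /= min_l //.
  by rewrite (_ : (size v - d.+1).+2 = (size v - d).+1); [apply: IH|]; lia.
Qed.

Lemma spec_ev kd v z d X : d <= size v -> (size v).+1 <= B ->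
  spec (conf QQuery (size w).+1 (ctape kd v) (size v).+1 (z ++ markw false v)) X ->
  spec (conf QE4 (size w).+1 (ctape kd v) (size v - d).+1 (z ++ markw false (take (size v - d) v))) X.
Proof.
move=> Hd HB H; elim: d Hd => [|d IH] Hd.
  rewrite subn0; apply: ospec_trans => //=; first by rewrite ltnn; reflexivity.
  rewrite take_size -[None](_ : ctape kd v (size v).+1 = None) ?write_same'; last by rewrite /= ltnn.
  by rewrite /shift_in /= min_l.
have Hlt : size v - d.+1 < size v by lia.
apply: (@ospec_trans cmach O w B _ _ _ _ _ QE5 MStay (ctape kd v (size v - d.+1).+1) MStay (Some false)) => //=.
- by rewrite Hlt.
- by lia.
rewrite (write_same' (ctape kd v) (size v - d.+1).+1) /shift_in /= min_l //.
apply: (@ospec_trans cmach O w B _ _ _ _ _ QE4 MStay (ctape kd v (size v - d.+1).+1) MRight (Some (nth false v (size v - d.+1)))) => //=.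
- by rewrite Hlt.
- by lia.
rewrite (write_same' (ctape kd v) (size v - d.+1).+1) /shift_in /= min_l //.
rewrite !rcons_cat -markw_take //.
have E : (size v - d.+1).+1 = size v - d by lia.
by rewrite E; apply: IH; lia.
Qed.

Lemma spec_ew kd v z d X : d <= size w -> (size v).+1 <= B ->
  spec (conf QE4 (size w).+1 (ctape kd v) 1 (z ++ markw true w)) X ->
  spec (conf QE2 (size w - d).+1 (ctape kd v) 0 (z ++ markw true (take (size w - d) w))) X.
Proof.
move=> Hd HB H; elim: d Hd => [|d IH] Hd.
  rewrite subn0; apply: ospec_trans => //=; first by rewrite ltnn; reflexivity.
  by rewrite take_size (write_same' (ctape kd v)) /shift_in /= min_l.
have Hlt : size w - d.+1 < size w by lia.
apply: (@ospec_trans cmach O w B _ _ _ _ _ QE3 MStay (ctape kd v 0) MStay (Some true)) => //=.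
  by rewrite Hlt.
rewrite (write_same' (ctape kd v) 0) /shift_in /= min_l; last by lia.
apply: (@ospec_trans cmach O w B _ _ _ _ _ QE2 MRight (ctape kd v 0) MStay (Some (nth false w (size w - d.+1)))) => //=.
  by rewrite Hlt.
rewrite (write_same' (ctape kd v) 0) /shift_in /= min_l; last by lia.
rewrite !rcons_cat -markw_take //.
have E : (size w - d.+1).+1 = size w - d by lia.
by rewrite E; apply: IH; lia.
Qed.

Lemma spec_ask kd v X : (size v).+1 <= B ->
  spec (conf (QBack (asb (O (encq kd.1 kd.2 w v)))) (size w).+1 (ctape kd v) 0 [::]) X ->
  spec (conf QE0 0 (ctape kd v) 0 [::]) X.
Proof.
move=> HB H.
apply: ospec_trans => //=.
rewrite (write_same' (ctape kd v) 0) /shift_in /= min0n.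
apply: ospec_trans => //=.
rewrite (write_same' (ctape kd v) 0) /shift_in /= (_ : minn 1 _ = 1); last by rewrite min_l.
have := @spec_ew kd v [:: kd.1; kd.2] (size w) X (leqnn _) HB; rewrite subnn take0 => Z; apply: Z.
have Z2 := @spec_ev kd v ([:: kd.1; kd.2] ++ markw true w) (size v) X (leqnn _) HB.
rewrite subnn take0 cats0 in Z2; apply: Z2.
apply: ospec_query => //; rewrite (_ : _ ++ _ = encq kd.1 kd.2 w v) //.
have Hk : spec (conf (QBack (asb (O (encq kd.1 kd.2 w v)))) (size w).+1 (ctape kd v) (size v).+1 [::]) X.
  exact: spec_back.
case E: (asb _) Hk => Hk.
  apply: ospec_trans => //=.
  by rewrite (write_same' (ctape kd v) (size v).+1) /shift_in /= min_l.
apply: ospec_trans => //=.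
by rewrite (write_same' (ctape kd v) (size v).+1) /shift_in /= min_l.
Qed.

(** The protocol of the machine in terms of the oracle: answers are collected until the stop query
    succeeds, and then the final query decides. *)
Inductive census : seq bool -> Prop :=
| census_stop v : O (encq false true w v) -> O (encq true true w v) -> census v
| census_next v : ~ O (encq false true w v) -> census (rcons v (asb (O (encq false false w v)))) -> census v.

Lemma census_stopE v : O (encq false true w v) -> (O (encq true true w v) <-> census v).
Proof. by move=> H; split=> [|Hc]; [apply: census_stop|case: Hc H]. Qed.

Lemma census_nextE v : ~ O (encq false true w v) ->
  (census (rcons v (asb (O (encq false false w v)))) <-> census v).
Proof. by move=> H; split=> [|Hc]; [apply: census_next|case: Hc H]. Qed.

Lemma spec_final v : (size v).+1 <= B ->
  spec (conf QE0 0 (ctape (true, true) v) 0 [::]) (O (encq true true w v)).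
Proof.
move=> HB; apply: spec_ask => //; case E: (asb _).
  apply: ospec_trans => //=.
  apply: (@ospec_iff _ _ _ _ _ True); first by split=> // _; apply/asbP.
  exact: ospec_accept.
apply: ospec_trans => //=.
apply: (@ospec_iff _ _ _ _ _ False); first by split=> // /asbP; rewrite E.
apply: ospec_loop => // c1 /ostep_inv [_ [[_ [q1 [di1 [a1 [d1 [ob1 [[<- <- <- <- <-] ->]]]]]]]|[//]]].
by rewrite (write_same' _ 0) /= /shift_in /= !minnn.
Qed.

Lemma spec_stop ans v X : spec (conf QE0 0 (ctape (ans, ans) v) 0 [::]) X ->
  spec (conf (QBack ans) (size w).+1 (ctape (false, true) v) 0 [::]) X.
Proof.
move=> H; apply: (@ospec_trans cmach O w B _ _ _ _ _ QIn MStay (Some (inl (ans, ans))) MStay None) => //;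
  try by case: (ans).
by rewrite write_kind /shift_in /= minnn; apply: spec_in.
Qed.

Lemma spec_census d v : size v + d < B ->
  (forall v', size v' = size v + d -> O (encq false true w v')) ->
  spec (conf QE0 0 (ctape (false, true) v) 0 [::]) (census v).
Proof.
elim: d v => [|d IH] v HB Hstop; (apply: spec_ask; first by lia); apply: spec_stop; rewrite [X in O X]/=;
  case E: (asb _).
- by apply: (ospec_iff _ (spec_final _)); [apply: census_stopE; apply/asbP|lia].
- have Ht : asb (O (encq false true w v)) by apply/asbP; apply: Hstop; rewrite addn0.
  by rewrite Ht in E.
- by apply: (ospec_iff _ (spec_final _)); [apply: census_stopE; apply/asbP|lia].
apply: spec_ask; first by lia.
set ans := asb _.
apply: (@ospec_trans cmach O w B _ _ _ _ _ (QApp ans) MStay (Some (inl (false, true))) MRight None) => //;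
  try by case: (ans).
rewrite write_kind /shift_in /= minnn.
have Z := @spec_app (false, true) v (size w).+1 ans (size v) (census v) (leqnn _).
rewrite subnn in Z; apply: Z => //; first by lia.
apply: spec_wk; rewrite ?size_rcons //; first by lia.
have En : ~ O (encq false true w v) by move/asbP; rewrite E.
apply: (@ospec_iff _ _ _ _ _ (census (rcons v (asb (O (encq false false w v)))))).
  exact: census_nextE.
apply: IH; first by rewrite size_rcons; lia.
by move=> v' Hv'; apply: Hstop; rewrite Hv' size_rcons; lia.
Qed.

Lemma spec_start d : d < B -> (forall v', size v' = d -> O (encq false true w v')) ->
  spec (otm_init cmach) (census [::]).
Proof.
move=> HB Hs; rewrite /otm_init; apply: ospec_trans => //=.
rewrite /shift_in /= min0n (_ : write_cell _ 0 _ = ctape (false, true) [::]); last first.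
  by apply: functional_extensionality => -[|i].
exact: (@spec_census d).
Qed.

End Machine.

(** The condition on stop queries limits the number of answers to a multiple of the logarithm; apart
    from the kind in cell 0 the work tape holds nothing else. *)
Theorem census_LNP (O : language) (L : language) a : NP_language O ->
  (forall w v, size v = a * (trunc_log 2 (size w)).+1 -> O (encq false true w v)) ->
  (forall w, L w <-> census O w [::]) -> LNP_language L.
Proof.
move=> HO Hs HL; exists O, cmach; split=> //.
  exists a.+1 => w c Hc.
  have [H _] := @spec_start O w (a.+1 * (trunc_log 2 (size w)).+1) (a * (trunc_log 2 (size w)).+1) ltac:(by rewrite mulSn; lia) (Hs w).
  exact: H.
move=> w; rewrite HL.
have [_ H] := @spec_start O w (a.+1 * (trunc_log 2 (size w)).+1) (a * (trunc_log 2 (size w)).+1) ltac:(by rewrite mulSn; lia) (Hs w).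
by rewrite -H.
Qed.

(** * Bisection for the largest census total *)

Definition bnum (v : seq bool) : nat := foldl (fun a (b : bool) => a.*2 + b) 0 v.

Lemma bnum_rcons v b : bnum (rcons v b) = (bnum v).*2 + b.
Proof. by rewrite /bnum foldl_rcons. Qed.

Lemma bnum_lt v : bnum v < 2 ^ size v.
Proof.
elim/last_ind: v => [|v b IH] //; rewrite bnum_rcons size_rcons expnS.
by case: b; lia.
Qed.

Lemma nth_markw m s i : i < size s ->
  nth false (markw m s) i.*2 = m /\ nth false (markw m s) i.*2.+1 = nth false s i.
Proof. by elim: s i => //= x s IH [|i] Hi //=; have [] := IH i Hi. Qed.

Lemma size_markw m s : size (markw m s) = (size s).*2.
Proof. by elim: s => //= x s ->. Qed.

Lemma size_encq k1 k2 w v : size (encq k1 k2 w v) = ((size w + size v).*2).+2.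
Proof. by rewrite /= size_cat !size_markw doubleD. Qed.

Lemma nth_encq_w k1 k2 w v i : i < size w ->
  nth false (encq k1 k2 w v) i.*2.+2 /\ nth false (encq k1 k2 w v) i.*2.+3 = nth false w i.
Proof.
move=> Hi; have [H1 H2] := nth_markw true Hi.
by rewrite /= !nth_cat size_markw ltn_double Hi H1 -doubleS leq_double Hi H2.
Qed.

Lemma nth_encq_v k1 k2 w v i : i < size v ->
  nth false (encq k1 k2 w v) (size w + i).*2.+2 = false /\
  nth false (encq k1 k2 w v) (size w + i).*2.+3 = nth false v i.
Proof.
move=> Hi; have [H1 H2] := nth_markw false Hi.
rewrite /= !nth_cat size_markw ltn_double -doubleS leq_double.
by rewrite [_ < size w]ltnNge leq_addr /= doubleD -addnS !addKn H1 H2.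
Qed.

Section Census.
Variables (sigma : signature) (Omega : problem sigma) (m : nat) (r : even_scheme sigma m.+1).
Hypothesis Hr : defines (fun A b e => even_accepts b r e) Omega.
Variables (v c : nat) (pb : nat).
Local Notation L := [:: r].
Hypotheses (HL : okL v (L : seq (even_scheme sigma m.+1))) (Hc : szL c (L : seq (even_scheme sigma m.+1))).
Hypothesis Hpb : forall w n', coded sigma w n'.+2 ->
  tot v n'.+1 (@Strue sigma v w n' m.+1 L) L < (size w).+2 ^ pb /\ c * n'.+2 ^ v + c + n'.+2 <= (size w).+2 ^ pb.

(* [l] and [p] are the lengths of the input and of the list of answers; the certificate
   tabulates the powers of two and the values of the prefixes of that list. *)
Definition query_ok (l p : nat) (I : nat -> bool) (F : nat -> nat) : Prop :=
  (forall i, i < l -> I (i + i).+2) /\ (forall i, i < p -> ~ I (l + i + (l + i)).+2) /\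
  F (pair 6 0) = 1 /\ F (pair 7 0) = 0 /\
  (forall i, i < p -> F (pair 6 i.+1) = 2 * F (pair 6 i)) /\
  forall i, i < p -> (I (l + i + (l + i)).+3 -> F (pair 7 i.+1) = (2 * F (pair 7 i)).+1) /\
                     (~ I (l + i + (l + i)).+3 -> F (pair 7 i.+1) = 2 * F (pair 7 i)).

(** The answers are the leading binary digits of T / [l.+2 ^ pb], where T is the largest total,
    smaller than the denominator. The first case is the stop query: enough digits are known to
    determine T. The second asks whether the next digit is 1, that is, whether some certificate
    reaches the midpoint. The third asks for a certificate that reaches the value found and claims
    acceptance. *)
Definition query_ans (l p : nat) (I : nat -> bool) (F : nat -> nat) : Prop :=
  let bit x := I (x + x).+3 : Prop in
  (~ I 0 /\ I 1 /\ l.+2 ^ pb <= F (pair 6 p)) \/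
  (~ I 0 /\ ~ I 1 /\ cert v c l bit F L /\ (2 * F (pair 7 p)).+1 * l.+2 ^ pb <= ctot v F L * (2 * F (pair 6 p))) \/
  (I 0 /\ I 1 /\ cert v c l bit F L /\ F (pair 7 p) * l.+2 ^ pb <= ctot v F L * F (pair 6 p) /\ ctrue F m.+1 0).

Definition query (b : nat) (I : nat -> bool) (F : nat -> nat) : Prop :=
  exists2 l, l < b & exists2 p, p < b & b = (l + p + (l + p)).+3 /\ query_ok l p I F /\ query_ans l p I F.

Lemma df_query : defin (fun x e => query (base x) (fun i => inp x 0 [:: i]) (fn x)).
Proof.
have HI (g : ctx -> (nat -> nat) -> nat) : dterm g -> defin (fun x e => inp x 0 [:: g x e]) by exact: df_inp1.
apply: df_ex; first exact: dt_base.
apply: df_ex; first exact: dt_base.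
apply: df_and; first by apply: df_eq; dtm.
apply: df_and.
  do ?[apply: df_and]; try (by apply: df_eq; dtm); (apply: df_all; first by dtm).
  - by apply: HI; dtm.
  - by apply: df_not; apply: HI; dtm.
  - by apply: df_eq; dtm.
  - by apply: df_and; apply: df_imp; [apply: HI; dtm|apply: df_eq; dtm|apply: df_not; apply: HI; dtm|apply: df_eq; dtm].
have HC : defin (fun x e => cert v c (e 1) (fun y => inp x 0 [:: (y + y).+3]) (fn x) (L : seq (even_scheme sigma m.+1))).
  apply: (@df_cert sigma v c (fun _ e => e 1) (fun x _ y => inp x 0 [:: (y + y).+3]) (fun x _ => fn x)).
  - exact: dt_var.
  - by move=> s g Hg; apply: HI; dtm.
  - exact: deff_fn.
have HT : dterm (fun x e => ctot v (fn x) (L : seq (even_scheme sigma m.+1))).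
  exact: (@dt_ctot sigma v (fun x _ => fn x) _ _ deff_fn).
apply: df_or; last apply: df_or.
- by do ?[apply: df_and]; [apply: df_not; apply: HI; dtm|apply: HI; dtm|apply: df_le; dtm].
- apply: df_and; first by apply: df_not; apply: HI; dtm.
  apply: df_and; first by apply: df_not; apply: HI; dtm.
  by apply: df_and; [exact: HC|apply: df_le; dtm].
- apply: df_and; first by apply: HI; dtm.
  apply: df_and; first by apply: HI; dtm.
  by apply: df_and; [exact: HC|apply: df_and; [apply: df_le; dtm|apply: df_eq; dtm]].
Qed.

Lemma query_unique l p l' p' I F F' : l + p = l' + p' -> query_ok l p I F -> query_ok l' p' I F' -> l = l' /\ p = p'.
Proof.
move=> E [H1 [H2 _]] [H1' [H2' _]].
suff El : l = l' by split=> //; lia.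
case: (ltngtP l l') => // Hl.
- have p0 : 0 < p by lia.
  by have := H2 0 p0; rewrite addn0; case; apply: H1'.
- have p0 : 0 < p' by lia.
  by have := H2' 0 p0; rewrite addn0; case; apply: H1.
Qed.

Section Word.
Variables (k1 k2 : bool) (w vv : seq bool).
Let z := encq k1 k2 w vv.
Let I i := nth false z i.

Lemma dbl x : x + x = x.*2.
Proof. by rewrite addnn. Qed.

Lemma query_okP F : query_ok (size w) (size vv) I F <->
  forall i, i <= size vv -> F (pair 6 i) = 2 ^ i /\ F (pair 7 i) = bnum (take i vv).
Proof.
have Hv i : i < size vv -> (I (size w + i + (size w + i)).+2 = false) /\ I (size w + i + (size w + i)).+3 = nth false vv i.
  by move=> Hi; rewrite /I dbl; apply: nth_encq_v.
have Ht i : i < size vv -> bnum (take i.+1 vv) = (bnum (take i vv)).*2 + nth false vv i.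
  by move=> Hi; rewrite (take_nth false Hi) bnum_rcons.
split.
  case=> _ [_ [H6 [H7 [G6 G7]]]]; elim=> [|i IH] Hi; first by rewrite take0.
  have [I6 I7] := IH (ltnW Hi); rewrite G6 // I6 expnS; split=> //.
  have [Z1 Z2] := G7 i Hi; have [_ Hn] := Hv i Hi; rewrite Hn in Z1 Z2; rewrite Ht //.
  by case: (nth _ _ _) Z1 Z2 => Z1 Z2; [rewrite Z1 // I7|rewrite Z2 // I7]; lia.
move=> H; split; first by move=> i Hi; rewrite /I dbl; case: (@nth_encq_w k1 k2 w vv i Hi).
split; first by move=> i Hi; case: (Hv i Hi) => ->.
have [H6 H7] := H 0 isT; split=> //; split; first by rewrite H7 take0.
split=> i Hi; have [G6 G7] := H i (ltnW Hi); have [G6' G7'] := H i.+1 Hi.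
  by rewrite G6' G6 expnS.
have [_ ->] := Hv i Hi; rewrite G7' G7 Ht //.
by case: (nth _ _ _); split=> // _; lia.
Qed.

Lemma Ik : I 0 = k1 /\ I 1 = k2.
Proof. by []. Qed.

Lemma Ibit x : x < size w -> (I (x + x).+3 : Prop) <-> nth false w x.
Proof. by move=> Hx; rewrite /I dbl; have [_ ->] := @nth_encq_w k1 k2 w vv x Hx. Qed.

Lemma queryP F : query (size z).+1 I F <-> query_ok (size w) (size vv) I F /\ query_ans (size w) (size vv) I F.
Proof.
have Es : (size z).+1 = (size w + size vv + (size w + size vv)).+3 by rewrite /z size_encq dbl.
split.
  case=> l _ [p _ [E [H1 H2]]].
  have Elp : l + p = size w + size vv by lia.
  suff : exists F', query_ok (size w) (size vv) I F'.
    case=> F' H'; have [El Ep] := query_unique Elp H1 H'.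
    by rewrite -El -Ep.
  (* A correct table for the actual lengths, so that [query_unique] identifies the guessed lengths
     with them. *)
  have [F' [E' _]] := @pack (fun i x => if i == 6 then minn (2 ^ x) (2 ^ size vv) else if i == 7 then minn (bnum (take x vv)) (2 ^ size vv) else 0)
     (2 ^ size vv) ltac:(by move=> i x /=; case: (i == 6); [exact: geq_minr|case: (i == 7) => //; exact: geq_minr]).
  exists F'; apply/query_okP => i Hi; rewrite !E' /=; split; apply/minn_idPl.
    by rewrite leq_exp2l.
  apply: ltnW; apply: leq_trans (bnum_lt _) _; rewrite leq_exp2l // size_take; case: ltnP => //.
by case=> H1 H2; exists (size w); [|exists (size vv)]; rewrite ?Es //; lia.
Qed.

End Word.

Lemma query_okB k1 k2 w vv F : query_ok (size w) (size vv) (fun i => nth false (encq k1 k2 w vv) i) F ->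
  F (pair 6 (size vv)) = 2 ^ size vv /\ F (pair 7 (size vv)) = bnum vv.
Proof. by move=> /query_okP /(_ _ (leqnn _)); rewrite take_size. Qed.

(* Any certificate indexed below 6 extends to one with the tables of the answers. *)
Lemma extend_cert k1 k2 w vv k F0 : (forall x, F0 x <= k) -> 2 ^ size vv <= k ->
  exists F, [/\ forall x, F x <= k, forall i x, i < 6 -> F (pair i x) = F0 (pair i x)
    & query_ok (size w) (size vv) (fun i => nth false (encq k1 k2 w vv) i) F].
Proof.
move=> HF0 Hk.
have [F [EF LF]] := @pack (fun i x => if i < 6 then F0 (pair i x) else if i == 6 then minn (2 ^ x) (2 ^ size vv)
    else minn (bnum (take x vv)) (2 ^ size vv)) k
  ltac:(by move=> i x /=; case: (i < 6) => //; case: (i == 6); apply: leq_trans (geq_minr _ _) Hk).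
exists F; split=> //; first by move=> i x Hi; rewrite EF Hi.
apply/query_okP => i Hi; rewrite !EF /=; split; apply/minn_idPl.
  by rewrite leq_exp2l.
by apply: ltnW; apply: leq_trans (bnum_lt _) _; rewrite leq_exp2l // size_take; case: ltnP.
Qed.

Lemma cert_ext l bit F F' (HF : forall i x, i < 6 -> F (pair i x) = F' (pair i x)) :
  (cert v c l bit F L <-> cert v c l bit F' L) /\ ctot v F L = ctot v F' L /\ ctrue F = ctrue F'.
Proof.
have E i : i < 6 -> (fun x => F (pair i x)) = (fun x => F' (pair i x)).
  by move=> Hi; apply: functional_extensionality => x; apply: HF.
have E0 : cN F = cN F' by apply: HF.
have E1 : ccst F = ccst F' by apply: (E 1).
have E2 : cdig F = cdig F' by apply: (E 2).
have E3 : ctrue F = ctrue F'.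
  by apply: functional_extensionality => a; apply: functional_extensionality => b; rewrite /ctrue HF.
have E4 : cR F = cR F'.
  by do 3!(apply: functional_extensionality => ?); rewrite /cR HF.
have E5 : ccnt F = ccnt F'.
  by do 2!(apply: functional_extensionality => ?); rewrite /ccnt HF.
have Hcnt m' (L' : seq (even_scheme sigma m')) : cnt_cert v F L' <-> cnt_cert v F' L'.
  by elim: m' L' => //= m' IH L'; rewrite IH E5 E3 E0.
have Htot m' (L' : seq (even_scheme sigma m')) : ctot v F L' = ctot v F' L'.
  by elim: m' L' => //= m' IH L'; rewrite IH E5 E0.
split; last by [].
by rewrite /cert /coded_cert E0 E1 E2 E3 E4 Hcnt.
Qed.

Variables (kb : nat) (f : fm).
Hypothesis Hf : forall x e, query (base x) (fun i => inp x 0 [:: i]) (fn x) <-> holds x e f.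

Definition qlang (z : seq bool) : Prop := exists F, (forall x, F x <= (size z).+2 ^ kb) /\ holds (Ctx (size z).+1 (word_inp z) nospec F) (fun=> 0) f.

Lemma qlangP k1 k2 w vv : let z := encq k1 k2 w vv in
  qlang z <-> exists F, [/\ forall x, F x <= (size z).+2 ^ kb,
     query_ok (size w) (size vv) (fun i => nth false z i) F & query_ans (size w) (size vv) (fun i => nth false z i) F].
Proof.
have EI (z : seq bool) : (fun i => word_inp z 0 [:: i]) = (fun i => nth false z i).
  apply: functional_extensionality => i; rewrite /word_inp /= /word_fun.
  by case: ltnP => Hi; [case: (nth _ _ _)|rewrite nth_default].
move=> z; rewrite /qlang; split=> -[F].
  by case=> HF /Hf /=; rewrite EI => /queryP [H1 H2]; exists F.
by case=> HF H1 H2; exists F; split=> //; apply/Hf => /=; rewrite EI; apply/queryP.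
Qed.

Section Correct.
Variable w : seq bool.
Let PB := (size w).+2 ^ pb.
Let stp := (2 * pb) * (trunc_log 2 (size w)).+1.
Hypothesis Hkb : forall vv k1 k2, size vv <= stp ->
  PB <= (size (encq k1 k2 w vv)).+2 ^ kb /\ 2 ^ size vv <= (size (encq k1 k2 w vv)).+2 ^ kb.

Lemma qstop vv : size vv <= stp -> (qlang (encq false true w vv) <-> PB <= 2 ^ size vv).
Proof.
move=> Hs; rewrite qlangP; split.
  case=> F [_ Hq [[_ [_ H]]|[[_ [//]]|[//]]]].
  by have [E6 _] := query_okB Hq; rewrite E6 in H.
move=> H; have [_ Hk] := Hkb false true Hs.
have [F [F1 _ F3]] := @extend_cert false true w vv _ (fun=> 0) (fun=> leq0n _) Hk.
by exists F; split=> //; left; split=> //; split=> //; have [-> _] := query_okB F3.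
Qed.

Lemma stp_enough : PB <= 2 ^ stp.
Proof.
rewrite /PB /stp mulnAC expnM; apply: leq_exp2; rewrite mulnC expnM.
(* Here [l.+2 <= x ^ 2], which accounts for the factor 2 in [stp]. *)
set l := size w; set x := 2 ^ (trunc_log 2 l).+1.
have x2 : 2 <= x by rewrite /x expnS leq_pmulr // expn_gt0.
have xl : l < x.
  by case: (posnP l) => [->|l0]; [lia|rewrite /x; have /andP[] := trunc_log_bounds (isT : 1 < 2) l0].
rewrite -mulnn; nia.
Qed.

(** Equal kind bits rule out the stop query, and a positive answer to either of the other two
    requires a certificate, which contains a check that [w] is an encoding. *)
Lemma qbad k2 vv n0 : (forall n', ~ coded sigma w n'.+2) -> k2 = n0 -> ~ qlang (encq k2 k2 w vv).
Proof.
move=> Hn _ /qlangP [F [HF Hq Ha]].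
have Hcert : ~ cert v c (size w) (fun x => nth false (encq k2 k2 w vv) (x + x).+3 : Prop) F L.
  case=> HCC _.
  have Hb p : p < size w -> (nth false (encq k2 k2 w vv) (p + p).+3 : Prop) <-> nth false w p by apply: Ibit.
  by have [n' [Hcod _ _]] := proj1 (coded_certP Hb Hc F) HCC; apply: (Hn n').
by case: Ha => [[H1 [H2 _]]|[[_ [_ [/Hcert]]]|[_ [_ [/Hcert]]]]].
Qed.

Section Coded.
Variable n' : nat.
Hypothesis Hcod : coded sigma w n'.+2.
Let T := tot v n'.+1 (@Strue sigma v w n' m.+1 L) L.

Lemma TPB : T < PB.
Proof. by case: (Hpb Hcod). Qed.

Lemma cert_query k1 k2 vv F : (forall x, F x <= (size (encq k1 k2 w vv)).+2 ^ kb) ->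
  cert v c (size w) (fun x => nth false (encq k1 k2 w vv) (x + x).+3 : Prop) F L ->
  ctot v F L <= T /\ (ctot v F L = T -> ctrue F m.+1 0 <-> Tset v w n' L 0).
Proof.
move=> HF HC.
have Hb p : p < size w -> (nth false (encq k1 k2 w vv) (p + p).+3 : Prop) <-> nth false w p by apply: Ibit.
have HF' x : F x <= c + (size (encq k1 k2 w vv)).+2 ^ kb by apply: leq_trans (HF x) (leq_addl _ _).
have [_ H1 H2] := cert_sound Hb HL Hc HF' (leq_addr _ _) HC Hcod (agree_true v w n' L).
split=> // /H2 [_ Hag]; apply: Hag.
by rewrite mul1n expn_gt0.
Qed.

Lemma query_cert k1 k2 vv : size vv <= stp -> exists F,
  [/\ forall x, F x <= (size (encq k1 k2 w vv)).+2 ^ kb,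
      query_ok (size w) (size vv) (fun i => nth false (encq k1 k2 w vv) i) F,
      cert v c (size w) (fun x => nth false (encq k1 k2 w vv) (x + x).+3 : Prop) F L,
      ctot v F L = T & ctrue F m.+1 0 <-> Tset v w n' L 0].
Proof.
move=> Hs; have [Hk1 Hk2] := Hkb k1 k2 Hs; have [_ Hk] := Hpb Hcod.
have Hb p : p < size w -> (nth false (encq k1 k2 w vv) (p + p).+3 : Prop) <-> nth false w p by apply: Ibit.
have [F0 [A1 A2 A3 A4 A5]] := cert_complete Hb HL Hc Hcod (leq_trans Hk Hk1).
have [F [B1 B2 B3]] := @extend_cert k1 k2 w vv _ F0 A1 Hk2.
have [C1 [C2 C3]] := @cert_ext (size w) (fun x => nth false (encq k1 k2 w vv) (x + x).+3 : Prop) F F0 B2.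
exists F; split=> //; [exact/C1|by rewrite C2|rewrite C3].
by case: A4 => _ A4; apply: A4; rewrite mul1n expn_gt0.
Qed.

Lemma qask vv : size vv <= stp -> (qlang (encq false false w vv) <-> (2 * bnum vv).+1 * PB <= T * (2 * 2 ^ size vv)).
Proof.
move=> Hs; rewrite qlangP; split.
  case=> F [HF Hq [[_ [//]]|[[_ [_ [HC H]]]|[//]]]].
  have [E6 E7] := query_okB Hq; rewrite E6 E7 in H.
  have [H1 _] := cert_query HF HC.
  by apply: leq_trans H _; rewrite leq_mul2r H1 orbT.
move=> H; have [F [F1 F2 F3 F4 F5]] := query_cert false false Hs.
exists F; split=> //; right; left; split=> //; split=> //; split=> //.
by have [-> ->] := query_okB F2; rewrite F4.
Qed.

(** With this many digits, T is the only total not above T that is compatible with the answers. A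
    certificate that passes thus has the largest total, so its claims are exactly the truth. *)
Lemma qfinal vv : size vv <= stp -> PB <= 2 ^ size vv ->
  bnum vv * PB <= T * 2 ^ size vv -> T * 2 ^ size vv < (bnum vv).+1 * PB ->
  (qlang (encq true true w vv) <-> Tset v w n' L 0).
Proof.
move=> Hs HP H1 H2; rewrite qlangP; split.
  case=> F [HF Hq [[//]|[[//]|[_ [_ [HC [H HS]]]]]]].
  have [E6 E7] := query_okB Hq; rewrite E6 E7 in H.
  have [G1 G2] := cert_query HF HC.
  (* A smaller total would put T * 2 ^ [size vv] at least 2 ^ [size vv], hence at least [PB], above
     the lower end of the interval given by the answers. *)
  have ET : ctot v F L = T.
    apply/eqP; rewrite eqn_leq G1 /= leqNgt; apply/negP => Hlt.
    have G3 : (ctot v F L).+1 * 2 ^ size vv <= T * 2 ^ size vv by rewrite leq_mul2r Hlt orbT.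
    rewrite mulSn in G3; rewrite mulSn in H2.
    by move: G3 H2 H HP; set a := _ * _; set b := _ * 2 ^ _; set d := _ * _; lia.
  exact/(G2 ET).
move=> HT; have [F [F1 F2 F3 F4 F5]] := query_cert true true Hs.
exists F; split=> //; right; right; split=> //; split=> //; split=> //.
by have [-> ->] := query_okB F2; rewrite F4; split=> //; apply/F5.
Qed.

(** The two inequalities are the invariant of bisection: [bnum vv] is the integral part of T * 2 ^
    [size vv] / [PB]. *)
Lemma census_coded d vv : size vv + d = stp ->
  bnum vv * PB <= T * 2 ^ size vv -> T * 2 ^ size vv < (bnum vv).+1 * PB ->
  (census qlang w vv <-> Tset v w n' L 0).
Proof.
elim: d vv => [|d IH] vv Hd H1 H2; have Hs : size vv <= stp by lia.
  have HB : PB <= 2 ^ size vv by have := stp_enough; rewrite -Hd addn0.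
  by rewrite -(census_stopE (proj2 (qstop Hs) HB)) qfinal.
case: (classic (PB <= 2 ^ size vv)) => HB.
  by rewrite -(census_stopE (proj2 (qstop Hs) HB)) qfinal.
rewrite -census_nextE; last by rewrite qstop.
have HA := qask Hs.
apply: IH; rewrite ?size_rcons ?addSnnS // bnum_rcons expnS mulnCA;
  set b := asb _; have Hb : b <-> (2 * bnum vv).+1 * PB <= T * (2 * 2 ^ size vv) by rewrite -HA /b asbP.
- move: Hb; case: b => Hb; first by rewrite addn1 -mul2n mulnCA; apply/Hb.
  by rewrite addn0 -mul2n -mulnA leq_mul2l H1 orbT.
- move: Hb; case: b => Hb.
    by rewrite addn1 -doubleS -mul2n -mulnA ltn_mul2l H2.
  by rewrite addn0 -mul2n mulnCA ltnNge; apply/negP => /Hb.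
Qed.

End Coded.

Lemma census_bad d vv : size vv + d = stp -> (forall n', ~ coded sigma w n'.+2) -> ~ census qlang w vv.
Proof.
move=> + Hn; elim: d vv => [|d IH] vv Hd; have Hs : size vv <= stp by lia.
  have HB : PB <= 2 ^ size vv by have := stp_enough; rewrite -Hd addn0.
  by rewrite -(census_stopE (proj2 (qstop Hs) HB)); apply: qbad erefl.
case: (classic (PB <= 2 ^ size vv)) => HB.
  by rewrite -(census_stopE (proj2 (qstop Hs) HB)); apply: qbad erefl.
rewrite -census_nextE; last by rewrite qstop.
by apply: IH; rewrite size_rcons addSnnS.
Qed.

Lemma censusP : encoding Omega w <-> census qlang w [::].
Proof.
have HT n' : Omega (wstruct sigma w n') <-> Tset v w n' L 0.
  have X1 := @Tset0 sigma v w n' m.+1 L r erefl.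
  have X2 := @Hr (wstruct sigma w n') _ (ord_builtins_successor n').
  exact: iff_trans (iff_sym X2) (iff_sym X1).
rewrite encodingP; case: (classic (exists n', coded sigma w n'.+2)) => [[n' Hcod]|Hn]; last first.
  split=> [[n' [Hcod _]]|H]; first by case: Hn; exists n'.
  by case: (@census_bad stp [::] erefl _ H) => n' Hcod; apply: Hn; exists n'.
have HTP := TPB Hcod.
rewrite (@census_coded n' Hcod stp [::]) // ?mul1n ?muln1 //.
split=> [[n1 [Hcod1 /HT]]|H]; last by exists n'; split=> //; apply/HT.
suff -> : n1 = n' by [].
case: Hcod => _ _ P1 S1 _; case: Hcod1 => _ _ P2 S2 _.
by case: (ltngtP n1 n') => // H; [move: (P1 n1.+2 H); rewrite S2|move: (P2 n'.+2 H); rewrite S1].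
Qed.

End Correct.

End Census.

Fixpoint tot_bound (sigma : signature) (v m : nat) : seq (even_scheme sigma m) -> nat -> nat :=
  match m with
  | 0 => fun _ _ => 0
  | m'.+1 => fun L n => tot_bound v (subtests L) n * (1 + size L * n ^ v) + size L * n ^ v
  end.

Lemma polyb_tot sigma v m (L : seq (even_scheme sigma m)) : polyb (tot_bound v L).
Proof.
elim: m L => [|m IH] L /=; first exact: polyb_const.
have H : polyb (fun n => size L * n ^ v) by apply: polyb_mul; [exact: polyb_const|apply/polyb_exp/polyb_id].
by apply: polyb_add => //; apply: polyb_mul => //; apply: polyb_add => //; exact: polyb_const.
Qed.

Lemma tot_le sigma v N S m (L : seq (even_scheme sigma m)) : tot v N S L <= tot_bound v L N.+1.
Proof.
elim: m L => //= m IH L; apply: leq_add; last exact: csum_le.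
by rewrite add1n leq_mul2r IH orbT.
Qed.

Theorem all_LNP (sigma : signature) (Omega : problem sigma) : NPSB_s_all Omega -> LNP Omega.
Proof.
case=> m0 [m0_gt0 H0].
(* Each odd level lies in the next even one, so only even levels have to be treated. *)
have [m Hm] : exists m, NPSB_s m.*2.+2 Omega.
  have := odd_double_half m0; case E: (odd m0) => /= Em.
    by exists m0./2; apply: NPSB_odd_even; rewrite -add1n Em.
  exists m0./2.-1; rewrite (_ : _.+2 = m0) // -[RHS]Em; have : 0 < m0./2 by lia.
  by case: (m0./2) => // k _; rewrite doubleS.
move: Hm; rewrite /NPSB_s /= odd_double /= doubleK => -[r [_ Ho Hr]].
pose L : seq (even_scheme sigma m.+1) := [:: r].
have [v /(_ v (leqnn v)) Hv] := @evt_even sigma m.+1 r.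
have HL : okL v L by move=> u [<-|].
have [c /(_ c (leqnn c)) Hc] := evt_szL L.
have [pb Ha] : polyb (fun n => (1 + tot_bound v L n) + (c * n ^ v + c + n)).
  by repeat first [apply: polyb_tot|apply: polyb_add|apply: polyb_mul|apply: polyb_const|apply/polyb_exp|apply: polyb_id].
have Hpb w n' : coded sigma w n'.+2 ->
    tot v n'.+1 (@Strue sigma v w n' m.+1 L) L < (size w).+2 ^ pb /\ c * n'.+2 ^ v + c + n'.+2 <= (size w).+2 ^ pb.
  case=> _ Hs _ _ _; have n1 : n'.+2 <= size w by rewrite Hs /code_len; lia.
  have H1 := Ha n'.+2 isT; have H2 := tot_le v n'.+1 (@Strue sigma v w n' m.+1 L) L.
  have H3 : n'.+2 ^ pb <= (size w).+2 ^ pb by apply: leq_exp2; lia.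
  by split; lia.
have [f Hf] := @df_query sigma m (r : even_scheme sigma m.+1) v c pb.
(* The exponent [4 * pb] comes from 2 ^ (log + 1) being at most the square of [(size w).+2], raised
   to the power [2 * pb]. *)
have Hkb w vv k1 k2 : size vv <= (2 * pb) * (trunc_log 2 (size w)).+1 ->
    (size w).+2 ^ pb <= (size (encq k1 k2 w vv)).+2 ^ (4 * pb) /\
    2 ^ size vv <= (size (encq k1 k2 w vv)).+2 ^ (4 * pb).
  move=> Hs; have Hz : (size w).+2 <= (size (encq k1 k2 w vv)).+2 by rewrite size_encq; lia.
  have Hz2 : (size w).+2 ^ (4 * pb) <= (size (encq k1 k2 w vv)).+2 ^ (4 * pb) by apply: leq_exp2.
  split; apply: leq_trans Hz2; first by rewrite leq_exp2l //; lia.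
  apply: (@leq_trans (2 ^ (2 * pb * (trunc_log 2 (size w)).+1))); first by rewrite leq_exp2l.
  rewrite mulnC expnM (_ : 4 * pb = 2 * (2 * pb)); last by lia.
  rewrite [leqRHS]expnM; apply: leq_exp2; rewrite expnS -mulnn.
  have : 2 ^ trunc_log 2 (size w) <= (size w).+1.
    case: (posnP (size w)) => [->//|w0]; apply: leqW.
    by have /andP[] := trunc_log_bounds (isT : 1 < 2) w0.
  by nia.
apply: (@census_LNP (@qlang (4 * pb) f) _ (2 * pb)).
- exact: word_eso_NP.
- move=> w v' Hv'.
  have Hs : size v' <= 2 * pb * (trunc_log 2 (size w)).+1 by rewrite Hv'.
  by apply/(qstop Hc Hf (Hkb w) Hs); rewrite Hv'; apply: (stp_enough pb Hc w).
- by move=> w; apply: (censusP Hr HL Hc Hpb Hf (Hkb w)).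
Qed.

(** * Computations of oracle machines between queries *)

Lemma divmod_inj P j y j' y' : y < P -> y' < P -> y + j * P = y' + j' * P -> j = j' /\ y = y'.
Proof.
move=> H H' E; have P0 : 0 < P by lia.
have Ej : j = j'.
  have := congr1 (divn^~ P) E; rewrite ![_ + _ * P]addnC !divnMDl // !divn_small // !addn0.
  by [].
by split=> //; move: E; rewrite Ej => /addIn.
Qed.

(* A deterministic run that ends in a halting configuration never repeats itself. *)
Lemma det_inj (X : Type) (step : X -> X -> Prop) T (g : nat -> X) :
  (forall x y y', step x y -> step x y' -> y = y') -> (forall t, t < T -> step (g t) (g t.+1)) ->
  (forall y, ~ step (g T) y) -> forall i j, i <= T -> j <= T -> g i = g j -> i = j.
Proof.
move=> Hd Hg HT.
have Hlt i j : i < j -> j <= T -> g i <> g j.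
  move=> ij jT E.
  have Hs s : j + s <= T -> g (i + s) = g (j + s).
    elim: s => [|s IH] Hs; first by rewrite !addn0.
    have Hij := IH ltac:(lia); rewrite !addnS; apply: (Hd (g (i + s))); first by apply: Hg; lia.
    by rewrite Hij; apply: Hg; lia.
  have := Hs (T - j) ltac:(lia); rewrite subnKC // => E2.
  by apply: (HT (g (i + (T - j)).+1)); rewrite -E2; apply: Hg; lia.
move=> i j iT jT E; case: (ltngtP i j) => // H.
  by case: (Hlt _ _ H jT).
by case: (Hlt _ _ H iT).
Qed.

Section Otm.
Variables (D : otm) (u : seq bool).
Local Notation work := (o_work D).
Local Notation len := (size u).

(** A configuration without the oracle tape; in logarithmic space only polynomially many are
    reachable. The string written meanwhile is collected by [wrun], which starts from an empty
    oracle tape. *)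
Record xc := X { xq : o_state D; xi : nat; xh : nat; xt : nat -> option work }.

Definition nxt (c : xc) : option (xc * option bool) :=
  if (xq c == o_accept D) || (xq c == o_query D) then None else
  let: (q', di, a, d, ob) := o_trans (xq c) (in_symbol u (xi c)) (xt c (xh c)) in
  Some (X q' (shift_in u di (xi c)) (shift d (xh c)) (write_cell (xt c) (xh c) a), ob).


Fixpoint wrun (t : nat) (d : xc) : option (xc * seq bool) :=
  if t is t'.+1 then
    if wrun t' d is Some (c, z) then
      if nxt c is Some (c', ob) then Some (c', if ob is Some x then rcons z x else z) else None
    else None
  else Some (d, [::]).

Lemma wrun_halt t t' d c z c' z' : wrun t d = Some (c, z) -> nxt c = None -> wrun t' d = Some (c', z') -> t' <= t.
Proof.
move=> H Hn; rewrite leqNgt => H'; apply/negP => Hlt.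
have Hnone s : wrun (t + s).+1 d = None.
  elim: s => [|s IH]; first by rewrite addn0 /= H Hn.
  by rewrite addnS /= in IH *; rewrite IH.
by move: H'; rewrite -(subnKC Hlt) addSn Hnone.
Qed.

Lemma wrun_uniq t t' d c z c' z' : wrun t d = Some (c, z) -> nxt c = None ->
  wrun t' d = Some (c', z') -> nxt c' = None -> c = c' /\ z = z'.
Proof.
move=> H Hn H' Hn'; have E : t = t'.
  by apply/eqP; rewrite eqn_leq (wrun_halt H' Hn' H) (wrun_halt H Hn H').
by move: H'; rewrite -E H => -[-> ->].
Qed.

Variable O : language.

Definition conf (c : xc) (z : seq bool) : otm_config D := OConfig (xq c) (xi c) (xt c) (xh c) z.

Definition otm_rr (c : xc) (z : seq bool) : Prop := otm_reach O u (conf c z).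

Lemma nxt_step c c' ob z : nxt c = Some (c', ob) ->
  otm_step O u (conf c z) (conf c' (if ob is Some x then rcons z x else z)).
Proof.
rewrite /nxt; case: ifP => //; case E: (o_trans _ _ _) => [[[[q' di] a] d] ob'] /negbT; rewrite negb_or => /andP[Ha Hq] [<- <-].
by constructor.
Qed.

Lemma rr_step c z c2 : otm_rr c z -> otm_step O u (conf c z) c2 -> otm_reach O u c2.
Proof. by move=> H1 H2; apply: rt_trans H1 _; apply: rt_step. Qed.

Lemma rr_wrun t d c z : otm_rr d [::] -> wrun t d = Some (c, z) -> otm_rr c z.
Proof.
move=> Hd; elim: t c z => [|t IH] c z /=; first by case=> <- <-.
case E: (wrun t d) => [[c1 z1]|] //; case En: (nxt c1) => [[c2 ob]|] // [<- <-].
exact: rr_step (IH _ _ E) (nxt_step _ En).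
Qed.

Variable HH : nat.
Hypothesis Hhead : forall c : otm_config D, otm_reach O u c -> oc_head c < HH.

Definition beta := #|work|.+1.

Definition sr (a : option work) : nat := if a is Some x then (frk x).+1 else 0.

Lemma sr_lt a : sr a < beta.
Proof. by case: a => //= x; rewrite ltnS; apply: frk_lt. Qed.

Lemma sr_inj : injective sr.
Proof. by move=> [x|] [y|] //= [/frk_inj ->]. Qed.

(** The tape as a number in base [beta], cell [i] being digit [i] and a blank the digit 0;
    [low tp HH] is the whole tape, and [low_split] isolates the scanned digit. *)
Definition low (tp : nat -> option work) (h : nat) : nat := \sum_(0 <= i < h) sr (tp i) * beta ^ i.

Definition high (tp : nat -> option work) (h : nat) : nat := \sum_(0 <= i < HH - h.+1) sr (tp (i + h.+1)) * beta ^ i.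

Lemma low_lt tp h : low tp h < beta ^ h.
Proof.
elim: h => [|h IH]; first by rewrite /low big_geq.
rewrite /low big_nat_recr //= -/(low tp h) expnS.
have := sr_lt (tp h); have := IH; have : 0 < beta ^ h by rewrite expn_gt0.
by set b := beta ^ h; set s := sr _; set l := low _ _; nia.
Qed.

Lemma low_split tp h : h < HH -> low tp HH = low tp h + (sr (tp h) + high tp h * beta) * beta ^ h.
Proof.
move=> Hh; rewrite /low (@big_cat_nat _ _ _ h) //=; last exact: ltnW.
congr (_ + _); rewrite big_ltn // mulnDl; congr (_ + _).
rewrite -mulnA -expnS /high big_distrl /= -{1}[h.+1]add0n big_addn.
by apply: eq_bigr => i _; rewrite expnD mulnA.
Qed.

Lemma low_write tp h a : h < HH -> low (write_cell tp h a) HH = low tp h + (sr a + high tp h * beta) * beta ^ h.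
Proof.
move=> Hh; rewrite (low_split _ Hh); congr (_ + (_ + _ * _) * _).
- by apply: eq_big_nat => i /andP[_ Hi]; rewrite /write_cell (ltn_eqF Hi).
- by rewrite /write_cell eqxx.
- by apply: eq_bigr => i _; rewrite /write_cell gtn_eqF // addnS ltnS leq_addl.
Qed.

Lemma high_lt tp h : high tp h < beta ^ HH.
Proof.
have H := low_lt (fun i => tp (i + h.+1)) (HH - h.+1).
by apply: leq_trans H _; rewrite leq_pexp2l ?leq_subr.
Qed.

Section Tables.
Variables (ub : nat -> Prop) (Hub : forall p, p < len -> (ub p <-> nth false u p)).
Variables (B : nat) (f : nat -> nat).

Definition insymn (l : nat) (i : nat) (s : insym) : Prop :=
  match s with
  | LeftEnd => i = 0
  | RightEnd => i = l.+1
  | Bit b => exists2 j, j < l & i = j.+1 /\ (if b then ub j else ~ ub j)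
  end.

Definition shiftedin (l : nat) (d : move) (i i' : nat) : Prop :=
  match d with
  | MRight => (i < l.+1 /\ i' = i.+1) \/ (i = l.+1 /\ i' = i)
  | _ => shifted d i i'
  end.

Definition syms := [:: LeftEnd; RightEnd; Bit true; Bit false].

(** Terms have only constant exponents, so the powers of [beta] are tabulated, up to the exponent in
    [f (pair 6 0)]. *)
Definition pwok : Prop := f (pair 5 0) = 1 /\
  forall h, h < f (pair 6 0) -> f (pair 5 h.+1) = f (pair 5 h) * beta.

Definition step1n (l : nat) (E : option bool -> Prop) (t : nat) : Prop :=
  exists q : o_state D, exists a : option work, exists2 s, List.In s syms &
    let r := o_trans q s a in
    ~~ ((q == o_accept D) || (q == o_query D)) /\
    f (pair 0 t) = frk q /\ insymn l (f (pair 1 t)) s /\ f (pair 2 t) <= f (pair 6 0) /\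
    (exists2 x, x < f (pair 5 (f (pair 2 t))) & exists2 y, y < B &
      f (pair 3 t) = x + (sr a + y * beta) * f (pair 5 (f (pair 2 t))) /\
      f (pair 3 t.+1) = x + (sr r.1.1.2 + y * beta) * f (pair 5 (f (pair 2 t)))) /\
    shiftedin l r.1.1.1.2 (f (pair 1 t)) (f (pair 1 t.+1)) /\ shifted r.1.2 (f (pair 2 t)) (f (pair 2 t.+1)) /\
    f (pair 0 t.+1) = frk r.1.1.1.1 /\ E r.2.

Definition snapx (t : nat) (c : xc) : Prop :=
  [/\ f (pair 0 t) = frk (xq c), f (pair 1 t) = xi c, f (pair 2 t) = xh c & f (pair 3 t) = low (xt c) HH].

Lemma pwE : pwok -> forall h, h <= f (pair 6 0) -> f (pair 5 h) = beta ^ h.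
Proof. by move=> [H0 HS]; elim=> [//|h IH] Hh; rewrite HS // IH 1?ltnW // expnSr. Qed.

Lemma insymP i s : i <= len.+1 -> (insymn len i s <-> in_symbol u i = s).
Proof.
move=> Hi; case: s => [||b] /=.
- by case: i Hi => [|i] //= _; case: ifP.
- case: i Hi => [|i] //= Hi; case: ltnP => H; split=> //; first by case; lia.
  by move=> _; congr _.+1; lia.
- case: i Hi => [|i] //= Hi; first by split=> [[j _ []]|].
  case: ltnP => H; last by split=> [[j jl [[Ej] _]]|//]; lia.
  split=> [[j jl [[->]]]|[Eb]].
    by case: b => Hj; congr Bit; [apply/(Hub jl)|apply/negbTE/negP => /(Hub jl)].
  by exists i => //; split=> //; rewrite -Eb; case E: (nth _ _ _); [apply/Hub|rewrite Hub // E].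
Qed.

Lemma shiftedinP d i i' : i <= len.+1 -> (shiftedin len d i i' <-> i' = shift_in u d i).
Proof.
move=> Hi; rewrite /shift_in; case: d => /=.
- by rewrite (minn_idPl _); lia.
- by rewrite (minn_idPl _).
- by case: (ltngtP i len.+1) Hi => // H _; [rewrite (minn_idPl _) //|rewrite H (minn_idPr _) //]; lia.
Qed.

Lemma in_syms s : List.In s syms.
Proof. by rewrite /syms /=; case: s => [||[]]; tauto. Qed.

Lemma step1n_sound E t c z : pwok -> otm_rr c z -> xi c <= len.+1 -> snapx t c -> step1n len E t ->
  exists c' ob, [/\ nxt c = Some (c', ob), snapx t.+1 c' & E ob].
Proof.
move=> Hpw Hr Hi [S0 S1 S2 S3] [q [a [s _ [Hq [E0 [E1 [E2 [[x xb [y yB [E3 E4]]] [E5 [E6 [E7 E8]]]]]]]]]]].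
have Hh : xh c < HH := Hhead Hr.
have Eq : q = xq c by apply: frk_inj; rewrite -E0 S0.
rewrite S1 insymP // in E1; rewrite S2 in E2 E6 xb E3 E4; rewrite (pwE Hpw E2) in xb E3 E4.
rewrite S3 (low_split _ Hh) in E3.
have [Ea Ex] := divmod_inj (low_lt _ _) xb E3.
have [Ey Es] := divmod_inj (sr_lt _) (sr_lt _) Ea.
have {}Es := sr_inj Es; subst q s a x y.
rewrite /nxt (negbTE Hq); move: E4 E5 E6 E7 E8; case: (o_trans _ _ _) => [[[[q' di] a'] d] ob] /= E4 E5 E6 E7 E8.
eexists; exists ob; split; first by reflexivity.
  split=> //=; first by apply/shiftedinP; rewrite ?S1 // -S1.
  - by apply/shiftedP.
  - by rewrite E4 low_write.
exact: E8.
Qed.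

Lemma step1n_complete E t c z c' ob : pwok -> otm_rr c z -> xi c <= len.+1 -> xh c <= f (pair 6 0) -> beta ^ HH <= B ->
  snapx t c -> snapx t.+1 c' -> nxt c = Some (c', ob) -> E ob -> step1n len E t.
Proof.
move=> Hpw Hr Hi Hn HB [S0 S1 S2 S3] [S0' S1' S2' S3'] + HE.
have Hh : xh c < HH := Hhead Hr.
rewrite /nxt; case: ifP => // /negbT Hq; case Et: (o_trans _ _ _) => [[[[q' di] a'] d] ob'] [Ec Eo].
rewrite -Ec /= in S0' S1' S2' S3'; rewrite -Eo in HE.
exists (xq c), (xt c (xh c)); exists (in_symbol u (xi c)); first exact: in_syms.
rewrite Et /=; split=> //; split=> //; split; first by rewrite S1 insymP.
rewrite S1 S2; split=> //; split.
  rewrite (pwE Hpw Hn); exists (low (xt c) (xh c)); first exact: low_lt.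
  exists (high (xt c) (xh c)); first by apply: leq_trans (high_lt _ _) HB.
  by rewrite S3 S3' -low_split // low_write.
split; first by apply/shiftedinP.
by split=> //; apply/shiftedP.
Qed.

End Tables.

End Otm.

(** * Formulas for oracle machines and their queries *)

Section Def.
Variables (D : otm) (M : ntm).
Variables (l B : nat) (ub : nat -> Prop) (f : nat -> nat).

Definition codec (t : nat) : nat := pair (pair (f (pair 0 t)) (f (pair 1 t))) (pair (f (pair 2 t)) (f (pair 3 t))).

Definition emit (t : nat) (ob : option bool) : Prop :=
  match ob with
  | None => f (pair 4 t.+1) = f (pair 4 t)
  | Some b => f (pair 4 t.+1) = (f (pair 4 t)).+1 /\ f (pair 8 (f (pair 4 t))) = nat_of_bool b
  end.

Definition inner (v : nat) : Prop :=
  exists2 T, T < B & pwok D f /\ v = codec 0 /\ f (pair 4 0) = 0 /\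
    (forall t, t < T -> step1n D ub B f l (emit t) t) /\ f (pair 0 T) = frk (o_query D) /\
    ntm_tab M B (f (pair 4 T)) (fun p => f (pair 8 p) = 1) (fun x => f (pair 7 x)).

Definition query_step (orc : nat -> Prop) (t : nat) : Prop :=
  o_query D != o_accept D /\ f (pair 0 t) = frk (o_query D) /\ f (pair 1 t.+1) = f (pair 1 t) /\
  f (pair 2 t.+1) = f (pair 2 t) /\ f (pair 3 t.+1) = f (pair 3 t) /\ f (pair 4 t.+1) = codec t.+1 /\
  ((orc (f (pair 4 t)) /\ f (pair 0 t.+1) = frk (o_yes D)) \/
   (~ orc (f (pair 4 t)) /\ f (pair 0 t.+1) = frk (o_no D))).

Definition outer (orc : nat -> Prop) : Prop :=
  exists2 T, T < B & pwok D f /\ f (pair 0 0) = frk (o_start D) /\ f (pair 1 0) = 0 /\ f (pair 2 0) = 0 /\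
    f (pair 3 0) = 0 /\ f (pair 4 0) = codec 0 /\
    (forall t, t < T -> step1n D ub B f l (fun _ => f (pair 4 t.+1) = f (pair 4 t)) t \/ query_step orc t) /\
    f (pair 0 T) = frk (o_accept D).

End Def.

Section Definable.
Variables (D : otm) (M : ntm).
Variables (l B : ctx -> (nat -> nat) -> nat) (ub : ctx -> (nat -> nat) -> nat -> Prop).
Hypotheses (Hl : dterm l) (HB : dterm B) (Hub : defp ub).

Lemma df_shiftedin L d g g' : dterm L -> dterm g -> dterm g' -> defin (fun c e => shiftedin (L c e) d (g c e) (g' c e)).
Proof. by move=> HL Hg Hg'; case: d => /=; try apply: df_shifted => //; dfn. Qed.

Lemma df_insymn L r g s : dterm L -> dterm g ->
  defin (fun c e => insymn (ub c (fun i => e (r i))) (L c e) (g c e) s).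
Proof.
move=> HL Hg; case: s => [||b] /=; [by dfn|by dfn|].
apply: df_ex => //; apply: df_and; first by dfn.
by case: b; [|apply: df_not]; apply: (Hub (fun i => (r i).+1)); dtm.
Qed.

Lemma df_pwok : defin (fun c e => pwok D (fn c)).
Proof. by rewrite /pwok; dfn. Qed.

Lemma df_step1n (E : ctx -> (nat -> nat) -> option bool -> Prop) r t :
  dterm t -> (forall ob, defin (fun c e => E c e ob)) ->
  defin (fun c e => step1n D (ub c (fun i => e (r i))) (B c (fun i => e (r i))) (fn c)
    (l c (fun i => e (r i))) (E c e) (t c e)).
Proof.
move=> Ht HE; rewrite /step1n.
apply: df_exf => q; apply: df_exf => a; apply: df_exs => s.
have HL : dterm (fun c e => l c (fun i => e (r i))) by exact: dt_ren.
have HB' : dterm (fun c e => B c (fun i => e (r i))) by exact: dt_ren.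
have HB1 := @dt_ren _ S HB'; have Ht1 := @dt_ren _ S Ht.
have Ht2 := @dt_ren _ S Ht1.
apply: df_and; first exact: df_const.
apply: df_and; first by dfn.
apply: df_and; first by apply: df_insymn => //; dtm.
apply: df_and; first by dfn.
apply: df_and.
  apply: df_ex; first by dtm.
  apply: df_ex; first exact: HB1.
  by apply: df_and; apply: df_eq; dtm.
apply: df_and; first by apply: df_shiftedin; dtm.
apply: df_and; first by apply: df_shifted; dtm.
by apply: df_and; first by dfn.
Qed.

Lemma dt_codec t : dterm t -> dterm (fun c e => codec (fn c) (t c e)).
Proof. by move=> Ht; rewrite /codec; dtm. Qed.

Lemma df_inner : defin (fun c e => inner D M (l c (fun i => e i.+1)) (B c (fun i => e i.+1)) (ub c (fun i => e i.+1)) (fn c) (e 0)).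
Proof.
rewrite /inner; apply: df_ex; first exact: (@dt_ren B S).
apply: df_and; first exact: df_pwok.
apply: df_and; first by apply: df_eq; [|apply: dt_codec]; dtm.
apply: df_and; first by dfn.
apply: df_and.
  apply: df_all; first by dtm.
  apply: (@df_step1n (fun c e ob => emit (fn c) (e 0) ob) (fun i => i.+3)); first by dtm.
  by case=> [b|] /=; dfn.
apply: df_and; first by dfn.
apply: (@df_ntm_tab M (fun c e => B c (fun i => e i.+2)) (fun c e => fn c (pair 4 (e 0)))
   (fun c e p => fn c (pair 8 p) = 1) (fun c e x => fn c (pair 7 x))).
- exact: (@dt_ren B (fun i => i.+2)).
- by dtm.
- by move=> r g Hg; dfn.
- by move=> r g Hg; dtm.
Qed.

Lemma df_outer : defin (fun c e => outer D (l c e) (B c e) (ub c e) (fn c) (orc c)).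
Proof.
rewrite /outer; apply: df_ex => //.
apply: df_and; first exact: df_pwok.
do 4!(apply: df_and; first by dfn).
apply: df_and; first by apply: df_eq; [|apply: dt_codec]; dtm.
apply: df_and; last by dfn.
apply: df_all; first by dtm.
apply: df_or.
  by apply: (@df_step1n (fun c e ob => fn c (pair 4 (e 0).+1) = fn c (pair 4 (e 0))) (fun i => i.+2)); [dtm|move=> _; dfn].
rewrite /query_step; apply: df_and; first exact: df_const.
do 4!(apply: df_and; first by dfn).
apply: df_and; first by apply: df_eq; [|apply: dt_codec]; dtm.
by dfn.
Qed.

End Definable.

Lemma pair_mono a b a' b' : a <= a' -> b <= b' -> pair a b <= pair a' b'.
Proof. by move=> Ha Hb; rewrite /pair leq_add // leq_mul // leq_add. Qed.

Lemma rt_seq (T : Type) (R : T -> T -> Prop) a b : clos_refl_trans _ R a b ->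
  exists n (g : nat -> T), [/\ g 0 = a, g n = b & forall i, i < n -> R (g i) (g i.+1)].
Proof.
move=> H; have {H} := clos_rt_rt1n _ _ _ _ H; elim=> [x|x y z Hxy _ [n [g [g0 gn Hg]]]].
  by exists 0, (fun=> x).
exists n.+1, (fun i => if i is j.+1 then g j else x); split=> //.
by case=> [|i] Hi; [rewrite g0|apply: Hg].
Qed.

(** * Correctness of the formulas for oracle machines *)

Section Sem.
Variables (D : otm) (M : ntm) (O : language) (u : seq bool) (HH kM : nat).
Hypothesis HO : forall z, O z <-> ntm_accepts M z.
Hypothesis Htime : forall z t c, ntm_run t (ntm_init M z) c -> t <= size z ^ kM + kM.
Hypothesis Hhead : forall c : otm_config D, otm_reach O u c -> oc_head c < HH.
Local Notation len := (size u).
Local Notation work := (o_work D).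
Local Notation beta := (beta D).
Local Notation otm_rr := (@otm_rr D u O).
Local Notation xcD := (@xc D).

Lemma reach_ok (c : otm_config D) : otm_reach O u c ->
  oc_inhead c <= len.+1 /\ forall i, HH <= i -> oc_tape c i = None.
Proof using Hhead.
move=> H; have := clos_rt_rtn1 _ _ _ _ H; elim=> [//|y z Hyz Hy [I1 I2]].
have Hh := Hhead (clos_rtn1_rt _ _ _ _ Hy).
case: y Hyz I1 I2 Hh {Hy} => q i tp h zz /ostep_inv [_ [[_ [q' [di [a [d [ob [E ->]]]]]]]|[_ ->]]] //= I1 I2 Hh.
split; first exact: geq_minr.
by move=> j Hj; rewrite /write_cell gtn_eqF ?I2 //; apply: leq_trans Hj.
Qed.

Lemma rr_xi (c : xcD) z : otm_rr c z -> xi c <= len.+1.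
Proof using Hhead. by case/reach_ok. Qed.

Definition CB := #|o_state D| * len.+2 * HH.+1 * beta ^ HH.

Definition xkey (c : xcD) : o_state D * 'I_len.+2 * 'I_HH.+1 * {ffun 'I_HH -> option work} :=
  (xq c, inord (xi c), inord (xh c), [ffun i : 'I_HH => xt c i]).

Lemma card_xkey : #|{: o_state D * 'I_len.+2 * 'I_HH.+1 * {ffun 'I_HH -> option work}}| = CB.
Proof using. by rewrite !card_prod card_ffun !card_ord card_option. Qed.

Lemma xkey_inj (c c' : xcD) z z' : otm_rr c z -> otm_rr c' z' -> xkey c = xkey c' -> c = c'.
Proof using Hhead.
move=> H H' [E1 /(congr1 val) E2 /(congr1 val) E3 /ffunP E4].
have [/= I1 I2] := reach_ok H; have [/= I1' I2'] := reach_ok H'.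
have Hh : xh c < HH := Hhead H; have Hh' : xh c' < HH := Hhead H'.
rewrite /= !inordK // in E2; rewrite /= !inordK ?ltnS 1?ltnW // in E3.
have E5 : xt c = xt c'.
  apply: functional_extensionality => i; case: (ltnP i HH) => Hi; last by rewrite I2 ?I2'.
  by have := E4 (Ordinal Hi); rewrite !ffunE.
by case: c c' E1 E2 E3 E5 {H H' E4 I1 I2 I1' I2' Hh Hh'} => [q i h tp] [q' i' h' tp'] /= -> -> -> ->.
Qed.

Definition codex (c : xcD) : nat := pair (pair (frk (xq c)) (xi c)) (pair (xh c) (low (xt c) HH)).

Lemma snapx_codec f t c : snapx HH f t c -> codec f t = codex c.
Proof using. by move=> [H0 H1 H2 H3]; rewrite /codec /codex H0 H1 H2 H3. Qed.

Lemma nxt_query (c : xcD) : xq c = o_query D -> nxt u c = None.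
Proof using. by move=> E; rewrite /nxt E eqxx orbT. Qed.

Lemma nxt_acc (c : xcD) : xq c = o_accept D -> nxt u c = None.
Proof using. by move=> E; rewrite /nxt E eqxx. Qed.

Variables (ub : nat -> Prop) (Hub : forall p, p < len -> (ub p <-> nth false u p)).
Variables (B k : nat).

Lemma inner_sound f d v : otm_rr d [::] -> v = codex d -> inner D M len B ub f v ->
  exists t c z, [/\ wrun u t d = Some (c, z), xq c = o_query D & O z].
Proof using HO Hhead Hub.
move=> Hd -> [T TB [Hpw [Ev [H40 [Hst [HT Htab]]]]]].
have S0 : snapx HH f 0 d by move: Ev => /pair_inj [/pair_inj [A0 A1] /pair_inj [A2 A3]].
have H t : t <= T -> exists c z, [/\ wrun u t d = Some (c, z), snapx HH f t c, f (pair 4 t) = size z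
    & forall p, p < size z -> f (pair 8 p) = nth false z p].
  elim: t => [_|t IH tT]; first by exists d, [::].
  have [c [z [Hw Hs H4 H8]]] := IH (ltnW tT).
  have Hr := rr_wrun Hd Hw.
  have [c' [ob [Hn Hs' HE]]] := step1n_sound Hhead Hub Hpw Hr (rr_xi Hr) Hs (Hst t tT).
  exists c', (if ob is Some x then rcons z x else z); rewrite /= Hw Hn; split=> //.
    by case: ob HE {Hn} => [b [-> _]|->]; rewrite ?size_rcons H4.
  case: ob HE {Hn} => [b [_ Hb]|_]; last exact: H8.
  move=> p; rewrite size_rcons ltnS nth_rcons => Hp; case: (ltngtP p (size z)) Hp => // [pz _|-> _]; first exact: H8.
  by rewrite -H4.
have [c [z [Hw [Hq _ _ _] H4 H8]]] := H T (leqnn _).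
exists T, c, z; split=> //; first by apply: frk_inj; rewrite -HT Hq.
apply/HO; rewrite H4 in Htab.
apply: (ntm_tab_sound (B := B) _ Htab) => p Hp; rewrite H8 //.
by case: (nth _ _ _).
Qed.

Hypotheses (HkS : #|o_state D| <= k) (Hkl : len.+1 <= k) (HkH : HH <= k) (HbB : beta ^ HH <= B) (HBk : B <= k).
Hypotheses (Hk1 : #|n_state M| <= k) (Hk2 : #|{: option (bool + n_extra M)}| <= k).
Hypotheses (HCB : CB * CB <= B) (HCM : CB ^ kM + kM < B) (Hkcode : pair (pair #|o_state D| len.+1) (pair HH (beta ^ HH)) <= k).

Lemma low_le (tp : nat -> option work) : low tp HH <= beta ^ HH.
Proof using. exact: ltnW (low_lt _ _). Qed.

Lemma CB0 : 0 < CB.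
Proof using.
rewrite /CB !muln_gt0 expn_gt0 /= !andbT; apply/card_gt0P; by exists (o_start D).
Qed.

Lemma inner_complete d t c z : otm_rr d [::] -> wrun u t d = Some (c, z) -> xq c = o_query D -> O z ->
  exists f, (forall x, f x <= k) /\ inner D M len B ub f (codex d).
Proof using HO Htime Hhead Hub HkS Hkl HkH HbB HBk Hk1 Hk2 HCB HCM Hkcode.
move=> Hd Hw Hq Oz.
pose gx s := if wrun u s d is Some (c1, z1) then (c1, z1) else (d, [::]).
have Hgx s : s <= t -> wrun u s d = Some (gx s).
  move=> st; rewrite /gx; case E: (wrun u s d) => [[c1 z1]|] //.
  have Hnone j : wrun u (s + j) d = None by elim: j => [|j IH]; rewrite ?addn0 // addnS /= IH.
  by move: Hw; rewrite -(subnKC st) Hnone.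
have Hrr s : s <= t -> otm_rr (gx s).1 (gx s).2.
  by move=> /Hgx; case: (gx s) => c1 z1 /= H; apply: rr_wrun H.
have Hstep s : s < t -> exists ob, nxt u (gx s).1 = Some ((gx s.+1).1, ob) /\
    (gx s.+1).2 = if ob is Some x then rcons (gx s).2 x else (gx s).2.
  move=> st; have := Hgx _ st; rewrite /= (Hgx _ (ltnW st)).
  case: (gx s) => c1 z1 /=; case: (nxt u c1) => [[c2 ob]|] // [<-] /=; by exists ob.
have Egt : gx t = (c, z) by have := Hgx t (leqnn _); rewrite Hw => -[].
(* Between queries the machine is deterministic, and the run ends at a query, where [nxt] is
   undefined; so no configuration repeats and there are fewer than [CB] steps. *)
have Hinj : forall i j, i <= t -> j <= t -> (gx i).1 = (gx j).1 -> i = j.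
  apply: (@det_inj _ (fun c1 c2 => exists ob, nxt u c1 = Some (c2, ob)) t (fun s => (gx s).1)).
  - by move=> x y y' [ob ->] [ob' [->]].
  - by move=> s st; have [ob [-> _]] := Hstep s st; exists ob.
  - by move=> y [ob]; rewrite Egt nxt_query.
have Ht : t < CB.
  have Hi : injective (fun s : 'I_t.+1 => xkey (gx s).1).
    move=> s s' E; apply: val_inj; have sT : s <= t by rewrite -ltnS.
    have sT' : s' <= t by rewrite -ltnS.
    by apply: Hinj => //; exact: (xkey_inj (Hrr s sT) (Hrr s' sT') E).
  by have := leq_card _ Hi; rewrite card_ord card_xkey.
have HtB : t < B by apply: leq_trans Ht (leq_trans _ HCB); rewrite leq_pmulr // CB0.
have Hsz s : s <= t -> size (gx s).2 <= s.
  elim: s => [_|s IH st]; first by rewrite /gx.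
  have [ob [_ ->]] := Hstep s st; have := IH (ltnW st).
  by case: ob => [x|] H; rewrite ?size_rcons //; apply: leqW.
have Hpre s p : s <= t -> p < size (gx s).2 -> nth false (gx s).2 p = nth false z p.
  move=> st; rewrite -[z]/((c, z).2) -Egt.
  have [j Ej] : exists j, s + j = t by exists (t - s); rewrite subnKC.
  elim: j s st Ej => [|j IH] s st Ej Hp; first by rewrite -Ej addn0.
  have st' : s < t by lia.
  have [ob [_ E2]] := Hstep s st'; rewrite -(IH s.+1) ?E2 //; try lia.
    by case: ob {E2} => [x|] //; rewrite nth_rcons Hp.
  by case: ob {E2} => [x|] //; rewrite size_rcons ltnW.
have HzT : size z <= t by have := Hsz t (leqnn _); rewrite Egt.
have HMt t1 c1 : ntm_run t1 (ntm_init M z) c1 -> t1 < B.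
  move=> /Htime H; apply: leq_ltn_trans H (leq_ltn_trans _ HCM); rewrite leq_add2r.
  by case: (kM) => // k1; rewrite leq_exp2r // ltnW // (leq_ltn_trans HzT Ht).
have HUb p : p < size z -> ((nat_of_bool (nth false z p) = 1) <-> nth false z p) by move=> _; case: (nth _ _ _).
have [f7 [L7 H7]] := ntm_tab_complete HMt HUb Hk1 Hk2 HBk (proj1 (HO z) Oz).
have [f [Ef Lf]] := @pack (fun i x => minn (match i with 0 => frk (xq (gx x).1) | 1 => xi (gx x).1 | 2 => xh (gx x).1
   | 3 => low (xt (gx x).1) HH | 4 => size (gx x).2 | 5 => beta ^ x | 6 => HH | 7 => f7 x | _ => nat_of_bool (nth false z x) end) k) k
   (fun i x => geq_minr _ _).
have cap a : a <= k -> minn a k = a by move/minn_idPl.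
have f0 s : f (pair 0 s) = frk (xq (gx s).1) by rewrite Ef cap //; apply: leq_trans (ltnW (frk_lt _)) HkS.
have f1 s : s <= t -> f (pair 1 s) = xi (gx s).1 by move=> st; rewrite Ef cap //; apply: leq_trans (rr_xi (Hrr s st)) Hkl.
have f2 s : s <= t -> f (pair 2 s) = xh (gx s).1.
  by move=> st; rewrite Ef cap //; apply: leq_trans HkH; apply: ltnW; exact: (Hhead (Hrr s st)).
have f3 s : f (pair 3 s) = low (xt (gx s).1) HH by rewrite Ef cap //; apply: leq_trans (low_le _) (leq_trans HbB HBk).
have f4 s : s <= t -> f (pair 4 s) = size (gx s).2.
  by move=> st; rewrite Ef cap //; apply: leq_trans (Hsz s st) _; lia.
have f5 h : h <= HH -> f (pair 5 h) = beta ^ h.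
  by move=> Hh; rewrite Ef cap //; apply: leq_trans (leq_trans HbB HBk); rewrite leq_pexp2l.
have f6 : f (pair 6 0) = HH by rewrite Ef cap.
have f7E x : f (pair 7 x) = f7 x by rewrite Ef cap.
have f8 p : f (pair 8 p) = nth false z p.
  by rewrite Ef cap //; case: (nth _ _ _) => //; apply: leq_trans Hkl.
have Hpw : pwok D f.
  split; first by rewrite f5.
  by move=> h; rewrite f6 => Hh; rewrite !f5 ?expnSr // ltnW.
have Hsn s : s <= t -> snapx HH f s (gx s).1 by move=> st; split; [exact: f0|exact: f1|exact: f2|exact: f3].
exists f; split=> //; exists t => //; split=> //.
split; first by rewrite (snapx_codec (Hsn 0 (leq0n _))).
split; first by rewrite f4.
split.
  move=> s st; have [ob [Hn Hz]] := Hstep s st.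
  apply: (step1n_complete Hhead Hub Hpw (Hrr s (ltnW st)) (rr_xi (Hrr s (ltnW st))) _ HbB (Hsn s (ltnW st)) (Hsn s.+1 st) Hn).
    by rewrite f6; apply: ltnW; exact: (Hhead (Hrr s (ltnW st))).
  case: ob Hz {Hn} => [x|] Hz /=; rewrite !f4 ?(ltnW st) // Hz //.
  rewrite size_rcons; split=> //; rewrite f8 -(Hpre s.+1) ?Hz ?size_rcons // nth_rcons ltnn eqxx.
  by [].
split; first by rewrite f0 Egt /= Hq.
rewrite f4 // Egt /=.
have -> : (fun x => f (pair 7 x)) = f7 by apply: functional_extensionality.
have -> : (fun p => f (pair 8 p) = 1) = (fun p => nat_of_bool (nth false z p) = 1).
  by apply: functional_extensionality => p; rewrite f8.
exact: H7.
Qed.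

Definition inner_orc (v : nat) : Prop := exists f, (forall x, f x <= k) /\ inner D M len B ub f v.

(** By determinism [d] fixes the query string, so the inner formula cannot succeed with another
    string and its failure is a correct negative answer. *)
Lemma inner_orcP d t c z : otm_rr d [::] -> wrun u t d = Some (c, z) -> xq c = o_query D -> (inner_orc (codex d) <-> O z).
Proof using HO Htime Hhead Hub HkS Hkl HkH HbB HBk Hk1 Hk2 HCB HCM Hkcode.
move=> Hd Hw Hq; split; last exact: (inner_complete Hd Hw Hq).
case=> f [_ /(inner_sound Hd erefl) [t' [c' [z' [Hw' Hq' Oz]]]]].
by have [_ ->] := wrun_uniq Hw (nxt_query Hq) Hw' (nxt_query Hq').
Qed.

Lemma outer_sound f : outer D len B ub f inner_orc -> otm_accepts D O u.
Proof using HO Htime Hhead Hub HkS Hkl HkH HbB HBk Hk1 Hk2 HCB HCM Hkcode.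
case=> T TB [Hpw [A0 [A1 [A2 [A3 [A4 [Hst HT]]]]]]].
have H t : t <= T -> exists c z d s, [/\ otm_rr c z, snapx HH f t c, f (pair 4 t) = codex d, otm_rr d [::]
    & wrun u s d = Some (c, z)].
  elim: t => [_|t IH tT].
    pose c0 : xcD := X (o_start D) 0 0 (fun=> None).
    have H0 : snapx HH f 0 c0.
      by split=> //; rewrite A3 /low big1.
    exists c0, [::], c0, 0; split=> //; try exact: rt_refl.
    by rewrite A4 (snapx_codec H0).
  have [c [z [d [s [Hr Hs H4 Hd Hw]]]]] := IH (ltnW tT).
  case: (Hst t tT) => [H1|[Q1 [Q2 [Q3 [Q4 [Q5 [Q6 Q7]]]]]]].
    have [c' [ob [Hn Hs' HE]]] := step1n_sound Hhead Hub Hpw Hr (rr_xi Hr) Hs H1.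
    exists c', (if ob is Some x then rcons z x else z), d, s.+1; split=> //.
    - exact: rr_step Hr (nxt_step _ _ Hn).
    - by rewrite HE.
    - by rewrite /= Hw Hn.
  case: (Hs) => S0 S1 S2 S3.
  have Hq : xq c = o_query D by apply: frk_inj; rewrite -S0.
  pose c' : xcD := X (if asb (O z) then o_yes D else o_no D) (xi c) (xh c) (xt c).
  have Hr' : otm_rr c' [::].
    apply: rr_step Hr _; rewrite /conf Hq /c' /=; case E: (asb (O z)); constructor=> //; first exact/asbP.
    by move/asbP; rewrite E.
  have Hs' : snapx HH f t.+1 c'.
    split=> //; rewrite ?Q3 ?Q4 ?Q5 //= /c' /=.
    have HP := inner_orcP Hd Hw Hq; rewrite H4 in Q7.
    case: Q7 => -[/HP Oz ->]; first by have /asbP -> := Oz.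
    by case E: (asb _) => //; move/asbP: E.
  exists c', [::], c', 0; split=> //.
  by rewrite Q6 (snapx_codec Hs').
have [c [z [d [s [Hr [S0 _ _ _] _ _ _]]]]] := H T (leqnn _).
by exists (conf c z); split=> //; apply: frk_inj; rewrite -S0.
Qed.

Lemma outer_complete : otm_accepts D O u -> exists f, (forall x, f x <= k) /\ outer D len B ub f inner_orc.
Proof using HO Htime Hhead Hub HkS Hkl HkH HbB HBk Hk1 Hk2 HCB HCM Hkcode.
case=> ca [Hca Ha]; have [T [g [g0 gT Hg]]] := rt_seq Hca.
pose st (c : otm_config D) : xcD := X (oc_state c) (oc_inhead c) (oc_head c) (oc_tape c).
have conf_st c : conf (st c) (oc_oracle c) = c by case: c.
(* The configuration right after the last query before time [t], or the initial one. *)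
pose dd := fix dd t := if t is t'.+1 then if oc_state (g t') == o_query D then st (g t) else dd t' else st (g 0).
have Hreach t : t <= T -> otm_reach O u (g t).
  elim: t => [_|t IH tT]; first by rewrite g0; apply: rt_refl.
  by apply: rt_trans (IH (ltnW tT)) _; apply: rt_step; apply: Hg.
have Hrr t : t <= T -> otm_rr (st (g t)) (oc_oracle (g t)) by move=> tT; rewrite /otm_rr conf_st; apply: Hreach.
have Hstep t : t < T -> oc_state (g t) != o_accept D /\
   ((oc_state (g t) != o_query D /\ exists ob, nxt u (st (g t)) = Some (st (g t.+1), ob) /\
       oc_oracle (g t.+1) = if ob is Some x then rcons (oc_oracle (g t)) x else oc_oracle (g t)) \/
    (oc_state (g t) = o_query D /\ oc_oracle (g t.+1) = [::] /\
     st (g t.+1) = X (if asb (O (oc_oracle (g t))) then o_yes D else o_no D) (xi (st (g t))) (xh (st (g t))) (xt (st (g t))))).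
  move=> tT; move: (ostep_inv (Hg t tT)); case: (g t) => q i tp h z /= [Hqa H]; split=> //.
  case: H => [[Hq [q' [di [a [d [ob [E ->]]]]]]]|[Hq ->]]; [left|by right].
  split=> //; exists ob; split=> //.
  by rewrite /nxt /= (negbTE Hqa) (negbTE Hq) /= E.
have Hdd t : t <= T -> otm_rr (dd t) [::] /\ exists s, wrun u s (dd t) = Some (st (g t), oc_oracle (g t)).
  elim: t => [_|t IH tT].
    split; last by exists 0; rewrite /= g0.
    by rewrite /dd g0; apply: rt_refl.
  have [I1 [s I2]] := IH (ltnW tT); have [_ [[Hq [ob [Hn Hz]]]|[Hq [Hz Es]]]] := Hstep t tT.
    rewrite /= (negbTE Hq); split=> //; exists s.+1; rewrite /= I2 Hn Hz.
    by [].
  rewrite /= Hq eqxx; split; last by exists 0; rewrite /= Hz.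
  by have := Hrr _ tT; rewrite Hz.
have Horc t : t <= T -> oc_state (g t) = o_query D -> (inner_orc (codex (dd t)) <-> O (oc_oracle (g t))).
  by move=> tT Hq; have [I1 [s I2]] := Hdd t tT; apply: inner_orcP I1 I2 Hq.
(* The oracle tape is omitted from [xc], but the current configuration together with [dd] evolves
   deterministically. An accepting run thus repeats no such pair and has fewer than [CB * CB]
   steps. *)
pose step2 (x y : xcD * xcD) : Prop :=
  (exists ob, nxt u x.1 = Some (y.1, ob) /\ y.2 = x.2) \/
  (nxt u x.1 = None /\ xq x.1 = o_query D /\ xq x.1 <> o_accept D /\
   y.1 = X (if asb (inner_orc (codex x.2)) then o_yes D else o_no D) (xi x.1) (xh x.1) (xt x.1) /\ y.2 = y.1).
have Hinj : forall i j, i <= T -> j <= T -> (st (g i), dd i) = (st (g j), dd j) -> i = j.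
  apply: (@det_inj _ step2 T (fun t => (st (g t), dd t))).
  - move=> [c d] [c1 d1] [c2 d2] [[ob [/= E ->]]|[/= E [_ [_ [-> ->]]]]] [[ob' [/= H ->]]|[/= H [_ [_ [-> ->]]]]] //;
      rewrite E in H => //.
    by case: H => ->.
  - move=> t tT; have [Hqa [[Hq [ob [Hn Hz]]]|[Hq [Hz Es]]]] := Hstep t tT.
      by left; exists ob; rewrite /= (negbTE Hq).
    right; split; first exact: nxt_query.
    split=> //; split; first exact/eqP.
    rewrite /= Hq eqxx; split=> //; rewrite Es; congr X.
    have HP := Horc t (ltnW tT) Hq.
    case E: (asb (O _)); first by move/asbP: E => /HP /asbP ->.
    by case E2: (asb (inner_orc _)) => //; move/asbP: E2 => /HP /asbP; rewrite E.
  - move=> y [[ob [/= H _]]|[/= _ [_ [H _]]]]; last by case: H; rewrite gT.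
    by rewrite nxt_acc ?gT in H.
have HT : T < B.
  have Hi : injective (fun t : 'I_T.+1 => (xkey (st (g t)), xkey (dd t))).
    move=> s s' E; have E1 := congr1 fst E; have E2 := congr1 snd E.
    apply: val_inj; have sT : s <= T by rewrite -ltnS.
    have sT' : s' <= T by rewrite -ltnS.
    by apply: Hinj => //; rewrite (xkey_inj (Hrr s sT) (Hrr s' sT') E1) (xkey_inj (proj1 (Hdd s sT)) (proj1 (Hdd s' sT')) E2).
  have := leq_card _ Hi; rewrite card_ord card_prod card_xkey => H; exact: leq_trans H HCB.
have Hcx t : t <= T -> codex (dd t) <= k.
  move=> tT; have [Hd _] := Hdd t tT; apply: leq_trans Hkcode.
  apply: pair_mono; apply: pair_mono; [exact: ltnW (frk_lt _)|exact: rr_xi Hd|apply: ltnW; exact: (Hhead Hd)|exact: low_le].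
have [f [Ef Lf]] := @pack (fun i x => minn (match i with 0 => frk (oc_state (g x)) | 1 => oc_inhead (g x) | 2 => oc_head (g x)
   | 3 => low (oc_tape (g x)) HH | 4 => codex (dd x) | 5 => beta ^ x | _ => HH end) k) k (fun i x => geq_minr _ _).
have cap a : a <= k -> minn a k = a by move/minn_idPl.
have f0 s : f (pair 0 s) = frk (oc_state (g s)) by rewrite Ef cap //; apply: leq_trans (ltnW (frk_lt _)) HkS.
have f1 s : s <= T -> f (pair 1 s) = oc_inhead (g s) by move=> sT; rewrite Ef cap //; apply: leq_trans (rr_xi (Hrr s sT)) Hkl.
have f2 s : s <= T -> f (pair 2 s) = oc_head (g s).
  by move=> sT; rewrite Ef cap //; apply: leq_trans HkH; apply: ltnW; exact: (Hhead (Hrr s sT)).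
have f3 s : f (pair 3 s) = low (oc_tape (g s)) HH by rewrite Ef cap //; apply: leq_trans (low_le _) (leq_trans HbB HBk).
have f4 s : s <= T -> f (pair 4 s) = codex (dd s) by move=> sT; rewrite Ef cap // Hcx.
have f5 h : h <= HH -> f (pair 5 h) = beta ^ h.
  by move=> Hh; rewrite Ef cap //; apply: leq_trans (leq_trans HbB HBk); rewrite leq_pexp2l.
have f6 : f (pair 6 0) = HH by rewrite Ef cap.
have Hpw : pwok D f.
  split; first by rewrite f5.
  by move=> h; rewrite f6 => Hh; rewrite !f5 ?expnSr // ltnW.
have Hsn s : s <= T -> snapx HH f s (st (g s)) by move=> sT; split; [exact: f0|exact: f1|exact: f2|exact: f3].
exists f; split=> //; exists T => //; split=> //.
rewrite f0 f1 // f2 // f3 f4 // (snapx_codec (Hsn 0 (leq0n _))) g0 /= {1}/low big1 //.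
do 5!split=> //.
  by rewrite -g0.
split; last by rewrite f0 gT Ha.
move=> t tT; have [Hqa [[Hq [ob [Hn Hz]]]|[Hq [Hz Es]]]] := Hstep t tT.
  left; apply: (step1n_complete Hhead Hub Hpw (Hrr t (ltnW tT)) (rr_xi (Hrr t (ltnW tT))) _ HbB (Hsn t (ltnW tT)) (Hsn t.+1 tT) Hn).
    by rewrite f6; apply: ltnW; exact: (Hhead (Hrr t (ltnW tT))).
  by rewrite !f4 ?(ltnW tT) //= (negbTE Hq).
right; have HP := Horc t (ltnW tT) Hq.
have E1 := congr1 (@xi D) Es; have E2 := congr1 (@xh D) Es; have E3 := congr1 (@xt D) Es.
have E0 := congr1 (@xq D) Es; rewrite /= in E0 E1 E2 E3.
split; first by rewrite -Hq.
split; first by rewrite f0 Hq.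
split; first by rewrite !f1 ?(ltnW tT).
split; first by rewrite !f2 ?(ltnW tT).
split; first by rewrite !f3 E3.
split; first by rewrite f4 // (snapx_codec (Hsn t.+1 tT)) /= Hq eqxx.
rewrite f4 ?(ltnW tT) // f0 E0 HP.
case E: (asb _); first by left; split=> //; apply/asbP.
by right; split=> // /asbP; rewrite E.
Qed.

End Sem.

(** * L^NP is contained in the third level *)

Lemma polyb_pair g h : polyb g -> polyb h -> polyb (fun n => pair (g n) (h n)).
Proof.
move=> Hg Hh; have H := polyb_add Hg Hh.
exact: (polyb_add (polyb_mul H H) Hg).
Qed.

Lemma log_pow2 x : 0 < x -> 2 ^ (trunc_log 2 x).+1 <= 2 * x.
Proof. by move=> x0; rewrite expnS leq_mul2l; have /andP[-> _] := trunc_log_bounds (isT : 1 < 2) x0. Qed.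

(** Since [b] is at most [2 ^ b], an exponential of a logarithm becomes a power of [2 * g n]. This
    bounds the number of work tapes in logarithmic space. *)
Lemma polyb_log g b k : polyb g -> (forall n, 0 < g n) -> polyb (fun n => b ^ (k * (trunc_log 2 (g n)).+1).+1).
Proof.
move=> Hg g0.
apply: (@polyb_le _ (fun n => 2 ^ b * (2 * g n) ^ (b * k))); last first.
  by repeat first [apply: polyb_mul|apply: polyb_const|apply: polyb_exp|exact: Hg].
move=> n _; set t := (trunc_log 2 (g n)).+1.
apply: (@leq_trans ((2 ^ b) ^ (k * t).+1)).
  by rewrite leq_exp2r //; apply: ltnW; apply: ltn_expl.
rewrite expnS leq_mul2l; apply/orP; right.
rewrite -expnM (_ : b * (k * t) = t * (b * k)); last by lia.
rewrite expnM; case: (b * k) => // j; rewrite leq_exp2r //; exact: log_pow2.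
Qed.

Theorem LNP_scheme3 (sigma : signature) (Omega : problem sigma) : LNP Omega -> NPSB_s 3 Omega.
Proof.
case=> O [D [[M [[kM Htime] HO]] [k0 Hlog] HL]].
pose H0 n := (k0 * (trunc_log 2 (code_len sigma n)).+1).+1.
have len0 n : 0 < code_len sigma n by rewrite /code_len.
have HbH : polyb (fun n => beta D ^ H0 n) by apply: polyb_log => //; exact: polyb_code_len.
have HH0 : polyb H0.
  apply: (@polyb_le _ (fun n => k0 * (1 + code_len sigma n) + 1)).
    move=> n _; rewrite /H0 addn1 ltnS leq_mul2l; apply/orP; right; rewrite add1n ltnS.
    have /andP[H _] := trunc_log_bounds (isT : 1 < 2) (len0 n).
    by apply: leq_trans H; apply: ltnW; apply: ltn_expl.
  by repeat first [apply: polyb_code_len|apply: polyb_add|apply: polyb_mul|apply: polyb_const|apply: polyb_code_len].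
pose C0 n := #|o_state D| * (code_len sigma n).+2 * (H0 n).+1 * beta D ^ H0 n.
have HC0 : polyb C0.
  apply: (@polyb_le _ (fun n => #|o_state D| * (2 + code_len sigma n) * (1 + H0 n) * beta D ^ H0 n)).
    by move=> n _; rewrite /C0 add2n add1n.
  by repeat first [apply: polyb_code_len|apply: HbH|apply: HH0|apply: polyb_add|apply: polyb_mul|apply: polyb_const|apply: polyb_code_len].
(* The exponent [a] bounds the lengths of runs: pairs of configurations for the oracle machine, and
   the running time of the NP machine on strings of length at most [C0 n]. The exponent [kb] after
   it bounds all table entries. *)
have [a Ha] : polyb (fun n => C0 n * C0 n + (C0 n ^ kM + kM) + 1 + beta D ^ H0 n).
  by repeat first [apply: polyb_code_len|apply: HbH|apply: HC0|apply: polyb_exp|apply: polyb_add|apply: polyb_mul|apply: polyb_const].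
have [kb Hkb] : polyb (fun n => n ^ a + #|o_state D| + (1 + code_len sigma n) + H0 n + #|n_state M| +
    #|{: option (bool + n_extra M)}| + pair (pair #|o_state D| (1 + code_len sigma n)) (pair (H0 n) (beta D ^ H0 n))).
  by repeat first [apply: polyb_code_len|apply: HbH|apply: HH0|apply: polyb_pair|apply: polyb_exp|apply: polyb_id|apply: polyb_add|apply: polyb_mul
    |apply: polyb_const|apply: polyb_code_len].
pose l (c : ctx) (e : nat -> nat) := code_len sigma (base c).+1.
pose B (c : ctx) (e : nat -> nat) := (base c).+1 ^ a.
pose ub (c : ctx) (e : nat -> nat) (p : nat) := encbit sigma (base c).+1 (inp c) p.
have Hl : dterm l by apply: dt_code_len; dtm.
have HB : dterm B by rewrite /B; dtm.
have Hub : defp ub by move=> r g Hg; apply: df_encbit; dtm.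
have [fi Hfi] := df_inner D M Hl HB Hub.
have [fo Hfo] := df_outer D Hl HB Hub.
have [r [Hw Ho Hr]] := scheme3_of_eso sigma kb fo kb fi.
exists r; split=> // A b Hb.
have [rk [n' [Hrk En]]] := rank_of Hb.
rewrite (Hr _ _ _ _ Hrk) -(encoding_encode Omega A).
have Hiso := iso_tstruct Hrk En.
have -> : encoding Omega (encode A) <-> encoding Omega (encode (tstruct rk n')).
  rewrite !encoding_encode; split; first exact: (problem_iso Hiso).
  exact: (problem_iso (isomorphic_sym Hiso)).
have n1 : 1 < n'.+2 by [].
have Hs : size (encode (tstruct rk n')) = code_len sigma n'.+2 by rewrite size_encode card_ord.
rewrite HL.
set u := encode _ in Hs *.
have Hhead (c : otm_config D) : otm_reach O u c -> oc_head c < H0 n'.+2.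
  by move=> /Hlog; rewrite Hs /H0 ltnS.
have HU p : p < size u -> (encbit sigma n'.+2 (struct_inp rk) p <-> nth false u p).
  by rewrite Hs; exact: (encbitP Hrk En).
have ECB : CB D u (H0 n'.+2) = C0 n'.+2 by rewrite /CB Hs.
have := Ha _ n1; have := Hkb _ n1; set p1 := pair _ _; set k := n'.+2 ^ kb; set Bn := n'.+2 ^ a => Hk1 HB1.
have G1 : #|o_state D| <= k by lia.
have G2 : (size u).+1 <= k by rewrite Hs; lia.
have G3 : H0 n'.+2 <= k by lia.
have G4 : beta D ^ H0 n'.+2 <= Bn by lia.
have G5 : Bn <= k by lia.
have G6 : #|n_state M| <= k by lia.
have G7 : #|{: option (bool + n_extra M)}| <= k by lia.
have G8 : CB D u (H0 n'.+2) * CB D u (H0 n'.+2) <= Bn by rewrite ECB; lia.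
have G9 : CB D u (H0 n'.+2) ^ kM + kM < Bn by rewrite ECB; lia.
have G10 : pair (pair #|o_state D| (size u).+1) (pair (H0 n'.+2) (beta D ^ H0 n'.+2)) <= k by rewrite Hs -add1n; lia.
have S1 := outer_sound HO Htime Hhead HU G1 G2 G3 G4 G5 G6 G7 G8 G9 G10.
have S2 := outer_complete HO Htime Hhead HU G1 G2 G3 G4 G5 G6 G7 G8 G9 G10.
have Hin v : eso_struct kb fi rk (fun=> false) v <->
    inner_orc D M u (encbit sigma n'.+2 (struct_inp rk)) Bn k v.
  rewrite /eso_struct /inner_orc En; split=> -[F [HF1 HF2]]; exists F; split=> //.
    by move/Hfi: HF2; rewrite /l /B /ub /= Hs.
  by apply/Hfi; rewrite /l /B /ub /= -Hs.
have Eorc : (fun v => is_true (asb (eso_struct kb fi rk (fun=> false) v))) =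
    inner_orc D M u (encbit sigma n'.+2 (struct_inp rk)) Bn k.
  apply: functional_extensionality => v; apply: propositional_extensionality.
  exact: iff_trans (asbP _) (Hin v).
rewrite /eso_struct En in Eorc *; split.
  case=> F [_ /Hfo HF]; apply: (S1 F); move: HF; rewrite /l /B /ub /= -Hs.
  by rewrite -Eorc.
move=> /S2 [F [HF1 HF2]]; exists F; split=> //; apply/Hfo; rewrite /l /B /ub /= -Hs.
by rewrite -Eorc in HF2.
Qed.

Theorem theorem11 :
  (forall (sigma : signature) (Omega : problem sigma),
     (NPSB_s 1 Omega <-> NPSB_s 2 Omega) /\ (NPSB_s 2 Omega <-> NP Omega))
  /\
  (forall (sigma : signature) (Omega : problem sigma),
     (NPSB_s 3 Omega <-> NPSB_s_all Omega) /\ (NPSB_s_all Omega <-> LNP Omega)).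
Proof.
have H12 sigma (Omega : problem sigma) : NPSB_s 1 Omega -> NPSB_s 2 Omega := @NPSB_odd_even sigma Omega 0.
split=> sigma Omega; split; split=> H.
- exact: H12.
- exact/NP_scheme1/NPSB2_NP.
- exact: NPSB2_NP.
- exact/H12/NP_scheme1.
- by exists 3.
- exact/LNP_scheme3/all_LNP.
- exact: all_LNP.
- by exists 3; split=> //; apply: LNP_scheme3.
Qed.
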